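(* Let $H$ be a double-incommensurate twisted trilayer graphene tight-binding Hamiltonian and $\widehat H=\{\widehat H_q\}_{q\in\mathbb R^2}$ its family of reciprocal Hamiltonians (setting and assumptions as given in the context), and let $\epsilon>0$. Then for all $E\in\mathbb R$, $$\widehat{\mathcal D}_\epsilon(E)=\mathcal T\delta_\epsilon(E-\widehat H)=\mathcal D_\epsilon(E).$$
   Context: Lattices. Let $a=1.42\sqrt3$, $A=\frac a2\begin{bmatrix}2&1\\0&\sqrt3\end{bmatrix}$, $B=2\pi A^{-T}$, and let $\mathfrak R_\theta$ be the counterclockwise rotation of $\mathbb R^2$ by $\theta$. For twist angles $\theta_1,\theta_2,\theta_3$ and $j\in\{1,2,3\}$ put $A_j=\mathfrak R_{\theta_j}A$, $B_j=\mathfrak R_{\theta_j}B$, $\mathcal R_j=A_j\mathbb Z^2$, $\mathcal R_j^*=B_j\mathbb Z^2$, $\Gamma_j^*=B_j[0,1)^2$ (area $|\Gamma_j^*|$), $c_j^*=\sqrt{|\Gamma_j^*|}$. Orbital indices: $\mathcal A_j=\{jA,jB\}$, $\mathcal A=\bigcup_j\mathcal A_j$, with shifts $\tau_{jA}=0$, $\tau_{jB}=\mathfrak R_{\theta_j}\frac a2(1,\tfrac{\sqrt3}{3})^T$. Double incommensurability (assumed). For both families $(\mathcal R_j)_{j=1}^3$ and $(\mathcal R_j^* )_{j=1}^3$: for every $I\subset\{1,2,3\}$ and lattice vectors $v_j$ in the $j$th lattice, $\sum_{j\in I}v_j=0$ iff $v_j=0$ for all $j\in I$. Real-space Hamiltonian.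 $\Omega_j=\mathcal R_j\times\mathcal A_j$, $\Omega=\bigsqcup_{j=1}^3\Omega_j$. Given intralayer hoppings $h_{j\beta}^{j\alpha}:\mathcal R_j\to\mathbb C$ and, for $j\ne k$, continuous interlayer hoppings $h_{k\beta}^{j\alpha}:\mathbb R^2\to\mathbb C$, $H$ acts on $\ell^2(\Omega)$ by $$(H\psi)_{(R,j\alpha)}=\sum_{(R',j\beta)\in\Omega_j}(h_{j\beta}^{j\alpha})_{R-R'}\psi_{(R',j\beta)}+\sum_{k\neq j}\sum_{(R',k\beta)\in\Omega_k}h_{k\beta}^{j\alpha}(R+\tau_{j\alpha}-R'-\tau_{k\beta})\psi_{(R',k\beta)}.$$ Fourier transform: $\widehat h(\xi)=\frac1{4\pi^2}\int_{\mathbb R^2}h(x)e^{-i\xi\cdot x}dx$. Assumptions: (decay) there are $\gamma_1,\gamma_2>0$ such that for all $j\neq k$ and all orbitals $\sup_x|h_{k\beta}^{j\alpha}(x)|e^{\gamma_1\|x\|_2}+\sup_\xi|\widehat h_{k\beta}^{j\alpha}(\xi)|e^{\gamma_2\|\xi\|_2}<\infty$, and $\sup_{R\in\mathcal R_j}|(h_{j\beta}^{j\alpha})_R|e^{\gamma_1\|R\|_2}<\infty$; (hermiticity) $(h_{j\beta}^{j\alpha})_R=\overline{(h_{j\alpha}^{j\beta})_{-R}}$ and $h_{k\beta}^{j\alpha}(x)=\overline{h_{j\alpha}^{k\beta}(-x)}$; (nearest-layer coupling) $h_{3\beta}^{1\alpha}=h_{1\beta}^{3\alpha}=0$. Reciprocal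 Hamiltonian. $\kappa_j^*=\{G=(G_1,G_2,G_3)\in\bigoplus_{t=1}^3\mathcal R_t^*:G_j=0\}$, $\Omega_j^*=\kappa_j^*\times\mathcal A_j$, $\Omega^*=\bigsqcup_j\Omega_j^*$. For $q\in\mathbb R^2$, $\widehat H_q$ is the operator on $\ell^2(\Omega^* )$ with entries, for $(G,j\alpha)\in\Omega_j^*$ and $(G',k\beta)\in\Omega_k^*$: if $j=k$, $[\widehat H_q]^{(G,j\alpha)}_{(G',j\beta)}=\delta_{G,G'}\,\widetilde h_{j\beta}^{j\alpha}(q+\sum_tG_t)$ with $\widetilde h_{j\beta}^{j\alpha}(q)=\sum_{R\in\mathcal R_j}e^{-iq\cdot(R+\tau_{j\alpha}-\tau_{j\beta})}(h_{j\beta}^{j\alpha})_R$; if $j\ne k$ and $l$ is the third layer, $[\widehat H_q]^{(G,j\alpha)}_{(G',k\beta)}=\delta_{G_l,G_l'}\,c_j^*c_k^*e^{i(G_j'\cdot\tau_{j\alpha}-G_k\cdot\tau_{k\beta})}\,\widehat h_{k\beta}^{j\alpha}(q+G_j'+G_k+G_l)$. Densities of states. $\delta_\epsilon(E)=\frac1{\epsilon\sqrt{2\pi}}e^{-E^2/(2\epsilon^2)}$, and $\delta_\epsilon(E-X)$ is defined by functional calculus. With $\Omega_r=\{(R,j\alpha)\in\Omega:\|R\|_2<r\}$ and $\Omega_r^*=\{(G,j\alpha)\in\Omega^*:\|\bigoplus_{k\neq j}G_k\|_2<r\}$, $$\mathcal D_\epsilon(E)=\lim_{r\to\infty}\frac1{|\Omega_r|}\sum_{(R,j\alpha)\in\Omega_r}[\delta_\epsilon(E-H)]^{(R,j\alpha)}_{(R,j\alpha)},\qquad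 \widehat{\mathcal D}_\epsilon(E)=\lim_{r\to\infty}\frac1{|\Omega_r^*|}\sum_{(G,j\alpha)\in\Omega_r^*}[\delta_\epsilon(E-\widehat H_0)]^{(G,j\alpha)}_{(G,j\alpha)},$$ and $\mathcal Tf(\widehat H)=\nu^*\sum_{j\alpha\in\mathcal A}\int_{\Gamma_j^*}[f(\widehat H_q)]^{(0,j\alpha)}_{(0,j\alpha)}dq$ with $\nu^*=\big(\sum_{j=1}^3|\mathcal A_j||\Gamma_j^*|\big)^{-1}$. *)

(* Defs.v *)
From HB Require Import structures.
From mathcomp Require Import all_boot all_order all_algebra.
From mathcomp Require Import finmap.
From mathcomp Require Import all_classical all_reals all_analysis.
From mathcomp Require Import complex.

Set Implicit Arguments.
Unset Strict Implicit.
Unset Printing Implicit Defensive.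

Import Order.TTheory GRing.Theory Num.Theory.
Import numFieldNormedType.Exports.

Local Open Scope classical_set_scope.
Local Open Scope ring_scope.
Local Open Scope complex_scope.

Section ComplexAnalysis.
Context {R : realType}.

Definition expi (t : R) : R[i] := cos t +i* sin t.

(* Unconditional sums: both are junk unless the family is absolutely summable. *)
Definition rsum {I : choiceType} (f : I -> R) : R :=
  fine (\esum_(i in [set: I]) (Num.max (f i) 0)%:E) -
  fine (\esum_(i in [set: I]) (Num.max (- f i) 0)%:E).

Definition csum {I : choiceType} (f : I -> R[i]) : R[i] :=
  rsum (fun i => complex.Re (f i)) +i* rsum (fun i => complex.Im (f i)).

Definition col2 (x y : R) : 'cV[R]_2 := \col_i (if i == 0 then x else y).

Definition mx22 (p q r s : R) : 'M[R]_2 :=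
  \matrix_(i, j) (if i == 0 then (if j == 0 then p else q)
                  else (if j == 0 then r else s)).

Definition dot (u v : 'cV[R]_2) : R := \sum_i u i 0 * v i 0.

(* The canonical norm of 'cV[R]_2 is the sup norm; this is the Euclidean one. *)
Definition norm2 (u : 'cV[R]_2) : R := Num.sqrt (dot u u).

(* R * R carries the measurable structure, 'cV[R]_2 the linear one. *)
Definition vec (x : R * R) : 'cV[R]_2 := col2 x.1 x.2.

Local Notation lebesgue2 := (@lebesgue_measure R \x @lebesgue_measure R)%E.

Definition area (D : set 'cV[R]_2) : R := fine (lebesgue2 (vec @^-1` D)).

Definition cintegral2 (D : set 'cV[R]_2) (f : 'cV[R]_2 -> R[i]) : R[i] :=
  fine (\int[lebesgue2]_(x in vec @^-1` D)
          (complex.Re (f (vec x)))%:E)%E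
  +i*
  fine (\int[lebesgue2]_(x in vec @^-1` D)
          (complex.Im (f (vec x)))%:E)%E.

Definition fourier (h : 'cV[R]_2 -> R[i]) (xi : 'cV[R]_2) : R[i] :=
  ((4 * pi ^+ 2)^-1)%:C * cintegral2 setT (fun x => h x * expi (- dot xi x)).

End ComplexAnalysis.

(* Operators on l2(I) are represented by maps on all families I -> R[i], of
   which only the values on square-summable families matter. *)
Section BoundedOperators.
Context {R : realType} {I : choiceType}.
Implicit Types (psi phi : I -> R[i]) (S T : (I -> R[i]) -> I -> R[i]).

Definition l2norm psi : \bar R :=
  sqrte (\esum_(i in [set: I]) (Normc.normc (psi i) ^+ 2)%:E).

Definition ell2 psi : Prop := (l2norm psi < +oo)%E.

Definition basis_vec (w : I) : I -> R[i] := fun i => (i == w)%:R.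

Definition opnorm T : \bar R :=
  ereal_sup [set l2norm (T psi) | psi in [set psi | (l2norm psi <= 1)%E]].

Definition bounded_op T : Prop :=
  (forall (c : R[i]) psi phi, ell2 psi -> ell2 phi ->
     T (fun i => c * psi i + phi i) = (fun i => c * T psi i + T phi i)) /\
  (opnorm T < +oo)%E.

Definition in_resolvent T (z : R[i]) : Prop :=
  exists2 S, bounded_op S & forall psi, ell2 psi ->
    S (fun i => z * psi i - T psi i) = psi /\
    (fun i => z * S psi i - T (S psi) i) = psi.

Definition spectrum T : set R[i] := [set z | ~ in_resolvent T z].

Definition poly_op (p : {poly R}) T : (I -> R[i]) -> I -> R[i] :=
  fun psi i => \sum_(k < size p) (p`_k)%:C * iter k T psi i.

(* Continuous functional calculus of a bounded self-adjoint operator T (whose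
   spectrum is real): S = f(T) when S is the limit in operator norm of p_n(T) for
   polynomials p_n converging to f uniformly on the spectrum of T. *)
Definition is_fcalc T (f : R -> R) S : Prop :=
  bounded_op S /\
  exists p : nat -> {poly R},
    (forall e : R, 0 < e -> \forall n \near \oo,
       forall x : R, spectrum T x%:C -> `|(p n).[x] - f x| < e) /\
    opnorm (fun psi i => S psi i - poly_op (p n) T psi i) @[n --> \oo] --> 0%E.

Definition fcalc T (f : R -> R) : (I -> R[i]) -> I -> R[i] :=
  xget (fun _ _ => 0) [set S | is_fcalc T f S].

Definition op_entry T (w w' : I) : R[i] := T (basis_vec w') w.

End BoundedOperators.

Section DensityAverages.
Context {R : realType} {I : choiceType}.

(* A r is expected to be finite for every r. *)
Definition set_average (A : R -> set I) (f : I -> R[i]) (r : R) : R[i] :=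
  (#|` fset_set (A r)|%:R)^-1 * \sum_(w \in A r) f w.

End DensityAverages.

Section TrilayerGraphene.
Context {R : realType}.

Definition layer := 'I_3.
(* false is the orbital jA and true the orbital jB of a layer j. *)
Definition orbital := bool.
(* Lattice vectors are represented by their integer coordinates. *)
Definition Z2 := 'cV[int]_2.

Definition latc : R := 142%:R / 100%:R * Num.sqrt 3.
Definition mxA : 'M[R]_2 := (latc / 2) *: mx22 2 1 0 (Num.sqrt 3).
Definition mxB : 'M[R]_2 := (2 * pi) *: (invmx mxA)^T.
Definition rotmx (t : R) : 'M[R]_2 := mx22 (cos t) (- sin t) (sin t) (cos t).

Definition latvec (L : 'M[R]_2) (n : Z2) : 'cV[R]_2 := L *m map_mx intr n.

Definition incommensurate (L : layer -> 'M[R]_2) : Prop :=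
  forall (J : {set layer}) (n : layer -> Z2),
    \sum_(j in J) latvec (L j) (n j) = 0 <->
    (forall j, j \in J -> latvec (L j) (n j) = 0).

Definition third (j k : layer) : layer :=
  odflt j [pick l : layer | (l != j) && (l != k)].

Section TwistedLattices.
Variable theta : layer -> R.

Definition mxAj (j : layer) : 'M[R]_2 := rotmx (theta j) *m mxA.
Definition mxBj (j : layer) : 'M[R]_2 := rotmx (theta j) *m mxB.

Definition double_incommensurate : Prop :=
  incommensurate mxAj /\ incommensurate mxBj.

Definition lat (j : layer) (n : Z2) : 'cV[R]_2 := latvec (mxAj j) n.
Definition rlat (j : layer) (n : Z2) : 'cV[R]_2 := latvec (mxBj j) n.

Definition rcell (j : layer) : set 'cV[R]_2 :=
  [set mxBj j *m u | u in [set u : 'cV[R]_2 | forall i, 0 <= u i 0 < 1]].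

Definition cstar (j : layer) : R := Num.sqrt (area (rcell j)).

Definition tau (j : layer) (a : orbital) : 'cV[R]_2 :=
  if a then rotmx (theta j) *m ((latc / 2) *: col2 1 (Num.sqrt 3 / 3)) else 0.

(* (n, j, a) stands for the site (A_j n, ja). *)
Definition Omega : choiceType := (Z2 * layer * orbital)%type.

Definition Omega_r (r : R) : set Omega :=
  [set w : Omega | norm2 (lat w.1.2 w.1.1) < r].

(* (G, j, a) with G_j = 0; the vector G_t is B_t (G t). *)
Definition Omega_star : choiceType :=
  {w : {ffun layer -> Z2} * layer * orbital | w.1.1 w.1.2 == 0}.

Definition smom (w : Omega_star) : layer -> Z2 := (val w).1.1.
Definition slay (w : Omega_star) : layer := (val w).1.2.
Definition sorb (w : Omega_star) : orbital := (val w).2.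

Lemma Omega_star0_subproof (j : layer) (a : orbital) :
  let w : {ffun layer -> Z2} * layer * orbital := ([ffun=> 0], j, a) in
  w.1.1 w.1.2 == 0.
Proof. by rewrite /= ffunE. Qed.

Definition Omega_star0 (j : layer) (a : orbital) : Omega_star :=
  exist _ ([ffun=> 0], j, a) (Omega_star0_subproof j a).

Definition Omega_star_r (r : R) : set Omega_star :=
  [set w | Num.sqrt (\sum_(k | k != slay w) norm2 (rlat k (smom w k)) ^+ 2) < r].

End TwistedLattices.

(* intra j a b n is (h_{jb}^{ja})_{A_j n}; inter j a k b is h_{kb}^{ja}, whose value
   is irrelevant when j = k. *)
Record hoppings := Hoppings {
  intra : layer -> orbital -> orbital -> Z2 -> R[i];
  inter : layer -> orbital -> layer -> orbital -> 'cV[R]_2 -> R[i] }.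

Section Hamiltonian.
Variables (theta : layer -> R) (h : hoppings).

Definition continuous_hoppings : Prop :=
  forall j a k b, j != k ->
    continuous (inter h j a k b : 'cV[R]_2 -> R[i]^o).

Definition exp_decay : Prop :=
  exists g1 g2 : R, [/\ 0 < g1, 0 < g2,
    forall j a k b, j != k ->
      (ereal_sup [set (Normc.normc (inter h j a k b x) * expR (g1 * norm2 x))%:E
                 | x in [set: 'cV[R]_2]] +
       ereal_sup [set (Normc.normc (fourier (inter h j a k b) xi)
                       * expR (g2 * norm2 xi))%:E
                 | xi in [set: 'cV[R]_2]] < +oo)%E
  & forall j a b,
      (ereal_sup [set (Normc.normc (intra h j a b n)
                       * expR (g1 * norm2 (lat theta j n)))%:E
                 | n in [set: Z2]] < +oo)%E].

Definition hermitian_hoppings : Prop :=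
  (forall j a b n, intra h j a b n = (intra h j b a (- n))^*) /\
  (forall j a k b x, j != k -> inter h j a k b x = (inter h k b j a (- x))^*).

Definition nearest_layer_coupling : Prop :=
  forall a b x, inter h ord0 a ord_max b x = 0 /\
                inter h ord_max a ord0 b x = 0.

Definition real_hamiltonian (psi : Omega -> R[i]) : Omega -> R[i] :=
  fun w => let: (n, j, a) := w in
    csum (fun p : Z2 * orbital =>
            intra h j a p.2 (n - p.1) * psi (p.1, j, p.2)) +
    \sum_(k : layer | k != j)
      csum (fun p : Z2 * orbital =>
              inter h j a k p.2
                (lat theta j n + tau theta j a
                 - lat theta k p.1 - tau theta k p.2)
              * psi (p.1, k, p.2)).

Definition intra_bloch (j : layer) (a b : orbital) (q : 'cV[R]_2) : R[i] :=
  csum (fun n : Z2 =>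
    expi (- dot q (lat theta j n + tau theta j a - tau theta j b))
    * intra h j a b n).

Definition reciprocal_entry (q : 'cV[R]_2) (w w' : Omega_star) : R[i] :=
  let G := smom w in let j := slay w in let a := sorb w in
  let G' := smom w' in let k := slay w' in let b := sorb w' in
  if j == k then
    ((val w).1.1 == (val w').1.1)%:R
    * intra_bloch j a b (q + \sum_t rlat theta t (G t))
  else
    let l := third j k in
    (G l == G' l)%:R * (cstar theta j * cstar theta k)%:C
    * expi (dot (rlat theta j (G' j)) (tau theta j a)
            - dot (rlat theta k (G k)) (tau theta k b))
    * fourier (inter h j a k b)
        (q + rlat theta j (G' j) + rlat theta k (G k) + rlat theta l (G l)).

Definition reciprocal_hamiltonian (q : 'cV[R]_2) (psi : Omega_star -> R[i]) :
    Omega_star -> R[i] :=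
  fun w => csum (fun w' => reciprocal_entry q w w' * psi w').

Definition gauss (eps E : R) : R :=
  (eps * Num.sqrt (2 * pi))^-1 * expR (- (E ^+ 2 / (2 * eps ^+ 2))).

Definition real_dos_average (eps E : R) : R -> R[i] :=
  set_average (Omega_r theta)
    (fun w => op_entry (fcalc real_hamiltonian (fun x => gauss eps (E - x))) w w).

Definition reciprocal_dos_average (eps E : R) : R -> R[i] :=
  set_average (Omega_star_r theta)
    (fun w => op_entry
       (fcalc (reciprocal_hamiltonian 0) (fun x => gauss eps (E - x))) w w).

Definition real_dos (eps E : R) : R[i] :=
  lim ((real_dos_average eps E r : R[i]^o) @[r --> +oo]).

Definition reciprocal_dos (eps E : R) : R[i] :=
  lim ((reciprocal_dos_average eps E r : R[i]^o) @[r --> +oo]).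

Definition nu_star : R :=
  (\sum_(j : layer) #|{: orbital}|%:R * area (rcell theta j))^-1.

Definition momentum_trace (f : R -> R) : R[i] :=
  nu_star%:C * \sum_(j : layer) \sum_(a : orbital)
    cintegral2 (rcell theta j) (fun q =>
      op_entry (fcalc (reciprocal_hamiltonian q) f)
        (Omega_star0 j a) (Omega_star0 j a)).

End Hamiltonian.
End TrilayerGraphene.

Arguments hoppings : clear implicits.

(* Main.v *)
(** Both Hamiltonians are Hermitian kernels with absolutely summable rows, and
the Gaussian is entire, so the functional calculus [f(H)] has the kernel
[sum_n b_n H^n], and likewise for the reciprocal Hamiltonians [Hhat_q].  By
Poisson summation the plane waves [Phi_q(R,G) = e^{i(q + sum G).(R + tau)}] of a
fixed layer and orbital intertwine [H] with [Hhat_q], hence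
[f(H) Phi_q = Phi_q f(Hhat_q)].

Fix a layer [j] and an orbital, and let [a_r(m)] be the average over the sites
[|A_j n| < r] of the entry of [f(H)] between [A_j n] and [A_j (n + m)].
Averaging the intertwining relation, the terms [e^{i(sum G' - sum G).A_j n}] with
[G' <> G] tend to 0, because incommensurability of the reciprocal lattices makes
these characters of [Z^2] nontrivial.  Therefore
[sum_m a_r(m) e^{i q.A_j m}] tends to the diagonal entry [F(q)] of [f(Hhat_q)] at
[G = 0].  The coefficients [a_r(m)] decay exponentially in [m], uniformly in [r],
so integrating over the unit cell shows that they converge, and
[F(q) = sum_m c_m e^{i q.A_j m}].

The three densities are now all equal to the mean of [c_0] over the six orbitals:
the real space average is the limit of [a_r(0)], the momentum integral is the
zeroth Fourier coefficient of [F], and the reciprocal average is that of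
[F(sum G)], where incommensurability of the real lattices kills every [m <> 0]. *)

Require Import Defs.
From mathcomp Require Import all_boot all_order all_algebra.
From mathcomp Require Import finmap.
From mathcomp Require Import all_classical all_reals all_analysis.
From mathcomp Require Import measurable_realfun.
From mathcomp Require Import complex.
From mathcomp Require Import ring lra zify.

Set Implicit Arguments.
Unset Strict Implicit.
Unset Printing Implicit Defensive.

Import Order.TTheory GRing.Theory Num.Theory.
Import numFieldNormedType.Exports.

Local Open Scope classical_set_scope.
Local Open Scope ring_scope.
Local Open Scope complex_scope.

(** * Absolutely summable families *)

(** [fcalc] picks an arbitrary operator among the limits of polynomials in H that approximate f on
    the spectrum alone. That it has the entries of the power series rests on bounding p(T) by the
    values of |p| on the spectrum. This is done without a spectral theorem: p^2 - N is factored over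
    the complex numbers, and T - z is bounded below off the spectrum.

    Plane waves are bounded but not square summable, so the power series must also act on bounded
    families. Hence operators are carried by kernels with row bounds (for bounded families) and
    column bounds (for summable families); the Schur test leads back to l2.

    Poisson summation needs a continuous function without Fourier coefficients to vanish at one
    point only, and powers of one trigonometric peak give this.

    Equidistribution needs no asymptotic count: translation by a basis vector multiplies the
    character by some z different from 1 and changes the ball only near its boundary, which is
    smaller by a factor of order r. Upper and lower bounds by powers of r suffice. *)

Notation nrm := Normc.normc.

Section ComplexNorm.
Context {R : realType}.
Implicit Types (x y z : R[i]).

Lemma nrm_ge0 z : 0 <= nrm z.
Proof. by case: z => a b; exact: sqrtr_ge0. Qed.

Lemma nrmM x y : nrm (x * y) = nrm x * nrm y.
Proof. exact: Normc.normcM. Qed.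

Lemma nrmD x y : nrm (x + y) <= nrm x + nrm y.
Proof. exact: le_normcD. Qed.

Lemma nrmN x : nrm (- x) = nrm x.
Proof. exact: normcN. Qed.

Lemma nrmB x y : nrm (x - y) <= nrm x + nrm y.
Proof. by rewrite (le_trans (nrmD _ _))// nrmN. Qed.

Lemma nrmBC x y : nrm (x - y) = nrm (y - x).
Proof. by rewrite -nrmN opprB. Qed.

Lemma nrm0 : nrm (0 : R[i]) = 0.
Proof. exact: Normc.normc0. Qed.

Lemma nrm1 : nrm (1 : R[i]) = 1.
Proof. exact: Normc.normc1. Qed.

Lemma nrm_eq0 z : nrm z = 0 -> z = 0.
Proof. exact: Normc.eq0_normc. Qed.

Lemma nrm_real (a : R) : nrm a%:C = `|a|.
Proof. by rewrite /= expr0n /= addr0 sqrtr_sqr. Qed.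

Lemma normE z : `|z| = (nrm z)%:C.
Proof. by case: z. Qed.

Lemma nrm_sqr z : nrm z ^+ 2 = complex.Re z ^+ 2 + complex.Im z ^+ 2.
Proof. by case: z => a b /=; rewrite sqr_sqrtr// addr_ge0// sqr_ge0. Qed.

Lemma nrm_conj z : nrm (conjc z) = nrm z.
Proof. by case: z => a b /=; rewrite sqrrN. Qed.

Lemma Re_le_nrm z : `|complex.Re z| <= nrm z.
Proof. by case: z => a b /=; rewrite -sqrtr_sqr ler_wsqrtr// lerDl sqr_ge0. Qed.

Lemma Im_le_nrm z : `|complex.Im z| <= nrm z.
Proof. by case: z => a b /=; rewrite -sqrtr_sqr ler_wsqrtr// lerDr sqr_ge0. Qed.

Lemma nrm_le_ReIm z : nrm z <= `|complex.Re z| + `|complex.Im z|.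
Proof.
case: z => a b /=; rewrite -(@ler_pXn2r _ 2)// ?nnegrE ?sqrtr_ge0 ?addr_ge0//.
rewrite sqr_sqrtr ?addr_ge0 ?sqr_ge0// sqrrD !real_normK ?num_real//.
by rewrite addrAC lerDl mulrn_wge0// mulr_ge0.
Qed.

Lemma nrm_sum I (s : seq I) (P : pred I) (f : I -> R[i]) :
  nrm (\sum_(i <- s | P i) f i) <= \sum_(i <- s | P i) nrm (f i).
Proof.
elim/big_rec2: _ => [|i a b _ h]; first by rewrite nrm0.
by rewrite (le_trans (nrmD _ _))// lerD2l.
Qed.

Lemma cReD x y : complex.Re (x + y) = complex.Re x + complex.Re y.
Proof. by case: x; case: y. Qed.
Lemma cImD x y : complex.Im (x + y) = complex.Im x + complex.Im y.
Proof. by case: x; case: y. Qed.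
Lemma cReN x : complex.Re (- x) = - complex.Re x.
Proof. by case: x. Qed.
Lemma cImN x : complex.Im (- x) = - complex.Im x.
Proof. by case: x. Qed.
Lemma cReM x y : complex.Re (x * y) =
  complex.Re x * complex.Re y - complex.Im x * complex.Im y.
Proof. by case: x; case: y. Qed.
Lemma cImM x y : complex.Im (x * y) =
  complex.Re x * complex.Im y + complex.Im x * complex.Re y.
Proof. by case: x => a b; case: y => c d. Qed.
Lemma complex_eq x y :
  complex.Re x = complex.Re y -> complex.Im x = complex.Im y -> x = y.
Proof. by case: x => a b; case: y => c d /= -> ->. Qed.

Lemma rcM (a b : R) : (a * b)%:C = a%:C * b%:C :> R[i].
Proof. by rewrite rmorphM. Qed.
Lemma nrm_expi (t : R) : nrm (expi t) = 1.
Proof. by rewrite /expi /= cos2Dsin2 sqrtr1. Qed.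

Lemma expiD (s t : R) : expi (s + t) = expi s * expi t.
Proof.
apply: complex_eq; rewrite ?cReM ?cImM /= ?cosD// sinD.
by rewrite addrC [X in _ + X]mulrC mulrC.
Qed.

Lemma expi0 : expi (0 : R) = 1.
Proof. by rewrite /expi cos0 sin0. Qed.

Lemma conj_expi (t : R) : (conjc (expi t)) = expi (- t).
Proof. by rewrite /expi /= cosN sinN. Qed.

End ComplexNorm.

Section RealSums.
Context {R : realType} {I : choiceType}.
Implicit Types f g h : I -> R.

Definition rsm f := (\esum_(i in [set: I]) `|f i|%:E < +oo)%E.

Lemma esum_EFin_ge0 f : (forall i, 0 <= f i) ->
  (0 <= \esum_(i in [set: I]) (f i)%:E)%E.
Proof. by move=> f0; apply: esum_ge0 => i _; rewrite lee_fin. Qed.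

Lemma rsm_le f g : (forall i, `|f i| <= g i) ->
  (\esum_(i in [set: I]) (g i)%:E < +oo)%E -> rsm f.
Proof.
move=> fg; apply: le_lt_trans; apply: le_esum => i _.
by rewrite lee_fin.
Qed.

Lemma rsm_ge0 f : (forall i, 0 <= f i) ->
  (\esum_(i in [set: I]) (f i)%:E < +oo)%E -> rsm f.
Proof. by move=> f0; apply: rsm_le => i; rewrite ger0_norm. Qed.

(** The positive and negative parts that define [rsum] are not additive in f. Allowing any
    decomposition into nonnegative summable families makes linearity and Fubini follow from the
    corresponding facts for nonnegative sums. *)
Lemma rsum_decomp f g h :
  (forall i, 0 <= g i) -> (forall i, 0 <= h i) ->
  (\esum_(i in [set: I]) (g i)%:E < +oo)%E ->
  (\esum_(i in [set: I]) (h i)%:E < +oo)%E ->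
  (forall i, f i = g i - h i) ->
  rsum f = fine (\esum_(i in [set: I]) (g i)%:E)
         - fine (\esum_(i in [set: I]) (h i)%:E).
Proof.
move=> g0 h0 gf hf fE.
have aux (u : I -> R) : (forall i, 0 <= u i) ->
  (\esum_(i in [set: I]) (u i)%:E < +oo)%E -> summable setT (fun i => (u i)%:E).
  move=> u0; rewrite /summable.
  by congr (_ < _)%E; apply: eq_esum => i _; rewrite gee0_abs// lee_fin.
have finE (u : I -> R) : (forall i, 0 <= u i) ->
  (\esum_(i in [set: I]) (u i)%:E < +oo)%E ->
   (\esum_(i in [set: I]) (u i)%:E)%E \is a fin_num.
  by move=> u0 uf; rewrite ge0_fin_numE// esum_EFin_ge0.
have := @esumB R I setT (fun i => (g i)%:E) (fun i => (h i)%:E).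
move=> /(_ (aux _ g0 gf) (aux _ h0 hf)).
have lef (i : I) : `|f i| <= g i + h i.
  by rewrite fE (le_trans (ler_normB _ _))// !ger0_norm.
have ghf : (\esum_(i in [set: I]) (g i + h i)%:E < +oo)%E.
  under eq_esum do rewrite EFinD.
  rewrite esumD ?lte_add_pinfty// => i _; rewrite lee_fin//.
rewrite (_ : esum setT _ = \esum_(i in [set: I]) (Num.max (f i) 0)%:E); last first.
  by apply: eq_esum => i _; rewrite funeposE fE /= -EFinB EFin_max.
rewrite (_ : esum setT ((fun i => (g i)%:E) \- (fun i => (h i)%:E))^\-%E =
   \esum_(i in [set: I]) (Num.max (- f i) 0)%:E); last first.
  by apply: eq_esum => i _; rewrite funenegE fE /= EFin_max.
move=> E; rewrite /rsum -!fineB ?finE//.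
- by congr fine; apply: E => i _; rewrite lee_fin.
- by move=> i; rewrite le_max lexx orbT.
- apply: le_lt_trans ghf; apply: le_esum => i _; rewrite lee_fin ge_max.
  by rewrite (le_trans (ler_norm _) (lef i)) (le_trans (normr_ge0 _) (lef i)).
- by move=> i; rewrite le_max lexx orbT.
- apply: le_lt_trans ghf; apply: le_esum => i _; rewrite lee_fin ge_max.
  rewrite (le_trans (normr_ge0 _) (lef i)) (le_trans _ (lef i))//.
  by rewrite -normrN ler_norm.
Qed.

Lemma rsum_ge0E f : (forall i, 0 <= f i) ->
  (\esum_(i in [set: I]) (f i)%:E < +oo)%E ->
  rsum f = fine (\esum_(i in [set: I]) (f i)%:E).
Proof.
move=> f0 ff; rewrite (@rsum_decomp f f (fun=> 0))//.
- by rewrite (@esum1 _ _ _ (fun=> 0%:E)) ?subr0.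
- by rewrite esum1.
- by move=> i; rewrite subr0.
Qed.

Lemma rsmD f g : rsm f -> rsm g -> rsm (fun i => f i + g i).
Proof.
move=> ff gf; apply: (@rsm_le _ (fun i => `|f i| + `|g i|)).
  by move=> i; exact: ler_normD.
under eq_esum do rewrite EFinD.
by rewrite esumD ?lte_add_pinfty// => i _; rewrite lee_fin.
Qed.

Lemma rsm_pos f : rsm f -> (\esum_(i in [set: I]) (Num.max (f i) 0)%:E < +oo)%E.
Proof.
apply: le_lt_trans; apply: le_esum => i _.
by rewrite lee_fin ge_max ler_norm normr_ge0.
Qed.

Lemma rsm_neg f : rsm f -> (\esum_(i in [set: I]) (Num.max (- f i) 0)%:E < +oo)%E.
Proof.
apply: le_lt_trans; apply: le_esum => i _.
by rewrite lee_fin ge_max -normrN ler_norm normr_ge0.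
Qed.

Lemma max0_ge0 (x : R) : 0 <= Num.max x 0.
Proof. by rewrite le_max lexx orbT. Qed.

Lemma max0B (x : R) : x = Num.max x 0 - Num.max (- x) 0.
Proof.
rewrite /Num.max; case: ltgtP => [x0|x0|->]; rewrite ?oppr_lt0 ?oppr_gt0.
- by rewrite ltNge (ltW x0) /= sub0r opprK.
- by rewrite x0 subr0.
- by rewrite oppr0 ltxx subr0.
Qed.

Lemma esum_fin f : (forall i, 0 <= f i) ->
  (\esum_(i in [set: I]) (f i)%:E < +oo)%E ->
  (\esum_(i in [set: I]) (f i)%:E)%E \is a fin_num.
Proof. by move=> u0 uf; rewrite ge0_fin_numE// esum_EFin_ge0. Qed.

Lemma rsumD f g : rsm f -> rsm g -> rsum (fun i => f i + g i) = rsum f + rsum g.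
Proof.
move=> ff gf.
rewrite (@rsum_decomp _ (fun i => Num.max (f i) 0 + Num.max (g i) 0)
   (fun i => Num.max (- f i) 0 + Num.max (- g i) 0)).
- under eq_esum do rewrite EFinD.
  under [X in _ - fine X]eq_esum do rewrite EFinD.
  rewrite !esumD; try by move=> i _; rewrite lee_fin max0_ge0.
  rewrite !fineD; try by apply: esum_fin => [i|]; rewrite ?max0_ge0//;
    (exact: rsm_pos || exact: rsm_neg).
  by rewrite /rsum opprD addrACA.
- by move=> i; rewrite addr_ge0 ?max0_ge0.
- by move=> i; rewrite addr_ge0 ?max0_ge0.
- under eq_esum do rewrite EFinD.
  rewrite esumD; try by move=> i _; rewrite lee_fin max0_ge0.
  by rewrite lte_add_pinfty ?rsm_pos.
- under eq_esum do rewrite EFinD.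
  rewrite esumD; try by move=> i _; rewrite lee_fin max0_ge0.
  by rewrite lte_add_pinfty// rsm_neg.
- by move=> i; rewrite opprD addrACA -!max0B.
Qed.

Lemma esumZl (c : R) f : 0 <= c -> (forall i, 0 <= f i) ->
  (\esum_(i in [set: I]) (c * f i)%:E = c%:E * \esum_(i in [set: I]) (f i)%:E)%E.
Proof.
move=> c0 f0; move: c0; rewrite le_eqVlt => /predU1P[<-|c0].
  by rewrite mul0e esum1// => i _; rewrite mul0r.
rewrite /esum; apply/eqP; rewrite eq_le; apply/andP; split.
  apply: ge_ereal_sup => _ [X [Xf _] <-].
  under eq_fsbigr do rewrite EFinM.
  rewrite -ge0_mule_fsumr; last by move=> i; rewrite lee_fin.
  rewrite lee_pmul2l ?lte_fin//.
  by apply: ereal_sup_ubound; exists X.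
rewrite -lee_pdivlMl//; apply: ge_ereal_sup => _ [X [Xf _] <-].
rewrite lee_pdivlMl// ge0_mule_fsumr; last by move=> i; rewrite lee_fin.
by apply: ereal_sup_ubound; exists X.
Qed.

Lemma rsmZ c f : rsm f -> rsm (fun i => c * f i).
Proof.
rewrite /rsm => ff; under eq_esum do rewrite normrM.
rewrite esumZl//.
rewrite -(fineK (esum_fin _ ff)) //.
exact: ltey.
Qed.

Lemma rsumN f : rsum (fun i => - f i) = - rsum f.
Proof. by rewrite /rsum opprB; under [X in _ - fine X]eq_esum do rewrite opprK. Qed.

Lemma rsumZ c f : rsm f -> rsum (fun i => c * f i) = c * rsum f.
Proof.
move=> ff.
wlog c0 : c / 0 <= c.
  move=> H; have [/H//|c0] := leP 0 c.
  rewrite -[c]opprK mulNr -H ?oppr_ge0 ?ltW// -rsumN.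
  by congr rsum; apply/funext => i; rewrite mulNr.
rewrite (@rsum_decomp _ (fun i => c * Num.max (f i) 0)
   (fun i => c * Num.max (- f i) 0)).
- rewrite !esumZl//; try by move=> i; exact: max0_ge0.
  rewrite !fineM//; try by apply: esum_fin => [i|]; rewrite ?max0_ge0//;
    (exact: rsm_pos || exact: rsm_neg).
  by rewrite -mulrBr.
- by move=> i; rewrite mulr_ge0 ?max0_ge0.
- by move=> i; rewrite mulr_ge0 ?max0_ge0.
- rewrite esumZl//; last by move=> i; exact: max0_ge0.
  rewrite -(fineK (esum_fin _ (rsm_pos ff))) ?ltey// => i; exact: max0_ge0.
- rewrite esumZl//; last by move=> i; exact: max0_ge0.
  rewrite -(fineK (esum_fin _ (rsm_neg ff))) ?ltey// => i; exact: max0_ge0.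
- by move=> i; rewrite -mulrBr -max0B.
Qed.

Lemma rsum_ge0 f : (forall i, 0 <= f i) -> 0 <= rsum f.
Proof.
move=> f0; rewrite /rsum [X in _ - fine X]esum1 ?subr0.
  by rewrite fine_ge0// esum_EFin_ge0// => i; exact: max0_ge0.
by move=> i _; rewrite max_r// oppr_le0.
Qed.

Lemma rsm_sub f g : rsm f -> rsm g -> rsm (fun i => f i - g i).
Proof.
move=> ff gf; apply: rsmD => //.
by rewrite /rsm; under eq_esum do rewrite normrN.
Qed.

Lemma rsumB f g : rsm f -> rsm g -> rsum (fun i => f i - g i) = rsum f - rsum g.
Proof.
move=> ff gf; rewrite rsumD ?rsumN//.
by rewrite /rsm; under eq_esum do rewrite normrN.
Qed.

Lemma le_rsum f g : rsm f -> rsm g -> (forall i, f i <= g i) -> rsum f <= rsum g.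
Proof.
by move=> ff gf fg; rewrite -subr_ge0 -rsumB// rsum_ge0// => i; rewrite subr_ge0.
Qed.

Lemma rsumE f : (forall i, 0 <= f i) -> rsm f ->
  (\esum_(i in [set: I]) (f i)%:E)%E = (rsum f)%:E.
Proof.
move=> f0; rewrite /rsm; under eq_esum do rewrite ger0_norm//.
by move=> ff; rewrite rsum_ge0E// fineK// esum_fin.
Qed.

End RealSums.

Section RealSums2.
Context {R : realType}.

Lemma esum_pair (I J : choiceType) (f : I -> J -> R) :
  (forall i j, 0 <= f i j) ->
  (\esum_(i in [set: I]) \esum_(j in [set: J]) (f i j)%:E =
   \esum_(p in [set: (I * J)%type]) (f p.1 p.2)%:E)%E.
Proof.
move=> f0; rewrite esum_esum; last by move=> i j _ _; rewrite lee_fin.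
by congr esum; apply/seteqP; split => -[].
Qed.

Lemma esum_swap (I J : choiceType) (f : I -> J -> R) :
  (forall i j, 0 <= f i j) ->
  (\esum_(i in [set: I]) \esum_(j in [set: J]) (f i j)%:E =
   \esum_(j in [set: J]) \esum_(i in [set: I]) (f i j)%:E)%E.
Proof.
move=> f0; rewrite !esum_pair//.
rewrite (@reindex_esum R (I * J)%type (J * I)%type setT setT (fun p => (p.2, p.1)))//.
by split => // [[i j] [i' j'] _ _ [-> ->]|[i j] _]; last by exists (j, i).
Qed.

Lemma rsm_pair (I J : choiceType) (f : I * J -> R) :
  rsm f -> forall i, rsm (fun j => f (i, j)).
Proof.
rewrite /rsm => ff i.
have E : (\esum_(i in [set: I]) \esum_(j in [set: J]) `|f (i, j)|%:E =
   \esum_(p in [set: (I * J)%type]) `|f p|%:E)%E.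
  rewrite (@esum_pair _ _ (fun i j => `|f (i, j)|))//.
  by apply: eq_esum => -[].
rewrite -E in ff; apply: le_lt_trans ff; apply: esum_ge; exists [set i].
  by split => //; exact: finite_set1.
by rewrite fsbig_set1.
Qed.

(** Tonelli applies to the positive and the negative part of f separately. The inner sums P and N of
    these parts are in general not the parts of the inner sums of f, which is why [rsum_decomp] is
    needed. *)
Lemma rsum_pair (I J : choiceType) (f : I * J -> R) : rsm f ->
  rsm (fun i => rsum (fun j => f (i, j))) /\
  rsum f = rsum (fun i => rsum (fun j => f (i, j))).
Proof.
move=> ff.
have fi := rsm_pair ff.
pose P i := fine (\esum_(j in [set: J]) (Num.max (f (i, j)) 0)%:E)%E.
pose N i := fine (\esum_(j in [set: J]) (Num.max (- f (i, j)) 0)%:E)%E.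
have PE : (\esum_(i in [set: I]) (P i)%:E =
   \esum_(p in [set: (I * J)%type]) (Num.max (f p) 0)%:E)%E.
  rewrite (_ : (fun p : I * J => (Num.max (f p) 0)%:E) =
     (fun p => (Num.max (f (p.1, p.2)) 0)%:E)); last by apply/funext => -[].
  rewrite -(@esum_pair _ _ (fun i j => Num.max (f (i, j)) 0))//; last first.
    by move=> i j; exact: max0_ge0.
  apply: eq_esum => i _; rewrite fineK//; apply: esum_fin; last exact: rsm_pos.
  by move=> j; exact: max0_ge0.
have NE : (\esum_(i in [set: I]) (N i)%:E =
   \esum_(p in [set: (I * J)%type]) (Num.max (- f p) 0)%:E)%E.
  rewrite (_ : (fun p : I * J => (Num.max (- f p) 0)%:E) =
     (fun p => (Num.max (- f (p.1, p.2)) 0)%:E)); last by apply/funext => -[].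
  rewrite -(@esum_pair _ _ (fun i j => Num.max (- f (i, j)) 0))//; last first.
    by move=> i j; exact: max0_ge0.
  apply: eq_esum => i _; rewrite fineK//; apply: esum_fin; last exact: rsm_neg.
  by move=> j; exact: max0_ge0.
have P0 i : 0 <= P i.
  by apply: fine_ge0; apply: esum_EFin_ge0 => j; exact: max0_ge0.
have N0 i : 0 <= N i.
  by apply: fine_ge0; apply: esum_EFin_ge0 => j; exact: max0_ge0.
have PF : (\esum_(i in [set: I]) (P i)%:E < +oo)%E by rewrite PE rsm_pos.
have NF : (\esum_(i in [set: I]) (N i)%:E < +oo)%E by rewrite NE rsm_neg.
have E : (fun i => rsum (fun j => f (i, j))) = (fun i => P i - N i) by [].
split; rewrite E; first by apply: rsm_sub; exact: rsm_ge0.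
by rewrite (@rsum_decomp _ _ (fun i => P i - N i) P N)// PE NE.
Qed.

End RealSums2.

Section ComplexSums.
Context {R : realType}.

(** Extended-real valued, so that comparisons and Tonelli exchanges can be stated before finiteness
    is known. *)
Definition asum {I : choiceType} (f : I -> R[i]) : \bar R :=
  (\esum_(i in [set: I]) (nrm (f i))%:E)%E.
Definition summ {I : choiceType} (f : I -> R[i]) : Prop := (asum f < +oo)%E.

Section OneIndex.
Context {I : choiceType}.
Implicit Types (f g : I -> R[i]) (c : R[i]).

Lemma summ_Re f : summ f -> rsm (fun i => complex.Re (f i)).
Proof. by apply: rsm_le => i; exact: Re_le_nrm. Qed.

Lemma summ_Im f : summ f -> rsm (fun i => complex.Im (f i)).
Proof. by apply: rsm_le => i; exact: Im_le_nrm. Qed.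

Lemma asum_ge0 f : (0 <= asum f)%E.
Proof. by apply: esum_EFin_ge0 => i; exact: nrm_ge0. Qed.

Lemma summ_rsm f : summ f <-> rsm (fun i => nrm (f i)).
Proof.
rewrite /summ /rsm /asum; suff -> : (fun i => (nrm (f i))%:E) =
  (fun i => `|nrm (f i)|%:E) by [].
by apply/funext => i; rewrite ger0_norm ?nrm_ge0.
Qed.

Lemma summ_real (f : I -> R) : rsm f -> summ (fun i => (f i)%:C).
Proof.
rewrite /summ /asum /rsm; congr (_ < _)%E; apply: eq_esum => i _.
by rewrite nrm_real.
Qed.

Lemma asum_le f g : (forall i, nrm (f i) <= nrm (g i)) -> (asum f <= asum g)%E.
Proof. by move=> fg; apply: le_esum => i _; rewrite lee_fin. Qed.

Lemma summ_le f g : (forall i, nrm (f i) <= nrm (g i)) -> summ g -> summ f.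
Proof. by move=> /asum_le; exact: le_lt_trans. Qed.

Lemma summ_le_r f (g : I -> R) : (forall i, nrm (f i) <= g i) -> rsm g -> summ f.
Proof.
move=> fg gs; apply/summ_rsm; apply: rsm_le gs => i.
by rewrite ger0_norm ?nrm_ge0// (le_trans (fg i))// ler_norm.
Qed.

Lemma asumD f g : (asum (fun i => f i + g i)%R <= asum f + asum g)%E.
Proof.
rewrite /asum -esumD; try by move=> i _; rewrite lee_fin nrm_ge0.
by apply: le_esum => i _; rewrite -EFinD lee_fin nrmD.
Qed.

Lemma summD f g : summ f -> summ g -> summ (fun i => f i + g i).
Proof. by move=> ff gf; apply: le_lt_trans (asumD _ _) _; rewrite lte_add_pinfty. Qed.

Lemma summN f : summ f -> summ (fun i => - f i).
Proof. by apply: summ_le => i; rewrite nrmN. Qed.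

Lemma asumZ c f : (asum (fun i => c * f i)%R = (nrm c)%:E * asum f)%E.
Proof.
rewrite /asum -esumZl ?nrm_ge0//; last by move=> i; exact: nrm_ge0.
by apply: eq_esum => i _; rewrite nrmM.
Qed.

Lemma summ_fin f : summ f -> asum f \is a fin_num.
Proof. by move=> ff; rewrite ge0_fin_numE ?asum_ge0. Qed.

Lemma summZ c f : summ f -> summ (fun i => c * f i).
Proof.
by move=> ff; rewrite /summ asumZ -(fineK (summ_fin ff)) ltey.
Qed.

Lemma summ_bnd f (g : I -> R[i]) (C : R) : (forall i, nrm (g i) <= C) ->
  summ f -> summ (fun i => g i * f i).
Proof.
move=> gC ff.
apply: (@summ_le _ (fun i => C%:C * f i)); last exact: summZ.
move=> i; rewrite !nrmM ler_wpM2r ?nrm_ge0// nrm_real.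
by rewrite (le_trans (gC i))// ler_norm.
Qed.

Lemma csumD f g : summ f -> summ g ->
  csum (fun i => f i + g i) = csum f + csum g.
Proof.
move=> ff gf; apply: complex_eq; rewrite /csum ?cReD ?cImD /= -rsumD.
- by congr rsum; apply/funext => i; rewrite cReD.
- exact: summ_Re.
- exact: summ_Re.
- by congr rsum; apply/funext => i; rewrite cImD.
- exact: summ_Im.
- exact: summ_Im.
Qed.

Lemma csumZ c f : summ f -> csum (fun i => c * f i) = c * csum f.
Proof.
move=> ff.
have fR := summ_Re ff; have fI := summ_Im ff.
apply: complex_eq; rewrite /csum ?cReM ?cImM /= -!rsumZ//.
- rewrite -rsumB; [|exact: rsmZ..].
  by congr rsum; apply/funext => i; rewrite cReM.
- rewrite -rsumD; [|exact: rsmZ..].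
  by congr rsum; apply/funext => i; rewrite cImM.
Qed.

Lemma csumN f : summ f -> csum (fun i => - f i) = - csum f.
Proof.
move=> ff; rewrite -mulN1r -csumZ//.
by congr csum; apply/funext => i; rewrite mulN1r.
Qed.

Lemma csumB f g : summ f -> summ g ->
  csum (fun i => f i - g i) = csum f - csum g.
Proof. by move=> ff gf; rewrite csumD ?csumN//; exact: summN. Qed.

Lemma csum0 : csum (fun _ : I => 0 : R[i]) = 0.
Proof.
have ff : summ (fun _ : I => 0 : R[i]).
  by rewrite /summ /asum esum1 ?ltry// => i _; rewrite nrm0.
transitivity (csum (fun _ : I => 0 * (0 : R[i]))); last by rewrite csumZ// mul0r.
by congr csum; apply/funext => i; rewrite mul0r.
Qed.

Lemma summ0 : summ (fun _ : I => 0 : R[i]).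
Proof. by rewrite /summ /asum esum1 ?ltry// => i _; rewrite nrm0. Qed.

Lemma csum_conj f : csum (fun i => (conjc (f i))) = (conjc (csum f)).
Proof.
apply: complex_eq => /=.
  by congr rsum; apply/funext => i; case: (f i).
by rewrite -rsumN; congr rsum; apply/funext => i; case: (f i).
Qed.

Lemma nrm_csum f : summ f -> ((nrm (csum f))%:E <= asum f)%E.
Proof.
move=> ff; have := ff; rewrite summ_rsm => fr.
have [->|n0] := eqVneq (nrm (csum f)) 0; first exact: asum_ge0.
have n1 : 0 < nrm (csum f) by rewrite lt_neqAle eq_sym n0 nrm_ge0.
rewrite /asum rsumE//; last by move=> i; exact: nrm_ge0.
rewrite lee_fin -(ler_pM2l n1) -expr2.
set z := csum f in n0 n1 *.
(* With z the sum, |z|^2 is the sum of the real numbers Re (conj z f_i), each at most |z| |f_i|. *)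
have -> : nrm z ^+ 2 = rsum (fun i => complex.Re ((conjc z) * f i)).
  transitivity (complex.Re (csum (fun i => (conjc z) * f i))); last by [].
  rewrite csumZ// -/z nrm_sqr; case: z {n0 n1} => a b /=.
  by rewrite -!expr2 mulNr opprK.
rewrite -rsumZ//; apply: le_rsum.
- by apply: summ_Re; exact: summZ.
- exact: rsmZ.
- by move=> i; rewrite (le_trans (ler_norm _))// (le_trans (Re_le_nrm _))// nrmM nrm_conj.
Qed.

Lemma nrm_csum_le f (C : R) : (asum f <= C%:E)%E -> nrm (csum f) <= C.
Proof.
move=> fC; rewrite -lee_fin (le_trans _ fC)// nrm_csum//.
by rewrite /summ (le_lt_trans fC)// ltry.
Qed.

Lemma csum_real (f : I -> R) : csum (fun i => (f i)%:C) = (rsum f)%:C.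
Proof.
apply: complex_eq => //=.
by rewrite /rsum [X in fine X]esum1 ?[X in _ - fine X]esum1 ?subr0// => i _; rewrite ?oppr0 max_r.
Qed.

End OneIndex.

Lemma asum_swap (I J : choiceType) (f : I -> J -> R[i]) :
  (\esum_(i in [set: I]) asum (f i) = \esum_(j in [set: J]) asum (f ^~ j))%E.
Proof. by rewrite /asum esum_swap// => i j; exact: nrm_ge0. Qed.

Lemma asum_pair (I J : choiceType) (f : I -> J -> R[i]) :
  (\esum_(i in [set: I]) asum (f i) = asum (fun p : I * J => f p.1 p.2))%E.
Proof. by rewrite /asum esum_pair// => i j; exact: nrm_ge0. Qed.

Lemma csum_pair (I J : choiceType) (f : I * J -> R[i]) : summ f ->
  csum f = csum (fun i => csum (fun j => f (i, j))).
Proof.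
move=> ff; have [_ h1] := rsum_pair (summ_Re ff).
by have [_ h2] := rsum_pair (summ_Im ff); rewrite /csum h1 h2.
Qed.

Lemma asum_reindex (I J : choiceType) (e : I -> J) (f : J -> R[i]) :
  bijective e -> asum (fun i => f (e i)) = asum f.
Proof.
move=> be; apply/esym; apply: (@reindex_esum R I J setT setT e (fun j => (nrm (f j))%:E)).
case: be => g gK Kg; split => // [x y _ _ /(can_inj gK)//|y _].
by exists (g y).
Qed.

Lemma csum_reindex (I J : choiceType) (e : I -> J) (f : J -> R[i]) :
  bijective e -> csum (fun i => f (e i)) = csum f.
Proof.
move=> [g gK Kg].
have be : set_bij setT setT e.
  split => // [x y _ _ /(can_inj gK)//|y _]; by exists (g y).
rewrite /csum /rsum; congr ((fine _ - fine _) +i* (fine _ - fine _)); apply/esym.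
- exact: (@reindex_esum R I J setT setT e (fun j => (Num.max (complex.Re (f j)) 0)%:E) be).
- exact: (@reindex_esum R I J setT setT e (fun j => (Num.max (- complex.Re (f j)) 0)%:E) be).
- exact: (@reindex_esum R I J setT setT e (fun j => (Num.max (complex.Im (f j)) 0)%:E) be).
- exact: (@reindex_esum R I J setT setT e (fun j => (Num.max (- complex.Im (f j)) 0)%:E) be).
Qed.

Lemma summ_reindex (I J : choiceType) (e : I -> J) (f : J -> R[i]) :
  bijective e -> summ (fun i => f (e i)) <-> summ f.
Proof. by move=> be; rewrite /summ asum_reindex. Qed.

Lemma asum_inner_le (I J : choiceType) (f : I -> J -> R[i]) i :
  (asum (f i) <= \esum_(i in [set: I]) asum (f i))%E.
Proof.
apply: esum_ge; exists [set i]; first by split => //; exact: finite_set1.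
by rewrite fsbig_set1.
Qed.

Lemma csum_swap (I J : choiceType) (f : I -> J -> R[i]) :
  (\esum_(i in [set: I]) asum (f i) < +oo)%E ->
  csum (fun i => csum (fun j => f i j)) = csum (fun j => csum (fun i => f i j)).
Proof.
move=> ff.
have fs : summ (fun p : I * J => f p.1 p.2) by rewrite /summ -asum_pair.
rewrite -(csum_pair fs).
have be : bijective (fun p : J * I => (p.2, p.1)) by exists (fun p => (p.2, p.1)) => -[].
rewrite -(csum_reindex _ be) /= (@csum_pair J I (fun p => f p.2 p.1))//.
by have := summ_reindex (fun p : I * J => f p.1 p.2) be; rewrite /= => ->.
Qed.

Lemma csum_fsbig (I : choiceType) (f : I -> R[i]) (F : {fset I}) :
  (forall i, i \notin F -> f i = 0) -> csum f = \sum_(i <- F) f i.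
Proof.
move=> f0.
have esumF (g : I -> R) : (forall i, i \notin F -> g i = 0) -> (forall i, 0 <= g i) ->
   fine (\esum_(i in [set: I]) (g i)%:E)%E = \sum_(i <- F) g i.
  move=> g0 gp; rewrite (esumID [set` F]); last by move=> *; rewrite lee_fin.
  rewrite !setTI [X in (_ + X)%E]esum1 ?adde0; last first.
    by move=> i /= /negP iF; rewrite g0.
  rewrite esum_fset//; last by move=> *; rewrite lee_fin.
  by rewrite fsbig_finite//= set_fsetK sumEFin.
have rsumF (g : I -> R) : (forall i, i \notin F -> g i = 0) -> rsum g = \sum_(i <- F) g i.
  move=> g0; rewrite /rsum !esumF.
  - by rewrite -sumrB; apply: eq_bigr => i _; rewrite -max0B.
  - by move=> i /g0 ->; rewrite oppr0 max_r.
  - by move=> i; exact: max0_ge0.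
  - by move=> i /g0 ->; rewrite max_r.
  - by move=> i; exact: max0_ge0.
rewrite /csum !rsumF; last 2 first.
- by move=> i /f0 ->.
- by move=> i /f0 ->.
by apply: complex_eq => /=; elim/big_rec2: _ => // i x y _ ->; rewrite ?cReD ?cImD.
Qed.

Lemma csum_one (I : choiceType) (f : I -> R[i]) (i0 : I) :
  (forall i, i != i0 -> f i = 0) -> csum f = f i0.
Proof.
move=> f0; rewrite (@csum_fsbig _ _ [fset i0]%fset); first by rewrite big_seq_fset1.
by move=> i; rewrite inE => /f0.
Qed.

Lemma asum_one (I : choiceType) (f : I -> R[i]) (i0 : I) :
  (forall i, i != i0 -> f i = 0) -> asum f = (nrm (f i0))%:E.
Proof.
move=> f0; rewrite /asum (esumID [set i0]); last by move=> *; rewrite lee_fin nrm_ge0.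
rewrite !setTI [X in (_ + X)%E]esum1 ?adde0; last first.
  by move=> i /= /eqP ii; rewrite f0// nrm0.
by rewrite esum_set1// lee_fin nrm_ge0.
Qed.

Lemma csum_bigsum (I : choiceType) (J : Type) (s : seq J) (P : pred J) (f : J -> I -> R[i]) :
  (forall j, P j -> summ (f j)) ->
  csum (fun i => \sum_(j <- s | P j) f j i) = \sum_(j <- s | P j) csum (f j).
Proof.
move=> ff.
suff [] : summ (fun i => \sum_(j <- s | P j) f j i) /\
   csum (fun i => \sum_(j <- s | P j) f j i) = \sum_(j <- s | P j) csum (f j) by [].
elim: s => [|j s [IH1 IH2]].
  rewrite (_ : (fun i => _) = (fun=> 0)) ?big_nil; last by apply/funext => i; rewrite big_nil.
  by split; [exact: summ0|exact: csum0].
rewrite (_ : (fun i => _) = (fun i => (if P j then f j i else 0) +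
    \sum_(j <- s | P j) f j i)); last first.
  by apply/funext => i; rewrite big_cons; case: ifP => //; rewrite add0r.
rewrite big_cons; case: ifPn => Pj.
  by split; [apply: summD => //; exact: ff|rewrite csumD ?IH2//; exact: ff].
split; first by apply: summD => //; exact: summ0.
by rewrite csumD// ?csum0 ?add0r//; exact: summ0.
Qed.

Lemma summ_bigsum (I : choiceType) (J : Type) (s : seq J) (P : pred J) (f : J -> I -> R[i]) :
  (forall j, P j -> summ (f j)) -> summ (fun i => \sum_(j <- s | P j) f j i).
Proof.
move=> ff; elim: s => [|j s IH].
  rewrite (_ : (fun i => _) = (fun=> 0)) ?big_nil; last by apply/funext => i; rewrite big_nil.
  exact: summ0.
rewrite (_ : (fun i => _) = (fun i => (if P j then f j i else 0) +
    \sum_(j <- s | P j) f j i)); last first.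
  by apply/funext => i; rewrite big_cons; case: ifP => //; rewrite add0r.
by apply: summD => //; have [/ff //|_] := boolP (P j); exact: summ0.
Qed.

Lemma csum_fintype (I : finType) (f : I -> R[i]) : csum f = \sum_i f i.
Proof.
rewrite (@csum_fsbig _ _ [fset x | x in I]%fset) ?big_fset//=.
  apply: perm_big; apply: uniq_perm; rewrite ?fset_uniq ?index_enum_uniq// => i.
  by rewrite !inE mem_index_enum.
by move=> i; rewrite !inE.
Qed.

End ComplexSums.

(** * Complex limits along filters and dominated convergence for sums *)

Section Limits.
Context {R : realType}.

(** Stated with the real-valued [nrm], since the canonical norm of [R[i]] takes its values in
    [R[i]]; [clim_cvg] returns to the topological limit. *)
Definition clim {T : Type} (F : set_system T) (u : T -> R[i]) (L : R[i]) : Prop :=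
  forall e : R, 0 < e -> \forall x \near F, nrm (u x - L) < e.

Section OneFilter.
Context {T : Type} {F : set_system T} {FF : Filter F}.
Implicit Types (u v : T -> R[i]) (L M : R[i]).

Lemma clim_cst L : clim F (fun=> L) L.
Proof. by move=> e e0; apply: nearW => x; rewrite subrr nrm0. Qed.

Lemma clim_near_eq u v L : (\forall x \near F, u x = v x) -> clim F u L -> clim F v L.
Proof. by move=> uv uL e /uL; apply: filterS2 uv => x ->. Qed.

Lemma climD u v L M : clim F u L -> clim F v M -> clim F (fun x => u x + v x) (L + M).
Proof.
move=> uL vM e e0; have e2 : 0 < e / 2 by lra.
near=> x.
have h1 : nrm (u x - L) < e / 2 by near: x; exact: uL.
have h2 : nrm (v x - M) < e / 2 by near: x; exact: vM.
rewrite opprD addrACA (le_lt_trans (nrmD _ _))//; lra.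
Unshelve. all: by end_near. Qed.

Lemma climZ c u L : clim F u L -> clim F (fun x => c * u x) (c * L).
Proof.
move=> uL e e0; have d0 : 0 < e / (nrm c + 1).
  by rewrite divr_gt0// ltr_wpDl ?nrm_ge0.
apply: filterS (uL _ d0) => x h; rewrite -mulrBr nrmM.
have c0 := nrm_ge0 c.
rewrite (@le_lt_trans _ _ ((nrm c + 1) * nrm (u x - L)))//.
  by rewrite ler_wpM2r ?nrm_ge0//; lra.
by rewrite mulrC -ltr_pdivlMr//; lra.
Qed.

Lemma climN u L : clim F u L -> clim F (fun x => - u x) (- L).
Proof.
move=> uL; have := climZ (-1) uL; rewrite mulN1r; apply: clim_near_eq.
by apply: nearW => x; rewrite mulN1r.
Qed.

Lemma climB u v L M : clim F u L -> clim F v M -> clim F (fun x => u x - v x) (L - M).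
Proof. by move=> uL /climN; exact: climD. Qed.

Lemma clim_sum (J : Type) (s : seq J) (u : J -> T -> R[i]) (L : J -> R[i]) :
  (forall j, clim F (u j) (L j)) ->
  clim F (fun x => \sum_(j <- s) u j x) (\sum_(j <- s) L j).
Proof.
move=> uL; elim: s => [|j s IH].
  rewrite big_nil; apply: clim_near_eq (clim_cst 0).
  by apply: nearW => x; rewrite big_nil.
rewrite big_cons; apply: clim_near_eq (climD (uL j) IH).
by apply: nearW => x; rewrite big_cons.
Qed.

Lemma clim_squeeze u L (v : T -> R) : (\forall x \near F, nrm (u x - L) <= v x) ->
  v @ F --> 0 -> clim F u L.
Proof.
move=> uv v0 e e0.
have : \forall x \near F, `|0 - v x| < e by move/cvgrPdist_lt: v0; exact.
apply: filterS2 uv => x h1 h2.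
by rewrite (le_lt_trans h1)// (le_lt_trans (ler_norm _))// -normrN -[- v x]add0r.
Qed.

Lemma clim_ReIm u L : clim F u L <->
  ((complex.Re (u x) @[x --> F] --> complex.Re L) /\
   (complex.Im (u x) @[x --> F] --> complex.Im L)).
Proof.
split => [uL|[uR uI] e e0].
  split; apply/cvgrPdistC_lt => e e0; apply: filterS (uL _ e0) => x.
    by apply: le_lt_trans; rewrite -cReN -cReD Re_le_nrm.
  by apply: le_lt_trans; rewrite -cImN -cImD Im_le_nrm.
have e2 : 0 < e / 2 by lra.
move/cvgrPdistC_lt/(_ _ e2): uR; move/cvgrPdistC_lt/(_ _ e2): uI.
apply: filterS2 => x h1 h2.
rewrite (le_lt_trans (nrm_le_ReIm _))// cReD cReN cImD cImN; lra.
Qed.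

Lemma clim_cvg u L : clim F u L <-> (u x : R[i]^o) @[x --> F] --> (L : R[i]^o).
Proof.
split => [uL|uL e e0].
  apply/cvgrPdistC_lt => e e0.
  have eE : e = (complex.Re e)%:C.
    by move: e0; rewrite ltcE => /andP[/eqP E _]; apply: complex_eq.
  rewrite eE; apply: filterS (uL (complex.Re e) _) => [x|].
    by rewrite normE ltcR.
  by move: e0; rewrite eE ltcR.
have e0' : (0 : R[i]) < e%:C by rewrite ltcR.
move/cvgrPdistC_lt/(_ _ e0'): uL.
by apply: filterS => x; rewrite normE ltcR.
Qed.

Lemma clim_nrm_le u L (C : R) : ProperFilter F -> clim F u L ->
  (\forall x \near F, nrm (u x) <= C) -> nrm L <= C.
Proof.
move=> PF uL uC; apply/ler_addgt0Pr => e e0.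
have [x [h1 h2]] := @filter_ex _ F PF _ (filterI (uL _ e0) uC).
rewrite (_ : L = u x - (u x - L)); last by rewrite opprB addrC subrK.
by rewrite (le_trans (nrmB _ _))// lerD// ltW.
Qed.

Lemma clim_unique u L M : ProperFilter F -> clim F u L -> clim F u M -> L = M.
Proof.
move=> PF uL uM; apply/eqP; rewrite -subr_eq0; apply/eqP/nrm_eq0/eqP.
rewrite eq_le nrm_ge0 andbT; apply: (@clim_nrm_le (fun=> 0)).
- have := climB uL uM; apply: clim_near_eq; apply: nearW => x; exact: subrr.
- by apply: nearW => x; rewrite nrm0.
Qed.

End OneFilter.

Lemma esum_tail (I : choiceType) (g : I -> R) (e : R) :
  (forall i, 0 <= g i) -> rsm g -> 0 < e ->
  exists A : {fset I}, (\esum_(i in [set: I]) (if i \in A then 0 else g i)%:E <= e%:E)%E.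
Proof.
move=> g0 gs e0.
have gE := rsumE g0 gs.
have : ((rsum g - e)%:E < \esum_(i in [set: I]) (g i)%:E)%E.
  by rewrite gE lte_fin; lra.
move=> /ereal_sup_gt[_ [X [Xf _] <-] hX].
exists (fset_set X).
have E : (rsum g)%:E = (\esum_(i in X) (g i)%:E + \esum_(i in ~` X) (g i)%:E)%E.
  by rewrite -gE (esumID X) ?setTI// => i _; rewrite lee_fin.
rewrite esum_fset// in E; last by move=> *; rewrite lee_fin.
rewrite (_ : esum setT _ = \esum_(i in ~` X) (g i)%:E); last first.
  rewrite [RHS]esum_mkcond; apply: eq_esum => i _.
  rewrite in_fset_set// in_setC; by case: ifP.
move: hX E; rewrite fsbig_finite//= sumEFin lte_fin.
move: (\esum_(i in ~` X) _)%E => [r| |] //.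
  by move=> + [] => h1 h2; rewrite lee_fin; lra.
Qed.

Lemma asum_le_rsum (I : choiceType) (f : I -> R[i]) (g : I -> R) :
  (forall i, nrm (f i) <= g i) -> rsm g -> (asum f <= (rsum g)%:E)%E.
Proof.
move=> fg gs; rewrite -rsumE//; last by move=> i; rewrite (le_trans (nrm_ge0 _) (fg i)).
by apply: le_esum => i _; rewrite lee_fin.
Qed.

Lemma csum_approx (I : choiceType) (f : I -> R[i]) (g : I -> R) (A : {fset I}) (e : R) :
  (forall i, nrm (f i) <= g i) -> rsm g ->
  (\esum_(i in [set: I]) (if i \in A then 0 else g i)%:E <= e%:E)%E ->
  nrm (csum f - \sum_(i <- A) f i) <= e.
Proof.
move=> fg gs ge.
have fs : summ f by exact: summ_le_r gs.
pose fA i := if i \in A then f i else 0.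
have fAs : summ fA.
  by apply: summ_le fs => i; rewrite /fA; case: ifP => //; rewrite nrm0 nrm_ge0.
have -> : \sum_(i <- A) f i = csum fA.
  rewrite (@csum_fsbig _ _ _ A); last by move=> i /negbTE; rewrite /fA => ->.
  by rewrite big_seq [RHS]big_seq; apply: eq_bigr => i iA; rewrite /fA iA.
rewrite -csumB//; apply: nrm_csum_le; apply: le_trans ge.
apply: le_esum => i _; rewrite lee_fin /fA.
by case: ifP => _; rewrite ?subrr ?nrm0// subr0.
Qed.

(** Tannery's theorem: a finite set A carries all but e / 3 of the majorant, so both tails are small
    uniformly in x and only finitely many terms have to converge. *)
Lemma csum_clim (T : Type) (F : set_system T) (FF : Filter F) (I : choiceType)
    (f : T -> I -> R[i]) (l : I -> R[i]) (g : I -> R) :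
  rsm g -> (\forall x \near F, forall i, nrm (f x i) <= g i) ->
  (forall i, nrm (l i) <= g i) ->
  (forall i, clim F (f ^~ i) (l i)) ->
  clim F (fun x => csum (f x)) (csum l).
Proof.
move=> gs fg lg fl e e0.
have g0 i : 0 <= g i by rewrite (le_trans (nrm_ge0 _) (lg i)).
have e3 : 0 < e / 3 by lra.
have [A hA] := esum_tail g0 gs e3.
have sl : clim F (fun x => \sum_(i <- A) f x i) (\sum_(i <- A) l i).
  exact: clim_sum.
near=> x.
have h1 : nrm (\sum_(i <- A) f x i - \sum_(i <- A) l i) < e / 3 by near: x; exact: sl.
have h2 : nrm (csum (f x) - \sum_(i <- A) f x i) <= e / 3.
  by apply: csum_approx gs hA; near: x.
have h3 := csum_approx lg gs hA.
rewrite (_ : csum (f x) - csum l = (csum (f x) - \sum_(i <- A) f x i) +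
  ((\sum_(i <- A) f x i - \sum_(i <- A) l i) - (csum l - \sum_(i <- A) l i))); last by ring.
rewrite (le_lt_trans (nrmD _ _))//.
have h4 := nrmB (\sum_(i <- A) f x i - \sum_(i <- A) l i) (csum l - \sum_(i <- A) l i).
lra.
Unshelve. all: by end_near. Qed.

Lemma csum_exhaust (I : choiceType) (f : I -> R[i]) (A : nat -> {fset I}) :
  (forall i, \forall n \near \oo, i \in A n) -> summ f ->
  clim \oo (fun n => \sum_(i <- A n) f i) (csum f).
Proof.
move=> hA fs.
apply: (@clim_near_eq _ \oo _ (fun n => csum (fun i => if i \in A n then f i else 0))).
  apply: nearW => n; rewrite (@csum_fsbig _ _ _ (A n)); last by move=> i /negbTE ->.
  by rewrite big_seq [RHS]big_seq; apply: eq_bigr => i ->.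
apply: (@csum_clim nat \oo _ I _ _ (fun i => nrm (f i))).
- by apply: (proj1 (summ_rsm f)).
- by apply: nearW => n i; case: ifP => //; rewrite nrm0 nrm_ge0.
- by [].
- move=> i; apply: clim_near_eq (clim_cst (f i)).
  by apply: filterS (hA i) => n ->.
Qed.

Lemma csum_nat_split (n : nat) (f : nat -> R[i]) : summ f ->
  csum f = \sum_(k < n) f k + csum (fun k => if (k < n)%N then 0 else f k).
Proof.
move=> fs.
have s1 : summ (fun k => if (k < n)%N then f k else 0).
  by apply: summ_le fs => k; case: ifP => //; rewrite nrm0 nrm_ge0.
have s2 : summ (fun k => if (k < n)%N then 0 else f k).
  by apply: summ_le fs => k; case: ifP => //; rewrite nrm0 nrm_ge0.
have -> : \sum_(k < n) f k = csum (fun k => if (k < n)%N then f k else 0).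
  rewrite (@csum_fsbig _ _ _ [fset x | x in iota 0 n]%fset); last first.
    by move=> k; rewrite !inE /= mem_iota /= add0n => /negbTE ->.
  rewrite -(big_mkord xpredT) /index_iota subn0.
  transitivity (\sum_(k <- iota 0 n) (if (k < n)%N then f k else 0)).
    rewrite big_seq [RHS]big_seq; apply: eq_bigr => k.
    by rewrite mem_iota /= add0n => ->.
  apply: perm_big; apply: uniq_perm; rewrite ?fset_uniq ?iota_uniq// => i.
  by rewrite !inE.
rewrite -csumD//; congr csum; apply/funext => k.
by case: ifP; rewrite ?addr0 ?add0r.
Qed.

Lemma esum_nat_le (f : nat -> R) (B : R) : (forall k, 0 <= f k) ->
  (forall n, \sum_(k < n) f k <= B) ->
  (\esum_(k in [set: nat]) (f k)%:E <= B%:E)%E.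
Proof.
move=> f0 fB; rewrite -nneseries_esumT; last by move=> k; rewrite lee_fin.
apply: lime_le; first by apply: is_cvg_nneseries => k _ _; rewrite lee_fin.
by apply: nearW => n; rewrite sumEFin lee_fin big_mkord.
Qed.

Lemma rsm_geo (q : R) : 0 <= q -> q < 1 -> rsm (fun n => q ^+ n).
Proof.
move=> q0 q1; apply: rsm_ge0 => [n|]; first exact: exprn_ge0.
have q2 : 0 < 1 - q by lra.
apply: (@le_lt_trans _ _ ((1 - q)^-1)%:E); last exact: ltry.
apply: esum_nat_le => [n|n]; first exact: exprn_ge0.
rewrite -[leRHS]mul1r ler_pdivlMr// mulrC -opprB mulNr -subrX1 opprB gerBl.
exact: exprn_ge0.
Qed.

Lemma csum_nat (f : nat -> R[i]) : summ f ->
  clim \oo (fun n => \sum_(i < n) f i) (csum f).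
Proof.
move=> fs; have := @csum_exhaust nat f (fun n => [fset x | x in iota 0 n]%fset) _ fs.
have h i : \forall n \near \oo, i \in [fset x | x in iota 0 n]%fset.
  near=> n; rewrite !inE /= mem_iota /= add0n.
  by near: n; exact: nbhs_infty_gt.
move=> /(_ h); apply: clim_near_eq; apply: nearW => n.
rewrite -(big_mkord xpredT) /index_iota subn0; apply: perm_big.
apply: uniq_perm; rewrite ?fset_uniq ?iota_uniq// => i.
by rewrite !inE.
Unshelve. all: by end_near. Qed.

Lemma csum_nat_recl (f : nat -> R[i]) : summ f ->
  csum f = f 0%N + csum (fun n => f n.+1).
Proof.
move=> fs.
have fs1 : summ (fun n => f n.+1).
  rewrite /summ (le_lt_trans _ fs)// /asum.
  rewrite -(@esum_image R nat nat setT S (fun k => (nrm (f k))%:E)).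
    rewrite esum_mkcond; apply: le_esum => k _.
    by case: ifP => // _; rewrite lee_fin nrm_ge0.
  by move=> i j _ _ [].
have h1 := csum_nat fs.
have h2 : clim \oo (fun n => f 0%N + \sum_(i < n) f i.+1) (f 0%N + csum (fun n => f n.+1)).
  by apply: climD; [exact: clim_cst|exact: csum_nat].
apply: (@clim_unique nat \oo _ (fun n => \sum_(i < n.+1) f i)).
  move=> e e0; have [N _ hN] := h1 e e0; exists N => // n /= Nn.
  by apply: hN; exact: leqW.
apply: clim_near_eq h2; apply: nearW => n.
by rewrite big_ord_recl.
Qed.

End Limits.

(** * Kernels and their functional calculus *)

Section Kernels.
Context {R : realType}.

Definition kop {I J : choiceType} (K : I -> J -> R[i]) (psi : J -> R[i]) : I -> R[i] :=
  fun i => csum (fun j => K i j * psi j).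

(** A row bound is an operator bound on bounded families, a column bound one on summable families.
    Both survive powers and power series of the kernel. *)
Definition rowb {I J : choiceType} (K : I -> J -> R[i]) (C : R) :=
  forall i, (asum (K i) <= C%:E)%E.

Definition colb {I J : choiceType} (K : I -> J -> R[i]) (C : R) :=
  forall j, (asum (K ^~ j) <= C%:E)%E.

Definition bnd {I : choiceType} (psi : I -> R[i]) (M : R) := forall i, nrm (psi i) <= M.

Section Rect.
Context {I J : choiceType}.
Implicit Types (K : I -> J -> R[i]) (psi phi : J -> R[i]).

Lemma rowb_summ K C i : rowb K C -> summ (K i).
Proof. by move=> KC; rewrite /summ (le_lt_trans (KC i)) ?ltry. Qed.

Lemma asum_bnd (f : J -> R[i]) psi (c M : R) : (asum f <= c%:E)%E -> bnd psi M ->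
  0 <= M -> (asum (fun j => f j * psi j)%R <= (c * M)%:E)%E.
Proof.
move=> fc pM M0.
have fs : summ f by rewrite /summ (le_lt_trans fc) ?ltry.
have : (asum (fun j => M%:C * f j)%R <= (c * M)%:E)%E.
  rewrite asumZ nrm_real ger0_norm// mulrC EFinM lee_wpmul2l//.
apply: le_trans; apply: asum_le => j.
by rewrite !nrmM nrm_real ger0_norm// mulrC ler_wpM2r ?nrm_ge0.
Qed.

Lemma kop_asum K C psi M i : rowb K C -> bnd psi M -> 0 <= M ->
  (asum (fun j => K i j * psi j)%R <= (C * M)%:E)%E.
Proof. by move=> KC pM M0; apply: asum_bnd. Qed.

Lemma kop_summ K C psi M i : rowb K C -> bnd psi M -> 0 <= M ->
  summ (fun j => K i j * psi j).
Proof.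
by move=> KC pM M0; rewrite /summ (le_lt_trans (kop_asum i KC pM M0)) ?ltry.
Qed.

Lemma kop_bnd K C psi M : rowb K C -> bnd psi M -> 0 <= M -> bnd (kop K psi) (C * M).
Proof. by move=> KC pM M0 i; apply: nrm_csum_le; apply: kop_asum. Qed.

Lemma kop_lin K C psi phi M N c : rowb K C -> bnd psi M -> 0 <= M ->
  bnd phi N -> 0 <= N ->
  kop K (fun j => c * psi j + phi j) = (fun i => c * kop K psi i + kop K phi i).
Proof.
move=> KC pM M0 pN N0; apply/funext => i; rewrite /kop.
have s1 := kop_summ i KC pM M0; have s2 := kop_summ i KC pN N0.
rewrite -csumZ// -csumD//; last exact: summZ.
by congr csum; apply/funext => j; ring.
Qed.

Lemma kop_l1 K C psi : colb K C -> summ psi -> 0 <= C ->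
  (asum (kop K psi) <= C%:E * asum psi)%E /\
  (\esum_(i in [set: I]) asum (fun j => K i j * psi j)%R <= C%:E * asum psi)%E.
Proof.
move=> KC ps C0.
have h : (\esum_(i in [set: I]) asum (fun j => K i j * psi j)%R <= C%:E * asum psi)%E.
  rewrite asum_swap /asum.
  rewrite -esumZl//; last by move=> j; exact: nrm_ge0.
  apply: le_esum => j _.
  have -> : (\esum_(i in [set: I]) (nrm (K i j * psi j))%:E =
     asum (fun i => psi j * K i j)%R)%E.
    by apply: eq_esum => i _; rewrite mulrC.
  rewrite asumZ muleC EFinM lee_wpmul2r ?lee_fin ?nrm_ge0//; exact: KC.
split => //; apply: le_trans h; apply: le_esum => i _.
have [fi|fi] := boolP (asum (fun j => K i j * psi j)%R < +oo)%E; first exact: nrm_csum.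
by move: fi; rewrite -leNgt leye_eq => /eqP ->; rewrite leey.
Qed.

End Rect.

Lemma kop_comp {I J L : choiceType} (K : I -> J -> R[i]) (P : J -> L -> R[i]) C D psi M i :
  rowb K C -> rowb P D -> bnd psi M -> 0 <= M -> 0 <= D ->
  kop K (kop P psi) i = kop (fun i l => csum (fun j => K i j * P j l)) psi i /\
  (asum (fun l => csum (fun j => K i j * P j l)%R) <= (C * D)%:E)%E.
Proof.
move=> KC PD pM M0 D0.
have Ks := rowb_summ i KC.
have tot (N : R) (phi : L -> R[i]) : bnd phi N -> 0 <= N ->
   (\esum_(j in [set: J]) asum (fun l => K i j * (P j l * phi l))%R <= (C * (D * N))%:E)%E.
  move=> pN N0.
  apply: (@le_trans _ _ (asum (fun j => (D * N)%:C * K i j)%R)); last first.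
    rewrite asumZ nrm_real ger0_norm ?mulr_ge0// [C * _]mulrC [leRHS]EFinM.
    by rewrite lee_wpmul2l ?lee_fin ?mulr_ge0//; exact: KC.
  apply: le_esum => j _; rewrite asumZ nrmM nrm_real ger0_norm ?mulr_ge0//.
  rewrite mulrC EFinM lee_wpmul2l ?lee_fin ?nrm_ge0//.
  exact: kop_asum.
split.
  rewrite /kop.
  transitivity (csum (fun j => csum (fun l => K i j * (P j l * psi l)))).
    congr csum; apply/funext => j; rewrite csumZ//; exact: kop_summ PD pM M0.
  rewrite csum_swap; last by rewrite (le_lt_trans (tot _ _ pM M0)) ?ltry.
  congr csum; apply/funext => l.
  rewrite mulrC -csumZ; last first.
    apply: (@summ_le _ _ _ (fun j => D%:C * K i j)); last exact: summZ.
    move=> j; rewrite mulrC !nrmM nrm_real ger0_norm// ler_wpM2r ?nrm_ge0//.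
    rewrite -lee_fin (le_trans _ (PD j))//.
    apply: esum_ge; exists [set l]; first by split => //; exact: finite_set1.
    by rewrite fsbig_set1.
  by congr csum; apply/funext => j; ring.
(* The constant family 1 turns [tot] into a bound on the double sum of |K i j P j l|, hence on the
   row of the product kernel. *)
have b1 : bnd (fun _ : L => 1 : R[i]) 1 by move=> l; rewrite nrm1.
have := tot 1 (fun=> 1) b1 ler01; rewrite mulr1; apply: le_trans.
under eq_esum do under eq_fun do rewrite mulr1.
rewrite asum_swap; apply: le_esum => l _.
have [fi|fi] := boolP (asum (fun j => K i j * P j l)%R < +oo)%E; first exact: nrm_csum.
by move: fi; rewrite -leNgt leye_eq => /eqP ->; rewrite leey.
Qed.

Section Square.
Context {I : choiceType}.
Implicit Types (K : I -> I -> R[i]) (psi phi : I -> R[i]).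

Definition kpow K n i j : R[i] := iter n (kop K) (basis_vec j) i.

Lemma basis_bnd (j : I) : bnd (basis_vec j : I -> R[i]) 1.
Proof. by move=> i; rewrite /basis_vec; case: eqP => _; rewrite ?nrm1 ?nrm0. Qed.

Lemma csum_basis (f : I -> R[i]) j : csum (fun l => f l * basis_vec j l) = f j.
Proof.
rewrite (@csum_one _ _ _ j) /basis_vec; first by rewrite eqxx mulr1.
by move=> i /negbTE ->; rewrite mulr0.
Qed.

Lemma csum_basis' (f : I -> R[i]) i : csum (fun l => basis_vec l i * f l) = f i.
Proof.
rewrite (@csum_one _ _ _ i) /basis_vec; first by rewrite eqxx mul1r.
by move=> l; rewrite eq_sym => /negbTE ->; rewrite mul0r.
Qed.

Lemma iter_kop_bnd K C n psi M : rowb K C -> 0 <= C -> bnd psi M -> 0 <= M ->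
  bnd (iter n (kop K) psi) (C ^+ n * M).
Proof.
move=> KC C0 pM M0; elim: n => [|n IH]; first by rewrite expr0 mul1r.
by rewrite exprS -mulrA /=; apply: kop_bnd => //; rewrite mulr_ge0 ?exprn_ge0.
Qed.

Lemma iter_kop_lin K C n psi phi M N c : rowb K C -> 0 <= C ->
  bnd psi M -> 0 <= M -> bnd phi N -> 0 <= N ->
  iter n (kop K) (fun j => c * psi j + phi j) =
  (fun i => c * iter n (kop K) psi i + iter n (kop K) phi i).
Proof.
move=> KC C0 pM M0 pN N0; elim: n => [//|n IH] /=.
rewrite IH; apply: (kop_lin c KC).
- exact: iter_kop_bnd.
- by rewrite mulr_ge0 ?exprn_ge0.
- exact: iter_kop_bnd.
- by rewrite mulr_ge0 ?exprn_ge0.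
Qed.

Lemma kpow_rowb K C n : rowb K C -> 0 <= C ->
  rowb (kpow K n) (C ^+ n) /\
  (forall psi M, bnd psi M -> 0 <= M -> kop (kpow K n) psi = iter n (kop K) psi).
Proof.
move=> KC C0; elim: n => [|n [IH1 IH2]].
  split.
    move=> i; rewrite /kpow /= (@asum_one _ _ _ i) /basis_vec ?eqxx ?nrm1//.
    by move=> l; rewrite eq_sym => /negbTE ->.
  by move=> psi M pM M0; apply/funext => i; rewrite /kop /kpow /= csum_basis'.
have D0 : 0 <= C ^+ n by rewrite exprn_ge0.
have E i : kpow K n.+1 i = (fun l => csum (fun j => K i j * kpow K n j l)) by [].
split.
  move=> i; rewrite E exprS.
  have b0 : bnd (fun _ : I => 0 : R[i]) 0 by move=> l; rewrite nrm0.
  by case: (@kop_comp I I I K (kpow K n) C _ (fun=> 0) 0 i KC IH1 b0).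
move=> psi M pM M0; apply/funext => i /=.
rewrite -(IH2 _ M)//.
by case: (kop_comp i KC IH1 pM M0 D0) => ->.
Qed.

Lemma iter_kop_l1 K C n psi : colb K C -> 0 <= C -> summ psi ->
  (asum (iter n (kop K) psi) <= (C ^+ n)%:E * asum psi)%E.
Proof.
move=> KC C0 ps; elim: n => [|n IH]; first by rewrite expr0 mul1e.
have s : summ (iter n (kop K) psi).
  rewrite /summ (le_lt_trans IH)// -(fineK (summ_fin ps)) ltry//.
have [h _] := kop_l1 KC s C0.
rewrite /= (le_trans h)// exprS EFinM -muleA lee_wpmul2l//.
Qed.

Lemma kpow_colb K C n : colb K C -> 0 <= C -> colb (kpow K n) (C ^+ n).
Proof.
move=> KC C0 j.
have E : asum (basis_vec j : I -> R[i]) = 1%E.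
  rewrite (@asum_one _ _ _ j) /basis_vec ?eqxx ?nrm1//.
  by move=> l /negbTE ->.
have s : summ (basis_vec j : I -> R[i]) by rewrite /summ E ltry.
by have := iter_kop_l1 n KC C0 s; rewrite E mule1.
Qed.

End Square.

(* For f x = sum b_n x^n, [fop b K] is f(K) and [fker b K] is its kernel. *)
Section Functional.
Context {I : choiceType}.
Implicit Types (K : I -> I -> R[i]) (psi phi : I -> R[i]) (b : nat -> R).

Definition fop b K psi i : R[i] := csum (fun n => (b n)%:C * iter n (kop K) psi i).
Definition fker b K i j : R[i] := fop b K (basis_vec j) i.
Definition bsum b (C : R) := rsum (fun n => `|b n| * C ^+ n).
Definition bsm b (C : R) := rsm (fun n => `|b n| * C ^+ n).

Lemma bsum_ge0 b C : 0 <= C -> 0 <= bsum b C.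
Proof. by move=> C0; apply: rsum_ge0 => n; rewrite mulr_ge0 ?exprn_ge0. Qed.

Lemma fop_asum b K C psi M i : rowb K C -> 0 <= C -> bnd psi M -> 0 <= M -> bsm b C ->
  (asum (fun n => (b n)%:C * iter n (kop K) psi i)%R <= (bsum b C * M)%:E)%E.
Proof.
move=> KC C0 pM M0 bC.
apply: (@le_trans _ _ (rsum (fun n => M * (`|b n| * C ^+ n)))%:E).
  apply: asum_le_rsum; last exact: rsmZ.
  move=> n; rewrite nrmM nrm_real mulrCA ler_wpM2l// mulrC.
  exact: (iter_kop_bnd n KC C0 pM M0).
by rewrite rsumZ// mulrC.
Qed.

Lemma fker_tot b K C psi M i : rowb K C -> 0 <= C -> bnd psi M -> 0 <= M -> bsm b C ->
  (\esum_(n in [set: nat]) asum (fun j => (b n)%:C * kpow K n i j * psi j)%R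
    <= (bsum b C * M)%:E)%E.
Proof.
move=> KC C0 pM M0 bC.
apply: (@le_trans _ _ (rsum (fun n => M * (`|b n| * C ^+ n)))%:E); last first.
  by rewrite rsumZ// mulrC.
rewrite -rsumE; last 2 first.
- by move=> n; rewrite !mulr_ge0 ?exprn_ge0.
- exact: rsmZ.
apply: le_esum => n _.
under eq_fun do rewrite -mulrA.
rewrite asumZ nrm_real mulrCA EFinM lee_wpmul2l ?lee_fin// mulrC.
apply: kop_asum => //.
by case: (kpow_rowb n KC C0).
Qed.

Lemma fopE b K C psi M : rowb K C -> 0 <= C -> bnd psi M -> 0 <= M -> bsm b C ->
  fop b K psi = kop (fker b K) psi.
Proof.
move=> KC C0 pM M0 bC; apply/funext => i; rewrite /fop /kop.
transitivity (csum (fun n => csum (fun j => (b n)%:C * kpow K n i j * psi j))).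
  congr csum; apply/funext => n.
  have [h1 h2] := kpow_rowb n KC C0; rewrite -(h2 _ _ pM M0) /kop -csumZ.
    by congr csum; apply/funext => j; rewrite mulrA.
  exact: kop_summ h1 pM M0.
rewrite csum_swap; last first.
  by rewrite (le_lt_trans (fker_tot i KC C0 pM M0 bC)) ?ltry.
congr csum; apply/funext => j.
rewrite /fker /fop mulrC -csumZ.
  by congr csum; apply/funext => n; rewrite mulrC.
rewrite /summ (le_lt_trans (fop_asum i KC C0 (basis_bnd j) ler01 bC))//.
exact: ltry.
Qed.

Lemma fker_rowb b K C : rowb K C -> 0 <= C -> bsm b C -> rowb (fker b K) (bsum b C).
Proof.
move=> KC C0 bC i.
have b1 : bnd (fun _ : I => 1 : R[i]) 1 by move=> l; rewrite nrm1.
have := fker_tot i KC C0 b1 ler01 bC; rewrite mulr1; apply: le_trans.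
rewrite asum_swap; apply: le_esum => j _.
rewrite /fker /fop.
under [in leRHS]eq_fun do rewrite mulr1.
apply: nrm_csum.
rewrite /summ (le_lt_trans (fop_asum i KC C0 (basis_bnd j) ler01 bC))//.
exact: ltry.
Qed.

Lemma fker_colb b K C D : rowb K D -> 0 <= D -> bsm b D ->
  colb K C -> 0 <= C -> bsm b C -> colb (fker b K) (bsum b C).
Proof.
move=> KD D0 bD KC C0 bC j.
rewrite /bsum -rsumE//; last by move=> n; rewrite mulr_ge0 ?exprn_ge0.
apply: (@le_trans _ _ (\esum_(n in [set: nat]) asum (fun i => (b n)%:C * kpow K n i j)%R)%E); last first.
  apply: le_esum => n _; rewrite asumZ nrm_real EFinM lee_wpmul2l ?lee_fin//.
  exact: kpow_colb.
rewrite asum_swap; apply: le_esum => i _.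
apply: nrm_csum.
rewrite /summ (le_lt_trans (fop_asum i KD D0 (basis_bnd j) ler01 bD))//.
exact: ltry.
Qed.

End Functional.

(** Induction through H^(n+1) Phi = H (Phi L^n) = Phi L L^n. Phi is only bounded, so the summability
    in each exchange comes from the rows of H and the columns of L. *)
Lemma kop_intertwine_iter {I J : choiceType} (H : I -> I -> R[i]) (L : J -> J -> R[i])
    (Phi : I -> J -> R[i]) C D M :
  rowb H C -> colb L D -> 0 <= C -> 0 <= D -> 0 <= M ->
  (forall i v, nrm (Phi i v) <= M) ->
  (forall i v, kop H (Phi ^~ v) i = csum (fun v' => Phi i v' * L v' v)) ->
  forall n i v, iter n (kop H) (Phi ^~ v) i = csum (fun v' => Phi i v' * kpow L n v' v).
Proof.
move=> HC LD C0 D0 M0 PM HL n i v.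
elim: n i => [|n IH] i; first by rewrite /kpow /= csum_basis.
rewrite iterS (_ : iter n (kop H) (Phi ^~ v) = kop Phi (kpow L n ^~ v)); last first.
  by apply/funext => w; rewrite IH /kop.
have ps : summ (kpow L n ^~ v).
  by rewrite /summ (le_lt_trans (kpow_colb n LD D0 v)) ?ltry.
have Hs := rowb_summ _ HC.
transitivity (csum (fun w => csum (fun v' => H i w * (Phi w v' * kpow L n v' v)))).
  congr csum; apply/funext => w; rewrite csumZ//.
  exact: (@summ_bnd _ _ _ _ M).
rewrite csum_swap; last first.
  apply: (@le_lt_trans _ _ (asum (fun w => (M * fine (asum (kpow L n ^~ v)))%:C * H i w)%R)); last first.
    exact: summZ.
  apply: le_esum => w _; rewrite asumZ nrmM nrm_real ger0_norm; last first.
    by rewrite mulr_ge0// fine_ge0// asum_ge0.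
  rewrite [in leRHS]mulrC EFinM lee_wpmul2l ?lee_fin ?nrm_ge0// EFinM fineK ?summ_fin//.
  rewrite -[M in (M%:E * _)%E](ger0_norm M0) -nrm_real -asumZ.
  by apply: asum_le => u; rewrite !nrmM ler_wpM2r ?nrm_ge0// nrm_real (le_trans (PM _ _))// ler_norm.
transitivity (csum (fun v' => csum (fun v'' => Phi i v'' * L v'' v' * kpow L n v' v))).
  congr csum; apply/funext => v'.
  transitivity (kop H (Phi ^~ v') i * kpow L n v' v).
    rewrite /kop mulrC -csumZ.
      by congr csum; apply/funext => w; ring.
    apply: (@summ_le _ _ _ (fun w => M%:C * H i w)); last exact: summZ.
    move=> w; rewrite !nrmM mulrC nrm_real ler_wpM2r ?nrm_ge0//.
    by rewrite (le_trans (PM _ _))// ler_norm.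
  rewrite HL mulrC -csumZ; first by congr csum; apply/funext => w; ring.
  apply: (@summ_bnd _ _ _ _ M) => //.
  by rewrite /summ (le_lt_trans (LD v')) ?ltry.
rewrite csum_swap; last first.
  apply: (@le_lt_trans _ _ (asum (fun v' => (M * D)%:C * kpow L n v' v)%R)); last first.
    exact: summZ.
  apply: le_esum => v' _.
  apply: (@le_trans _ _ (asum (fun v'' => (M%:C * kpow L n v' v) * L v'' v')%R)).
    apply: asum_le => u; rewrite !nrmM nrm_real (ger0_norm M0) mulrAC.
    by rewrite ler_wpM2r ?nrm_ge0// ler_wpM2r ?nrm_ge0.
  rewrite asumZ !nrmM !nrm_real !ger0_norm ?mulr_ge0// [in leRHS]mulrAC.
  by rewrite [in leRHS]EFinM lee_wpmul2l ?lee_fin ?mulr_ge0 ?nrm_ge0//; exact: LD.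
congr csum; apply/funext => v''.
rewrite -csumZ.
  by congr csum; apply/funext => u; rewrite mulrA.
apply: (@summ_bnd _ _ _ _ D) => // v'.
rewrite -lee_fin (le_trans _ (LD v'))//.
apply: esum_ge; exists [set v'']; first by split => //; exact: finite_set1.
by rewrite fsbig_set1.
Qed.

Lemma kop_intertwine {I J : choiceType} (H : I -> I -> R[i]) (L : J -> J -> R[i])
    (Phi : I -> J -> R[i]) C D M b :
  rowb H C -> colb L D -> 0 <= C -> 0 <= D -> 0 <= M -> bsm b C -> bsm b D ->
  (forall i v, nrm (Phi i v) <= M) ->
  (forall i v, kop H (Phi ^~ v) i = csum (fun v' => Phi i v' * L v' v)) ->
  forall i v, kop (fker b H) (Phi ^~ v) i = csum (fun v' => Phi i v' * fker b L v' v).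
Proof.
move=> HC LD C0 D0 M0 bC bD PM HL i v.
rewrite -(fopE HC C0 (PM ^~ v) M0 bC) /fop.
have tot : (\esum_(n in [set: nat]) asum (fun v' => Phi i v' * ((b n)%:C * kpow L n v' v))%R < +oo)%E.
  apply: (@le_lt_trans _ _ (\esum_(n in [set: nat]) (M * (`|b n| * D ^+ n))%:E)%E); last first.
    rewrite esumZl//; last by move=> n; rewrite mulr_ge0 ?exprn_ge0.
    by rewrite rsumE ?ltry// => n; rewrite mulr_ge0 ?exprn_ge0.
  apply: le_esum => n _.
  apply: (@le_trans _ _ (asum (fun v' => (M * `|b n|)%:C * kpow L n v' v)%R)).
    apply: asum_le => u; rewrite !nrmM !nrm_real normrM (ger0_norm M0) normr_id -mulrA.
    by rewrite ler_wpM2r ?mulr_ge0 ?nrm_ge0.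
  rewrite asumZ nrm_real ger0_norm ?mulr_ge0// mulrA [leRHS]EFinM lee_wpmul2l ?lee_fin ?mulr_ge0//.
  exact: kpow_colb.
transitivity (csum (fun n => csum (fun v' => Phi i v' * ((b n)%:C * kpow L n v' v)))).
  congr csum; apply/funext => n.
  rewrite (kop_intertwine_iter HC LD C0 D0 M0 PM HL) -csumZ.
    by congr csum; apply/funext => u; ring.
  apply: (@summ_bnd _ _ _ _ M) => //.
  by rewrite /summ (le_lt_trans (kpow_colb n LD D0 v)) ?ltry.
rewrite csum_swap//; congr csum; apply/funext => v'.
rewrite /fker /fop -csumZ//.
apply: (@summ_le_r _ _ _ (fun n => `|b n| * D ^+ n)) => // n.
rewrite nrmM nrm_real ler_wpM2l//.
rewrite -lee_fin (le_trans _ (kpow_colb n LD D0 v))//.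
apply: esum_ge; exists [set v']; first by split => //; exact: finite_set1.
by rewrite fsbig_set1.
Qed.

(* A multiplicative weight turns entrywise decay of K into decay of f(K). *)
Lemma kpow_decay {I : choiceType} (K : I -> I -> R[i]) (W : I -> I -> R) C D n i j :
  rowb K D -> 0 <= D ->
  (forall i j, 0 < W i j) -> W j j <= 1 -> 0 <= C ->
  (forall i j k, W i k <= W i j * W j k) ->
  rowb (fun i j => (W i j)%:C * K i j) C ->
  W i j * nrm (kpow K n i j) <= C ^+ n.
Proof.
move=> KD D0 W0 W1 C0 WM KC; elim: n i => [|n IH] i.
  rewrite expr0 /kpow /= /basis_vec; have [->|_] := eqVneq i j.
    by rewrite nrm1 mulr1.
  by rewrite nrm0 mulr0.
rewrite -[W i j](ger0_norm (ltW (W0 i j))) -nrm_real -nrmM exprS.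
(* The weight is distributed along the path: W i j / W i l is at most W l j, so the first factor is
   controlled by the weighted row bound and the second by induction. *)
have -> : (W i j)%:C * kpow K n.+1 i j =
  csum (fun l => (W i l)%:C * K i l * ((W i j / W i l)%:C * kpow K n l j)).
  rewrite [kpow K n.+1 i j]/= /kop.
  rewrite -csumZ.
    congr csum; apply/funext => l.
    by rewrite mulrACA -rmorphM [W i l * _]mulrC divfK// gt_eqF.
  apply: (kop_summ i KD (iter_kop_bnd n KD D0 (basis_bnd j) ler01)).
  by rewrite mulr1 exprn_ge0.
apply: nrm_csum_le; apply: asum_bnd => //; last by rewrite exprn_ge0.
move=> l; apply: le_trans (IH l).
rewrite nrmM ler_wpM2r ?nrm_ge0// nrm_real.
by rewrite ger0_norm ?divr_ge0 ?(ltW (W0 _ _))// ler_pdivrMr// mulrC.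
Qed.

End Kernels.

(** * Square-summable families and the Schur test *)

Section EllTwo.
Context {R : realType} {I : choiceType}.
Implicit Types (psi phi : I -> R[i]) (K : I -> I -> R[i]).

Definition nsq psi : R := rsum (fun i => nrm (psi i) ^+ 2).
Definition ip phi psi : R[i] := csum (fun i => (conjc (phi i)) * psi i).

Lemma ell2P psi : ell2 psi <-> rsm (fun i => nrm (psi i) ^+ 2).
Proof.
rewrite /ell2 /l2norm /rsm.
have -> : (\esum_(i in [set: I]) (nrm (psi i) ^+ 2)%:E =
   \esum_(i in [set: I]) `|nrm (psi i) ^+ 2|%:E)%E.
  by apply: eq_esum => i _; rewrite ger0_norm// sqr_ge0.
have := @esum_EFin_ge0 R I (fun i => `|nrm (psi i) ^+ 2|) (fun i => normr_ge0 _).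
by move: (\esum_(i in _) _)%E => [r| |] //= _; rewrite !ltry.
Qed.

Lemma l2normE psi : ell2 psi -> l2norm psi = (Num.sqrt (nsq psi))%:E.
Proof.
by move=> /ell2P h; rewrite /l2norm rsumE// => i; exact: sqr_ge0.
Qed.

Lemma nsq_ge0 psi : 0 <= nsq psi.
Proof. by apply: rsum_ge0 => i; exact: sqr_ge0. Qed.

Lemma nsq_bnd psi : ell2 psi -> bnd psi (Num.sqrt (nsq psi)).
Proof.
move=> /ell2P h i; rewrite -(@ler_pXn2r _ 2)// ?nnegrE ?nrm_ge0 ?sqrtr_ge0//.
rewrite sqr_sqrtr ?nsq_ge0// -lee_fin -rsumE//; last by move=> j; exact: sqr_ge0.
apply: esum_ge; exists [set i]; first by split => //; exact: finite_set1.
by rewrite fsbig_set1.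
Qed.

Lemma sqr_nrmD (a b : R[i]) :
  nrm (a + b) ^+ 2 = nrm a ^+ 2 + nrm b ^+ 2 + 2 * complex.Re ((conjc a) * b).
Proof. by rewrite !nrm_sqr; case: a => a1 a2; case: b => b1 b2 /=; ring. Qed.

Lemma ell2_summ phi psi : ell2 phi -> ell2 psi -> summ (fun i => (conjc (phi i)) * psi i).
Proof.
move=> /ell2P h1 /ell2P h2; apply: summ_le_r (rsmD h1 h2) => i.
rewrite nrmM nrm_conj.
have := sqr_ge0 (nrm (phi i) - nrm (psi i)).
have := nrm_ge0 (phi i); have := nrm_ge0 (psi i).
nra.
Qed.

Lemma ell2D phi psi : ell2 phi -> ell2 psi -> ell2 (fun i => phi i + psi i).
Proof.
move=> /ell2P h1 /ell2P h2; apply/ell2P.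
have := rsmZ 2 (rsmD h1 h2); apply: le_lt_trans; apply: le_esum => i _.
rewrite lee_fin !ger0_norm ?sqr_ge0 ?mulr_ge0 ?addr_ge0 ?sqr_ge0//.
apply: (@le_trans _ _ ((nrm (phi i) + nrm (psi i)) ^+ 2)).
  by rewrite ler_pXn2r ?nnegrE ?addr_ge0 ?nrm_ge0// nrmD.
have := sqr_ge0 (nrm (phi i) - nrm (psi i)); nra.
Qed.

Lemma ell2Z c psi : ell2 psi -> ell2 (fun i => c * psi i) /\
  nsq (fun i => c * psi i) = nrm c ^+ 2 * nsq psi.
Proof.
move=> /ell2P h.
have E : (fun i => nrm (c * psi i) ^+ 2) = (fun i => nrm c ^+ 2 * nrm (psi i) ^+ 2).
  by apply/funext => i; rewrite nrmM exprMn.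
split; first by apply/ell2P; rewrite E; exact: rsmZ.
by rewrite /nsq E rsumZ.
Qed.

Lemma ell20 : ell2 (fun _ : I => 0 : R[i]) /\ nsq (fun _ : I => 0 : R[i]) = 0.
Proof.
have E : (fun i : I => nrm (0 : R[i]) ^+ 2) = (fun=> 0).
  by apply/funext => i; rewrite nrm0 expr0n.
have h : rsm (fun i : I => (0 : R)).
  by rewrite /rsm esum1 ?ltry// => i _; rewrite normr0.
split; first by apply/ell2P; rewrite E.
rewrite /nsq E rsum_ge0E//; last by move: h; rewrite /rsm; under eq_esum do rewrite normr0.
by rewrite esum1.
Qed.

Lemma nsqD phi psi : ell2 phi -> ell2 psi ->
  nsq (fun i => phi i + psi i) = nsq phi + nsq psi + 2 * complex.Re (ip phi psi).
Proof.
move=> h1 h2; have s := ell2_summ h1 h2.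
move: h1 h2 => /ell2P h1 /ell2P h2.
rewrite /nsq -rsumD// /ip /= -rsumZ; last exact: summ_Re.
rewrite -rsumD; last 2 first.
- exact: rsmD.
- by apply: rsmZ; exact: summ_Re.
by congr rsum; apply/funext => i; rewrite sqr_nrmD.
Qed.

Lemma ipE psi : ell2 psi -> ip psi psi = (nsq psi)%:C.
Proof.
move=> _; rewrite /nsq -csum_real; congr csum; apply/funext => i.
apply: complex_eq; rewrite ?cReM ?cImM /= ?nrm_sqr; case: (psi i) => a b /=; ring.
Qed.

Lemma ipC phi psi : ip phi psi = (conjc (ip psi phi)).
Proof.
rewrite /ip -csum_conj; congr csum; apply/funext => i.
by rewrite rmorphM /= conjcK mulrC.
Qed.

Lemma ipZr phi psi c : ell2 phi -> ell2 psi -> ip phi (fun i => c * psi i) = c * ip phi psi.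
Proof.
move=> h1 h2; rewrite /ip -csumZ; last exact: ell2_summ.
by congr csum; apply/funext => i; rewrite mulrCA.
Qed.

Lemma ipDr phi psi chi : ell2 phi -> ell2 psi -> ell2 chi ->
  ip phi (fun i => psi i + chi i) = ip phi psi + ip phi chi.
Proof.
move=> h1 h2 h3; rewrite /ip -csumD; [|exact: ell2_summ..].
by congr csum; apply/funext => i; rewrite mulrDr.
Qed.

Lemma ipDl phi psi chi : ell2 phi -> ell2 psi -> ell2 chi ->
  ip (fun i => psi i + chi i) phi = ip psi phi + ip chi phi.
Proof.
move=> h1 h2 h3; rewrite /ip -csumD; [|exact: ell2_summ..].
by congr csum; apply/funext => i; rewrite rmorphD mulrDl.
Qed.

Lemma ipZl phi psi c : ell2 phi -> ell2 psi ->
  ip (fun i => c * psi i) phi = (conjc c) * ip psi phi.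
Proof.
move=> h1 h2; rewrite /ip -csumZ; last exact: ell2_summ.
by congr csum; apply/funext => i; rewrite rmorphM mulrA.
Qed.

Lemma nsqD_le phi psi : ell2 phi -> ell2 psi ->
  nsq (fun i => phi i + psi i) <= 2 * nsq phi + 2 * nsq psi.
Proof.
move=> h1 h2; have h3 := ell2D h1 h2.
move: h1 h2 h3 => /ell2P h1 /ell2P h2 /ell2P h3.
rewrite /nsq -!rsumZ// -rsumD; [|exact: rsmZ..].
apply: le_rsum => //; first by apply: rsmD; exact: rsmZ.
move=> i; apply: (@le_trans _ _ ((nrm (phi i) + nrm (psi i)) ^+ 2)).
  by rewrite ler_pXn2r ?nnegrE ?addr_ge0 ?nrm_ge0// nrmD.
have := sqr_ge0 (nrm (phi i) - nrm (psi i)); nra.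
Qed.

(** Schur test: with S the i-th row sum of |K psi|, Cauchy-Schwarz bounds S^2 by C times the sum
    over j of |K i j| |psi j|^2, and summing over i uses the column bound. *)
Lemma kop_ell2 K C psi : rowb K C -> colb K C -> 0 < C -> ell2 psi ->
  ell2 (kop K psi) /\ nsq (kop K psi) <= C ^+ 2 * nsq psi.
Proof.
move=> KR KC C0 ps; have p2 := ps; move/ell2P in p2.
pose sq i : R[i] := (nrm (psi i) ^+ 2)%:C.
have sqs : summ sq.
  by apply: summ_le_r p2 => i; rewrite nrm_real ger0_norm// sqr_ge0.
have asq : asum sq = (nsq psi)%:E.
  rewrite /asum /nsq -rsumE//; last by move=> i; exact: sqr_ge0.
  by apply: eq_esum => i _; rewrite nrm_real ger0_norm// sqr_ge0.
have [_ tot] := kop_l1 KC sqs (ltW C0).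
pose g i := fine (asum (fun j => K i j * sq j)).
have sqb : bnd sq (nsq psi).
  move=> i; rewrite -lee_fin -asq; apply: esum_ge; exists [set i].
    by split => //; exact: finite_set1.
  by rewrite fsbig_set1.
have gE i : asum (fun j => K i j * sq j) = (g i)%:E.
  rewrite /g fineK// ge0_fin_numE ?asum_ge0//.
  by have := kop_asum i KR sqb (nsq_ge0 _); move/le_lt_trans; apply; rewrite ltry.
have gtot : (\esum_(i in [set: I]) (g i)%:E <= (C * nsq psi)%:E)%E.
  rewrite EFinM -asq; apply: le_trans tot; apply: le_esum => i _; by rewrite gE.
have g0 i : 0 <= g i by rewrite /g fine_ge0// asum_ge0.
have gs : rsm g by apply: rsm_ge0 => //; rewrite (le_lt_trans gtot)// ltry.
have key i : nrm (kop K psi i) ^+ 2 <= C * g i.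
  have Ks := rowb_summ i KR.
  have pb := nsq_bnd ps.
  have KPs := kop_summ i KR pb (sqrtr_ge0 _).
  pose S := rsum (fun j => nrm (K i j * psi j)).
  have rK : rsm (fun j => nrm (K i j)) := proj1 (summ_rsm _) Ks.
  have rKP : rsm (fun j => nrm (K i j * psi j)) := proj1 (summ_rsm _) KPs.
  have rKS : rsm (fun j => nrm (K i j * sq j)).
    by apply: (proj1 (summ_rsm _)); rewrite /summ gE ltry.
  have S1 : nrm (kop K psi i) <= S.
    by apply: nrm_csum_le; rewrite /asum rsumE// => j; exact: nrm_ge0.
  have kC : rsum (fun j => nrm (K i j)) <= C.
    by have := KR i; rewrite /asum rsumE// => j; exact: nrm_ge0.
  have gi : rsum (fun j => nrm (K i j * sq j)) = g i.
    by apply: EFin_inj; rewrite -gE /asum rsumE// => j; exact: nrm_ge0.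
  have S0 : 0 <= S by apply: rsum_ge0 => j; exact: nrm_ge0.
  (* Cauchy-Schwarz in the form 2 t x <= x^2 + t^2 with x = |psi j|; the choice t = S / C makes the
     sum yield S^2 / C <= g i. *)
  have : rsum (fun j => 2 * (S / C) * nrm (K i j * psi j)) <=
     rsum (fun j => nrm (K i j * sq j) + (S / C) ^+ 2 * nrm (K i j)).
    apply: le_rsum.
    - exact: rsmZ.
    - by apply: rsmD => //; exact: rsmZ.
    move=> j; rewrite !nrmM nrm_real ger0_norm ?sqr_ge0//.
    have := mulr_ge0 (nrm_ge0 (K i j)) (sqr_ge0 (S / C - nrm (psi j))).
    by nra.
  rewrite rsumD//; last exact: rsmZ.
  rewrite !rsumZ// gi -/S => h.
  have h2 : (S / C) ^+ 2 * rsum (fun j => nrm (K i j)) <= (S / C) ^+ 2 * C.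
    by rewrite ler_wpM2l ?sqr_ge0.
  have E1 : S = (S / C) * C by rewrite divfK// gt_eqF.
  have h3 : S ^+ 2 <= C * g i.
    set t := S / C in h h2 E1.
    rewrite E1 in h *.
    have : t ^+ 2 * C <= g i by nra.
    move=> h4; rewrite (_ : (t * C) ^+ 2 = C * (t ^+ 2 * C)); last by ring.
    by rewrite ler_wpM2l// ltW.
  apply: le_trans h3; rewrite ler_pXn2r ?nnegrE ?nrm_ge0//.
have e2 : rsm (fun i => nrm (kop K psi i) ^+ 2).
  have := rsmZ C gs; apply: le_lt_trans; apply: le_esum => i _.
  by rewrite lee_fin ger0_norm ?sqr_ge0// (le_trans (key i))// ler_norm.
split; first exact/ell2P.
rewrite /nsq; apply: (@le_trans _ _ (rsum (fun i => C * g i))).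
  by apply: le_rsum => //; exact: rsmZ.
rewrite rsumZ// expr2 -mulrA ler_wpM2l ?(ltW C0)//.
by rewrite -lee_fin -rsumE.
Qed.

Definition hermk K := forall i j, K i j = (conjc (K j i)).

Lemma herm_colb K C : hermk K -> rowb K C -> colb K C.
Proof.
move=> Kh KC j; apply: le_trans (KC j); apply: asum_le => i.
by rewrite Kh nrm_conj.
Qed.

(** Exchange of two sums. The double family is dominated by |K i j| (|phi j|^2 + |psi i|^2),
    summable by the column bound for the first term and the row bound for the second. *)
Lemma kop_adj K C phi psi : hermk K -> rowb K C -> 0 < C -> ell2 phi -> ell2 psi ->
  ip (kop K phi) psi = ip phi (kop K psi).
Proof.
move=> Kh KR C0 p1 p2; have KC := herm_colb Kh KR.
pose sq (u : I -> R[i]) i : R[i] := (nrm (u i) ^+ 2)%:C.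
have sqs u : ell2 u -> summ (sq u).
  by move=> /ell2P; apply: summ_le_r => i; rewrite nrm_real ger0_norm// sqr_ge0.
have [_ t1] := kop_l1 KC (sqs _ p1) (ltW C0).
have p2s := sqs _ p2.
have tot : (\esum_(i in [set: I]) asum (fun j => ((conjc (K i j)) * (conjc (phi j)) * psi i))%R < +oo)%E.
  apply: (@le_lt_trans _ _ (\esum_(i in [set: I]) (asum (fun j => K i j * sq phi j)%R +
     C%:E * (nrm (sq psi i))%:E))%E).
    apply: le_esum => i _.
    apply: (@le_trans _ _ (asum (fun j => K i j * sq phi j)%R + asum (fun j => sq psi i * K i j)%R)%E).
      rewrite /asum -esumD; try by move=> *; rewrite lee_fin nrm_ge0.
      apply: le_esum => j _; rewrite -EFinD lee_fin !nrmM !nrm_conj !nrm_real.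
      rewrite !ger0_norm ?sqr_ge0//.
      have := mulr_ge0 (nrm_ge0 (K i j)) (sqr_ge0 (nrm (phi j) - nrm (psi i))).
      have := mulr_ge0 (nrm_ge0 (K i j)) (sqr_ge0 (nrm (phi j))).
      have := mulr_ge0 (nrm_ge0 (K i j)) (sqr_ge0 (nrm (psi i))).
      by nra.
    apply: leeD2l; rewrite asumZ muleC; apply: lee_wpmul2r; last exact: KR.
    by rewrite lee_fin nrm_ge0.
  rewrite esumD; last 2 first.
  - by move=> i _; exact: asum_ge0.
  - by move=> i _; rewrite -EFinM lee_fin mulr_ge0 ?nrm_ge0 ?ltW.
  apply: lte_add_pinfty.
    rewrite (le_lt_trans t1)// -(fineK (summ_fin (sqs _ p1))) ltry//.
  rewrite esumZl ?(ltW C0)//; last by move=> i; exact: nrm_ge0.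
  by rewrite -/(asum _) -(fineK (summ_fin p2s)) ltry.
have pb1 := nsq_bnd p1; have pb2 := nsq_bnd p2.
transitivity (csum (fun i => csum (fun j => (conjc (K i j)) * (conjc (phi j)) * psi i))).
  congr csum; apply/funext => i.
  have -> : (conjc (kop K phi i)) = csum (fun j => (conjc (K i j * phi j))) by rewrite csum_conj.
  rewrite mulrC -csumZ.
    by congr csum; apply/funext => j; rewrite rmorphM /= mulrC.
  have := kop_summ i KR pb1 (sqrtr_ge0 _).
  by apply: summ_le => j; rewrite nrm_conj.
rewrite csum_swap//; congr csum; apply/funext => j.
rewrite /kop -csumZ; last exact: (kop_summ j KR pb2 (sqrtr_ge0 _)).
by congr csum; apply/funext => i; rewrite [in RHS]Kh; ring.
Qed.

Lemma basis_ell2 w : ell2 (basis_vec w : I -> R[i]) /\ nsq (basis_vec w : I -> R[i]) = 1.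
Proof.
have E : (\esum_(i in [set: I]) (nrm (basis_vec w i : R[i]) ^+ 2)%:E = 1)%E.
  rewrite (esumID [set w]); last by move=> *; rewrite lee_fin sqr_ge0.
  rewrite !setTI esum_set1 ?lee_fin ?sqr_ge0//.
  rewrite [X in (_ + X)%E]esum1.
    by rewrite /basis_vec eqxx nrm1 expr1n adde0.
  by move=> i /= /eqP /negbTE h; rewrite /basis_vec h nrm0 expr0n.
have s : rsm (fun i => nrm (basis_vec w i : R[i]) ^+ 2).
  by apply: rsm_ge0 => [i|]; rewrite ?sqr_ge0// E ltry.
split; first exact/ell2P.
by apply: EFin_inj; rewrite /nsq -rsumE// => i; exact: sqr_ge0.
Qed.

End EllTwo.

(** * Spectral bound for polynomials and entries of the functional calculus *)

Section FunctionalCalculus.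
Context {R : realType} {I : choiceType}.
Variables (K : I -> I -> R[i]) (C : R).
Hypotheses (Kh : hermk K) (KC : rowb K C) (C0 : 0 < C).
Implicit Types (psi phi : I -> R[i]).

Local Notation T := (kop K).

Let KCc : colb K C := herm_colb Kh KC.

Lemma T_ell2 psi : ell2 psi -> ell2 (T psi).
Proof. by move=> /(kop_ell2 KC KCc C0)[]. Qed.

Lemma iterT_ell2 n psi : ell2 psi -> ell2 (iter n T psi).
Proof. by move=> p; elim: n => [//|n IH] /=; exact: T_ell2. Qed.

Lemma T_lin c phi psi : ell2 phi -> ell2 psi ->
  T (fun i => c * phi i + psi i) = (fun i => c * T phi i + T psi i).
Proof.
by move=> p1 p2; apply: (kop_lin c KC (nsq_bnd p1) _ (nsq_bnd p2)); exact: sqrtr_ge0.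
Qed.

Lemma iterT_lin n c phi psi : ell2 phi -> ell2 psi ->
  iter n T (fun i => c * phi i + psi i) = (fun i => c * iter n T phi i + iter n T psi i).
Proof.
by move=> p1 p2; apply: (iter_kop_lin n c KC (ltW C0) (nsq_bnd p1) _ (nsq_bnd p2)); exact: sqrtr_ge0.
Qed.

(** Complex coefficients, unlike [poly_op], because the spectral bound splits real polynomials into
    linear factors over [R[i]]. *)
Definition cop (P : {poly R[i]}) psi : I -> R[i] :=
  fun i => \sum_(k < size P) P`_k * iter k T psi i.

Lemma cop_wide n (P : {poly R[i]}) psi i : (size P <= n)%N ->
  cop P psi i = \sum_(k < n) P`_k * iter k T psi i.
Proof.
move=> Pn; rewrite /cop (big_ord_widen n (fun k => P`_k * iter k T psi i) Pn).
rewrite big_mkcond; apply: eq_bigr => k _; case: ltnP => // h.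
by rewrite nth_default// mul0r.
Qed.

Lemma cop_bigsum_ell2 (n : nat) (a : nat -> R[i]) psi : ell2 psi ->
  ell2 (fun i => \sum_(k < n) a k * iter k T psi i).
Proof.
move=> p; elim: n => [|n IH].
  rewrite (_ : (fun i => _) = fun=> 0); last by apply/funext => i; rewrite big_ord0.
  by case: (@ell20 R I).
rewrite (_ : (fun i => _) = fun i => \sum_(k < n) a k * iter k T psi i + a n * iter n T psi i).
  by apply: ell2D => //; case: (ell2Z (a n) (iterT_ell2 n p)).
by apply/funext => i; rewrite big_ord_recr.
Qed.

Lemma cop_ell2 P psi : ell2 psi -> ell2 (cop P psi).
Proof. exact: cop_bigsum_ell2. Qed.

Lemma copD P Q psi : cop (P + Q) psi = (fun i => cop P psi i + cop Q psi i).
Proof.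
apply/funext => i.
rewrite !(@cop_wide (maxn (size P) (size Q)))//.
- by rewrite -big_split /=; apply: eq_bigr => k _; rewrite coefD mulrDl.
- exact: leq_maxr.
- exact: leq_maxl.
- exact: size_polyD.
Qed.

Lemma copZ c P psi : cop (c *: P) psi = (fun i => c * cop P psi i).
Proof.
apply/funext => i; rewrite (@cop_wide (size P))//; last exact: size_scale_leq.
rewrite /cop big_distrr /=; apply: eq_bigr => k _; by rewrite coefZ mulrA.
Qed.

Lemma copC c psi : cop c%:P psi = (fun i => c * psi i).
Proof.
apply/funext => i; rewrite (@cop_wide 1) ?size_polyC_leq1//.
by rewrite big_ord1 coefC.
Qed.

Lemma cop0 psi : cop 0 psi = (fun=> 0).
Proof. by apply/funext => i; rewrite -polyC0 copC mul0r. Qed.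

Lemma cop1 psi : cop 1 psi = psi.
Proof. by apply/funext => i; rewrite -polyC1 copC mul1r. Qed.

Lemma cop_mulX P psi : cop (P * 'X) psi = cop P (T psi).
Proof.
apply/funext => i; rewrite (@cop_wide (size P).+1); last first.
  by rewrite (leq_trans (size_polyMleq _ _))// size_polyX addn2.
rewrite big_ord_recl coefMX eqxx mul0r add0r; apply: eq_bigr => k _.
by rewrite coefMX /= -iterSr.
Qed.

Lemma copXT P psi : ell2 psi -> cop P (T psi) = T (cop P psi).
Proof.
move=> p; rewrite /cop.
elim: (size P) => [|n IH].
  rewrite (_ : (fun i => _) = fun=> 0); last by apply/funext => i; rewrite big_ord0.
  rewrite (_ : (fun i => _) = fun=> 0); last by apply/funext => i; rewrite big_ord0.
  apply/funext => i; rewrite /kop -[LHS](@csum0 R I).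
  by congr csum; apply/funext => j; rewrite mulr0.
pose u m psi i := \sum_(k < m) P`_k * iter k T psi i.
rewrite (_ : (fun i => \sum_(k < n.+1) P`_k * iter k T (T psi) i) =
  fun i => P`_n * iter n T (T psi) i + u n (T psi) i); last first.
  by apply/funext => i; rewrite big_ord_recr /= addrC.
rewrite (_ : (fun i => \sum_(k < n.+1) P`_k * iter k T psi i) =
  fun i => P`_n * iter n T psi i + u n psi i); last first.
  by apply/funext => i; rewrite big_ord_recr /= addrC.
rewrite T_lin; last 2 first.
- exact: iterT_ell2.
- exact: cop_bigsum_ell2.
by rewrite -IH -iterSr.
Qed.

Lemma copM P Q psi : ell2 psi -> cop (P * Q) psi = cop P (cop Q psi).
Proof.
elim/poly_ind: P psi => [|P c IH] psi p.
  by rewrite mul0r !cop0.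
rewrite mulrDl -mulrA [_ * Q]mulrC mulrA !copD !cop_mulX IH; last exact: T_ell2.
rewrite mul_polyC copZ copC.
by rewrite copXT.
Qed.

Lemma cop_lin P c phi psi : ell2 phi -> ell2 psi ->
  cop P (fun i => c * phi i + psi i) = (fun i => c * cop P phi i + cop P psi i).
Proof.
move=> p1 p2; apply/funext => i; rewrite /cop big_distrr /= -big_split /=.
by apply: eq_bigr => k _; rewrite iterT_lin// mulrDr mulrCA.
Qed.

Lemma cop_bounded P : exists2 B : R, 0 <= B &
  forall psi, ell2 psi -> nsq (cop P psi) <= B * nsq psi.
Proof.
elim/poly_ind: P => [|P c [B B0 IH]].
  exists 0 => // psi p; rewrite cop0 mul0r.
  by case: (@ell20 R I) => _ ->.
exists (2 * B * C ^+ 2 + 2 * nrm c ^+ 2).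
  by rewrite addr_ge0// !mulr_ge0// ?exprn_ge0 ?nrm_ge0// ltW.
move=> psi p; rewrite copD cop_mulX copC.
have [h1 h2] := ell2Z c p.
apply: (le_trans (nsqD_le (cop_ell2 P (T_ell2 p)) h1)).
rewrite h2.
have := IH _ (T_ell2 p); have [_ h3] := kop_ell2 KC KCc C0 p.
have h4 : B * nsq (T psi) <= B * (C ^+ 2 * nsq psi) by rewrite ler_wpM2l.
lra.
Qed.

Lemma T_adj phi psi : ell2 phi -> ell2 psi -> ip (T phi) psi = ip phi (T psi).
Proof. exact: kop_adj Kh KC C0. Qed.

Local Notation rc := (map_poly (real_complex R)).

Lemma poly_opE (p : {poly R}) psi : poly_op p T psi = cop (rc p) psi.
Proof.
apply/funext => i; rewrite /poly_op /cop size_map_poly.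
by apply: eq_bigr => k _; rewrite coef_map.
Qed.

Lemma cop_adj (p : {poly R}) phi psi : ell2 phi -> ell2 psi ->
  ip (cop (rc p) phi) psi = ip phi (cop (rc p) psi).
Proof.
elim/poly_ind: p phi psi => [|p c IH] phi psi p1 p2.
  by rewrite rmorph0 -polyC0 !copC ipZl// ipZr// conjc0 !mul0r.
rewrite rmorphD rmorphM /= map_polyX map_polyC /= !copD !cop_mulX !copC.
have h1 := (cop_ell2 (rc p) (T_ell2 p1)); have h2 := cop_ell2 (rc p) (T_ell2 p2).
have [z1 _] := ell2Z c%:C p1; have [z2 _] := ell2Z c%:C p2.
rewrite ipDl// ipDr// ipZl// ipZr// IH//; last exact: T_ell2.
rewrite T_adj//; last exact: cop_ell2.
by rewrite -copXT// conjc_real.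
Qed.

(** Stands in for invertibility: it passes to products, it holds for T - z off the spectrum, and its
    failure for p(T)^2 - N produces a point of the spectrum. *)
Definition bddbelow (S : (I -> R[i]) -> I -> R[i]) : Prop :=
  exists2 c : R, 0 < c & forall psi, ell2 psi -> c * nsq psi <= nsq (S psi).

Lemma ip_T_real psi : ell2 psi -> complex.Im (ip (T psi) psi) = 0.
Proof.
move=> p; have := T_adj p p; rewrite [in RHS]ipC.
case: (ip (T psi) psi) => a b /= [] h; lra.
Qed.

(** For z = a + ib the square norm of (T - z) psi is that of (T - a) psi plus b^2 times that of psi:
    the cross term drops out because the quadratic form of T - a is real. *)
Lemma below_nonreal (z : R[i]) : complex.Im z != 0 ->
  bddbelow (fun psi i => T psi i - z * psi i).
Proof.
case: z => a b /= b0; exists (b ^+ 2); first by rewrite lt_neqAle eq_sym sqrf_eq0 b0 sqr_ge0.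
move=> psi p.
have [p1 n1] := ell2Z (- a%:C) p.
have [p2 n2] := ell2Z (- (0 +i* b)) p.
have pT := T_ell2 p.
rewrite (_ : (fun i => _) = (fun i => (T psi i + - a%:C * psi i) + - (0 +i* b) * psi i)); last first.
  apply/funext => i; rewrite -addrA -mulrDl; congr (_ + _); rewrite -mulNr; congr (_ * _).
  by apply: complex_eq; rewrite ?cReD ?cImD /= ?oppr0 ?addr0 ?add0r.
rewrite nsqD//; last exact: ell2D.
rewrite n2 ipZr//; last exact: ell2D.
rewrite ipDl// ipZl// ipE// nrmN.
rewrite (_ : complex.Re _ = 0); last first.
  have := ip_T_real p; case: (ip (T psi) psi) => u v /= ->; ring.
rewrite mulr0 addr0 nrm_sqr /= expr0n /= add0r lerDr; exact: nsq_ge0.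
Qed.

Lemma opnorm_ge0 (S : (I -> R[i]) -> I -> R[i]) : (0 <= opnorm S)%E.
Proof.
apply: le_trans (ereal_sup_ubound _); last first.
  by exists (fun=> 0) => //=; case: (@ell20 R I) => h e; rewrite l2normE// e sqrtr0 lee_fin.
exact: sqrte_ge0.
Qed.

(** That S preserves [ell2] is extracted from the finiteness of [opnorm], by scaling psi into the
    unit ball. The 1 added to the constant keeps it positive. *)
Lemma bounded_op_nsq S : bounded_op S -> exists2 c : R, 0 < c &
  forall psi, ell2 psi -> ell2 (S psi) /\ nsq (S psi) <= c * nsq psi.
Proof.
move=> [Sl Sb].
have op0 := opnorm_ge0 S.
have S0 : S (fun=> 0) = (fun=> 0).
  have [e0 _] := @ell20 R I.
  have := Sl 1 _ _ e0 e0.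
  rewrite (_ : (fun i => 1 * 0 + 0) = fun=> 0); last by apply/funext => i; rewrite mul1r addr0.
  move=> h; apply/funext => i; have /(congr1 (fun f => f i)) := h.
  by rewrite mul1r => /eqP; rewrite -subr_eq subrr => /eqP <-.
have SZ c psi : ell2 psi -> S (fun i => c * psi i) = (fun i => c * S psi i).
  move=> p; have [e0 _] := @ell20 R I; have := Sl c _ _ p e0.
  rewrite (_ : (fun i => c * psi i + 0) = fun i => c * psi i); last by apply/funext => i; rewrite addr0.
  by rewrite S0 => ->; apply/funext => i; rewrite addr0.
pose c1 := fine (opnorm S).
have c1E : opnorm S = c1%:E by rewrite fineK// ge0_fin_numE.
have c10 : 0 <= c1 by rewrite fine_ge0.
have unit psi : ell2 psi -> nsq psi <= 1 -> ell2 (S psi) /\ nsq (S psi) <= c1 ^+ 2.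
  move=> p p1.
  have : (l2norm (S psi) <= c1%:E)%E.
    rewrite -c1E; apply: ereal_sup_ubound; exists psi => //=.
    by rewrite l2normE// lee_fin -sqrtr1 ler_wsqrtr.
  move=> h; have e : ell2 (S psi) by rewrite /ell2 (le_lt_trans h)// ltry.
  split => //; move: h; rewrite l2normE// lee_fin => h.
  by rewrite -[nsq _]sqr_sqrtr ?nsq_ge0// ler_pXn2r ?nnegrE ?sqrtr_ge0.
exists (c1 ^+ 2 + 1); first by rewrite ltr_wpDl ?sqr_ge0.
move=> psi p; have := nsq_ge0 psi; rewrite le_eqVlt => /predU1P[n0|n0].
  have : psi = fun=> 0.
    apply/funext => i; have := nsq_bnd p i; rewrite -n0 sqrtr0 => h.
    by apply: nrm_eq0; apply/eqP; rewrite eq_le h nrm_ge0.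
  by move=> ->; rewrite S0; case: (@ell20 R I) => e ->; rewrite mulr0.
pose t := (Num.sqrt (nsq psi))^-1.
have t0 : 0 < t by rewrite invr_gt0 sqrtr_gt0.
have t2 : t ^+ 2 * nsq psi = 1.
  by rewrite /t exprVn sqr_sqrtr ?(ltW n0)// mulVf// gt_eqF.
have [pt nt] := ell2Z t%:C p.
have [|e1 e2] := unit _ pt; first by rewrite nt nrm_real ger0_norm ?(ltW t0)// t2.
rewrite SZ// in e1 e2.
have tn : t%:C != 0 :> R[i] by rewrite eq_complex /= eqxx andbT gt_eqF.
have e3 : ell2 (S psi).
  have [+ _] := ell2Z (t^-1)%:C e1; congr ell2; apply/funext => i.
  by rewrite mulrA -rmorphM /= mulVf ?gt_eqF// mul1r.
split => //; have [_ e4] := ell2Z t%:C e3.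
rewrite e4 nrm_real ger0_norm ?(ltW t0)// in e2.
have : nsq (S psi) = (t ^+ 2 * nsq (S psi)) * nsq psi by rewrite mulrAC t2 mul1r.
move=> ->; apply: (@le_trans _ _ (c1 ^+ 2 * nsq psi)).
  by rewrite ler_wpM2r ?(ltW n0).
by rewrite mulrDl lerDl mul1r ltW.
Qed.

Lemma below_resolvent (z : R[i]) : in_resolvent T z ->
  bddbelow (fun psi i => T psi i - z * psi i).
Proof.
move=> [S /bounded_op_nsq [c c0 Sb] SE].
exists c^-1; first by rewrite invr_gt0.
move=> psi p; have [h _] := SE _ p.
have [pz _] := ell2Z (- z) p.
have e : ell2 (fun i => T psi i - z * psi i).
  have := ell2D (T_ell2 p) pz; congr ell2; apply/funext => i; by rewrite mulNr.
have [e2 n2] := ell2Z (-1) e.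
have E : (fun i => z * psi i - T psi i) = (fun i => -1 * (T psi i - z * psi i)).
  by apply/funext => i; ring.
have := Sb _ e2; rewrite -E h => -[_]; rewrite E n2 nrmN nrm1 expr1n mul1r.
by rewrite ler_pdivrMl.
Qed.

Lemma below_prod (zs : seq R[i]) :
  (forall z, z \in zs -> complex.Im z = 0 -> in_resolvent T z) ->
  bddbelow (cop (\prod_(z <- zs) ('X - z%:P))).
Proof.
elim: zs => [|z zs IH] hz.
  by exists 1 => // psi p; rewrite big_nil cop1 mul1r.
have [|c c0 hc] := IH; first by move=> w wz; apply: hz; rewrite inE wz orbT.
have [d d0 hd] : bddbelow (fun psi i => T psi i - z * psi i).
  have [zi|zi] := eqVneq (complex.Im z) 0; last exact: below_nonreal.
  by apply: below_resolvent; apply: hz => //; rewrite inE eqxx.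
exists (c * d); first exact: mulr_gt0.
move=> psi p; rewrite big_cons [_ * \prod_(_ <- _) _]mulrC copM//.
have -> : cop ('X - z%:P) psi = (fun i => T psi i - z * psi i).
  rewrite -['X]mul1r -polyCN copD cop_mulX cop1 copC.
  by apply/funext => i; rewrite mulNr.
have [pz _] := ell2Z (- z) p.
have e : ell2 (fun i => T psi i - z * psi i).
  have := ell2D (T_ell2 p) pz; congr ell2; apply/funext => i; by rewrite mulNr.
by apply: le_trans (hc _ e); rewrite -mulrA ler_wpM2l ?(ltW c0)// hd.
Qed.

(** Over [R[i]] the polynomial is a product of linear factors: real roots are handled by the
    resolvent, the others by self-adjointness. *)
Lemma below_poly (P : {poly R[i]}) : P != 0 ->
  (forall z, root P z -> complex.Im z = 0 -> in_resolvent T z) -> bddbelow (cop P).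
Proof.
move=> P0 hP; have [zs PE] := closed_field_poly_normal P.
have l0 : lead_coef P != 0 by rewrite lead_coef_eq0.
have [|c c0 hc] := @below_prod zs.
  move=> z zz; apply: hP; rewrite PE rootZ// root_prod_XsubC//.
exists (nrm (lead_coef P) ^+ 2 * c).
  rewrite mulr_gt0// exprn_gt0// lt_neqAle nrm_ge0 andbT eq_sym.
  by apply: contra_neq l0 => /nrm_eq0.
move=> psi p.
rewrite (_ : cop P psi = cop (lead_coef P *: \prod_(z <- zs) ('X - z%:P)) psi); last by rewrite -PE.
rewrite copZ; have [_ ->] := ell2Z (lead_coef P) (cop_ell2 (\prod_(z <- zs) ('X - z%:P)) p).
by rewrite -mulrA ler_wpM2l ?sqr_ge0// hc.
Qed.

Local Notation pT p := (cop (rc p)).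

(* The operator norm of a self-adjoint p(T) is attained on the spectrum: if N is
   its square then p(T)^2 - N is not bounded below. *)
Lemma norm_attained (p : {poly R}) : (exists psi, ell2 psi /\ 0 < nsq psi) ->
  exists N : R, [/\ 0 <= N,
    forall psi, ell2 psi -> nsq (pT p psi) <= N * nsq psi
  & ~ bddbelow (pT (p * p - N%:P))].
Proof.
move=> [u [pu u0]].
pose A := [set nsq (pT p psi) | psi in [set psi | ell2 psi /\ nsq psi <= 1]].
have [B B0 hB] := cop_bounded (rc p).
have A0 : A 0.
  exists (fun=> 0); first by case: (@ell20 R I) => h1 h2; split => //=; rewrite h2.
  case: (@ell20 R I) => h1 h2; apply/eqP; rewrite eq_le nsq_ge0 andbT.
  by rewrite (le_trans (hB _ h1))// h2 mulr0.
have Aub : has_ubound A.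
  exists B => _ [psi [p1 p2] <-]; apply: (le_trans (hB _ p1)).
  by rewrite -[leRHS]mulr1 ler_wpM2l.
have Asup : has_sup A by split => //; exists 0.
pose N := sup A.
have N0 : 0 <= N by apply: ub_le_sup.
have hN psi : ell2 psi -> nsq (pT p psi) <= N * nsq psi.
  move=> p1; have := nsq_ge0 psi; rewrite le_eqVlt => /predU1P[n0|n0].
    by rewrite (le_trans (hB _ p1))// -n0 !mulr0.
  pose t := (Num.sqrt (nsq psi))^-1.
  have t0 : 0 < t by rewrite invr_gt0 sqrtr_gt0.
  have t2 : t ^+ 2 * nsq psi = 1.
    by rewrite /t exprVn sqr_sqrtr ?(ltW n0)// mulVf// gt_eqF.
  have [pt nt] := ell2Z t%:C p1.
  rewrite nrm_real ger0_norm ?(ltW t0)// t2 in nt.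
  have : nsq (pT p (fun i => t%:C * psi i)) <= N.
    by apply: ub_le_sup => //; exists (fun i => t%:C * psi i) => //; split => //; rewrite nt.
  have [e0 _] := @ell20 R I.
  have := cop_lin (rc p) t%:C p1 e0.
  rewrite (_ : (fun i => _ + 0) = fun i => t%:C * psi i); last by apply/funext => i; rewrite addr0.
  move=> ->.
  have E0 : pT p (fun=> 0) = fun=> 0.
    apply/funext => i; apply: nrm_eq0; apply/eqP; rewrite eq_le nrm_ge0 andbT.
    have [_ z0] := @ell20 R I.
    have := nsq_bnd (cop_ell2 (rc p) e0) i.
    suff -> : nsq (pT p (fun=> 0)) = 0 by rewrite sqrtr0.
    by apply/eqP; rewrite eq_le nsq_ge0 andbT (le_trans (hB _ e0))// z0 mulr0.
  rewrite E0; under [X in nsq X]eq_fun do rewrite addr0.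
  have [_ ->] := ell2Z t%:C (cop_ell2 (rc p) p1).
  rewrite nrm_real ger0_norm ?(ltW t0)// => h.
  have -> : nsq (pT p psi) = (t ^+ 2 * nsq (pT p psi)) * nsq psi by rewrite mulrAC t2 mul1r.
  by rewrite ler_wpM2r ?(ltW n0).
exists N; split => // -[c c0 hc].
(* Expanding the square and moving p(T) across the inner product gives |p^2 psi|^2 - 2 N |p psi|^2 +
   N^2 |psi|^2, and |p^2 psi|^2 <= N |p psi|^2. *)
have est psi : ell2 psi -> nsq (pT (p * p - N%:P) psi) <= N * (N * nsq psi - nsq (pT p psi)).
  move=> p1; have p2 := cop_ell2 (rc p) p1; have p3 := cop_ell2 (rc p) p2.
  have [p4 n4] := ell2Z (- N%:C) p1.
  rewrite rmorphB rmorphM /= map_polyC /= -polyCN copD copM// copC nsqD// n4 ipZr// cop_adj// ipE//.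
  rewrite nrmN nrm_real ger0_norm//.
  have := hN _ p2.
  rewrite (_ : complex.Re _ = - (N * nsq (pT p psi))); last by rewrite /=; ring.
  by move=> h; nra.
have := N0; rewrite le_eqVlt => /predU1P[Nz|Np].
  have := est _ pu; rewrite -Nz mul0r => h.
  have := hc _ pu; have := mulr_gt0 c0 u0; rewrite -Nz; lra.
(* Take psi in the unit ball within d of the supremum N: d <= N / 2 forces |psi|^2 >= 1 / 2, and d
   <= c / (4 N) makes the estimate at most c / 4, below the lower bound c / 2. *)
pose d := Num.min (N / 2) (c / (4 * N)).
have d0 : 0 < d by rewrite lt_min !divr_gt0// mulr_gt0.
have [_ [psi [p1 p2] <-] h] := sup_adherent d0 Asup.
rewrite -/N in h.
have h1 := hc _ p1; have h2 := est _ p1; have h3 := hN _ p1.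
have d1 : d <= N / 2 by rewrite ge_min lexx.
have d2 : d * (4 * N) <= c by rewrite -ler_pdivlMr ?mulr_gt0// ge_min lexx orbT.
have q1 : 1 / 2 <= nsq psi.
  by rewrite -(ler_pM2l Np); lra.
have q2 : N * nsq psi <= N by rewrite -[leRHS]mulr1 ler_wpM2l.
have q3 : N * (N * nsq psi - nsq (pT p psi)) <= N * d by rewrite ler_wpM2l//; lra.
have q4 : c * (1 / 2) <= c * nsq psi by rewrite ler_wpM2l// ltW.
lra.
Qed.

(** The square N of the norm of p(T) equals p(x)^2 at some real x of the spectrum; otherwise no real
    root of p^2 - N would lie in the spectrum, and p(T)^2 - N would be bounded below. *)
Lemma spectral_bound (p : {poly R}) (s : R) : 0 <= s ->
  (forall x : R, spectrum T x%:C -> `|p.[x]| <= s) ->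
  forall psi, ell2 psi -> nsq (pT p psi) <= s ^+ 2 * nsq psi.
Proof.
move=> s0 hs.
have key (q : {poly R}) (N : R) : q * q - N%:P != 0 -> ~ bddbelow (pT (q * q - N%:P)) ->
    exists x : R, spectrum T x%:C /\ q.[x] ^+ 2 = N.
  move=> q0 nb; apply: contrapT => hn; apply: nb; apply: below_poly.
    by rewrite map_poly_eq0.
  move=> z rz z0; apply: contrapT => nz; apply: hn.
  exists (complex.Re z); have zE : z = (complex.Re z)%:C by apply: complex_eq.
  split; first by rewrite /spectrum /= -zE.
  move: rz; rewrite zE /root horner_map /= !hornerE /= => /eqP.
  by move=> /complexI /eqP; rewrite subr_eq0 => /eqP <-; rewrite expr2.
have [[u [pu u0]]|no] := pselect (exists psi, ell2 psi /\ 0 < nsq psi); last first.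
  have z psi : ell2 psi -> nsq psi = 0.
    move=> e; apply/eqP; rewrite eq_le nsq_ge0 andbT leNgt; apply/negP => h.
    by apply: no; exists psi.
  by move=> psi e; rewrite !z ?mulr0//; exact: cop_ell2.
have ex : exists psi, ell2 psi /\ 0 < nsq psi by exists u.
have [N [N0 hN nb]] := norm_attained p ex.
suff Ns : N <= s ^+ 2.
  by move=> psi e; rewrite (le_trans (hN _ e))// ler_wpM2r ?nsq_ge0.
(* If p^2 - N is the zero polynomial, every x is a root and all that is missing is some point of the
   spectrum; the argument applied to ['X] supplies one. *)
have [r0|r0] := eqVneq (p * p - N%:P) 0; last first.
  have [x [sx <-]] := key _ _ r0 nb.
  by rewrite -real_normK ?num_real// ler_pXn2r ?nnegrE ?normr_ge0// hs.
have [M [M0 hM nbM]] := norm_attained 'X ex.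
have [|x [sx _]] := key _ _ _ nbM.
  rewrite -expr2 -size_poly_eq0 size_XnsubC//.
have : (p * p - N%:P).[x] = 0 by rewrite r0 horner0.
rewrite !hornerE => /eqP; rewrite subr_eq0 => /eqP <-.
by rewrite -expr2 -real_normK ?num_real// ler_pXn2r ?nnegrE ?normr_ge0// hs.
Qed.

Lemma kop_bounded_op L D (S : (I -> R[i]) -> I -> R[i]) : rowb L D -> colb L D -> 0 < D ->
  (forall psi, ell2 psi -> S psi = kop L psi) ->
  bounded_op S /\ (opnorm S <= D%:E)%E.
Proof.
move=> LR LC D0 SE.
have op : (opnorm S <= D%:E)%E.
  apply: ge_ereal_sup => _ [psi p1 <-].
  have p : ell2 psi by rewrite /ell2 (le_lt_trans p1)// ltry.
  have [h1 h2] := kop_ell2 LR LC D0 p.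
  rewrite SE// l2normE// lee_fin -[D]ger0_norm ?(ltW D0)// -sqrtr_sqr ler_wsqrtr//.
  rewrite (le_trans h2)// -[leRHS]mulr1 ler_wpM2l ?sqr_ge0//.
  by move: p1 => /=; rewrite l2normE// lee_fin -[X in _ <= X]sqrtr1 ler_sqrt.
split => //; split; last by rewrite (le_lt_trans op)// ltry.
move=> c psi phi p1 p2; rewrite !SE//.
  by apply: (kop_lin c LR (nsq_bnd p1) _ (nsq_bnd p2)); exact: sqrtr_ge0.
by apply: ell2D => //; case: (ell2Z c p1).
Qed.

(** The slack [e] keeps the bound positive, as the Schur test requires, even if [bsum b C] is 0. *)
Lemma fop_bounded_op b e : bsm b C -> 0 < e ->
  bounded_op (fop b K) /\ (opnorm (fop b K) <= (bsum b C + e)%:E)%E.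
Proof.
move=> bC e0; have b0 := bsum_ge0 b (ltW C0).
apply: (@kop_bounded_op (fker b K)).
- move=> i; apply: le_trans (fker_rowb KC (ltW C0) bC i) _.
  by rewrite lee_fin lerDl ltW.
- move=> i; apply: le_trans (fker_colb KC (ltW C0) bC KCc (ltW C0) bC i) _.
  by rewrite lee_fin lerDl ltW.
- lra.
- by move=> psi p; apply: (fopE KC (ltW C0) (nsq_bnd p) (sqrtr_ge0 _) bC).
Qed.

Lemma fop_summ b psi i : bsm b C -> ell2 psi ->
  summ (fun n => (b n)%:C * iter n T psi i).
Proof.
move=> bC p.
by rewrite /summ (le_lt_trans (fop_asum i KC (ltW C0) (nsq_bnd p) (sqrtr_ge0 _) bC))// ltry.
Qed.

Lemma fop_comm b psi : bsm b C -> ell2 psi -> T (fop b K psi) = fop b K (T psi).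
Proof.
move=> bC p; apply/funext => i; rewrite /kop /fop.
have pb := nsq_bnd p; have Ks := rowb_summ i KC.
transitivity (csum (fun j => csum (fun n => K i j * ((b n)%:C * iter n T psi j)))).
  congr csum; apply/funext => j; rewrite csumZ//; exact: fop_summ.
rewrite csum_swap; last first.
  apply: (@le_lt_trans _ _ (asum (fun j => (bsum b C * Num.sqrt (nsq psi))%:C * K i j)%R)); last first.
    exact: summZ.
  apply: le_esum => j _; rewrite asumZ nrmM nrm_real ger0_norm; last first.
    by rewrite mulr_ge0 ?sqrtr_ge0// bsum_ge0// ltW.
  rewrite [in leRHS]mulrC EFinM; apply: lee_wpmul2l; first by rewrite lee_fin nrm_ge0.
  exact: fop_asum (KC) (ltW C0) pb (sqrtr_ge0 _) bC.
congr csum; apply/funext => n; rewrite -iterSr /= /kop -csumZ.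
  by congr csum; apply/funext => j; ring.
exact: (kop_summ i KC (nsq_bnd (iterT_ell2 n p)) (sqrtr_ge0 _)).
Qed.

Lemma fop_lin b c phi psi : bsm b C -> ell2 phi -> ell2 psi ->
  fop b K (fun i => c * phi i + psi i) = (fun i => c * fop b K phi i + fop b K psi i).
Proof.
move=> bC p1 p2; have [[h _] _] := fop_bounded_op bC ltr01.
exact: h.
Qed.

(* The resolvent at |x| > C is given by the Neumann series. *)
Lemma spectrum_le (x : R) : spectrum T x%:C -> `|x| <= C.
Proof.
move=> sx; rewrite leNgt; apply/negP => xC; apply: sx.
have xp : 0 < `|x| by exact: lt_trans C0 xC.
have x0 : x != 0 by rewrite -normr_gt0.
pose b n := x^-1 ^+ n.+1.
have bs : bsm b C.
  have q1 : C / `|x| < 1 by rewrite ltr_pdivrMr// mul1r.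
  have q0 : 0 <= C / `|x| by rewrite divr_ge0 ?ltW.
  have := rsmZ `|x|^-1 (rsm_geo q0 q1).
  rewrite /bsm /rsm; congr (_ < _)%E; apply: eq_esum => n _.
  by rewrite /b normrX normfV exprS -mulrA -exprMn [_^-1 * C]mulrC.
have [Sb _] := fop_bounded_op bs ltr01.
exists (fop b K) => // psi p.
have [px _] := ell2Z x%:C p.
have [pT nT] := ell2Z (-1) (T_ell2 p).
have key : (fun i => x%:C * fop b K psi i - fop b K (T psi) i) = psi.
  apply/funext => i; rewrite /fop -csumZ; last exact: fop_summ.
  rewrite csum_nat_recl; last by apply: summZ; exact: fop_summ.
  rewrite /b expr1 /= mulrA -rmorphM divff//= mul1r -addrA -csumB; last 2 first.
  - have := fop_summ i bs (T_ell2 p); congr summ; apply/funext => n.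
    rewrite -iterSr mulrA -rmorphM; congr (_%:C * _).
    by rewrite /b [in RHS]exprS mulrA divff// mul1r.
  - exact: fop_summ (T_ell2 p).
  rewrite (_ : (fun n => _) = fun=> 0) ?csum0 ?addr0//.
  apply/funext => n; rewrite mulrA -rmorphM -iterSr [x^-1 ^+ n.+2]exprS mulrA divff// mul1r.
  exact: subrr.
split.
  rewrite (_ : (fun i => _ - _) = fun i => x%:C * psi i + (-1 * T psi i)); last first.
    by apply/funext => i; rewrite mulN1r.
  rewrite fop_lin// -[RHS]key; apply/funext => i; congr (_ + _).
  have [e0 _] := @ell20 R I.
  have := fop_lin (-1) bs (T_ell2 p) e0.
  rewrite (_ : (fun i => -1 * T psi i + 0) = fun i => -1 * T psi i); last first.
    by apply/funext => j; rewrite addr0.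
  move=> ->; rewrite mulN1r.
  suff -> : fop b K (fun=> 0) i = 0 by rewrite addr0.
  rewrite /fop -[RHS](@csum0 R nat); congr csum; apply/funext => n.
  suff -> : iter n T (fun=> 0) = fun=> 0 by rewrite mulr0.
  elim: n => [//|n IH] /=; rewrite IH.
  apply/funext => j; rewrite /kop -[RHS](@csum0 R I); congr csum; apply/funext => l.
  by rewrite mulr0.
by rewrite fop_comm.
Qed.

Definition btail n (b : nat -> R) k := if (k < n)%N then 0 else b k.

Lemma btail_bsm n b D : bsm b D -> bsm (btail n b) D.
Proof.
rewrite /bsm; apply: le_lt_trans; apply: le_esum => k _.
rewrite lee_fin /btail; case: ifP => // _.
by rewrite normr0 mul0r normr0.
Qed.

Lemma btail_cvg b D e : 0 <= D -> bsm b D -> 0 < e ->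
  \forall n \near \oo, bsum (btail n b) D < e.
Proof.
move=> D0 bD e0.
have : clim \oo (fun n => csum (fun k => (`|btail n b k| * D ^+ k)%:C)) (csum (fun _ : nat => 0 : R[i])).
  apply: (@csum_clim R nat \oo _ nat _ _ (fun k => `|b k| * D ^+ k)) => //.
  - apply: nearW => n k; rewrite nrm_real ger0_norm ?mulr_ge0 ?exprn_ge0//.
    rewrite ler_wpM2r ?exprn_ge0// /btail; case: ifP => //; by rewrite normr0.
  - by move=> k; rewrite nrm0 mulr_ge0 ?exprn_ge0.
  - move=> k; apply: clim_near_eq (clim_cst 0).
    near=> n; rewrite /btail ifT ?normr0 ?mul0r//.
    by near: n; exact: nbhs_infty_gt.
move=> /(_ e e0); rewrite csum0; apply: filterS => n.
by rewrite subr0 csum_real nrm_real ger0_norm// bsum_ge0.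
Unshelve. all: by end_near. Qed.

Section PowerSeries.
Variables (b : nat -> R) (f : R -> R).
Hypotheses (bD : forall D, 0 <= D -> bsm b D)
  (fE : forall x, f x = rsum (fun k => b k * x ^+ k)).

Let pol n : {poly R} := \poly_(k < n) b k.

Lemma pol_approx n x : `|x| <= C -> `|(pol n).[x] - f x| <= bsum (btail n b) C.
Proof.
move=> xC; have bC := bD (ltW C0).
have s : summ (fun k => (b k * x ^+ k)%:C).
  apply: summ_le_r bC => k; rewrite nrm_real normrM normrX ler_wpM2l//.
  by rewrite lerXn2r ?nnegrE ?(ltW C0).
rewrite -nrm_real (_ : ((pol n).[x] - f x)%:C =
  (pol n).[x]%:C - (rsum (fun k => b k * x ^+ k))%:C); last by rewrite -fE rmorphB.
rewrite -csum_real (csum_nat_split n s).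
rewrite horner_poly (rmorph_sum (real_complex R)) opprD addrA subrr add0r nrmN.
apply: nrm_csum_le; apply: asum_le_rsum; last exact: btail_bsm.
move=> k; rewrite /btail; case: ifP => _; first by rewrite nrm0 normr0 mul0r.
by rewrite nrm_real normrM normrX ler_wpM2l// lerXn2r ?nnegrE ?(ltW C0).
Qed.

Lemma fop_pol n psi : ell2 psi ->
  (fun i => fop b K psi i - poly_op (pol n) T psi i) = fop (btail n b) K psi.
Proof.
move=> p; apply/funext => i; have bC := bD (ltW C0).
rewrite {1}/fop (csum_nat_split n (fop_summ i bC p)) poly_opE.
rewrite (@cop_wide n); last first.
  by rewrite size_map_poly size_poly.
rewrite addrAC (_ : \sum_(k < n) _ - _ = 0) ?add0r; last first.
  apply/eqP; rewrite subr_eq0; apply/eqP; apply: eq_bigr => k _.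
  by rewrite coef_map coef_poly ltn_ord.
rewrite /fop; congr csum; apply/funext => k; rewrite /btail.
by case: ifP => // _; rewrite mul0r.
Qed.

(** The witnesses are the truncations of the series: the spectrum lies in [-C, C], where they
    converge uniformly, and the same tail controls the operator norm of the remainder. *)
Lemma is_fcalc_fop : is_fcalc T f (fop b K).
Proof.
have bC := bD (ltW C0).
split; first by case: (fop_bounded_op bC ltr01).
exists pol; split.
  move=> e e0; apply: filterS (btail_cvg (ltW C0) bC e0) => n hn x /spectrum_le xC.
  exact: le_lt_trans (pol_approx n xC) hn.
move=> A [d /= d0 hA].
have d2 : 0 < d / 2 by lra.
suff : \forall n \near \oo,
  A (opnorm (fun psi i => fop b K psi i - poly_op (pol n) T psi i)%R) by [].
apply: filterS (btail_cvg (ltW C0) bC d2) => n h0.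
have [h1 h2] := fop_bounded_op (btail_bsm n bC) d2.
have opE : opnorm (fun psi i => fop b K psi i - poly_op (pol n) T psi i) =
    opnorm (fop (btail n b) K).
  congr ereal_sup; apply: eq_imagel => psi /= p1; rewrite fop_pol//.
  by rewrite /ell2 (le_lt_trans p1)// ltry.
rewrite /= opE; have := opnorm_ge0 (fop (btail n b) K); move: h2.
case: (opnorm _) => [r| |] //; rewrite !lee_fin => h3 h4.
by apply: hA => /=; rewrite sub0r normrN ger0_norm//; lra.
Qed.

(** [xget] may return another operator, reached by other polynomials p n. These and the truncations
    are both close to f on the spectrum, so [spectral_bound] makes the two polynomial operators
    close and the entries agree. *)
Lemma op_entry_fcalc w w' : op_entry (fcalc T f) w w' = fker b K w w'.
Proof.
have bC := bD (ltW C0).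
have : is_fcalc T f (fcalc T f).
  by rewrite /fcalc; case: xgetP => // h; have := h _ is_fcalc_fop.
set S := fcalc T f => -[Sb [p [pf pS]]].
have [e1 n1] := basis_ell2 w' : ell2 (basis_vec w' : I -> R[i]) /\ _.
apply/eqP; rewrite -subr_eq0; apply/eqP/nrm_eq0/eqP; rewrite eq_le nrm_ge0 andbT.
apply/ler_addgt0Pr => e e0; rewrite add0r.
have e4 : 0 < e / 4 by lra.
have hop : \forall n \near \oo,
    (opnorm (fun psi i => S psi i - poly_op (p n) T psi i)%R < (e / 4)%:E)%E.
  apply: (pS [set x | (x < (e / 4)%:E)%E]); exists (e / 4) => // r /=; rewrite sub0r normrN => hr.
  by rewrite lte_fin (le_lt_trans (ler_norm _) hr).
near \oo => n.
have h1 : forall x : R, spectrum T x%:C -> `|(p n).[x] - f x| < e / 4 by near: n; exact: pf.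
have h2 : bsum (btail n b) C < e / 4 by near: n; exact: (btail_cvg (ltW C0) bC e4).
have h3 : (opnorm (fun psi i => S psi i - poly_op (p n) T psi i)%R < (e / 4)%:E)%E by near: n.
have A1 : nrm (S (basis_vec w') w - poly_op (p n) T (basis_vec w') w) <= e / 4.
  have h : (l2norm (fun i => S (basis_vec w') i - poly_op (p n) T (basis_vec w') i)%R <= (e / 4)%:E)%E.
    apply: le_trans (ltW h3); apply: ereal_sup_ubound; exists (basis_vec w') => //=.
    by rewrite l2normE// n1 sqrtr1.
  have el : ell2 (fun i => S (basis_vec w') i - poly_op (p n) T (basis_vec w') i).
    by rewrite /ell2 (le_lt_trans h)// ltry.
  move: h; rewrite l2normE// lee_fin; apply: le_trans.
  exact: (nsq_bnd el w).
have A2 : nrm (poly_op (p n) T (basis_vec w') w - poly_op (pol n) T (basis_vec w') w) <= e / 2.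
  have hs x : spectrum T x%:C -> `|(p n - pol n).[x]| <= e / 2.
    move=> sx; have := h1 _ sx; have := pol_approx n (spectrum_le sx).
    rewrite hornerD hornerN => q1 q2.
    have := ler_normB ((p n).[x] - f x) ((pol n).[x] - f x).
    rewrite (_ : (p n).[x] - f x - _ = (p n).[x] - (pol n).[x]); last by ring.
    by move=> q3; lra.
  have e2 : 0 <= e / 2 by lra.
  have := spectral_bound e2 hs e1; rewrite n1 mulr1 => q.
  have el := cop_ell2 (rc (p n - pol n)) e1.
  have q2 := nsq_bnd el w.
  rewrite !poly_opE (_ : _ - _ = cop (rc (p n - pol n)) (basis_vec w') w); last first.
    by rewrite rmorphB copD -[- rc (pol n)]scaleN1r copZ mulN1r.
  apply: (le_trans q2); rewrite -[leRHS]ger0_norm// -sqrtr_sqr.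
  exact: ler_wsqrtr.
have A3 : nrm (poly_op (pol n) T (basis_vec w') w - fker b K w w') <= e / 4.
  rewrite nrmBC /fker.
  have /(congr1 (fun g => g w)) /= -> := fop_pol n e1.
  apply: nrm_csum_le.
  apply: (le_trans (fop_asum w KC (ltW C0) (basis_bnd w') ler01 (btail_bsm n bC))).
  by rewrite mulr1 lee_fin ltW.
rewrite /op_entry (_ : S _ _ - _ = (S (basis_vec w') w - poly_op (p n) T (basis_vec w') w) +
  ((poly_op (p n) T (basis_vec w') w - poly_op (pol n) T (basis_vec w') w) +
   (poly_op (pol n) T (basis_vec w') w - fker b K w w'))); last by ring.
apply: (le_trans (nrmD _ _)).
have := nrmD (poly_op (p n) T (basis_vec w') w - poly_op (pol n) T (basis_vec w') w)
   (poly_op (pol n) T (basis_vec w') w - fker b K w w').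
lra.
Unshelve. all: by end_near. Qed.

End PowerSeries.

End FunctionalCalculus.

(** [real_hamiltonian] is identified with a kernel operator on [ell2] only. This is enough, because
    resolvents and operator norms, hence the functional calculus, see an operator only through
    [ell2]. *)
Lemma fcalc_ext {R : realType} {I : choiceType} (T T' : (I -> R[i]) -> I -> R[i]) (f : R -> R) :
  (forall psi, ell2 psi -> ell2 (T psi)) ->
  (forall psi, ell2 psi -> T' psi = T psi) -> fcalc T' f = fcalc T f.
Proof.
move=> Te TE.
have itE n psi : ell2 psi -> ell2 (iter n T psi) /\ iter n T' psi = iter n T psi.
  move=> p; elim: n => [//|n [IH1 IH2]] /=; rewrite IH2; split; first exact: Te.
  exact: TE.
have pE (p : {poly R}) psi : ell2 psi -> poly_op p T' psi = poly_op p T psi.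
  move=> h; apply/funext => i; apply: eq_bigr => k _.
  by have [_ ->] := itE k _ h.
have rE z : in_resolvent T' z <-> in_resolvent T z.
  split => -[S Sb SE]; exists S => // psi p; have [h1 h2] := SE _ p.
    have [c _ Sl] := bounded_op_nsq Sb.
    by rewrite -(TE _ p) -(TE (S psi))//; case: (Sl _ p).
  have [c _ Sl] := bounded_op_nsq Sb.
  by rewrite (TE _ p) (TE (S psi))//; case: (Sl _ p).
have sE : spectrum T' = spectrum T.
  by apply/seteqP; split => z /= h1 h2; apply: h1; apply/rE.
have opE S p : (fun n : nat => opnorm (fun psi i => S psi i - poly_op (p n) T' psi i)) =
    (fun n => opnorm (fun psi i => S psi i - poly_op (p n) T psi i)).
  apply/funext => n; congr ereal_sup; apply: eq_imagel => psi /= p1; rewrite pE//.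
  by rewrite /ell2 (le_lt_trans p1)// ltry.
rewrite /fcalc; congr xget; apply/seteqP; split => S /= [Sb [p [pf pS]]]; split => //;
  exists p; split.
- by move: pf; rewrite sE.
- by move: pS; rewrite opE.
- by move: pf; rewrite sE.
- by move: pS; rewrite -opE.
Qed.

(** * The power series of the Gaussian *)

Section Entire.
Context {R : realType}.

Lemma exp_rsum (y : R) : rsm (fun k => y ^+ k / k`!%:R) /\
  expR y = rsum (fun k => y ^+ k / k`!%:R).
Proof.
have cv (z : R) : (fun n => \sum_(k < n) z ^+ k / k`!%:R) @ \oo --> expR z.
  have := @is_cvg_series_exp_coeff R z.
  rewrite /expR /exp_coeff => /cvg_ex[l hl].
  rewrite (cvg_lim _ hl)//.
  rewrite (_ : (fun n => _) = [series z ^+ n / n`!%:R]_n)//.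
  by apply/funext => n; rewrite /series /= big_mkord.
have s : rsm (fun k => y ^+ k / k`!%:R).
  rewrite /rsm; apply: (@le_lt_trans _ _ (expR `|y|)%:E); last exact: ltry.
  under eq_esum do rewrite normrM normrX normfV normr_nat.
  apply: esum_nat_le => [k|n]; first by rewrite divr_ge0 ?exprn_ge0.
  rewrite -[expR _](cvg_lim _ (cv `|y|))//.
  apply: (@nondecreasing_cvgn_le _ (fun n => \sum_(k < n) `|y| ^+ k / k`!%:R)).
    apply/nondecreasing_seqP => m; rewrite big_ord_recr /= lerDl divr_ge0 ?exprn_ge0//.
  by apply/cvg_ex; exists (expR `|y|); exact: cv.
split => //.
have h1 : clim \oo (fun n => \sum_(k < n) (y ^+ k / k`!%:R)%:C) (rsum (fun k => y ^+ k / k`!%:R))%:C.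
  rewrite -csum_real; apply: csum_nat.
  exact: summ_real.
have h2 : clim \oo (fun n => \sum_(k < n) (y ^+ k / k`!%:R)%:C) (expR y)%:C.
  apply: (@clim_squeeze _ _ \oo _ _ _ (fun n => `|\sum_(k < n) y ^+ k / k`!%:R - expR y|)).
    by apply: nearW => n; rewrite -rmorph_sum -rmorphB nrm_real.
  by apply/norm_cvg0P; apply/subr_cvg0; exact: cv.
exact: complexI (clim_unique _ h2 h1).
Qed.

Definition entire (f : R -> R) := exists2 b : nat -> R,
  (forall D, 0 <= D -> bsm b D) & forall x, f x = rsum (fun k => b k * x ^+ k).

(** Collects the monomials a_j x^(d j) by degree, several j being allowed to share one. Absolute
    convergence at every radius justifies the regrouping. *)
Lemma entire_family (J : choiceType) (a : J -> R) (d : J -> nat) (f : R -> R) :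
  (forall D, 0 <= D -> rsm (fun j => a j * D ^+ d j)) ->
  (forall x, f x = rsum (fun j => a j * x ^+ d j)) -> entire f.
Proof.
move=> as_ fE.
pose t j k : R := if d j == k then a j else 0.
have tot (D : R) : 0 <= D -> (\esum_(k in [set: nat]) asum (fun j => (t j k * D ^+ k)%:C) < +oo)%E.
  move=> D0; apply: le_lt_trans (as_ D D0); rewrite asum_swap; apply: le_esum => j _.
  rewrite (@asum_one _ _ _ (d j)) /t ?eqxx ?nrm_real//.
  by move=> k; rewrite eq_sym => /negbTE ->; rewrite mul0r.
have ts k : summ (fun j => (t j k)%:C).
  have := le_lt_trans (asum_inner_le _ k) (tot 1 ler01).
  by congr (_ < _)%E; congr asum; apply/funext => j; rewrite expr1n mulr1.
have bE k D : (rsum (fun j => t j k) * D ^+ k)%:C = csum (fun j => (t j k * D ^+ k)%:C).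
  rewrite mulrC rcM -csum_real -csumZ//; congr csum; apply/funext => j.
  by rewrite -rcM mulrC.
exists (fun k => rsum (fun j => t j k)).
  move=> D D0; rewrite /bsm; apply: le_lt_trans (tot D D0); apply: le_esum => k _.
  rewrite normrM normr_id -normrM -nrm_real bE.
  by apply: nrm_csum; apply: le_lt_trans (tot D D0); exact: asum_inner_le.
move=> x; apply: complexI; rewrite fE -!csum_real.
transitivity (csum (fun j => csum (fun k => (t j k * x ^+ k)%:C))).
  congr csum; apply/funext => j; rewrite (@csum_one _ _ _ (d j)) /t ?eqxx//.
  by move=> k; rewrite eq_sym => /negbTE ->; rewrite mul0r.
rewrite csum_swap; first by congr csum; apply/funext => k; rewrite bE.
rewrite asum_swap; have := tot `|x| (normr_ge0 _); apply: le_lt_trans.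
apply: le_esum => k _; apply: asum_le => j.
by rewrite !nrm_real !normrM !normrX normr_id.
Qed.

Lemma gauss_entire (eps E : R) : 0 < eps -> entire (fun x => gauss eps (E - x)).
Proof.
move=> e0.
(* Expanding (E - x)^2 splits the Gaussian into a constant times exp (al x) exp (be x^2), a product
   of two exponential series indexed by pairs of naturals. *)
pose c0 := (eps * Num.sqrt (2 * pi))^-1 * expR (- (E ^+ 2 / (2 * eps ^+ 2))).
pose al := E / eps ^+ 2; pose be := - (1 / (2 * eps ^+ 2)).
have gE x : gauss eps (E - x) = c0 * (expR (al * x) * expR (be * x ^+ 2)).
  rewrite /gauss /c0 -mulrA -!expRD; congr (_ * expR _).
  rewrite /al /be; field; lra.
pose a (p : nat * nat) : R := c0 * (al ^+ p.1 / p.1`!%:R * (be ^+ p.2 / p.2`!%:R)).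
pose d (p : nat * nat) := (p.1 + 2 * p.2)%N.
have aE x p : a p * x ^+ d p =
    c0 * ((al * x) ^+ p.1 / p.1`!%:R * ((be * x ^+ 2) ^+ p.2 / p.2`!%:R)).
  rewrite /a /d exprD exprM !exprMn; ring.
have sp (u v : R) : rsm (fun p : nat * nat => c0 * (u ^+ p.1 / p.1`!%:R * (v ^+ p.2 / p.2`!%:R))).
  apply: rsmZ.
  have [su _] := exp_rsum `|u|; have [sv _] := exp_rsum `|v|.
  have u0 k : 0 <= `|u| ^+ k / k`!%:R by rewrite divr_ge0 ?exprn_ge0.
  have v0 k : 0 <= `|v| ^+ k / k`!%:R by rewrite divr_ge0 ?exprn_ge0.
  apply: (@rsm_le _ _ _ (fun p => `|u| ^+ p.1 / p.1`!%:R * (`|v| ^+ p.2 / p.2`!%:R))).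
    by move=> p; rewrite !normrM !normrX !normfV !normr_nat.
  rewrite -(@esum_pair _ _ _ (fun i j => `|u| ^+ i / i`!%:R * (`|v| ^+ j / j`!%:R))); last first.
    by move=> i j; rewrite mulr_ge0.
  rewrite (@eq_esum _ _ _ _ (fun i => (rsum (fun k => `|v| ^+ k / k`!%:R) * (`|u| ^+ i / i`!%:R))%:E)).
    rewrite esumZl//; last exact: rsum_ge0.
    by rewrite rsumE// ltry.
  by move=> i _; rewrite esumZl// rsumE// -EFinM mulrC.
apply: (@entire_family _ a d).
  by move=> D _; under eq_fun do rewrite aE; exact: sp.
move=> x; transitivity (rsum (fun p : nat * nat =>
    c0 * ((al * x) ^+ p.1 / p.1`!%:R * ((be * x ^+ 2) ^+ p.2 / p.2`!%:R)))); last first.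
  by congr rsum; apply/funext => p; rewrite aE.
have [s1 E1] := exp_rsum (al * x); have [s2 E2] := exp_rsum (be * x ^+ 2).
rewrite (proj2 (rsum_pair (sp _ _))) gE /= E1 E2.
rewrite mulrCA mulrC -rsumZ.
  congr rsum; apply/funext => i; rewrite rsumZ; last exact: rsmZ.
  rewrite rsumZ//; ring.
exact: s1.
Qed.

End Entire.

(** * Integration over the plane *)

Section AffineChange.
Context {R : realType}.

Local Notation lam := (@lebesgue_measure R).
Local Notation lam2 := (@lebesgue_measure R \x @lebesgue_measure R)%E.

Lemma measurable_affine (a b : R) :
  measurable_fun setT (fun x : measurableTypeR R => a * x + b : measurableTypeR R).
Proof.
apply: (@continuous_measurable_fun R (fun x => a * x + b)) => x.
by apply: cvgD; [apply: cvgM; [exact: cvg_cst|exact: cvg_id]|exact: cvg_cst].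
Qed.

(** The scaled push-forward agrees with Lebesgue measure on half-open intervals, which characterises
    the latter. For negative a the preimage is half-open on the other side, with the same length. *)
Lemma lebesgue_affine (a b : R) (A : set (measurableTypeR R)) : a != 0 -> measurable A ->
  lam A = (`|a|%:E * lam ((fun x : measurableTypeR R => (a * x + b)%R : measurableTypeR R) @^-1` A))%E.
Proof.
move=> a0 mA.
have ap : 0 < `|a| by rewrite normr_gt0.
pose phi := fun x : measurableTypeR R => a * x + b : measurableTypeR R.
have mphi : measurable_fun setT phi by exact: measurable_affine.
pose mu : {measure set (measurableTypeR R) -> \bar R} :=
  mscale (NngNum (normr_ge0 a)) (pushforward lam phi).
apply: (@lebesgue_measure_unique R (mu mphi) _ A mA).
move=> _ [[c d]] _ <-.
rewrite [RHS](_ : _ = (`|a|%:E * lam (phi @^-1` `]c, d]%classic))%E)//.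
rewrite [LHS]lebesgue_measure_itv /=.
have [a0'|a0'] : 0 < a \/ a < 0 by move: a0; rewrite neq_lt => /orP[]; [right|left].
  have -> : phi @^-1` `]c, d]%classic = `](c - b) / a, (d - b) / a]%classic.
    apply/seteqP; split => x /=; rewrite !in_itv /= /phi ltr_pdivrMr// ler_pdivlMr// ![x * a]mulrC => /andP[]; rewrite ?ltrBlDr ?lerBrDr => -> ->//.
  rewrite lebesgue_measure_itv /= !lte_fin ltr_pM2r ?invr_gt0// ltrD2r.
  case: ifP => _; last by rewrite mule0.
  rewrite -!EFinB -EFinM gtr0_norm//; congr _%:E.
  by rewrite -mulrBl opprB addrA subrK mulrC divfK.
have -> : phi @^-1` `]c, d]%classic = `[(d - b) / a, (c - b) / a[%classic.
  apply/seteqP; split => x /=; rewrite !in_itv /= /phi ltr_ndivlMr// ler_ndivrMr// ![x * a]mulrC => /andP[]; rewrite ?ltrBrDr ?lerBlDr ?ltrBlDr ?lerBrDr => -> ->//.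
rewrite lebesgue_measure_itv /= !lte_fin ltr_nM2r ?invr_lt0// ltrD2r.
case: ifP => _; last by rewrite mule0.
rewrite -!EFinB -EFinM ltr0_norm//; congr _%:E.
by rewrite -mulrBl opprB addrA subrK mulNr mulrC divfK ?opprB.
Qed.

Lemma integral_affine (a b : R) (f : R -> \bar R) : a != 0 ->
  measurable_fun setT f -> (forall x, 0 <= f x)%E ->
  (\int[lam]_x f (a * x + b)%R = (`|a|^-1)%:E * \int[lam]_x f x)%E.
Proof.
move=> a0 mf f0.
have ap : 0 < `|a| by rewrite normr_gt0.
pose phi := fun x : measurableTypeR R => a * x + b : measurableTypeR R.
have mphi : measurable_fun setT phi by exact: measurable_affine.
pose mu : {measure set (measurableTypeR R) -> \bar R} := pushforward lam phi.
have E : (\int[lam]_x f x = (`|a|%:E * \int[lam]_x f (phi x)))%E.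
  rewrite (@eq_measure_integral _ _ _ setT (mscale (NngNum (normr_ge0 a)) (mu mphi))); last first.
    by move=> A mA _; exact: (lebesgue_affine b a0 mA).
  rewrite ge0_integral_mscale//.
  by rewrite (@ge0_integral_pushforward _ _ _ _ _ phi mphi lam setT f).
by rewrite E muleA -EFinM mulVf ?mul1e// gt_eqF.
Qed.

Lemma measurable_lin2 (p q c : R) :
  measurable_fun setT (fun z : measurableTypeR R * measurableTypeR R => p * z.1 + q * z.2 + c : R).
Proof.
apply: measurable_funD; last exact: measurable_cst.
by apply: measurable_funD; apply: measurable_funM => //; exact: measurable_cst.
Qed.

Let aff (p q r s b1 b2 : R) (z : measurableTypeR R * measurableTypeR R) :
    measurableTypeR R * measurableTypeR R :=
  (p * z.1 + q * z.2 + b1, r * z.1 + s * z.2 + b2).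

Lemma measurable_aff (p q r s b1 b2 : R) : measurable_fun setT (aff p q r s b1 b2).
Proof. by apply: measurable_fun_pair; exact: measurable_lin2. Qed.

Lemma integral_aff2_aux (p q r s b1 b2 : R) (f : measurableTypeR R * measurableTypeR R -> \bar R) :
  p != 0 -> p * s - q * r != 0 -> measurable_fun setT f -> (forall x, 0 <= f x)%E ->
  (\int[lam2]_z f (aff p q r s b1 b2 z) = (`|p * s - q * r|^-1)%:E * \int[lam2]_z f z)%E.
Proof.
move=> p0 D0 mf f0.
have mg : measurable_fun setT (f \o aff p q r s b1 b2).
  by apply: measurableT_comp => //; exact: measurable_aff.
rewrite (@fubini_tonelli2 _ _ _ _ _ lam lam _ mg); last by move=> z; exact: f0.
rewrite (@fubini_tonelli2 _ _ _ _ _ lam lam _ mf)//.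
rewrite /fubini_G.
pose D := p * s - q * r.
(* substitute u = p x + q y + b1 for fixed y, then exchange the integrals *)
pose g (u y : R) := f (u, D / p * y + (r / p * (u - b1) + b2)).
have mg2 : measurable_fun setT (fun z : measurableTypeR R * measurableTypeR R => g z.1 z.2).
  apply: measurableT_comp => //; apply: measurable_fun_pair => //.
  rewrite (_ : (fun z => _) = fun z : measurableTypeR R * measurableTypeR R => r / p * z.1 + D / p * z.2 + (b2 - r / p * b1)).
    exact: measurable_lin2.
  by apply/funext => z; ring.
have E1 y : (\int[lam]_x f (aff p q r s b1 b2 (x, y)) = (`|p|^-1)%:E * \int[lam]_u g u y)%E.
  rewrite -(integral_affine (q * y + b1) p0 (f := g ^~ y))//; last first.
    by move=> x; exact: f0.
    exact: (measurableT_comp mg2 (measurable_pair2 y)).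
  apply: eq_integral => x _; rewrite /g /aff /=; congr (f (_, _)); first by ring.
  by rewrite /D; field.
under eq_integral do rewrite E1.
rewrite ge0_integralZl//; last 2 first.
- exact: (@measurable_fun_fubini_tonelli_G _ _ _ _ _ lam _ mg2 (fun z => f0 _)).
- by move=> y _; apply: integral_ge0 => x _; exact: f0.
rewrite -(@fubini_tonelli2 _ _ _ _ _ lam lam _ mg2); last by move=> z; exact: f0.
rewrite (@fubini_tonelli1 _ _ _ _ _ lam lam _ mg2); last by move=> z; exact: f0.
rewrite /fubini_F.
have Dp : D / p != 0 by rewrite mulf_neq0 ?invr_neq0.
have E2 u : (\int[lam]_y g u y = (`|D / p|^-1)%:E * \int[lam]_y f (u, y))%E.
  rewrite -(integral_affine (r / p * (u - b1) + b2) Dp (f := fun y => f (u, y)))//.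
  exact: (measurableT_comp mf (measurable_pair1 u)).
under eq_integral do rewrite E2.
rewrite ge0_integralZl//; last 2 first.
- exact: (@measurable_fun_fubini_tonelli_F _ _ _ _ _ lam _ mf f0).
- by move=> y _; apply: integral_ge0 => x _; exact: f0.
rewrite muleA -EFinM -(@fubini_tonelli1 _ _ _ _ _ lam lam _ mf)// (@fubini_tonelli2 _ _ _ _ _ lam lam _ mf)//.
congr (_%:E * _)%E; rewrite -invfM -normrM -/D; congr (`|_|^-1).
by rewrite mulrC divfK.
Qed.

Lemma integral_swap2 (f : measurableTypeR R * measurableTypeR R -> \bar R) :
  measurable_fun setT f -> (forall x, 0 <= f x)%E ->
  (\int[lam2]_z f (z.2, z.1) = \int[lam2]_z f z)%E.
Proof.
move=> mf f0.
have mg : measurable_fun setT (fun z : measurableTypeR R * measurableTypeR R => f (z.2, z.1)).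
  by apply: measurableT_comp => //; exact: measurable_swap.
rewrite (@fubini_tonelli1 _ _ _ _ _ lam lam _ mg)// (@fubini_tonelli2 _ _ _ _ _ lam lam _ mf)//.
Qed.

(** If p = 0 the determinant forces q to be nonzero, and exchanging the coordinates leads back to
    [integral_aff2_aux] with the determinant negated. *)
Lemma integral_aff2 (p q r s b1 b2 : R) (f : measurableTypeR R * measurableTypeR R -> \bar R) :
  p * s - q * r != 0 -> measurable_fun setT f -> (forall x, 0 <= f x)%E ->
  (\int[lam2]_z f (aff p q r s b1 b2 z) = (`|p * s - q * r|^-1)%:E * \int[lam2]_z f z)%E.
Proof.
move=> D0 mf f0; have [p0|p0] := eqVneq p 0; last exact: integral_aff2_aux.
have q0 : q != 0 by apply: contraNneq D0 => ->; rewrite p0 !mul0r subrr.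
have mg : measurable_fun setT (f \o aff p q r s b1 b2).
  by apply: measurableT_comp => //; exact: measurable_aff.
rewrite -(integral_swap2 mg)//.
rewrite (_ : (fun z => _) = fun z => f (aff q p s r b1 b2 z)); last first.
  by apply/funext => z; rewrite /= /aff /=; congr (f (_, _)); ring.
rewrite integral_aff2_aux//; last by rewrite -opprB oppr_eq0.
congr ((_)%:E * _)%E; rewrite distrC; congr (`|_|^-1); ring.
by move=> z; exact: f0.
Qed.

End AffineChange.

Section PlaneIntegral.
Context {R : realType}.

Local Notation T2 := (measurableTypeR R * measurableTypeR R)%type.
Local Notation lam := (@lebesgue_measure R).
Local Notation lam2 := (@lebesgue_measure R \x @lebesgue_measure R)%E.
Local Notation plane := 'cV[R]_2.
Implicit Types (f g : plane -> R[i]).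

Definition rmeas (u : T2 -> R) := measurable_fun setT u.
Definition rint (u : T2 -> R) := lam2.-integrable setT (EFin \o u).
Definition cmeas g := rmeas (fun z => complex.Re (g (vec z))) /\
                      rmeas (fun z => complex.Im (g (vec z))).
Definition cint g := rint (fun z => complex.Re (g (vec z))) /\
                     rint (fun z => complex.Im (g (vec z))).
Definition cI g : R[i] := cintegral2 setT g.

Lemma cIE g : cI g = (\int[lam2]_z complex.Re (g (vec z)))%R
                  +i* (\int[lam2]_z complex.Im (g (vec z)))%R.
Proof. by rewrite /cI /cintegral2 preimage_setT. Qed.

Lemma rint_le (u w : T2 -> R) : rmeas u -> rint w -> (forall z, `|u z| <= w z) -> rint u.
Proof.
move=> mu iw uw; apply: le_integrable iw => //; first exact/measurable_EFinP.
by move=> z; rewrite lee_fin (le_trans (uw z))// ler_norm.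
Qed.

Lemma rint_meas (u : T2 -> R) : rint u -> rmeas u.
Proof. by move=> /measurable_int/measurable_EFinP. Qed.

Lemma cint_le f (w : T2 -> R) : cmeas f -> rint w -> (forall z, nrm (f (vec z)) <= w z) -> cint f.
Proof.
move=> [m1 m2] iw fw; split.
  by apply: rint_le iw _ => // z; rewrite (le_trans (Re_le_nrm _)).
by apply: rint_le iw _ => // z; rewrite (le_trans (Im_le_nrm _)).
Qed.

Lemma cint_meas f : cint f -> cmeas f.
Proof. by move=> [h1 h2]; split; exact: rint_meas. Qed.

Lemma cmeas_cst c : cmeas (fun=> c).
Proof. by split; exact: measurable_cst. Qed.

Lemma cmeasD f g : cmeas f -> cmeas g -> cmeas (fun x => f x + g x).
Proof.
move=> [f1 f2] [g1 g2]; split; rewrite /rmeas.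
  by under eq_fun do rewrite cReD; exact: measurable_funD.
by under eq_fun do rewrite cImD; exact: measurable_funD.
Qed.

Lemma cmeasM f g : cmeas f -> cmeas g -> cmeas (fun x => f x * g x).
Proof.
move=> [f1 f2] [g1 g2]; split; rewrite /rmeas.
  under eq_fun do rewrite cReM.
  by apply: measurable_funB; exact: measurable_funM.
under eq_fun do rewrite cImM.
by apply: measurable_funD; exact: measurable_funM.
Qed.

Lemma cmeas_sum (J : Type) (s : seq J) (F : J -> plane -> R[i]) :
  (forall j, cmeas (F j)) -> cmeas (fun x => \sum_(j <- s) F j x).
Proof.
move=> Fm; elim: s => [|j s IH].
  rewrite (_ : (fun x => _) = fun=> 0); first exact: cmeas_cst.
  by apply/funext => x; rewrite big_nil.
rewrite (_ : (fun x => _) = fun x => F j x + \sum_(j <- s) F j x); first exact: cmeasD.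
by apply/funext => x; rewrite big_cons.
Qed.

Lemma cI_D f g : cint f -> cint g -> cI (fun x => f x + g x) = cI f + cI g.
Proof.
move=> [f1 f2] [g1 g2]; rewrite !cIE; apply: complex_eq => /=.
  by rewrite -RintegralD//; apply: eq_Rintegral => z _; rewrite cReD.
by rewrite -RintegralD//; apply: eq_Rintegral => z _; rewrite cImD.
Qed.

Lemma cintD f g : cint f -> cint g -> cint (fun x => f x + g x).
Proof.
move=> [f1 f2] [g1 g2]; split; rewrite /rint.
  rewrite (_ : _ \o _ = ((EFin \o (fun z => complex.Re (f (vec z)))) \+
     (EFin \o (fun z => complex.Re (g (vec z)))))%E); first exact: integrableD.
  by apply/funext => z /=; rewrite cReD EFinD.
rewrite (_ : _ \o _ = ((EFin \o (fun z => complex.Im (f (vec z)))) \+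
     (EFin \o (fun z => complex.Im (g (vec z)))))%E); first exact: integrableD.
by apply/funext => z /=; rewrite cImD EFinD.
Qed.

Lemma rintZ c (u : T2 -> R) : rint u -> rint (fun z => c * u z).
Proof. by move=> ui; exact: (integrableZl measurableT c ui). Qed.

Lemma rintB (u w : T2 -> R) : rint u -> rint w -> rint (fun z => u z - w z).
Proof. by move=> ui wi; exact: (integrableB measurableT ui wi). Qed.

Lemma rintD (u w : T2 -> R) : rint u -> rint w -> rint (fun z => u z + w z).
Proof. by move=> ui wi; exact: (integrableD measurableT ui wi). Qed.

Lemma cI_Z c f : cint f -> cint (fun x => c * f x) /\ cI (fun x => c * f x) = c * cI f.
Proof.
move=> [f1 f2]; split.
  split; rewrite /rint.
    rewrite (_ : (fun z => _) = (fun z => complex.Re c * complex.Re (f (vec z)) - complex.Im c * complex.Im (f (vec z)))).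
      by apply: rintB; exact: rintZ.
    by apply/funext => z; rewrite cReM.
  rewrite (_ : (fun z => _) = (fun z => complex.Re c * complex.Im (f (vec z)) + complex.Im c * complex.Re (f (vec z)))).
    by apply: rintD; exact: rintZ.
  by apply/funext => z; rewrite cImM.
rewrite !cIE; apply: complex_eq; rewrite ?cReM ?cImM /= -!RintegralZl//.
  rewrite -RintegralB//; [|exact: rintZ..].
  by apply: eq_Rintegral => z _; rewrite cReM.
rewrite -RintegralD//; [|exact: rintZ..].
by apply: eq_Rintegral => z _; rewrite cImM.
Qed.

Lemma cint0 : cint (fun=> 0).
Proof. by split; exact: integrable0. Qed.

Lemma cI0 : cI (fun=> 0) = 0.
Proof.
rewrite cIE; apply: complex_eq => /=; by rewrite /Rintegral integral0.
Qed.

Lemma cI_sum (J : Type) (s : seq J) (F : J -> plane -> R[i]) :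
  (forall j, cint (F j)) -> cint (fun x => \sum_(j <- s) F j x) /\
  cI (fun x => \sum_(j <- s) F j x) = \sum_(j <- s) cI (F j).
Proof.
move=> Fi; elim: s => [|j s [IH1 IH2]].
  rewrite (_ : (fun x => _) = fun=> 0); last by apply/funext => x; rewrite big_nil.
  by rewrite big_nil; split; [exact: cint0|exact: cI0].
rewrite (_ : (fun x => _) = fun x => F j x + \sum_(j <- s) F j x).
  by rewrite big_cons -IH2 cI_D//; split => //; exact: cintD.
by apply/funext => x; rewrite big_cons.
Qed.

Lemma rI_dct (u : nat -> T2 -> R) (l w : T2 -> R) :
  (forall n, rmeas (u n)) -> rint w -> (forall n z, `|u n z| <= w z) ->
  (forall z, u ^~ z @ \oo --> l z) ->
  rint l /\ (fun n => \int[lam2]_z u n z)%R @ \oo --> (\int[lam2]_z l z)%R.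
Proof.
move=> mu iw uw ul.
have ml : rmeas l by exact: (measurable_fun_cvg mu (fun z _ => ul z)).
have mun n : measurable_fun setT (EFin \o u n) by apply/measurable_EFinP; exact: mu.
have mel : measurable_fun setT (EFin \o l) by exact/measurable_EFinP.
have ae1 : {ae lam2, forall z : T2, setT z -> (fun n => (EFin \o u n) z) @ \oo --> (EFin \o l) z}.
  by apply: aeW => z _; apply: cvg_EFin; [exact: nearW|exact: ul].
have ae2 : {ae lam2, forall (z : T2) (n : nat), setT z -> (`|(EFin \o u n) z| <= (EFin \o w) z)%E}.
  by apply: aeW => z n _; rewrite /= lee_fin.
have [h1 _ h2] := dominated_convergence measurableT mun mel ae1 iw ae2.
split => //.
rewrite /Rintegral; apply: fine_cvg.
by rewrite fineK//; apply: integrable_fin_num.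
Qed.

(** The limit is not assumed measurable; it inherits this from the sequence. This is how the
    diagonal entries become integrable functions of q. *)
Lemma cI_dct (F : nat -> plane -> R[i]) (l : plane -> R[i]) (w : T2 -> R) :
  (forall n, cmeas (F n)) -> rint w -> (forall n z, nrm (F n (vec z)) <= w z) ->
  (forall x, clim \oo (F ^~ x) (l x)) ->
  cint l /\ clim \oo (fun n => cI (F n)) (cI l).
Proof.
move=> mF iw Fw Fl.
have [h1 h2] := @rI_dct (fun n z => complex.Re (F n (vec z))) (fun z => complex.Re (l (vec z))) w
  (fun n => (mF n).1) iw (fun n z => le_trans (Re_le_nrm _) (Fw n z))
  (fun z => (proj1 (clim_ReIm _ _) (Fl (vec z))).1).
have [h3 h4] := @rI_dct (fun n z => complex.Im (F n (vec z))) (fun z => complex.Im (l (vec z))) w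
  (fun n => (mF n).2) iw (fun n z => le_trans (Im_le_nrm _) (Fw n z))
  (fun z => (proj1 (clim_ReIm _ _) (Fl (vec z))).2).
split; first by split.
apply/clim_ReIm; split.
  rewrite [cI l]cIE /= (_ : (fun n => complex.Re (cI (F n))) =
    (fun n => \int[lam2]_z complex.Re (F n (vec z)))%R)//.
rewrite [cI l]cIE /= (_ : (fun n => complex.Im (cI (F n))) =
  (fun n => \int[lam2]_z complex.Im (F n (vec z)))%R)//.
Qed.

Lemma cmeas_clim (F : nat -> plane -> R[i]) (l : plane -> R[i]) :
  (forall n, cmeas (F n)) -> (forall x, clim \oo (F ^~ x) (l x)) -> cmeas l.
Proof.
move=> mF Fl; split.
  apply: (@measurable_fun_cvg _ _ _ setT (fun n z => complex.Re (F n (vec z)))).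
    by move=> n; exact: (mF n).1.
  by move=> z _; exact: (proj1 (clim_ReIm _ _) (Fl (vec z))).1.
apply: (@measurable_fun_cvg _ _ _ setT (fun n z => complex.Im (F n (vec z)))).
  by move=> n; exact: (mF n).2.
by move=> z _; exact: (proj1 (clim_ReIm _ _) (Fl (vec z))).2.
Qed.

Definition affm (M : 'M[R]_2) (b : plane) (z : T2) : T2 :=
  (M 0 0 * z.1 + M 0 1 * z.2 + b 0 0, M 1 0 * z.1 + M 1 1 * z.2 + b 1 0).

Lemma ord2 (i : 'I_2) : i = 0 \/ i = 1.
Proof. by case: i => -[|[|]] // h; [left|right]; apply/val_inj. Qed.

Lemma vec_affm M b z : vec (affm M b z) = M *m vec z + b.
Proof.
apply/matrixP => i j; rewrite !ord1 !mxE big_ord_recl big_ord1 !mxE /=.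
have -> : lift ord0 ord0 = 1 :> 'I_2 by apply/val_inj.
by case: (ord2 i) => ->.
Qed.

Lemma det22 (M : 'M[R]_2) : \det M = M 0 0 * M 1 1 - M 0 1 * M 1 0.
Proof.
rewrite (expand_det_row _ 0) !big_ord_recl big_ord0 addr0 /cofactor !det_mx11 !mxE /=.
have l1 : lift ord0 ord0 = 1 :> 'I_2 by apply/val_inj.
have l2 : lift 1 0 = 0 :> 'I_2 by apply/val_inj.
by rewrite l1 l2 /= expr0 mul1r expr1 mulN1r mulrN.
Qed.

Lemma rmeas_affm M b (u : T2 -> R) : rmeas u -> rmeas (fun z => u (affm M b z)).
Proof. by move=> mu; apply: measurableT_comp mu _; exact: measurable_aff. Qed.

Lemma integral_affm M b (u : T2 -> \bar R) : \det M != 0 ->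
  measurable_fun setT u -> (forall z, 0 <= u z)%E ->
  (\int[lam2]_z u (affm M b z) = (`|\det M|^-1)%:E * \int[lam2]_z u z)%E.
Proof.
rewrite det22 => D0 mu u0.
exact: (integral_aff2 (b 0 0) (b 1 0) D0 mu u0).
Qed.

Lemma rI_affm M b (u : T2 -> R) : \det M != 0 -> rint u ->
  rint (fun z => u (affm M b z)) /\
  (\int[lam2]_z u (affm M b z) = `|\det M|^-1 * \int[lam2]_z u z)%R.
Proof.
move=> D0 iu.
have mu := rint_meas iu.
have meu : measurable_fun setT (EFin \o u) by exact/measurable_EFinP.
have int : rint (fun z => u (affm M b z)).
  apply/integrableP; split; first by apply/measurable_EFinP; exact: rmeas_affm.
  have /integrableP[_ fin] := iu.
  rewrite (integral_affm b (u := fun z => `|(u z)%:E|%E) D0)//.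
    by apply: lte_mul_pinfty; rewrite ?lee_fin.
  exact: measurableT_comp.
split => //.
have E (v : T2 -> R) : (\int[lam2]_x (v x)%:E = \int[lam2]_x (fun z => (v z)%:E)^\+ x
   - \int[lam2]_x (fun z => (v z)%:E)^\- x)%E by exact: (integralE lam2 setT).
rewrite /Rintegral (E u) (E (fun z => u (affm M b z))).
have ip : (\int[lam2]_x (fun z => (u z)%:E)^\+ x)%E \is a fin_num.
  by apply: integrable_fin_num => //; exact: integrable_funepos.
have in_ : (\int[lam2]_x (fun z => (u z)%:E)^\- x)%E \is a fin_num.
  by apply: integrable_fin_num => //; exact: integrable_funeneg.
rewrite (_ : (\int[lam2]_x (fun z => (u (affm M b z))%:E)^\+ x)%E =
  ((`|\det M|^-1)%:E * \int[lam2]_x (fun z => (u z)%:E)^\+ x)%E); last first.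
  rewrite -(@integral_affm M b ((fun z => (u z)%:E)^\+)%E D0)//.
    by apply: eq_integral => z _; rewrite !funeposE.
  exact: measurable_funepos.
rewrite (_ : (\int[lam2]_x (fun z => (u (affm M b z))%:E)^\- x)%E =
  ((`|\det M|^-1)%:E * \int[lam2]_x (fun z => (u z)%:E)^\- x)%E); last first.
  rewrite -(@integral_affm M b ((fun z => (u z)%:E)^\-)%E D0)//.
    by apply: eq_integral => z _; rewrite !funenegE.
  exact: measurable_funeneg.
by rewrite -(fineK ip) -(fineK in_) -!EFinM -!EFinB /= mulrBr.
Qed.

Lemma cI_affine M b f : \det M != 0 -> cint f ->
  cint (fun x => f (M *m x + b)) /\
  cI (fun x => f (M *m x + b)) = (`|\det M|^-1)%:C * cI f.
Proof.
move=> D0 [f1 f2].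
have [i1 e1] := rI_affm b D0 f1; have [i2 e2] := rI_affm b D0 f2.
split.
  split.
    by move: i1; congr rint; apply/funext => z; rewrite vec_affm.
  by move: i2; congr rint; apply/funext => z; rewrite vec_affm.
rewrite !cIE; apply: complex_eq; rewrite ?cReM ?cImM /= mul0r ?subr0 ?addr0.
  by rewrite -e1; apply: eq_Rintegral => z _; rewrite vec_affm.
by rewrite -e2; apply: eq_Rintegral => z _; rewrite vec_affm.
Qed.

Lemma cmeas_affine M b f : cmeas f -> cmeas (fun x => f (M *m x + b)).
Proof.
move=> [f1 f2]; split.
  by have := rmeas_affm M b f1; congr rmeas; apply/funext => z; rewrite vec_affm.
by have := rmeas_affm M b f2; congr rmeas; apply/funext => z; rewrite vec_affm.
Qed.

End PlaneIntegral.

Section PlaneGeometry.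
Context {R : realType}.
Local Notation plane := 'cV[R]_2.
Implicit Types (u v w : plane).

Lemma dotE u v : dot u v = u 0 0 * v 0 0 + u 1 0 * v 1 0.
Proof.
rewrite /dot big_ord_recl big_ord1.
by rewrite (_ : lift ord0 ord0 = 1 :> 'I_2)//; apply/val_inj.
Qed.

Lemma dotDl u v w : dot (u + v) w = dot u w + dot v w.
Proof. by rewrite !dotE !mxE; ring. Qed.
Lemma dotDr u v w : dot u (v + w) = dot u v + dot u w.
Proof. by rewrite !dotE !mxE; ring. Qed.
Lemma dotNl u v : dot (- u) v = - dot u v.
Proof. by rewrite !dotE !mxE; ring. Qed.
Lemma dotNr u v : dot u (- v) = - dot u v.
Proof. by rewrite !dotE !mxE; ring. Qed.
Lemma dot0l v : dot 0 v = 0.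
Proof. by rewrite !dotE !mxE; ring. Qed.
Lemma dot0r v : dot v 0 = 0.
Proof. by rewrite !dotE !mxE; ring. Qed.

Lemma plane_eq u v : u 0 0 = v 0 0 -> u 1 0 = v 1 0 -> u = v.
Proof. by move=> h0 h1; apply/matrixP => i j; rewrite !ord1; case: (ord2 i) => ->. Qed.

Lemma mulmx2E (M : 'M[R]_2) u i : (M *m u) i 0 = M i 0 * u 0 0 + M i 1 * u 1 0.
Proof.
rewrite !mxE big_ord_recl big_ord1.
by rewrite (_ : lift ord0 ord0 = 1 :> 'I_2)//; apply/val_inj.
Qed.

Lemma norm2_ge0 u : 0 <= norm2 u.
Proof. exact: sqrtr_ge0. Qed.

Lemma dot_ge0 u : 0 <= dot u u.
Proof. by rewrite dotE -!expr2 addr_ge0 ?sqr_ge0. Qed.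

Lemma norm2_sqr u : norm2 u ^+ 2 = dot u u.
Proof. by rewrite sqr_sqrtr ?dot_ge0. Qed.

Lemma norm2N u : norm2 (- u) = norm2 u.
Proof. by rewrite /norm2 dotNl dotNr opprK. Qed.

Lemma coord_le_norm2 u i : `|u i 0| <= norm2 u.
Proof.
rewrite -sqrtr_sqr ler_wsqrtr// dotE -!expr2.
by case: (ord2 i) => ->; rewrite ?lerDl ?lerDr sqr_ge0.
Qed.

Lemma norm2_le_coord u : norm2 u <= `|u 0 0| + `|u 1 0|.
Proof.
rewrite -(@ler_pXn2r _ 2)// ?nnegrE ?norm2_ge0 ?addr_ge0//.
rewrite norm2_sqr dotE -!expr2 sqrrD !real_normK ?num_real//.
by rewrite addrAC lerDl mulrn_wge0// mulr_ge0.
Qed.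

Lemma norm2D u v : norm2 (u + v) <= norm2 u + norm2 v.
Proof.
rewrite -(@ler_pXn2r _ 2)// ?nnegrE ?addr_ge0 ?norm2_ge0//.
rewrite sqrrD !norm2_sqr.
have cs : dot u v <= norm2 u * norm2 v.
  rewrite -[leRHS]ger0_norm ?mulr_ge0 ?norm2_ge0//.
  apply: (le_trans (ler_norm _)); rewrite -ler_sqr ?nnegrE//.
  rewrite !real_normK ?num_real// exprMn !norm2_sqr !dotE.
  have := sqr_ge0 (u 0 0 * v 1 0 - u 1 0 * v 0 0); nra.
have -> : dot (u + v) (u + v) = dot u u + dot v v + 2 * dot u v.
  by rewrite !dotE !mxE; ring.
rewrite -mulr_natl; lra.
Qed.

Lemma norm2_rot t u : norm2 (rotmx t *m u) = norm2 u.
Proof.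
rewrite /norm2; congr Num.sqrt; rewrite !dotE !mulmx2E !mxE /=.
have := cos2Dsin2 t; set c := cos t; set s := sin t => h.
transitivity ((c ^+ 2 + s ^+ 2) * (u 0 0 * u 0 0 + u 1 0 * u 1 0)); first by ring.
by rewrite h mul1r.
Qed.

Lemma norm2_0 : norm2 (0 : plane) = 0.
Proof. by rewrite /norm2 dot0l sqrtr0. Qed.

Lemma coord_le_mul (M : 'M[R]_2) : \det M != 0 -> exists2 c : R, 0 < c &
  forall u i, c * `|u i 0| <= norm2 (M *m u).
Proof.
move=> D0.
pose k := 1 + `|invmx M 0 0| + `|invmx M 0 1| + `|invmx M 1 0| + `|invmx M 1 1|.
have k0 : 0 < k by rewrite !ltr_pwDl.
exists k^-1; first by rewrite invr_gt0.
move=> u i; rewrite ler_pdivrMl//.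
have Mu : M \in unitmx by rewrite unitmxE unitfE.
have -> : `|u i 0| = `|(invmx M *m (M *m u)) i 0| by rewrite mulKmx.
rewrite mulmx2E.
apply: (le_trans (ler_normD _ _)); rewrite !normrM.
have h0 := coord_le_norm2 (M *m u) 0; have h1 := coord_le_norm2 (M *m u) 1.
have n0 := norm2_ge0 (M *m u).
have q0 : `|invmx M i 0| * `|(M *m u) 0 0| <= `|invmx M i 0| * norm2 (M *m u) by rewrite ler_wpM2l.
have q1 : `|invmx M i 1| * `|(M *m u) 1 0| <= `|invmx M i 1| * norm2 (M *m u) by rewrite ler_wpM2l.
apply: (le_trans (lerD q0 q1)); rewrite -mulrDl ler_wpM2r//.
have a0 := normr_ge0 (invmx M 0 0); have a1 := normr_ge0 (invmx M 0 1).
have a2 := normr_ge0 (invmx M 1 0); have a3 := normr_ge0 (invmx M 1 1).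
by rewrite /k; case: (ord2 i) => ->; lra.
Qed.

End PlaneGeometry.

(** * Exponential sums over lattices, uniform in the shift *)

Section LatticeSums.
Context {R : realType}.
Local Notation plane := 'cV[R]_2.

Definition zv (n : Z2) : plane := map_mx intr n.

Lemma zvD m n : zv (m + n) = zv m + zv n.
Proof. by apply/matrixP => i j; rewrite !mxE rmorphD. Qed.
Lemma zvN n : zv (- n) = - zv n.
Proof. by apply/matrixP => i j; rewrite !mxE rmorphN. Qed.
Lemma zv0 : zv 0 = 0.
Proof. by apply/matrixP => i j; rewrite !mxE. Qed.

Definition zpair (p : int * int) : Z2 := \col_i (if i == 0 then p.1 else p.2).

Lemma zpair_bij : bijective zpair.
Proof.
exists (fun n : Z2 => (n 0 0, n 1 0)).
  by move=> [a b]; rewrite /zpair !mxE.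
move=> n; apply/matrixP => i j; rewrite !ord1 mxE.
by case: (ord2 i) => ->.
Qed.

Lemma esum_int_geo (g : R) : 0 < g ->
  (\esum_(k in [set: int]) (expR (- g * `|k%:~R|))%:E < +oo)%E.
Proof.
move=> g0.
have q1 : expR (- g) < 1 by rewrite expR_lt1 oppr_lt0.
have geo := rsm_geo (expR_ge0 (- g)) q1.
have geoE n : expR (- g) ^+ n = expR (- g * n%:R).
  by rewrite mulrC expRM_natl.
rewrite (esumID [set Posz n | n in [set: nat]]); last by move=> *; rewrite lee_fin expR_ge0.
rewrite !setTI.
have -> : ~` [set Posz n | n in [set: nat]] = [set Negz n | n in [set: nat]].
  by apply/seteqP; split => [[n h|n _]|_ [n _ <-] [m _]]//; case: h; exists n.
rewrite !esum_image//; last by move=> i j _ _ [].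
- apply: lte_add_pinfty.
    move: geo; rewrite /rsm; congr (_ < _)%E; apply: eq_esum => n _.
    by rewrite ger0_norm ?exprn_ge0 ?expR_ge0// geoE /= normr_nat.
  have := rsmZ (expR (- g)) geo; rewrite /rsm; congr (_ < _)%E; apply: eq_esum => n _.
  rewrite ger0_norm ?mulr_ge0 ?exprn_ge0 ?expR_ge0// -exprS geoE.
  by rewrite NegzE mulrNz normrN /= normr_nat.
- by move=> i j _ _ [].
Qed.

(** Uniform in s: reindexing by the integer part reduces to a shift in [0, 1), which costs at most
    the factor exp g. *)
Lemma lattice_sum1 (g : R) : 0 < g -> exists2 B : R, 0 <= B & forall s : R,
  (\esum_(k in [set: int]) (expR (- g * `|s + k%:~R|))%:E <= B%:E)%E.
Proof.
move=> g0; have fin := esum_int_geo g0.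
pose S := fine (\esum_(k in [set: int]) (expR (- g * `|k%:~R|))%:E).
have SE : (\esum_(k in [set: int]) (expR (- g * `|k%:~R|))%:E)%E = S%:E.
  by rewrite fineK// ge0_fin_numE// esum_EFin_ge0// => k; exact: expR_ge0.
have S0 : 0 <= S by rewrite fine_ge0// esum_EFin_ge0// => k; exact: expR_ge0.
exists (expR g * S); first by rewrite mulr_ge0 ?expR_ge0.
move=> s; rewrite EFinM -SE -esumZl ?expR_ge0//.
pose e (k : int) := k - Num.floor s.
rewrite (@reindex_esum R int int setT setT e); last first.
  split => // [x y _ _ /addIr//|y _]; exists (y + Num.floor s) => //; exact: addrK.
apply: le_esum => k _; rewrite lee_fin -expRD ler_expR /e rmorphB /=.
have := floor_le s; have := floorD1_gt s; rewrite rmorphD /= => h1 h2.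
have h3 : `|k%:~R| <= `|s + (k%:~R - (Num.floor s)%:~R)| + 1 :> R.
  rewrite -[X in X <= _](_ : `|(s + (k%:~R - (Num.floor s)%:~R)) - (s - (Num.floor s)%:~R)| = _); last first.
    by congr `|_|; ring.
  apply: (le_trans (ler_normB _ _)); rewrite lerD2l ger0_norm; lra.
nra.
Qed.

Lemma esum_Z2 (F : Z2 -> \bar R) :
  (\esum_(n in [set: Z2]) F n = \esum_(p in [set: (int * int)%type]) F (zpair p))%E.
Proof.
apply: reindex_esum; have [g gK Kg] := zpair_bij; split => //.
  by move=> x y _ _ /(can_inj gK).
by move=> y _; exists (g y).
Qed.

(** The norm dominates c / 2 times the sum of the coordinates of s + n in absolute value, so the sum
    is at most a product of two one-dimensional ones. Uniformity in xi is what turns decay into row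
    bounds. *)
Lemma lattice_sum (g : R) (M : 'M[R]_2) : 0 < g -> \det M != 0 ->
  exists2 B : R, 0 <= B & forall xi : plane,
  (\esum_(n in [set: Z2]) (expR (- g * norm2 (xi + M *m zv n)))%:E <= B%:E)%E.
Proof.
move=> g0 D0; have [c c0 hc] := coord_le_mul D0.
have gc0 : 0 < g * c / 2 by rewrite !mulr_gt0.
have [B B0 hB] := lattice_sum1 gc0.
exists (B * B); first exact: mulr_ge0.
move=> xi; rewrite esum_Z2.
pose s := invmx M *m xi.
have Mu : M \in unitmx by rewrite unitmxE unitfE.
pose F (a b : int) := expR (- (g * c / 2) * `|s 0 0 + a%:~R|) * expR (- (g * c / 2) * `|s 1 0 + b%:~R|).
apply: (@le_trans _ _ (\esum_(p in [set: (int * int)%type]) (F p.1 p.2)%:E)%E).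
  apply: le_esum => -[a b] _; rewrite lee_fin /F -expRD ler_expR.
  have -> : xi + M *m zv (zpair (a, b)) = M *m (s + zv (zpair (a, b))).
    by rewrite mulmxDr /s mulKVmx.
  have := hc (s + zv (zpair (a, b))) 0; have := hc (s + zv (zpair (a, b))) 1.
  rewrite !mxE /=; set N := norm2 _; set A0 := `|_|; set A1 := `|_| => h1 h2.
  have : g * (c * A0 + c * A1) <= g * (2 * N) by rewrite ler_pM2l//; lra.
  lra.
rewrite -(@esum_pair _ _ _ F); last by move=> a b; rewrite mulr_ge0 ?expR_ge0.
apply: (@le_trans _ _ (\esum_(a in [set: int]) (B * expR (- (g * c / 2) * `|s 0 0 + a%:~R|))%:E)%E).
  apply: le_esum => a _; rewrite esumZl ?expR_ge0//.
  by rewrite [B * _]mulrC [leRHS]EFinM lee_wpmul2l ?lee_fin ?expR_ge0.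
rewrite esumZl//.
by rewrite EFinM lee_wpmul2l ?lee_fin.
Qed.

Lemma lattice_rsm (g : R) (M : 'M[R]_2) xi : 0 < g -> \det M != 0 ->
  rsm (fun n : Z2 => expR (- g * norm2 (xi + M *m zv n))).
Proof.
move=> g0 D0; have [B _ hB] := lattice_sum g0 D0.
apply: rsm_ge0 => [n|]; first exact: expR_ge0.
by rewrite (le_lt_trans (hB xi))// ltry.
Qed.

End LatticeSums.

(** * Integrable majorants, the unit cell and measurability of continuous functions *)

Section UnitCell.
Context {R : realType}.
Local Notation T2 := (measurableTypeR R * measurableTypeR R)%type.
Local Notation lam := (@lebesgue_measure R).
Local Notation lam2 := (@lebesgue_measure R \x @lebesgue_measure R)%E.
Local Notation plane := 'cV[R]_2.

Definition ew (c : R) (z : T2) : R := expR (- c * `|z.1|) * expR (- c * `|z.2|).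

Lemma ew_ge0 c z : 0 <= ew c z.
Proof. by rewrite mulr_ge0 ?expR_ge0. Qed.

Lemma norm2_le_ew (g : R) (x : T2) : 0 < g -> expR (- g * norm2 (vec x)) <= ew (g / 2) x.
Proof.
move=> g0; rewrite /ew -expRD ler_expR.
have := coord_le_norm2 (vec x) 0; have := coord_le_norm2 (vec x) 1.
rewrite !mxE /= => h1 h2.
have : g * (`|x.1| + `|x.2|) <= g * (2 * norm2 (vec x)) by rewrite ler_pM2l//; lra.
lra.
Qed.

Lemma measurable_exp_abs (c : R) : measurable_fun setT (fun x : measurableTypeR R => expR (- c * `|x|) : R).
Proof.
apply: (@continuous_measurable_fun R (fun x => expR (- c * `|x|))) => x.
apply: continuous_comp; last exact: continuous_expR.
apply: cvgM; first exact: cvg_cst.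
exact: cvg_norm.
Qed.

(** exp (- c |x|) is at most 1 / c times the sum of the exponential density and its reflection, each
    of integral 1. *)
Lemma exp_abs_fin (c : R) : 0 < c ->
  (\int[lam]_x (expR (- c * `|x|))%:E < +oo)%E.
Proof.
move=> c0.
have mp := measurable_exponential_pdf c : measurable_fun setT (exponential_pdf c).
have mpN : measurable_fun setT (fun x : R => exponential_pdf c (- x)).
  by apply: measurableT_comp mp _.
have i1 := integral_exponential_pdf c0.
have p0 x := exponential_pdf_ge0 (ltW c0) x.
have i2 : (\int[lam]_x (exponential_pdf c (- x))%:E = 1)%E.
  have a0 : (-1 : R) != 0 by rewrite oppr_eq0 oner_eq0.
  have := @integral_affine R (-1) 0 (fun x => (exponential_pdf c x)%:E) a0 _ _.
  rewrite i1 normrN normr1 invr1 mule1 => <-.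
  - by apply: eq_integral => x _; rewrite mulN1r addr0.
  - exact/measurable_EFinP.
  - by move=> x; rewrite lee_fin.
apply: (@le_lt_trans _ _ (\int[lam]_x ((c^-1)%:E * ((exponential_pdf c x)%:E + (exponential_pdf c (- x))%:E)))%E).
  apply: ge0_le_integral => //.
  - by apply/measurable_EFinP; exact: measurable_exp_abs.
  - apply: measurable_funeM; apply: emeasurable_funD; exact/measurable_EFinP.
  move=> x _; rewrite -EFinD -EFinM lee_fin ler_pdivlMl//.
  have [x0|x0] := leP 0 x.
    by rewrite ger0_norm// (exponential_pdfE _ x0) lerDl p0.
  by rewrite ltr0_norm// [X in _ + X]exponential_pdfE ?oppr_ge0 ?(ltW x0)// lerDr p0.
rewrite ge0_integralZl//; last 3 first.
- by apply: emeasurable_funD; exact/measurable_EFinP.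
- by move=> x _; rewrite -EFinD lee_fin addr_ge0.
- by rewrite lee_fin invr_ge0 ltW.
rewrite ge0_integralD//; last 4 first.
- by move=> x _; rewrite lee_fin.
- exact/measurable_EFinP.
- by move=> x _; rewrite lee_fin.
- exact/measurable_EFinP.
by rewrite i1 i2 -EFinD -EFinM ltry.
Qed.

Lemma measurable_ew c : measurable_fun setT (ew c).
Proof.
by apply: measurable_funM; apply: (measurableT_comp (measurable_exp_abs c)).
Qed.

Lemma rint_ew (c : R) : 0 < c -> rint (ew c).
Proof.
move=> c0.
have mE : measurable_fun setT (fun z : T2 => (ew c z)%:E).
  by apply/measurable_EFinP; exact: measurable_ew.
have E0 (z : T2) : (0 <= (ew c z)%:E)%E by rewrite lee_fin ew_ge0.
apply/integrableP; split => //.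
rewrite (eq_integral (fun z : T2 => (ew c z)%:E)); last first.
  by move=> z _; rewrite /= ger0_norm ?ew_ge0.
rewrite (@fubini_tonelli1 _ _ _ _ _ lam lam _ mE)//.
have fin := exp_abs_fin c0.
have i0 : (0 <= \int[lam]_x (expR (- c * `|x|))%:E)%E.
  by apply: integral_ge0 => x _; rewrite lee_fin expR_ge0.
rewrite /fubini_F.
rewrite (eq_integral (fun x : measurableTypeR R => (fine (\int[lam]_x (expR (- c * `|x|))%:E))%:E * (expR (- c * `|x|))%:E)%E); last first.
  move=> x _; rewrite fineK ?ge0_fin_numE//.
  under eq_integral do rewrite /ew /= EFinM.
  rewrite ge0_integralZl ?lee_fin ?expR_ge0//; first by rewrite muleC.
  by apply/measurable_EFinP; exact: measurable_exp_abs.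
rewrite ge0_integralZl//.
- by apply: lte_mul_pinfty; rewrite ?lee_fin ?fine_ge0.
- by apply/measurable_EFinP; exact: measurable_exp_abs.
- by rewrite lee_fin fine_ge0.
Qed.

Lemma cint_exp (f : plane -> R[i]) (C g : R) : 0 < g -> cmeas f ->
  (forall x, nrm (f x) <= C * expR (- g * norm2 x)) -> cint f.
Proof.
move=> g0 mf fC.
have C0 : 0 <= C.
  by have := le_trans (nrm_ge0 _) (fC 0); rewrite norm2_0 mulr0 expR0 mulr1.
apply: (@cint_le _ _ (fun z => C * ew (g / 2) z)) => //.
  by apply: rintZ; apply: rint_ew; lra.
by move=> z; rewrite (le_trans (fC _))// ler_wpM2l// norm2_le_ew.
Qed.

Definition cellb (x : plane) : bool := (0 <= x 0 0 < 1) && (0 <= x 1 0 < 1).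
Definition icell (x : plane) : R[i] := (cellb x)%:R.

Lemma icell_real x : icell x = ((cellb x)%:R : R)%:C.
Proof. by rewrite /icell; case: cellb. Qed.

Lemma nrm_icell x : nrm (icell x) = (cellb x)%:R.
Proof. by rewrite icell_real nrm_real; case: cellb; rewrite ?normr1 ?normr0. Qed.

Definition box (a b : R) : set T2 := `[a, b[%classic `*` `[a, b[%classic.

Lemma measurable_box a b : measurable (box a b).
Proof. by apply: measurableX; exact: measurable_itv. Qed.

Lemma lam2_box a b : a <= b -> lam2 (box a b) = ((b - a) ^+ 2)%:E.
Proof.
move=> ab.
have li : lam `[a, b[%classic = (b - a)%:E.
  rewrite lebesgue_measure_itv /= lte_fin.
  by move: ab; rewrite le_eqVlt => /predU1P[->|->]; rewrite ?ltxx ?subrr// EFinB.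
rewrite product_measure1E; [|exact: measurable_itv..].
by rewrite expr2 EFinM; congr (_ * _)%E; exact: li.
Qed.

Lemma indic_boxE a b (z : T2) : \1_(box a b) z = ((a <= z.1 < b) && (a <= z.2 < b))%:R :> R.
Proof.
rewrite indicE; congr (nat_of_bool _)%:R.
apply/idP/idP => [|h]; rewrite inE /box /= !in_itv /=; first by move=> [-> ->].
by move/andP : h => [-> ->].
Qed.

Lemma rint_box a b : a <= b -> rint (\1_(box a b)) /\ (\int[lam2]_z \1_(box a b) z)%R = (b - a) ^+ 2.
Proof.
move=> ab.
have mb := measurable_box a b.
split.
  apply/integrableP; split; first by apply/measurable_EFinP; exact: measurable_indic.
  rewrite (eq_integral (fun z => (\1_(box a b) z)%:E)); last first.
    by move=> z _; rewrite /= ger0_norm// indicE.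
  rewrite integral_indic// setIT.
  by apply: le_lt_trans (ltry ((b - a) ^+ 2)); rewrite -lam2_box.
by rewrite /Rintegral integral_indic// setIT; exact: (congr1 fine (lam2_box ab)).
Qed.

Lemma rint_cell : rint (fun z : T2 => (cellb (vec z))%:R) /\
  (\int[lam2]_z (cellb (vec z))%:R)%R = 1.
Proof.
have E : (fun z : T2 => (cellb (vec z))%:R) = \1_(box 0 1) :> (T2 -> R).
  by apply/funext => z; rewrite indic_boxE /cellb !mxE.
rewrite E; have [h1 h2] := @rint_box 0 1 ler01.
by split => //; rewrite h2 subr0 expr1n.
Qed.

Lemma cmeas_icell : cmeas icell.
Proof.
split.
  have := rint_meas rint_cell.1; congr rmeas; apply/funext => z.
  by rewrite icell_real.
rewrite (_ : (fun z => _) = fun=> 0); first exact: measurable_cst.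
by apply/funext => z; rewrite icell_real.
Qed.

Lemma cint_icell (f : plane -> R[i]) (B : R) : cmeas f ->
  (forall x, cellb x -> nrm (f x) <= B) -> cint (fun x => icell x * f x).
Proof.
move=> mf fB.
apply: (@cint_le _ _ (fun z => B * (cellb (vec z))%:R)).
- by apply: cmeasM => //; exact: cmeas_icell.
- by apply: rintZ; exact: rint_cell.1.
move=> z; rewrite nrmM nrm_icell; have := fB (vec z).
by case: cellb => h; rewrite ?mul1r ?mulr1 ?mul0r ?mulr0//; exact: h.
Qed.

Lemma cI_icell : cI icell = 1.
Proof.
rewrite cIE; apply: complex_eq => /=.
  rewrite -[RHS]rint_cell.2; apply: eq_Rintegral => z _; by rewrite icell_real.
by rewrite (eq_Rintegral _ _ (g := fun=> 0)) ?Rintegral_cst// ?mul0r// => z _; rewrite icell_real.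
Qed.

Definition zfl (x : plane) : Z2 := zpair (Num.floor (x 0 0), Num.floor (x 1 0)).

Lemma cellb_zfl x n : cellb (x - zv n) = (n == zfl x).
Proof.
have key (t : R) (k : int) : (0 <= t - k%:~R < 1) = (k == Num.floor t).
  rewrite subr_ge0 ltrBlDl.
  apply/idP/eqP => [/andP[h1 h2]|->].
    by apply/esym/floor_def; rewrite h1 /= rmorphD /= .
  apply/andP; split; first exact: floor_le.
  by have := floorD1_gt t; rewrite rmorphD.
rewrite /cellb !mxE !key.
apply/andP/eqP => [[/eqP h0 /eqP h1]|->].
  apply/matrixP => i j; rewrite !ord1 /zfl !mxE; by case: (ord2 i) => ->.
by rewrite /zfl !mxE /=.
Qed.

(** Finite sets that exhaust Z^2 along the naturals, read off its enumeration, so that infinite sums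
    become limits of sequences, to which dominated convergence applies. *)
Definition zset (k : nat) : {fset Z2} := [fset x | x in pmap (@choice.unpickle Z2 : nat -> option Z2) (iota 0 k)]%fset.

Lemma zset_exhaust n : \forall k \near \oo, n \in zset k.
Proof.
near=> k; rewrite !inE /=.
rewrite mem_pmap; apply/mapP; exists (choice.pickle n); last by rewrite choice.pickleK.
rewrite mem_iota /= add0n; near: k; exact: nbhs_infty_gt.
Unshelve. all: by end_near. Qed.

Lemma csum_cell (f : Z2 -> R[i]) x : csum (fun n => icell (x - zv n) * f n) = f (zfl x).
Proof.
rewrite (@csum_one _ _ _ (zfl x)); first by rewrite /icell cellb_zfl eqxx mul1r.
by move=> n /negbTE h; rewrite /icell cellb_zfl h mul0r.
Qed.

Lemma summ_cell (f : Z2 -> R[i]) x : summ (fun n => icell (x - zv n) * f n).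
Proof.
rewrite /summ (@asum_one _ _ _ (zfl x)) ?ltry//.
by move=> n /negbTE h; rewrite /icell cellb_zfl h mul0r.
Qed.

Lemma sum_cell_le (A : {fset Z2}) x : nrm (\sum_(n <- A) icell (x - zv n)) <= 1.
Proof.
have -> : \sum_(n <- A) icell (x - zv n) = csum (fun n => icell (x - zv n) * (n \in A)%:R).
  rewrite (@csum_fsbig _ _ _ A); last by move=> n /negbTE ->; rewrite mulr0.
  by rewrite big_seq [RHS]big_seq; apply: eq_bigr => n ->; rewrite mulr1.
by rewrite csum_cell; case: (_ \in _); rewrite ?nrm1 ?nrm0.
Qed.

Definition ccont (f : plane -> R[i]) := forall x, clim (nbhs x) f (f x).

Lemma normr_plane (u : plane) : `|u| <= norm2 u.
Proof.
rewrite [leLHS]mx_normrE; apply/bigmax_leP; split; first exact: norm2_ge0.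
by move=> [i j] _ /=; rewrite ord1; exact: coord_le_norm2.
Qed.

Lemma norm2_le_normr (u : plane) : norm2 u <= 2 * `|u|.
Proof.
apply: (le_trans (norm2_le_coord u)).
have h i : `|u i 0| <= `|u|.
  by rewrite [leRHS]mx_normrE; apply: (@le_bigmax _ _ _ 0 (fun ij => `|u ij.1 ij.2|) (i, 0)).
have := h 0; have := h 1; lra.
Qed.

Lemma near_norm2 (x : plane) (e : R) : 0 < e -> \forall y \near x, norm2 (y - x) < e.
Proof.
move=> e0; have e2 : 0 < e / 2 by lra.
near=> y; apply: (le_lt_trans (norm2_le_normr _)).
rewrite -ltr_pdivlMl// mulrC distrC; near: y; exact: cvgr_dist_lt e2.
Unshelve. all: by end_near. Qed.

Lemma cvg_plane (T : Type) (F : set_system T) (FF : Filter F) (u : T -> plane) (x : plane) :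
  (forall e : R, 0 < e -> \forall t \near F, norm2 (u t - x) < e) -> u @ F --> x.
Proof.
move=> h; apply/cvgrPdist_lt => e e0; apply: filterS (h e e0) => t.
by rewrite distrC; apply: le_lt_trans; exact: normr_plane.
Qed.

(** A continuous function is the pointwise limit of step functions that take, on each cell of side 1
    / (k + 1), the value at its lower corner; a step function is in turn a limit of finite sums over
    cells. *)
Lemma cmeas_cont f : ccont f -> cmeas f.
Proof.
move=> cf.
pose p k (n : Z2) : plane := (k.+1%:R)^-1 *: zv n.
apply: (@cmeas_clim _ (fun k x => csum (fun n => icell (k.+1%:R *: x - zv n) * f (p k n)))).
  move=> k; apply: (@cmeas_clim _ (fun j x => \sum_(n <- zset j) icell (k.+1%:R *: x - zv n) * f (p k n))).
    move=> j; apply: cmeas_sum => n; apply: cmeasM; last exact: cmeas_cst.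
    have := cmeas_affine (k.+1%:R)%:M (- zv n) cmeas_icell.
    by under eq_fun do rewrite mul_scalar_mx.
  move=> x; apply: csum_exhaust; first exact: zset_exhaust.
  exact: summ_cell.
move=> x; under eq_fun do rewrite csum_cell.
have cv : (fun k => p k (zfl (k.+1%:R *: x))) @ \oo --> x.
  apply: cvg_plane => e e0.
  near=> k.
  have k0 : 0 < k.+1%:R :> R by rewrite ltr0n.
  have ke : (k.+1%:R)^-1 < e / 2 :> R.
    by near: k; apply: near_infty_natSinv_lt (PosNum (_ : 0 < e / 2)); lra.
  have co (t : R) : `|(k.+1%:R)^-1 * (Num.floor (k.+1%:R * t))%:~R - t| <= (k.+1%:R)^-1.
    rewrite -[X in _ - X](mulKf (lt0r_neq0 k0)) -mulrBr normrM ger0_norm ?invr_ge0 ?(ltW k0)//.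
    rewrite -[leRHS]mulr1 ler_wpM2l ?invr_ge0 ?(ltW k0)// distrC.
    have := floor_le (k.+1%:R * t); have := floorD1_gt (k.+1%:R * t).
    by rewrite rmorphD /= => h1 h2; rewrite ger0_norm; lra.
  apply: (le_lt_trans (norm2_le_coord _)).
  have := co (x 0 0); have := co (x 1 0).
  rewrite /p /zfl !mxE /= => h1 h2.
  by apply: (le_lt_trans (lerD h2 h1)); rewrite [e]splitr ltrD.
by move=> e e0; have := cv _ (cf x e e0).
Unshelve. all: by end_near. Qed.

End UnitCell.

(** * Poisson summation *)

Section Characters.
Context {R : realType}.
Local Notation plane := 'cV[R]_2.

Lemma expi_int (k : int) : expi (2 * pi * k%:~R : R) = 1.
Proof.
have nat_case (n : nat) : expi (2 * pi * n%:R : R) = 1.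
  elim: n => [|n IH]; first by rewrite mulr0 expi0.
  rewrite -[n.+1%:R]natr1 (mulrDr (2 * pi)) expiD IH mul1r mulr1 mulr_natl /expi cos2pi sin2pi.
  exact/complex_eq.
case: k => n; first exact: nat_case.
by rewrite NegzE mulrNz mulrN -conj_expi nat_case conjc1.
Qed.

(** For fixed m a character of the torus R^2 / Z^2, for fixed x a character of Z^2. Poisson
    summation uses the first reading, equidistribution the second. *)
Definition ch (m : Z2) (x : plane) : R[i] := expi (2 * pi * dot (zv m) x).

Lemma chD m x y : ch m (x + y) = ch m x * ch m y.
Proof. by rewrite /ch dotDr (mulrDr (2 * pi)) expiD. Qed.

Lemma chM m n x : ch m x * ch n x = ch (m + n) x.
Proof. by rewrite /ch zvD dotDl (mulrDr (2 * pi)) expiD. Qed.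

Lemma nrm_ch m x : nrm (ch m x) = 1. Proof. exact: nrm_expi. Qed.

Lemma ch0 x : ch 0 x = 1.
Proof. by rewrite /ch zv0 dot0l mulr0 expi0. Qed.

Lemma ch_0 m : ch m 0 = 1.
Proof. by rewrite /ch dot0r mulr0 expi0. Qed.

Lemma ch_zv m n : ch m (zv n) = 1.
Proof.
by rewrite /ch dotE !mxE -!rmorphM -rmorphD /=; exact: expi_int.
Qed.

Lemma chDz m x n : ch m (x + zv n) = ch m x.
Proof. by rewrite chD ch_zv mulr1. Qed.

Lemma chN m x : ch (- m) x = ch m (- x).
Proof. by rewrite /ch zvN dotNl dotNr. Qed.

Lemma ch_conj m x : conjc (ch m x) = ch (- m) x.
Proof. by rewrite /ch conj_expi zvN dotNl mulrN. Qed.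

Lemma cvg_dot (u x : plane) c : c * dot u y @[y --> x] --> c * dot u x.
Proof.
apply/(@cvgrPdist_lt _ _ _ _ (nbhs_filter x)) => e e0.
pose K : R := `|c| * (`|u 0 0| + `|u 1 0|) + 1.
have K0 : 0 < K by rewrite ltr_wpDl// mulr_ge0// addr_ge0.
have eK : 0 < e / K by rewrite divr_gt0.
apply: filterS (near_norm2 x eK) => y; rewrite ltr_pdivlMr// => h.
rewrite distrC -mulrBr -dotNr -dotDr normrM.
apply: le_lt_trans h; rewrite [leRHS]mulrC /K mulrDl mul1r ler_wpDr ?norm2_ge0//.
rewrite -mulrA ler_wpM2l// dotE (le_trans (ler_normD _ _))// !normrM mulrDl.
by rewrite lerD// ler_wpM2l// coord_le_norm2.
Qed.

Lemma ccont_expi (u : plane) c : ccont (fun x => expi (c * dot u x)).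
Proof.
move=> x; apply/clim_ReIm; rewrite /=.
have h := @cvg_dot u x c.
by split; (apply: cvg_comp h _; first [exact: continuous_cos|exact: continuous_sin]).
Qed.

Lemma ccont_ch m : ccont (ch m). Proof. exact: ccont_expi. Qed.

Lemma cmeas_ch m : cmeas (ch m). Proof. exact/cmeas_cont/ccont_ch. Qed.

Lemma cI_shift (f : plane -> R[i]) b : cint f -> cint (fun x => f (x + b)) /\ cI (fun x => f (x + b)) = cI f.
Proof.
move=> fi; have d1 : \det (1%:M : 'M[R]_2) != 0 by rewrite det1 oner_eq0.
have [a] := cI_affine b d1 fi.
under [X in cI X]eq_fun do rewrite mul1mx.
rewrite det1 normr1 invr1 => h; split; last by rewrite h mul1r.
by move: a; under eq_fun do rewrite mul1mx.
Qed.

Lemma cmeas_shift (f : plane -> R[i]) b : cmeas f -> cmeas (fun x => f (x + b)).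
Proof. by move=> /(cmeas_affine 1%:M b); under eq_fun do rewrite mul1mx. Qed.

Lemma rint_nrm (v : plane -> R[i]) : cint v -> rint (fun z => nrm (v (vec z))).
Proof.
move=> [h1 h2].
have k1 := integrable_norm h1; have k2 := integrable_norm h2.
apply: (@rint_le _ _ (fun z => `|complex.Re (v (vec z))| + `|complex.Im (v (vec z))|)).
- rewrite (_ : (fun z => _) = fun z => Num.sqrt (complex.Re (v (vec z)) ^+ 2 + complex.Im (v (vec z)) ^+ 2)); last first.
    by apply/funext => z; case: (v _).
  apply: (measurableT_comp (continuous_measurable_fun (@sqrt_continuous R))).
  by apply: measurable_funD; apply: measurable_funX; exact: rint_meas.
- exact: (rintD k1 k2).
- by move=> z; rewrite ger0_norm ?nrm_ge0// nrm_le_ReIm.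
Qed.

Lemma asum_ge (I : choiceType) (f : I -> R[i]) (A : {fset I}) :
  ((\sum_(i <- A) nrm (f i))%:E <= asum f)%E.
Proof.
rewrite -sumEFin /asum; apply: ereal_sup_ubound; exists [set` A] => //.
by rewrite fsbig_finite//= set_fsetK.
Qed.

(** Both sides are limits of the same finite sums over translated cells. The convergence is
    dominated by |v| over the plane, and by B over the cell after translating back. *)
Lemma cI_unfold (v : plane -> R[i]) (B : R) : cint v ->
  (forall x, asum (fun n => v (x + zv n)%R) <= B%:E)%E ->
  cI v = cI (fun x => icell x * csum (fun n => v (x + zv n))).
Proof.
move=> vi vB.
have mv := cint_meas vi.
have sv x : summ (fun n => v (x + zv n)) by apply: le_lt_trans (vB x) _; exact: ltry.
have rv := rint_nrm vi.
have part n : cint (fun x => icell (x - zv n) * v x).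
  apply: (@cint_le _ _ (fun z => nrm (v (vec z)))) => //.
  - by apply: cmeasM => //; apply: cmeas_shift; exact: cmeas_icell.
  - move=> z; rewrite nrmM nrm_icell; case: cellb; rewrite ?mul1r ?mul0r ?nrm_ge0//.
pose F k x := \sum_(n <- zset k) icell (x - zv n) * v x.
have [_ cF] : cint v /\ clim \oo (fun k => cI (F k)) (cI v).
  apply: (@cI_dct _ F v (fun z => nrm (v (vec z)))) => //.
  - by move=> k; apply: cmeas_sum => n; exact: cint_meas (part n).
  - move=> k z; rewrite /F -mulr_suml nrmM -[leRHS]mul1r ler_wpM2r ?nrm_ge0//.
    exact: sum_cell_le.
  - move=> x; have -> : v x = csum (fun n => icell (x - zv n) * v x) by rewrite (csum_cell (fun=> v x)).
    by apply: csum_exhaust; [exact: zset_exhaust|exact: (summ_cell (fun=> v x))].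
have [_ cG] : cint (fun x => icell x * csum (fun n => v (x + zv n))) /\
   clim \oo (fun k => cI (fun x => \sum_(n <- zset k) icell x * v (x + zv n)))
    (cI (fun x => icell x * csum (fun n => v (x + zv n)))).
  apply: (@cI_dct _ _ _ (fun z => B * (cellb (vec z))%:R)).
  - by move=> k; apply: cmeas_sum => n; apply: cmeasM; [exact: cmeas_icell|exact: cmeas_shift].
  - by apply: rintZ; exact: rint_cell.1.
  - move=> k z; rewrite -mulr_sumr nrmM nrm_icell mulrC ler_wpM2r//.
    by rewrite (le_trans (nrm_sum _ _ _))// -lee_fin (le_trans (asum_ge _ _)).
  - move=> x; under eq_fun do rewrite -mulr_sumr.
    by apply: climZ; apply: csum_exhaust => //; exact: zset_exhaust.
apply: (clim_unique _ cF); apply: clim_near_eq cG; near=> k.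
rewrite /F (cI_sum (zset k) part).2.
have part' n : cint (fun x => icell x * v (x + zv n)) /\ cI (fun x => icell x * v (x + zv n)) = cI (fun x => icell (x - zv n) * v x).
  by have := cI_shift (zv n) (part n); under eq_fun do rewrite addrK.
rewrite (cI_sum (zset k) (fun n => (part' n).1)).2.
by apply: eq_bigr => n _; exact: (part' n).2.
Unshelve. all: by end_near. Qed.

(** The translated cell is still a fundamental domain: every point has exactly one integer translate
    in it, so unfolding over it gives back w on the cell. *)
Lemma cI_cell_shift (w : plane -> R[i]) (B : R) t : cmeas w -> (forall x, nrm (w x) <= B) ->
  (forall x n, w (x + zv n) = w x) ->
  cI (fun x => icell x * w (x + t)) = cI (fun x => icell x * w x).
Proof.
move=> mw wB wp.
have B0 : 0 <= B by apply: le_trans (wB 0); exact: nrm_ge0.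
have i1 : cint (fun x => icell x * w (x + t)).
  by apply: (@cint_icell _ _ B) => //; exact: cmeas_shift.
have [i2 E2] := cI_shift (- t) i1.
rewrite -E2; under [X in cI X]eq_fun do rewrite subrK.
move: i2; under eq_fun do rewrite subrK.
move=> i2.
have cc x : (fun n => icell (x + zv n - t) * w (x + zv n)) = (fun n => icell (x - t - zv n) * w x) \o -%R.
  by apply/funext => n /=; rewrite wp zvN opprK addrAC.
have bN : bijective (-%R : Z2 -> Z2) by exists -%R; exact: opprK.
rewrite (@cI_unfold _ B i2).
  congr cI; apply/funext => x; congr (_ * _); rewrite cc.
  by rewrite (csum_reindex (fun n => icell (x - t - zv n) * w x) bN) (csum_cell (fun=> w x)).
move=> x; rewrite cc (asum_reindex (fun n => icell (x - t - zv n) * w x) bN).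
rewrite (@asum_one _ _ _ (zfl (x - t))); last first.
  by move=> n /negbTE h; rewrite /icell cellb_zfl h mul0r.
by rewrite lee_fin nrmM nrm_icell cellb_zfl eqxx mul1r.
Qed.

(** For nonzero m some translation multiplies the character by -1, while the integral over the cell
    is invariant under translation; it is therefore its own opposite. *)
Lemma cI_ch m : cI (fun x => icell x * ch m x) = (m == 0)%:R.
Proof.
have [->|m0] := eqVneq m 0.
  by under [X in cI X]eq_fun do rewrite ch0 mulr1; exact: cI_icell.
have [t tm] : exists t : plane, ch m t = -1.
  pose d : R := dot (zv m) (zv m).
  have d0 : d != 0.
    apply: contra_neq m0 => d0.
    have n0 : norm2 (zv m : plane) = 0 by rewrite /norm2 -[X in Num.sqrt X]/d d0 sqrtr0.
    have h i : `|(zv m : plane) i 0| <= 0 by rewrite -n0; exact: coord_le_norm2.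
    apply/matrixP => i j; rewrite ord1 mxE; apply/eqP; have := h i.
    by rewrite normr_le0 mxE intr_eq0.
  (* Its scalar product with m is 1 / 2, so the phase is pi. *)
  exists ((2 * d)^-1 *: zv m).
  rewrite /ch (_ : 2 * pi * _ = pi); first by rewrite /expi cospi sinpi; apply: complex_eq; rewrite /= ?oppr0.
  have -> : dot (zv m) ((2 * d)^-1 *: zv m) = (2 * d)^-1 * d.
    by rewrite /d !dotE !mxE /=; ring.
  by field.
have := @cI_cell_shift (ch m) 1 t (cmeas_ch m) _ _.
under [X in cI X]eq_fun do rewrite chD tm mulrN1 mulrN -mulN1r.
have i1 : cint (fun x => icell x * ch m x).
  by apply: (@cint_icell _ _ 1) => [|x _]; [exact: cmeas_ch|rewrite nrm_ch].
rewrite (cI_Z _ i1).2 mulN1r => h.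
have : cI (fun x : plane => icell x * ch m x) *+ 2 = 0.
  rewrite mulr2n -[X in X + _]h ?addNr// => x; [by rewrite nrm_ch|exact: chDz].
by move/eqP; rewrite mulrn_eq0 => /eqP.
Qed.

(** The product D w has no Fourier coefficients on the cell. The weight w starts at 1 and is
    multiplied by trigonometric polynomials; its measurability and boundedness are carried along so
    that the integrals stay linear. *)
Definition annih (D w : plane -> R[i]) : Prop :=
  [/\ cmeas w, (exists B, forall x, nrm (w x) <= B) &
      forall m, cI (fun x => icell x * (D x * w x * ch m x)) = 0].

Lemma annih_mul (D w : plane -> R[i]) (M : R) (c a b : R[i]) p p' : cmeas D -> (forall x, nrm (D x) <= M) ->
  annih D w -> annih D (fun x => (c + a * ch p x + b * ch p' x) * w x).
Proof.
move=> mD DM [mw [B wB] h].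
have mq : cmeas (fun x => c + a * ch p x + b * ch p' x).
  by do 2?apply: cmeasD; do ?[exact: cmeas_cst | exact: cmeas_ch | apply: cmeasM].
split.
- exact: cmeasM.
- exists ((nrm c + nrm a + nrm b) * B) => x; rewrite nrmM ler_pM ?nrm_ge0//.
  by rewrite !(le_trans (nrmD _ _))// !lerD// ?(le_trans (nrmD _ _))// ?lerD// nrmM nrm_ch mulr1.
move=> m.
have i1 k : cint (fun x => icell x * (D x * w x * ch k x)).
  apply: (@cint_icell _ _ (M * B)) => [|x _].
    by do !apply: cmeasM => //; exact: cmeas_ch.
  by rewrite nrmM nrm_ch mulr1 nrmM ler_pM ?nrm_ge0.
have [j0 e0] := cI_Z c (i1 m).
have [j1 e1] := cI_Z a (i1 (p + m)).
have [j2 e2] := cI_Z b (i1 (p' + m)).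
rewrite (_ : (fun x => _) = fun x => (c * (icell x * (D x * w x * ch m x)) + a * (icell x * (D x * w x * ch (p + m) x)))
   + b * (icell x * (D x * w x * ch (p' + m) x))); last first.
  by apply/funext => x; rewrite -!chM; ring.
by rewrite (cI_D (cintD j0 j1) j2) (cI_D j0 j1) e0 e1 e2 !h !mulr0 !addr0.
Qed.

Let e0 : Z2 := zpair (1, 0).
Let e1 : Z2 := zpair (0, 1).

(* A nonnegative trigonometric polynomial whose only peak in the cell is at the
   centre: its powers concentrate there, which forces a continuous function
   orthogonal to all characters to vanish at the centre. *)
Definition peak (x : plane) : R := sin (pi * x 0 0) ^+ 2 * sin (pi * x 1 0) ^+ 2.

Lemma sin2_ch (m : Z2) (x : plane) (t : R) : dot (zv m) x = t ->
  (sin (pi * t) ^+ 2)%:C = (1 / 2%:R)%:C + (- (1 / 4%:R))%:C * ch m x + (- (1 / 4%:R))%:C * ch (- m) x :> R[i].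
Proof.
move=> ht; rewrite -ch_conj /ch ht (_ : 2 * pi * t = (pi * t) *+ 2); last by rewrite -[RHS]mulr_natl mulrA.
rewrite /expi; apply: complex_eq => /=; last by ring.
have -> : cos (pi * t *+ 2) = 1 - sin (pi * t) ^+ 2 *+ 2.
  by rewrite mulr2n cosD -!expr2 cos2sin2; ring.
by field.
Qed.

Lemma annih_peak D M N : cmeas D -> (forall x, nrm (D x) <= M) -> annih D (fun=> 1) ->
  annih D (fun x => (peak x ^+ N)%:C).
Proof.
move=> mD DM h; elim: N => [|N IH]; first by under eq_fun do rewrite expr0.
have := annih_mul (1 / 2%:R)%:C (- (1 / 4%:R))%:C (- (1 / 4%:R))%:C e0 (- e0) mD DM
  (annih_mul (1 / 2%:R)%:C (- (1 / 4%:R))%:C (- (1 / 4%:R))%:C e1 (- e1) mD DM IH).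
congr annih; apply/funext => x.
rewrite -(@sin2_ch e0 x (x 0 0)); last by rewrite dotE !mxE /= mul1r mul0r addr0.
rewrite -(@sin2_ch e1 x (x 1 0)); last by rewrite dotE !mxE /= mul1r mul0r add0r.
by rewrite (exprS (peak x)) (rcM (peak x)) /peak (rcM (sin _ ^+ 2)) mulrA.
Qed.

Lemma sin2_le1 (t : R) : 0 <= sin t ^+ 2 <= 1.
Proof. by rewrite sqr_ge0 /=; have := cos2Dsin2 t; have := sqr_ge0 (cos t); lra. Qed.

Lemma peak_bnd x : 0 <= peak x <= 1.
Proof.
rewrite /peak; have /andP[h1 h2] := sin2_le1 (pi * x 0 0); have /andP[h3 h4] := sin2_le1 (pi * x 1 0).
by rewrite mulr_ge0//= -[leRHS]mulr1 ler_pM.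
Qed.

(** On [0, 1] the sine of pi t is the cosine of pi times the distance from t to 1 / 2, and the
    cosine decreases with that distance. *)
Lemma sin2_far (d t : R) : 0 < d -> d < 1 / 2 -> 0 <= t < 1 -> d <= `|t - 1 / 2| ->
  sin (pi * t) ^+ 2 <= cos (pi * d) ^+ 2.
Proof.
move=> d0 d1 /andP[t0 t1] td; have dge := ltW d0.
have p0 := pi_gt0 R.
have -> : sin (pi * t) = cos (pi * `|t - 1 / 2|).
  rewrite -cosBpihalf; have -> : pi * t - pi / 2 = pi * (t - 1 / 2) by ring.
  by have [h|h] := ger0P (t - 1 / 2) => //; rewrite mulrN cosN.
have th : `|t - 1 / 2| <= 1 / 2 by rewrite ler_norml; lra.
have c0 : 0 <= cos (pi * `|t - 1 / 2|).
  apply: cos_ge0_pihalf; apply/andP; split.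
    by rewrite (@le_trans _ _ 0)// ?mulr_ge0// ?(ltW p0)//; lra.
  by rewrite ler_pM2l//; lra.
rewrite ler_sqr ?nnegrE//; last first.
  by apply: cos_ge0_pihalf; apply/andP; split; [have : 0 < pi * d by rewrite mulr_gt0|rewrite ler_pM2l//]; lra.
rewrite leNgt ltr_cos; first by rewrite -leNgt ler_pM2l.
- by rewrite in_itv /= mulr_ge0 ?(ltW p0)//=; rewrite -[leRHS]mulr1 ler_pM2l//; lra.
- by rewrite in_itv /= mulr_ge0 ?(ltW p0)//=; rewrite -[leRHS]mulr1 ler_pM2l//; lra.
Qed.

Lemma cos_lt1 (d : R) : 0 < d -> d < 1 / 2 -> cos (pi * d) ^+ 2 < 1.
Proof.
move=> d0 d1; have p0 := pi_gt0 R.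
have s0 : 0 < sin (pi * d).
  by apply: sin_gt0_pi; rewrite mulr_gt0//= -[ltRHS]mulr1 ltr_pM2l//; lra.
have := cos2Dsin2 (pi * d); have : 0 < sin (pi * d) ^+ 2 by rewrite exprn_gt0.
lra.
Qed.

Lemma cvg_scoord (x : plane) i : sin (pi * y i 0) @[y --> x] --> sin (pi * x i 0).
Proof.
have h : pi * y i 0 @[y --> x] --> pi * x i 0.
  have := @cvg_dot (\col_k (k == i)%:R) x pi.
  have E y : dot (\col_k (k == i)%:R) y = y i 0 :> R.
    by rewrite dotE !mxE; have [->|->] := ord2 i; rewrite /= ?mul1r ?mul0r ?addr0 ?add0r.
  by under eq_fun do rewrite E; rewrite E.
by apply: cvg_comp h _; exact: continuous_sin.
Qed.

(** The centre rather than a lattice point, so that a neighbourhood of it lies inside the half-open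
    cell; [poisson] translates by it. *)
Definition ctr : plane := col2 (1 / 2) (1 / 2).

Lemma peak_ctr : peak ctr = 1.
Proof. by rewrite /peak !mxE /= mul1r sin_pihalf expr1n mulr1. Qed.

Lemma peak_near (b : R) : b < 1 -> \forall x \near ctr, b < peak x.
Proof.
move=> b1; have h : peak x @[x --> ctr] --> peak ctr.
  have s i := @cvgM _ _ _ (nbhs_filter ctr) _ _ _ _ (@cvg_scoord ctr i) (@cvg_scoord ctr i).
  exact: (@cvgM _ _ _ (nbhs_filter ctr) _ _ _ _ (s 0) (s 1)).
have := @cvgr_gt _ _ _ (nbhs_filter ctr) _ _ h b; rewrite peak_ctr; exact.
Qed.

Lemma near_box (x : plane) (P : plane -> Prop) : (\forall y \near x, P y) ->
  exists2 d : R, 0 < d & forall y : plane, `|y 0 0 - x 0 0| < d -> `|y 1 0 - x 1 0| < d -> P y.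
Proof.
move=> /nbhs_ballP[d /= d0 h]; exists d => // y h0 h1; apply: h.
split=> // i j; rewrite ord1 /ball /= distrC.
by have [->|->] := ord2 i.
Qed.

Lemma annih_ctr D M : ccont D -> (forall x, nrm (D x) <= M) -> annih D (fun=> 1) -> D ctr = 0.
Proof.
move=> cD DM h; have mD := cmeas_cont cD.
apply/eqP; apply: contraT => Dn0; exfalso.
have M0 : 0 <= M by apply: le_trans (DM 0); exact: nrm_ge0.
pose eta := nrm (D ctr) ^+ 2 / 2.
have nD : 0 < nrm (D ctr).
  by rewrite lt_neqAle nrm_ge0 andbT eq_sym; apply: contra_neq Dn0; exact: nrm_eq0.
have eta0 : 0 < eta by rewrite divr_gt0// exprn_gt0.
(* D is rotated so that its value at the centre is real and positive; u there equals 2 eta, hence u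
   exceeds eta nearby. *)
pose u x := complex.Re (conjc (D ctr) * D x).
have uM x : `|u x| <= nrm (D ctr) * M.
  by rewrite (le_trans (Re_le_nrm _))// nrmM nrm_conj ler_wpM2l// nrm_ge0.
have unear : \forall x \near ctr, eta < u x.
  have e0' : 0 < nrm (D ctr) / 2 by rewrite divr_gt0.
  apply: filterS (cD ctr _ e0') => x hx.
  have uc : u ctr = nrm (D ctr) ^+ 2.
    by rewrite /u nrm_sqr; case: (D ctr) => a b /=; ring.
  have : `|u x - u ctr| <= nrm (D ctr) * nrm (D x - D ctr).
    rewrite /u -cReN -cReD -mulrN -mulrDr (le_trans (Re_le_nrm _))// nrmM nrm_conj//.
  have : nrm (D ctr) * nrm (D x - D ctr) < nrm (D ctr) * (nrm (D ctr) / 2) by rewrite ltr_pM2l.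
  rewrite uc ler_norml /eta => h1 /andP[h2 h3]; lra.
have [d1 d10 hd1] := near_box unear.
pose d := Num.min d1 (1 / 4).
have d0 : 0 < d by rewrite lt_min d10 /=; lra.
have d14 : d <= 1 / 4 by rewrite ge_min lexx orbT.
(* Outside the box of half-width d the peak is at most be. The number al, midway between be and 1,
   is exceeded on the smaller box of half-width d', so large powers set al^N against the smaller
   be^N. *)
pose be := cos (pi * d) ^+ 2.
have be0 : 0 <= be by exact: sqr_ge0.
have be1 : be < 1 by apply: cos_lt1 => //; lra.
pose al := (1 + be) / 2.
have [d2 d20 hd2] := near_box (@peak_near al ltac:(rewrite /al; lra)).
pose d' := Num.min d d2 / 2.
have dd2 : Num.min d d2 <= d2 by rewrite ge_min lexx orbT.
have dd1 : Num.min d d2 <= d by rewrite ge_min lexx.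
have mm : 0 < Num.min d d2 by rewrite lt_min d0 d20.
have d'0 : 0 < d' by rewrite divr_gt0.
have [d'd d'd2] : d' < d /\ d' < d2 by rewrite /d'; lra.
have d'14 : d' <= 1 / 4 by lra.
pose q := box (1 / 2 - d') (1 / 2 + d').
have alN : 0 < al by rewrite /al; lra.
(* A minorant whose integral is explicit: the small box contributes at least eta al^N, and on the
   rest of the cell the integrand is at least - |D ctr| M be^N, being nonnegative wherever u exceeds
   eta. *)
have low N (z : R * R) : eta * al ^+ N * \1_q z - nrm (D ctr) * M * be ^+ N * (cellb (vec z))%:R
     <= complex.Re (conjc (D ctr) * (icell (vec z) * (D (vec z) * (peak (vec z) ^+ N)%:C * ch 0 (vec z)))).
  rewrite ch0 mulr1.
  have -> : complex.Re (conjc (D ctr) * (icell (vec z) * (D (vec z) * (peak (vec z) ^+ N)%:C)))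
     = (cellb (vec z))%:R * (u (vec z) * peak (vec z) ^+ N).
    rewrite /u icell_real; case: (D ctr) (D (vec z)) => a b [a' b'] /=; ring.
  have /andP[w0 w1] := peak_bnd (vec z).
  have wN0 : 0 <= peak (vec z) ^+ N by rewrite exprn_ge0.
  have beN0 : 0 <= be ^+ N by rewrite exprn_ge0.
  have nM0 : 0 <= nrm (D ctr) * M by rewrite mulr_ge0 ?nrm_ge0.
  rewrite /q indic_boxE; case: (boolP (cellb (vec z))) => [cz|cz]; last first.
    case: (boolP (_ && _)) => [/andP[/andP[a1 a2] /andP[a3 a4]]|_]; last by rewrite !mulr0 !mul0r subr0.
    by exfalso; move/negP: cz; apply; rewrite /cellb !mxE /=; apply/andP; split; lra.
  rewrite mulr1 (mul1r (u _ * _)).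
  have C0 : 0 <= nrm (D ctr) * M * be ^+ N by rewrite mulr_ge0.
  have [near|far] := boolP ((`|z.1 - 1 / 2| < d) && (`|z.2 - 1 / 2| < d)).
    have /andP[n1 n2] := near.
    have ub : eta < u (vec z).
      by apply: hd1; rewrite !mxE /=; [apply: lt_le_trans n1 _|apply: lt_le_trans n2 _]; rewrite ge_min lexx.
    rewrite lerBlDr; case: (boolP (_ && _)) => [/andP[/andP[a1 a2] /andP[a3 a4]]|_]; last first.
      by rewrite mulr0 addr_ge0// mulr_ge0// ltW// (lt_trans eta0).
    have [m1 m2] : `|z.1 - 1 / 2| <= d' /\ `|z.2 - 1 / 2| <= d' by rewrite !ler_norml; lra.
    have wa : al <= peak (vec z).
      by apply/ltW/hd2; rewrite !mxE /=; lra.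
    rewrite mulr1 -[leLHS]addr0 lerD//.
    by rewrite ler_pM ?(ltW ub) ?exprn_ge0 ?(ltW eta0) ?(ltW alN)// lerXn2r ?nnegrE ?(ltW alN).
  have -> : ((1 / 2 - d' <= z.1 < 1 / 2 + d') && (1 / 2 - d' <= z.2 < 1 / 2 + d')) = false.
    apply/negP => /andP[/andP[a1 a2] /andP[a3 a4]]; move/negP: far; apply.
    by rewrite !ltr_norml; lra.
  rewrite mulr0 sub0r.
  have wb : peak (vec z) <= be.
    move: cz; rewrite /cellb !mxE /= => /andP[c1 c2].
    have d12 : d < 1 / 2 by lra.
    have /andP[s1 s2] := sin2_le1 (pi * z.1); have /andP[s3 s4] := sin2_le1 (pi * z.2).
    rewrite /peak !mxE /=.
    move: far; rewrite negb_and -!leNgt => /orP[f|f].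
      by rewrite -[leRHS]mulr1 ler_pM// ; exact: sin2_far d0 d12 c1 f.
    by rewrite -[leRHS]mul1r ler_pM//; exact: sin2_far d0 d12 c2 f.
  have wbN : peak (vec z) ^+ N <= be ^+ N by rewrite lerXn2r ?nnegrE.
  have : `|u (vec z) * peak (vec z) ^+ N| <= nrm (D ctr) * M * be ^+ N.
    by rewrite normrM (ger0_norm wN0) ler_pM.
  by rewrite ler_norml => /andP[].
have dd : 1 / 2 - d' <= 1 / 2 + d' by lra.
have [rb Eb] := rint_box dd; have [rc Ec] := @rint_cell R.
have main N : eta * al ^+ N * (2 * d') ^+ 2 <= nrm (D ctr) * M * be ^+ N.
  have [mw [B wB] hN] := annih_peak N mD DM h.
  have i1 : cint (fun x => icell x * (D x * (peak x ^+ N)%:C * ch 0 x)).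
    apply: (@cint_icell _ _ (M * B)) => [|x _].
      by do !apply: cmeasM => //; exact: cmeas_ch.
    by rewrite nrmM nrm_ch mulr1 nrmM ler_pM ?nrm_ge0.
  have [[r1 _] E1] := cI_Z (conjc (D ctr)) i1.
  move: E1; rewrite hN mulr0 cIE => /(congr1 (@complex.Re R)) /= E1.
  have r2 := rintB (rintZ (eta * al ^+ N) rb) (rintZ (nrm (D ctr) * M * be ^+ N) rc).
  have := @le_Rintegral _ _ _ _ _ _ _ measurableT r2 r1 (fun z _ => low N z).
  rewrite E1 RintegralB//; [|exact: rintZ..].
  rewrite !RintegralZl// Ec Eb mulr1.
  by rewrite (_ : 1 / 2 + d' - (1 / 2 - d') = 2 * d') ?subr_le0//; ring.
(* Since be < al, the powers of be / al tend to 0, which contradicts [main] for large N. The 1 added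
   to the denominator keeps it positive. *)
have [N hN] : exists N, (be / al) ^+ N < eta * (2 * d') ^+ 2 / (nrm (D ctr) * M + 1).
  have q1 : `|be / al| < 1.
    have q0 : 0 <= be / al by rewrite divr_ge0// ltW.
    by rewrite ger0_norm// ltr_pdivrMr// mul1r /al; lra.
  have e0' : 0 < eta * (2 * d') ^+ 2 / (nrm (D ctr) * M + 1).
    by rewrite divr_gt0 ?mulr_gt0 ?exprn_gt0 ?mulr_gt0// ltr_wpDl// mulr_ge0// nrm_ge0.
  have := @cvgr_lt _ _ _ _ _ _ (cvg_expr q1) _ e0'.
  by case=> N _ hN; exists N; apply: hN => /=.
have := main N; have aN : 0 < al ^+ N by rewrite exprn_gt0.
have P0 : 0 < nrm (D ctr) * M + 1 by rewrite ltr_wpDl// mulr_ge0// nrm_ge0.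
move: hN; rewrite ltr_pdivlMr// expr_div_n mulrAC ltr_pdivrMr// => hN h2.
have : be ^+ N * (nrm (D ctr) * M + 1) <= be ^+ N * (nrm (D ctr) * M).
  apply: le_trans (ltW hN) _; rewrite [leRHS]mulrC; apply: le_trans h2; lra.
rewrite mulrDr mulr1 gerDl => bN.
have be00 : be ^+ N = 0 by apply/eqP; rewrite eq_le bN exprn_ge0.
move: h2; rewrite be00 mulr0 leNgt => /negP; apply.
by rewrite !mulr_gt0// exprn_gt0// mulr_gt0.
Qed.

End Characters.

(** * Periodisation against trigonometric series *)

Section Poisson.
Context {R : realType}.
Local Notation plane := 'cV[R]_2.

Lemma climM {T : Type} (F : set_system T) (FF : Filter F) (u v : T -> R[i]) (L M : R[i]) :
  clim F u L -> clim F v M -> clim F (fun x => u x * v x) (L * M).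
Proof.
move=> /clim_ReIm[u1 u2] /clim_ReIm[v1 v2]; apply/clim_ReIm; split.
  rewrite cReM; under eq_fun do rewrite cReM.
  by apply: cvgB; apply: cvgM.
rewrite cImM; under eq_fun do rewrite cImM.
by apply: cvgD; apply: cvgM.
Qed.

Lemma ccontM (f g : plane -> R[i]) : ccont f -> ccont g -> ccont (fun x => f x * g x).
Proof. by move=> cf cg x; apply: (@climM _ _ (nbhs_filter x)); [exact: cf|exact: cg]. Qed.

Lemma near_shift (x b : plane) (P : plane -> Prop) :
  (\forall y \near (x + b), P y) -> \forall y \near x, P (y + b).
Proof.
move=> h; have [d d0 hd] := near_box h.
apply: filterS (near_norm2 x d0) => y yd; apply: hd.
  by apply: le_lt_trans yd; have := coord_le_norm2 (y - x) 0; rewrite !mxE; congr (`|_| <= _); ring.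
by apply: le_lt_trans yd; have := coord_le_norm2 (y - x) 1; rewrite !mxE; congr (`|_| <= _); ring.
Qed.

Lemma ccont_shift (f : plane -> R[i]) b : ccont f -> ccont (fun x => f (x + b)).
Proof. by move=> cf x e e0; exact: near_shift (cf (x + b) e e0). Qed.

Lemma ccont_csum (I : choiceType) (f : I -> plane -> R[i]) (g : plane -> I -> R) :
  (forall i, ccont (f i)) -> (forall x, rsm (g x)) ->
  (forall x, \forall y \near x, forall i, nrm (f i y) <= g x i) ->
  ccont (fun x => csum (fun i => f i x)).
Proof.
move=> cf sg fg x; apply: (@csum_clim _ _ _ (nbhs_filter x) _ _ _ (g x)) => //.
- exact: fg.
- exact: (nbhs_singleton (fg x)).
- by move=> i; exact: cf.
Qed.

Section TrigSeries.
Variable vh : Z2 -> R[i].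
Hypothesis vs : summ vh.

(** [vh m] stands for the integral against [ch m], which is the coefficient of frequency - m; hence
    the sign. *)
Definition trig (x : plane) := csum (fun m => vh (- m) * ch m x).

Lemma oppz_bij : bijective (-%R : Z2 -> Z2). Proof. by exists -%R; exact: opprK. Qed.

Let vsN : summ (fun m => vh (- m)). Proof. exact/(summ_reindex vh oppz_bij). Qed.

Let rsN : rsm (fun m => nrm (vh (- m))). Proof. exact: (proj1 (summ_rsm _) vsN). Qed.

Lemma dual_cont : ccont trig.
Proof.
apply: (@ccont_csum _ (fun m x => vh (- m) * ch m x) (fun _ m => nrm (vh (- m)))) => //.
  by move=> m; apply: ccontM; [move=> x; exact: (@clim_cst _ _ _ (nbhs_filter x))|exact: ccont_ch].
by move=> x; apply: (@filterE _ _ (nbhs_filter x)) => y m; rewrite nrmM nrm_ch mulr1.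
Qed.

Lemma dual_bnd x : nrm (trig x) <= rsum (fun m => nrm (vh (- m))).
Proof.
by apply: nrm_csum_le; apply: asum_le_rsum => // m; rewrite nrmM nrm_ch mulr1.
Qed.

Lemma dual_fourier b m : cI (fun x => icell x * (trig (x + b) * ch m x)) = ch m (- b) * vh m.
Proof.
have i1 k : cint (fun x : plane => icell x * ch k x).
  by apply: (@cint_icell _ _ 1) => [|x _]; [exact: cmeas_ch|rewrite nrm_ch].
have i2 k := cI_Z (vh (- k) * ch k b) (i1 (k + m)).
have sx x : summ (fun k => vh (- k) * ch k (x + b)).
  by apply: (@summ_le_r _ _ _ (fun k => nrm (vh (- k)))) => // k; rewrite nrmM nrm_ch mulr1.
have [_ cl] : cint (fun x => icell x * (trig (x + b) * ch m x)) /\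
  clim \oo (fun j => cI (fun x => \sum_(k <- zset j) (vh (- k) * ch k b) * (icell x * ch (k + m) x)))
   (cI (fun x => icell x * (trig (x + b) * ch m x))).
  have EE x k : vh (- k) * ch k b * (icell x * ch (k + m) x) = (icell x * ch m x) * (vh (- k) * ch k (x + b)).
    by rewrite -chM chD; ring.
  apply: (@cI_dct _ _ _ (fun z => rsum (fun m => nrm (vh (- m))) * (cellb (vec z))%:R)).
  - by move=> j; apply: cmeas_sum => k; exact: cint_meas (i2 k).1.
  - by apply: rintZ; exact: rint_cell.1.
  - move=> j z; under eq_bigr do rewrite EE.
    rewrite -mulr_sumr nrmM nrmM nrm_icell nrm_ch mulr1 mulrC ler_wpM2r//.
    rewrite (le_trans (nrm_sum _ _ _))// -lee_fin (le_trans (asum_ge _ _))//.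
    by apply: asum_le_rsum => // k; rewrite nrmM nrm_ch mulr1.
  - move=> x; under eq_fun do (under eq_bigr do rewrite EE; rewrite -mulr_sumr).
    have -> : icell x * (trig (x + b) * ch m x) = icell x * ch m x * trig (x + b) by ring.
    by apply: climZ; apply: csum_exhaust => //; exact: zset_exhaust.
apply: (clim_unique _ cl).
have -> : ch m (- b) * vh m = csum (fun k => (vh (- k) * ch k b) * (k + m == 0)%:R).
  rewrite (@csum_one _ _ _ (- m)); last by move=> k /negbTE h; rewrite addr_eq0 h mulr0.
  by rewrite addNr eqxx mulr1 opprK mulrC chN.
have := @csum_exhaust _ _ (fun k => (vh (- k) * ch k b) * (k + m == 0)%:R) zset zset_exhaust.
move=> /(_ _)/wrap[].
  apply: (@summ_le_r _ _ _ (fun k => nrm (vh (- k)))) => // k.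
  by rewrite !nrmM nrm_ch mulr1; case: eqP => _; rewrite ?nrm1 ?nrm0 ?mulr1 ?mulr0 ?nrm_ge0.
apply: clim_near_eq; near=> j.
rewrite (cI_sum (zset j) (fun k => (i2 k).1)).2; apply: eq_bigr => k _.
by rewrite (i2 k).2 cI_ch.
Unshelve. all: by end_near. Qed.

End TrigSeries.

Variables (v : plane -> R[i]) (C g : R).
Hypotheses (g0 : 0 < g) (vc : ccont v) (vd : forall x, nrm (v x) <= C * expR (- g * norm2 x)).
Let vh m := cI (fun x => v x * ch m x).
Hypothesis vs : summ vh.

Let C0 : 0 <= C.
Proof. by have := le_trans (nrm_ge0 _) (vd 0); rewrite norm2_0 mulr0 expR0 mulr1. Qed.

Let det1n : \det (1%:M : 'M[R]_2) != 0. Proof. by rewrite det1 oner_eq0. Qed.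

Lemma per_rsm (xi : plane) : rsm (fun n => C * expR (- g * norm2 (xi + zv n))).
Proof.
apply: rsmZ; have := @lattice_rsm R g 1%:M xi g0 det1n.
by under eq_fun do rewrite mul1mx.
Qed.

Lemma per_bnd : exists2 B, 0 <= B & forall x, (asum (fun n => v (x + zv n)%R) <= B%:E)%E.
Proof.
have [B B0 hB] := @lattice_sum R g 1%:M g0 det1n.
exists (C * B); first by rewrite mulr_ge0.
move=> x; apply: (@le_trans _ _ (\esum_(n in [set: Z2]) (C * expR (- g * norm2 (x + zv n)))%:E)%E).
  by apply: le_esum => n _; rewrite lee_fin.
rewrite esumZl// EFinM lee_pmul ?lee_fin ?esum_ge0//.
by have := hB x; under eq_esum do rewrite mul1mx.
Qed.

Let P x := csum (fun n => v (x + zv n)).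

(** Moving x by less than 1 changes the exponential majorant by at most the factor exp g, so the
    series is dominated uniformly near x. *)
Lemma per_cont : ccont P.
Proof.
apply: (@ccont_csum _ (fun n x => v (x + zv n)) (fun x n => expR g * (C * expR (- g * norm2 (x + zv n))))).
- by move=> n; exact: ccont_shift.
- by move=> x; apply: rsmZ; exact: per_rsm.
move=> x; apply: filterS (near_norm2 x ltr01) => y yx n.
apply: (le_trans (vd _)); rewrite mulrCA ler_wpM2l// -expRD ler_expR.
have : norm2 (x + zv n) <= norm2 (y + zv n) + norm2 (x - y).
  by rewrite (_ : x + zv n = (y + zv n) + (x - y)) ?norm2D//; apply: plane_eq; rewrite !mxE; ring.
rewrite -[norm2 (x - y)]norm2N opprB => h.
have : g * norm2 (x + zv n) <= g * (norm2 (y + zv n) + 1) by rewrite ler_pM2l//; lra.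
lra.
Qed.

Lemma per_fourier b m : cI (fun x => icell x * (P (x + b) * ch m x)) = ch m (- b) * vh m.
Proof.
have [B B0 hB] := per_bnd.
have i1 : cint (fun x => v x * ch m x).
  apply: (@cint_exp _ _ C g) => //.
    by apply: cmeasM; [exact: cmeas_cont|exact: cmeas_ch].
  by move=> x; rewrite nrmM nrm_ch mulr1.
have [i2 e2] := cI_shift b i1.
have [i3 e3] := cI_Z (ch m (- b)) i2.
rewrite /vh -e2 -e3.
have HE x : ch m (- b) * (v (x + b) * ch m (x + b)) = v (x + b) * ch m x.
  have K : ch m b * ch m (- b) = 1 by rewrite -chD subrr ch_0.
  rewrite chD (_ : _ * (_ * _) = v (x + b) * ch m x * (ch m b * ch m (- b))); last by ring.
  by rewrite K mulr1.
have EF := funext HE; rewrite EF in i3 *.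
rewrite (@cI_unfold _ _ B i3).
  congr cI; apply/funext => x; congr (_ * _); rewrite /P mulrC -csumZ; last first.
    by apply: le_lt_trans (hB _) _; exact: ltry.
  by congr csum; apply/funext => n; rewrite chDz mulrC addrAC.
move=> x; apply: le_trans (hB (x + b)); apply: asum_le => n.
by rewrite nrmM nrm_ch mulr1 addrAC.
Qed.

(** The periodisation of v and the series [trig] are continuous with the same Fourier coefficients.
    Their difference, translated so that 0 goes to the centre of the cell, vanishes there; this is
    the formula. *)
Theorem poisson : csum (fun n => v (zv n)) = csum vh.
Proof.
have [B B0 hB] := per_bnd.
pose D (x : plane) := P (x + - ctr) + -1 * trig vh (x + - ctr).
have PB x : nrm (P x) <= B by exact: nrm_csum_le.
set V := rsum (fun m => nrm (vh (- m))).
have cP := ccont_shift (- ctr) per_cont; have cE := ccont_shift (- ctr) (dual_cont vs).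
have cD : ccont D.
  move=> x; apply: (@climD _ _ _ (nbhs_filter x)); first exact: cP.
  by apply: (@climZ _ _ _ (nbhs_filter x)); exact: cE.
have DB x : nrm (D x) <= B + V.
  by rewrite (le_trans (nrmD _ _))// lerD// nrmM nrmN nrm1 mul1r dual_bnd.
have : D ctr = 0.
  apply: (annih_ctr cD DB); split; [exact: cmeas_cst|by exists 1 => x; rewrite nrm1|].
  move=> m.
  have i1 : cint (fun x => icell x * (P (x + - ctr) * ch m x)).
    apply: (@cint_icell _ _ B) => [|x _]; last by rewrite nrmM nrm_ch mulr1.
    by apply: cmeasM; [exact: cmeas_cont|exact: cmeas_ch].
  have i2 : cint (fun x => icell x * (trig vh (x + - ctr) * ch m x)).
    apply: (@cint_icell _ _ V) => [|x _]; last by rewrite nrmM nrm_ch mulr1 dual_bnd.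
    by apply: cmeasM; [exact: cmeas_cont|exact: cmeas_ch].
  have [i3 e3] := cI_Z (-1) i2.
  rewrite (_ : (fun x => _) = fun x => icell x * (P (x + - ctr) * ch m x) + -1 * (icell x * (trig vh (x + - ctr) * ch m x))); last first.
    by apply/funext => x; rewrite /D; ring.
  by rewrite (cI_D i1 i3) e3 per_fourier (dual_fourier vs) mulN1r subrr.
rewrite /D subrr mulN1r => /eqP; rewrite subr_eq0 => /eqP.
rewrite /P /trig; under eq_fun do rewrite add0r; move=> ->.
by under eq_fun do rewrite ch_0 mulr1; exact: (csum_reindex vh oppz_bij).
Qed.

End Poisson.

(** * The twisted lattices *)

Section Lattices.
Context {R : realType}.
Local Notation plane := 'cV[R]_2.
Local Notation lam2 := (@lebesgue_measure R \x @lebesgue_measure R)%E.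
Variable theta : layer -> R.

Lemma latc_gt0 : 0 < latc :> R.
Proof. by rewrite /latc mulr_gt0 ?divr_gt0 ?ltr0n// sqrtr_gt0 ltr0n. Qed.

Lemma det_mxA_neq0 : \det (mxA : 'M[R]_2) != 0.
Proof.
rewrite det22 !mxE /= mulr0 mulr0 subr0.
have := latc_gt0; have : 0 < Num.sqrt (3 : R) by rewrite sqrtr_gt0 ltr0n.
by move=> h1 h2; rewrite !mulf_neq0 ?invr_eq0 ?gt_eqF.
Qed.

Lemma det_rot (t : R) : \det (rotmx t) = 1.
Proof. by rewrite det22 !mxE /= mulNr opprK -!expr2 cos2Dsin2. Qed.

Lemma det_mxAj j : \det (mxAj theta j) = \det (mxA : 'M[R]_2).
Proof. by rewrite det_mulmx det_rot mul1r. Qed.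

Lemma mxA_unit : (mxA : 'M[R]_2) \in unitmx.
Proof. by rewrite unitmxE unitfE det_mxA_neq0. Qed.

Lemma det_mxB : \det (mxB : 'M[R]_2) = 4 * pi ^+ 2 / \det (mxA : 'M[R]_2).
Proof. by rewrite /mxB detZ det_tr det_inv exprMn; congr (_ * _ / _); rewrite -natrX. Qed.

Lemma det_mxB_neq0 : \det (mxB : 'M[R]_2) != 0.
Proof.
by rewrite det_mxB !mulf_neq0 ?invr_eq0 ?det_mxA_neq0 ?expf_neq0 ?gt_eqF ?pi_gt0.
Qed.

Lemma det_mxBj j : \det (mxBj theta j) = \det (mxB : 'M[R]_2).
Proof. by rewrite det_mulmx det_rot mul1r. Qed.

Lemma dot_tr (M : 'M[R]_2) (u v : plane) : dot (M^T *m u) v = dot u (M *m v).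
Proof. by rewrite !dotE !mulmx2E !mxE; ring. Qed.

Lemma dot_rot t (u v : plane) : dot (rotmx t *m u) (rotmx t *m v) = dot u v.
Proof.
rewrite !dotE !mulmx2E !mxE /=; have := cos2Dsin2 t => h.
transitivity ((cos t ^+ 2 + sin t ^+ 2) * (u 0 0 * v 0 0 + u 1 0 * v 1 0)); first by ring.
by rewrite h mul1r.
Qed.

(** B is 2 pi times the inverse transpose of A, and the common rotation preserves the scalar
    product. *)
Lemma dual j (u w : plane) : dot (mxBj theta j *m u) (mxAj theta j *m w) = 2 * pi * dot u w.
Proof.
rewrite /mxBj /mxAj -!mulmxA dot_rot /mxB -scalemxAl.
have dotZl c (x y : plane) : dot (c *: x) y = c * dot x y by rewrite !dotE !mxE; ring.
by rewrite dotZl dot_tr mulKmx// mxA_unit.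
Qed.

Lemma norm2_lat j n : norm2 (lat theta j n) = norm2 ((mxA : 'M[R]_2) *m zv n).
Proof. by rewrite /lat /latvec /mxAj -mulmxA norm2_rot. Qed.

Lemma norm2_rlat j n : norm2 (rlat theta j n) = norm2 ((mxB : 'M[R]_2) *m zv n).
Proof. by rewrite /rlat /latvec /mxBj -mulmxA norm2_rot. Qed.

Lemma latE j n : lat theta j n = mxAj theta j *m zv n. Proof. by []. Qed.
Lemma rlatE j n : rlat theta j n = mxBj theta j *m zv n. Proof. by []. Qed.

Lemma latD j m n : lat theta j (m + n) = lat theta j m + lat theta j n.
Proof. by rewrite !latE zvD mulmxDr. Qed.
Lemma latN j m : lat theta j (- m) = - lat theta j m.
Proof. by rewrite !latE zvN mulmxN. Qed.
Lemma lat0 j : lat theta j 0 = 0.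
Proof. by rewrite latE zv0 mulmx0. Qed.
Lemma rlatD j m n : rlat theta j (m + n) = rlat theta j m + rlat theta j n.
Proof. by rewrite !rlatE zvD mulmxDr. Qed.
Lemma rlatN j m : rlat theta j (- m) = - rlat theta j m.
Proof. by rewrite !rlatE zvN mulmxN. Qed.
Lemma rlat0 j : rlat theta j 0 = 0.
Proof. by rewrite rlatE zv0 mulmx0. Qed.

Lemma zv_eq0 (n : Z2) : zv n = 0 :> plane -> n = 0.
Proof.
move=> h; apply/matrixP => i j; rewrite ord1 mxE; apply/eqP.
by rewrite -(@intr_eq0 R); have := congr1 (fun u : plane => u i 0) h; rewrite !mxE => ->.
Qed.

Lemma latvec_eq0 (M : 'M[R]_2) n : \det M != 0 -> M *m zv n = 0 -> n = 0.
Proof.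
move=> d h; apply: zv_eq0; have MU : M \in unitmx by rewrite unitmxE unitfE.
by rewrite -(mulKmx MU (zv n)) h mulmx0.
Qed.

Lemma dual_int j (m n : Z2) : dot (rlat theta j m) (lat theta j n) = 2 * pi * dot (zv m) (zv n : plane).
Proof. exact: dual. Qed.

Lemma rcellE j : rcell theta j = [set x | cellb (invmx (mxBj theta j) *m x)].
Proof.
have BU : mxBj theta j \in unitmx by rewrite unitmxE unitfE det_mxBj det_mxB_neq0.
apply/seteqP; split => [x [u hu <-]|x hx] /=.
  by rewrite mulKmx// /cellb !hu.
exists (invmx (mxBj theta j) *m x); last by rewrite mulKVmx.
by move=> i; move/andP : hx => [h0 h1]; have [->|->] := ord2 i.
Qed.

Lemma cintegral2_mask (D : set plane) (P : plane -> bool) f : (D = [set x | P x]) ->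
  cintegral2 D f = cI (fun x => ((P x)%:R : R[i]) * f x).
Proof.
move=> ->; rewrite /cI /cintegral2 preimage_setT.
have E (u : plane -> R[i]) (pr : R[i] -> R) (g : R * R -> \bar R) :
    g = (fun z => (pr (((P (vec z))%:R : R[i]) * u (vec z)))%:E) ->
    (forall z, pr (((P (vec z))%:R : R[i]) * u (vec z)) = if P (vec z) then pr (u (vec z)) else 0) ->
    (\int[lam2]_(x in vec @^-1` [set x | P x]) (pr (u (vec x)))%:E = \int[lam2]_x g x)%E.
  move=> -> h; rewrite integral_mkcond; apply: eq_integral => z _; rewrite h patchE.
  by case: (boolP (P (vec z))) => pz; [rewrite mem_set|rewrite memNset//; exact/negP].
by congr (fine _ +i* fine _); apply: (E f) => // z; case: (P _); rewrite ?mul1r ?mul0r.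
Qed.

Lemma cintegral2_rcell j f : cintegral2 (rcell theta j) f =
  cI (fun x => icell (invmx (mxBj theta j) *m x) * f x).
Proof. exact: cintegral2_mask (rcellE j). Qed.

Let invB j : \det (invmx (mxBj theta j)) != 0.
Proof. by rewrite det_inv invr_eq0 det_mxBj det_mxB_neq0. Qed.

Lemma cI_rcell j f : cint (fun x => icell x * f (mxBj theta j *m x)) ->
  cintegral2 (rcell theta j) f = (`|\det (mxB : 'M[R]_2)|)%:C * cI (fun x => icell x * f (mxBj theta j *m x)).
Proof.
move=> fi; rewrite cintegral2_rcell.
have BU : mxBj theta j \in unitmx by rewrite unitmxE unitfE det_mxBj det_mxB_neq0.
have [_] := cI_affine 0 (invB j) fi.
under [X in cI X = _ -> _]eq_fun do rewrite addr0 mulKVmx//.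
by move=> ->; rewrite det_inv det_mxBj normfV invrK.
Qed.

Lemma area_rcell j : area (rcell theta j) = `|\det (mxB : 'M[R]_2)|.
Proof.
have i1 : cint (fun x : plane => icell x * 1).
  by apply: (@cint_icell _ _ 1) => [|x _]; [exact: cmeas_cst|rewrite nrm1].
have [i2 _] := cI_affine 0 (invB j) i1.
have := @cI_rcell j (fun=> 1) i1.
under [X in _ = _ * cI X -> _]eq_fun do rewrite mulr1.
rewrite cI_icell mulr1 /cintegral2 => /(congr1 (@complex.Re R)) /= <-.
have mD : measurable (vec @^-1` rcell theta j : set (measurableTypeR R * measurableTypeR R)).
  rewrite (_ : _ @^-1` _ = setT `&` (fun z => complex.Re (icell (invmx (mxBj theta j) *m vec z + 0))) @^-1` [set 1]).
    exact: (cmeas_affine _ 0 (@cmeas_icell R)).1 measurableT _ (measurable_set1 1).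
  apply/seteqP; rewrite rcellE; split => z /=; rewrite addr0 icell_real /=; first by move=> ->.
  by case: cellb => // -[_ /esym/eqP]; rewrite oner_eq0.
by rewrite /area integral_cst//= mul1e.
Qed.

Lemma cstarM j k : cstar theta j * cstar theta k = `|\det (mxB : 'M[R]_2)|.
Proof. by rewrite /cstar !area_rcell -expr2 sqr_sqrtr. Qed.

End Lattices.

(** * Averages over balls and equidistribution *)

Section Averages.
Context {R : realType}.

Lemma esum_inj (I J : choiceType) (e : I -> J) (a : J -> \bar R) : injective e ->
  (forall j, (forall i, e i != j) -> a j = 0%E) ->
  (\esum_(j in [set: J]) a j = \esum_(i in [set: I]) a (e i))%E.
Proof.
move=> ie a0; rewrite -(@reindex_esum R I J setT (range e) e a); last first.
  by split; [move=> i _; exists i|move=> x y _ _; exact: ie|move=> j].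
rewrite [RHS]esum_mkcond; apply: eq_esum => j _; case: ifPn => // /negP jr.
by rewrite a0// => i; apply/eqP => ij; apply: jr; rewrite inE; exists i.
Qed.

Lemma asum_inj (I J : choiceType) (e : I -> J) (f : J -> R[i]) : injective e ->
  (forall j, (forall i, e i != j) -> f j = 0) -> asum f = asum (fun i => f (e i)).
Proof. by move=> ie f0; apply: esum_inj => // j /f0 ->; rewrite nrm0. Qed.

Lemma csum_inj (I J : choiceType) (e : I -> J) (f : J -> R[i]) : injective e ->
  (forall j, (forall i, e i != j) -> f j = 0) -> csum f = csum (fun i => f (e i)).
Proof.
move=> ie f0; have key (g : R[i] -> R) : g 0 = 0 ->
    (\esum_(j in [set: J]) (g (f j))%:E = \esum_(i in [set: I]) (g (f (e i)))%:E)%E.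
  by move=> g0; apply: (@esum_inj _ _ e (fun j => (g (f j))%:E)) => // j /f0 ->; rewrite g0.
rewrite /csum /rsum; congr ((fine _ - fine _) +i* (fine _ - fine _)).
- by apply: (key (fun z => Num.max (complex.Re z) 0)); rewrite /= maxxx.
- by apply: (key (fun z => Num.max (- complex.Re z) 0)); rewrite /= oppr0 maxxx.
- by apply: (key (fun z => Num.max (complex.Im z) 0)); rewrite /= maxxx.
- by apply: (key (fun z => Num.max (- complex.Im z) 0)); rewrite /= oppr0 maxxx.
Qed.

Definition avgF {X : choiceType} (B : {fset X}) (g : X -> R[i]) : R[i] :=
  (#|` B|%:R)^-1 * \sum_(x <- B) g x.

Lemma sum_fset_csum {X : choiceType} (B : {fset X}) (g : X -> R[i]) :
  \sum_(x <- B) g x = csum (fun x => (x \in B)%:R * g x).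
Proof.
rewrite (@csum_fsbig _ _ _ B); last by move=> x /negbTE ->; rewrite mul0r.
by rewrite big_seq [RHS]big_seq; apply: eq_bigr => x ->; rewrite mul1r.
Qed.

Lemma sum_fset1 {X : choiceType} (B : {fset X}) : \sum_(x <- B) (1 : R[i]) = #|` B|%:R.
Proof. by rewrite big_const_seq count_predT iter_addr_0. Qed.

Lemma summ_fset {X : choiceType} (B : {fset X}) (g : X -> R[i]) : summ (fun x => (x \in B)%:R * g x).
Proof.
rewrite /summ /asum (esumID [set` B]); last by move=> *; rewrite lee_fin nrm_ge0.
rewrite !setTI [X in (_ + X)%E]esum1 ?adde0; last first.
  by move=> i /= /negP/negbTE ->; rewrite mul0r nrm0.
rewrite esum_fset//; last by move=> *; rewrite lee_fin nrm_ge0.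
by rewrite fsbig_finite//= set_fsetK sumEFin ltry.
Qed.

Lemma set_average_fset {X : choiceType} (A : R -> set X) (f : X -> R[i]) r (F : {fset X}) :
  A r = [set` F] -> set_average A f r = avgF F f.
Proof. by move=> E; rewrite /set_average E fsbig_finite//= set_fsetK. Qed.

Section Sectors.
Variables (X W : choiceType) (S : finType) (e : X * S -> W).
Hypothesis be : bijective e.
Variables (A : R -> set W) (B : R -> {fset X}).
Hypothesis AB : forall r x s, A r (e (x, s)) <-> x \in B r.

Lemma sector_finite r : A r = [set` [fset e p | p in (B r `*` [fset s in enum S])%fset]%fset].
Proof.
have [g ge eg] := be.
apply/seteqP; split => [w Aw|w] /=.
  apply/imfsetP; exists (g w); last by rewrite eg.
  rewrite /= in_fsetM !inE /= mem_enum andbT; apply/(AB r _ (g w).2).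
  by rewrite -surjective_pairing eg.
by case/imfsetP => -[x s] /=; rewrite in_fsetM => /andP[/= xB _] ->; exact/AB.
Qed.

Lemma sector_sum r (f : W -> R[i]) (F : {fset W}) : A r = [set` F] ->
  \sum_(w <- F) f w = \sum_(s : S) \sum_(x <- B r) f (e (x, s)).
Proof.
move=> AF; rewrite sum_fset_csum -(csum_reindex _ be).
have memF x s : (e (x, s) \in F) = (x \in B r).
  apply/idP/idP => h; first by apply/(AB r x s); rewrite AF.
  by have /(AB r x s) := h; rewrite AF.
have E : (fun p => (e p \in F)%:R * f (e p)) = (fun p : X * S => (p.1 \in B r)%:R * f (e p)).
  by apply/funext => -[x s]; rewrite memF.
rewrite E csum_pair; last first.
  move/(summ_reindex (fun w => (w \in F)%:R * f w) be) : (summ_fset F f).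
  by rewrite E.
rewrite exchange_big /= sum_fset_csum; congr csum; apply/funext => x.
by rewrite csum_fintype mulr_sumr.
Qed.

(** Each sector meets A r in a copy of the same set B r, so all sectors have equal weight. For an
    empty B r both sides are 0, the inverse of 0 being 0. *)
Lemma sector_average r (f : W -> R[i]) :
  set_average A f r = (#|S|%:R)^-1 * \sum_(s : S) avgF (B r) (fun x => f (e (x, s))).
Proof.
have AF := sector_finite r; rewrite (set_average_fset f AF) /avgF (sector_sum _ AF).
have c1 := @sector_sum r (fun=> 1) _ AF.
rewrite -sum_fset1 c1 -mulr_sumr mulrA; congr (_ * _).
by rewrite sum_fset1 sumr_const -[_ *+ _]mulr_natl invfM.
Qed.

End Sectors.

Lemma avgF_nrm {X : choiceType} (B : {fset X}) (g : X -> R[i]) (M : R) : 0 <= M ->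
  (forall x, nrm (g x) <= M) -> nrm (avgF B g) <= M.
Proof.
move=> M0 gM; rewrite /avgF.
have [b0|b0] := posnP (#|` B|); first by rewrite b0 invr0 mul0r nrm0.
have bR : 0 < #|` B|%:R :> R by rewrite ltr0n.
have E : (#|` B|%:R : R[i])^-1 = ((#|` B|%:R : R)^-1)%:C by rewrite rmorphV ?unitfE ?gt_eqF// rmorph_nat.
rewrite E nrmM nrm_real ger0_norm ?invr_ge0 ?ler0n// ler_pdivrMl//.
rewrite (le_trans (nrm_sum _ _ _))// (le_trans (ler_sum _ (fun x _ => gM x)))//.
by rewrite big_const_seq count_predT iter_addr_0 -[M *+ _]mulr_natl.
Qed.

Lemma avgF_csum {X I : choiceType} (B : {fset X}) (g : X -> I -> R[i]) :
  (forall x, summ (g x)) -> avgF B (fun x => csum (g x)) = csum (fun i => avgF B (g ^~ i)).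
Proof.
move=> sg; rewrite /avgF -csum_bigsum//; first by rewrite csumZ//; exact: summ_bigsum.
Qed.

Lemma avgF_cst {X : choiceType} (B : {fset X}) (c : R[i]) : (0 < #|` B|)%N -> avgF B (fun=> c) = c.
Proof.
move=> b0; rewrite /avgF big_const_seq count_predT iter_addr_0 -[c *+ _]mulr_natl mulKf//.
by rewrite pnatr_eq0 -lt0n.
Qed.

(* Moving [B] by [sigma] changes the sum only on the boundary, and multiplies it
   by [z] as well. *)
Lemma shift_bound {X : choiceType} (B : {fset X}) (sg : X -> X) (chi : X -> R[i]) (z : R[i]) (L : nat) :
  injective sg -> (forall x, nrm (chi x) <= 1) -> (forall x, chi (sg x) = z * chi x) ->
  (#|` [fset x in B | sg x \notin B]%fset| <= L)%N ->
  nrm (z - 1) * nrm (\sum_(x <- B) chi x) <= 2 * L%:R.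
Proof.
move=> isg chi1 hchi hL.
pose D1 := [fset x in B | sg x \notin B]%fset.
pose C1 := [fset x in B | sg x \in B]%fset.
pose C2 := [fset sg x | x in C1]%fset.
have sC2 : (C2 `<=` B)%fset.
  by apply/fsubsetP => y /imfsetP[x /=]; rewrite !inE /= => /andP[_ h] ->.
have sC1 : (C1 `<=` B)%fset by apply/fsubsetP => x; rewrite !inE /= => /andP[].
have D1E : D1 = (B `\` C1)%fset.
  by apply/fsetP => x; rewrite !inE /=; case: (x \in B); case: (sg x \in B).
have cE : #|` C2| = #|` C1| by rewrite card_imfset.
have cD : (#|` B `\` C2|)%fset = #|` D1| by rewrite D1E !cardfsDS// cE.
have sp (A : {fset X}) (u : X -> R[i]) : (A `<=` B)%fset -> \sum_(x <- B) u x = \sum_(x <- A) u x + \sum_(x <- (B `\` A)%fset) u x.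
  move=> AB; rewrite !sum_fset_csum -csumD; [|exact: summ_fset..].
  congr csum; apply/funext => x; rewrite -mulrDl !inE; congr (_ * _).
  by case: (boolP (x \in A)) => xA /=; rewrite ?(fsubsetP AB _ xA) ?addr0 ?add0r.
(* Multiplication by z moves the sum along sg: the points of B that stay in B give the sum over
   their images C2, the others remain as a boundary term over D1. *)
have e1 : z * \sum_(x <- B) chi x = \sum_(x <- C2) chi x + \sum_(x <- D1) z * chi x.
  rewrite mulr_sumr (sp C1)// D1E; congr (_ + _).
  have memC x : (sg x \in C2) = (x \in C1).
    by apply/imfsetP/idP => [[y yC /isg ->]//|xC]; exists x.
  have -> : \sum_(x <- C2) chi x = \sum_(x <- C1) chi (sg x).
    rewrite !sum_fset_csum (csum_inj isg); first by congr csum; apply/funext => x; rewrite memC.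
    move=> y yn; case: (boolP (y \in C2)) => yC; last by rewrite mul0r.
    by have /imfsetP[x _ yx] := yC; have := yn x; rewrite yx eqxx.
  by apply: eq_bigr => x _; rewrite hchi.
have e2 : (z - 1) * \sum_(x <- B) chi x = \sum_(x <- D1) z * chi x - \sum_(x <- (B `\` C2)%fset) chi x.
  by rewrite mulrBl mul1r e1 (sp C2 chi sC2); ring.
have bd (A : {fset X}) (u : X -> R[i]) : (forall x, nrm (u x) <= 1) -> nrm (\sum_(x <- A) u x) <= #|` A|%:R.
  move=> u1; rewrite (le_trans (nrm_sum _ _ _))// (le_trans (ler_sum _ (fun x _ => u1 x)))//.
  by rewrite big_const_seq count_predT iter_addr_0.
rewrite -nrmM e2 (le_trans (nrmB _ _))//.
have LR : #|` D1|%:R <= L%:R :> R by rewrite ler_nat.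
have zc x : nrm (z * chi x) <= 1 by rewrite -hchi.
have := bd D1 _ zc; have := bd (B `\` C2)%fset chi chi1; rewrite cD; lra.
Qed.

(** Boundary points are counted by the lines that carry them: p plays the projection along sg, and a
    line leaves a convex set once. *)
Lemma boundary_card (X L : choiceType) (B : {fset X}) (Lb : {fset L}) (p : X -> L) (sg : X -> X) :
  (forall x, x \in B -> p x \in Lb) ->
  (forall x y, x \in B -> y \in B -> sg x \notin B -> sg y \notin B -> p x = p y -> x = y) ->
  (#|` [fset x in B | sg x \notin B]%fset| <= #|` Lb|)%N.
Proof.
move=> pB inj; set D := [fset x in B | sg x \notin B]%fset.
have iD : {in D &, injective p}.
  by move=> x y; rewrite !inE /= => /andP[xB sx] /andP[yB sy]; exact: inj.
have := fsubset_leq_card (_ : ([fset p x | x in D] `<=` Lb)%fset).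
rewrite (eqP (introT (card_in_imfsetP p D) iD)); apply.
by apply/fsubsetP => l /imfsetP[x /=]; rewrite !inE => /andP[xB _] ->; exact: pB.
Qed.

Lemma card_iota m : #|` [fset i in iota 0 m]%fset| = m.
Proof. by rewrite card_fseq undup_id ?iota_uniq// size_iota. Qed.

Lemma mem_fiota m k : (k \in [fset i in iota 0 m]%fset) = (k < m)%N.
Proof. by rewrite inE /= mem_iota add0n. Qed.

Definition ibox (N : nat) : {fset int} := [fset (Posz i - Posz N)%R | i in [fset i in iota 0 (2 * N).+1]]%fset.

Lemma mem_ibox N (k : int) : `|k%:~R| <= N%:R :> R -> k \in ibox N.
Proof.
move=> h; have hk : (`|k| <= N%:Z)%R by rewrite -(ler_int R) intr_norm.
apply/imfsetP; exists `|(k + N%:Z)%R|%N; last by rewrite /=; lia.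
have : (`|(k + N%:Z)%R| < (2 * N).+1)%N by lia.
by rewrite -mem_fiota.
Qed.

Lemma card_ibox N : (#|` ibox N| <= (2 * N).+1)%N.
Proof. by rewrite (leq_trans (leq_imfset_card _ _ _))//; rewrite -[X in (_ <= X)%N]card_iota. Qed.

Lemma card_fsetM (X Y : choiceType) (A : {fset X}) (B : {fset Y}) :
  #|` (A `*` B)%fset| = (#|` A| * #|` B|)%N.
Proof.
apply/eqP; rewrite -(eqr_nat R[i]) natrM -!sum_fset1 (sum_fset_csum (A `*` B)%fset).
rewrite csum_pair; last exact: summ_fset.
rewrite mulr_suml (sum_fset_csum A); apply/eqP; congr csum; apply/funext => x.
rewrite mul1r sum_fset_csum -csumZ; last exact: summ_fset.
by congr csum; apply/funext => y; rewrite in_fsetM /= !mulr1 -natrM mulnb.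
Qed.

End Averages.

(** * Lattice points of balls *)

Section Balls.
Context {R : realType}.
Local Notation plane := 'cV[R]_2.
Variable M : 'M[R]_2.
Hypothesis dM : \det M != 0.

Lemma norm2Z (c : R) (u : plane) : norm2 (c *: u) = `|c| * norm2 u.
Proof.
have -> : norm2 (c *: u) = Num.sqrt (c ^+ 2 * dot u u).
  by rewrite /norm2 !dotE !mxE; congr Num.sqrt; ring.
by rewrite sqrtrM ?sqr_ge0// sqrtr_sqr.
Qed.

Lemma norm2_mul_le : exists2 L : R, 0 < L & forall u, norm2 (M *m u) <= L * (`|u 0 0| + `|u 1 0|).
Proof.
exists (`|M 0 0| + `|M 0 1| + `|M 1 0| + `|M 1 1| + 1) => [|u].
  by rewrite ltr_wpDl// !addr_ge0.
rewrite (le_trans (norm2_le_coord _))// !mulmx2E.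
have h i : `|M i 0 * u 0 0 + M i 1 * u 1 0| <= `|M i 0| * `|u 0 0| + `|M i 1| * `|u 1 0|.
  by rewrite (le_trans (ler_normD _ _))// !normrM.
have := h 0; have := h 1.
have p i j k : 0 <= `|M i j| * `|u k 0| by rewrite mulr_ge0.
have := p 0 0 0; have := p 0 0 1; have := p 0 1 0; have := p 0 1 1.
have := p 1 0 0; have := p 1 0 1; have := p 1 1 0; have := p 1 1 1.
have := normr_ge0 (u 0 0); have := normr_ge0 (u 1 0); nra.
Qed.

Lemma zb_finite r : finite_set [set n : Z2 | norm2 (M *m zv n) < r].
Proof.
have [c c0 hc] := coord_le_mul dM.
pose N := (Num.truncn (`|r| / c)).+1.
apply: (@sub_finite_set _ _ [set` [fset zpair p | p in (ibox N `*` ibox N)%fset]%fset]) => // n /= hn.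
have h i : n i 0 \in ibox N.
  apply: (@mem_ibox R); have := hc (zv n) i; rewrite mxE => h.
  apply: (@le_trans _ _ (`|r| / c)); last by rewrite ltW// truncnS_gt// divr_ge0// ltW.
  by rewrite ler_pdivlMr// mulrC (le_trans h)// (le_trans (ltW hn))// ler_norm.
apply/imfsetP; exists (n 0 0, n 1 0); first by rewrite /= in_fsetM /= !h.
by apply/matrixP => i j; rewrite ord1 mxE; have [->|->] := ord2 i.
Qed.

Definition zb (r : R) : {fset Z2} := fset_set [set n : Z2 | norm2 (M *m zv n) < r].

Lemma mem_zb r n : (n \in zb r) = (norm2 (M *m zv n) < r).
Proof. by rewrite in_fset_set ?inE//=; [apply/idP/idP; rewrite inE|exact: zb_finite]. Qed.

Lemma zb_coord : exists2 C : R, 0 < C & forall r n i, 1 <= r -> n \in zb r -> n i 0 \in ibox (Num.truncn (C * r)).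
Proof.
have [c c0 hc] := coord_le_mul dM.
exists (c^-1 + 1); first by rewrite addr_gt0// invr_gt0.
move=> r n i r1; rewrite mem_zb => hn; apply: (@mem_ibox R).
have r0 : 0 < r by lra.
have h := hc (zv n) i; rewrite mxE in h.
have h2 : `|(n i 0)%:~R| <= c^-1 * r :> R.
  by rewrite mulrC ler_pdivlMr// mulrC (le_trans h)// ltW.
apply: (le_trans h2).
have := truncnS_gt ((c^-1 + 1) * r); rewrite -natr1; lra.
Qed.

Lemma zb_lower : exists2 k : R, 0 < k & forall r, 0 < r -> k * r ^+ 2 <= #|` zb r|%:R.
Proof.
have [L L0 hL] := norm2_mul_le.
exists ((4 * L)^-1 ^+ 2); first by rewrite exprn_gt0// invr_gt0 mulr_gt0.
(* Integer points with both coordinates in [0, x] have an image of norm at most 2 L x = r / 2, and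
   there are at least x^2 of them. *)
move=> r r0; pose x := r / (4 * L).
have x0 : 0 < x by rewrite divr_gt0// mulr_gt0.
have [m mx mle] : exists2 m : nat, x < m%:R & forall q : nat, (q < m)%N -> q%:R <= x.
  exists (Num.truncn x).+1; first exact: truncnS_gt.
  by move=> q; rewrite ltnS truncn_ge_nat ?(ltW x0).
pose e (p : nat * nat) : Z2 := zpair (Posz p.1, Posz p.2).
have ie : injective e.
  move=> [a b] [c d] /matrixP h; have := h 0 0; have := h 1 0; rewrite !mxE /=.
  by move=> [->] [->].
pose F := [fset e p | p in ([fset i in iota 0 m] `*` [fset i in iota 0 m])%fset]%fset.
have cF : #|` F| = (m * m)%N.
  by rewrite (card_imfset _ _ ie) (@card_fsetM R) !card_iota.
have sF : (F `<=` zb r)%fset.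
  apply/fsubsetP => n /imfsetP[[a b]] /=; rewrite in_fsetM /= !mem_fiota => /andP[am bm] ->.
  rewrite mem_zb (le_lt_trans (hL _))// !mxE /=.
  have ux (q : nat) : (q < m)%N -> `|(Posz q)%:~R| <= x :> R.
    by move=> /mle h; rewrite ger0_norm.
  have := ux a am; have := ux b bm => hb ha.
  apply: (@le_lt_trans _ _ (L * (x + x))); first by rewrite ler_wpM2l ?(ltW L0)// lerD.
  have -> : L * (x + x) = r / 2 by rewrite /x; field; rewrite gt_eqF.
  lra.
apply: (@le_trans _ _ (#|` F|%:R)); last by rewrite ler_nat fsubset_leq_card.
rewrite cF natrM -exprMn mulrC -/x expr2 ler_pM ?(ltW x0) ?(ltW mx)//.
Qed.

Lemma zb_upper : exists2 K : R, 0 < K & forall r, 1 <= r -> #|` zb r|%:R <= K * r ^+ 2.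
Proof.
have [C C0 hC] := zb_coord.
exists ((2 * C + 1) ^+ 2); first by rewrite exprn_gt0//; lra.
move=> r r1; pose N := Num.truncn (C * r).
have sB : (zb r `<=` [fset zpair p | p in (ibox N `*` ibox N)%fset])%fset.
  apply/fsubsetP => n hn; apply/imfsetP; exists (n 0 0, n 1 0); first by rewrite /= in_fsetM /= !hC.
  by apply/matrixP => i j; rewrite ord1 mxE; have [->|->] := ord2 i.
have c1 : (#|` zb r| <= (2 * N).+1 * (2 * N).+1)%N.
  apply: (leq_trans (fsubset_leq_card sB)); apply: (leq_trans (leq_imfset_card _ _ _)) => /=.
  by rewrite (@card_fsetM R) leq_mul// card_ibox.
apply: (@le_trans _ _ (((2 * N).+1 * (2 * N).+1)%:R)); first by rewrite ler_nat.
have Nr : N%:R <= C * r by rewrite truncn_le// mulr_ge0//; lra.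
have h : (2 * N).+1%:R <= (2 * C + 1) * r by rewrite -natr1 natrM; lra.
by rewrite natrM -exprMn expr2 ler_pM.
Qed.

Definition unitz (i : 'I_2) : Z2 := \col_k (k == i)%:Z.

(* The ball is convex, so it meets every line along [unitz i] in an interval. *)
Lemma zb_convex r n (k : nat) i : n \in zb r -> n + unitz i *+ k.+1 \in zb r -> n + unitz i \in zb r.
Proof.
rewrite !mem_zb => h0 h1.
have t0 : 0 < k.+1%:R :> R by rewrite ltr0n.
have zvMn (u : Z2) q : zv (u *+ q) = q%:R *: zv u :> plane.
  by elim: q => [|q IH]; rewrite ?mulr0n ?zv0 ?scale0r// mulrS zvD IH -natr1 scalerDl scale1r addrC.
have E : M *m zv (n + unitz i) = (1 - k.+1%:R^-1) *: (M *m zv n) + k.+1%:R^-1 *: (M *m zv (n + unitz i *+ k.+1)).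
  rewrite !zvD zvMn !mulmxDr -!scalemxAr scalerDr scalerA mulVf ?gt_eqF// scale1r addrA -scalerDl.
  by rewrite subrK scale1r.
rewrite E (le_lt_trans (norm2D _ _))// !norm2Z.
have k1 : k.+1%:R^-1 <= 1 :> R by rewrite invf_le1// ler1n.
have k0 : 0 < k.+1%:R^-1 :> R by rewrite invr_gt0.
rewrite !ger0_norm ?subr_ge0 ?(ltW k0)//.
have q0 : (1 - k.+1%:R^-1) * norm2 (M *m zv n) <= (1 - k.+1%:R^-1) * r.
  by rewrite ler_wpM2l ?subr_ge0// ltW.
have q1 : k.+1%:R^-1 * norm2 (M *m zv (n + unitz i *+ k.+1)) < k.+1%:R^-1 * r by rewrite ltr_pM2l.
apply: lt_le_trans (ler_ltD q0 q1) _.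
by rewrite -mulrDl subrK mul1r.
Qed.

End Balls.

(** * Cancellation of nontrivial characters over balls *)

Section Equidistribution.
Context {R : realType}.
Local Notation plane := 'cV[R]_2.

Lemma expi_eq1 (t : R) : expi (2 * pi * t) = 1 -> exists k : int, t = k%:~R.
Proof.
move=> h; exists (Num.floor t); pose f := t - (Num.floor t)%:~R.
have f01 : 0 <= f < 1.
  have := floor_le t; have := floorD1_gt t; rewrite rmorphD /= => h1 h2; apply/andP; rewrite /f; split; lra.
have hf : expi (2 * pi * f) = 1.
  by rewrite /f mulrBr expiD h mul1r -mulrN -rmorphN; exact: expi_int.
have c1 : cos (pi * f) ^+ 2 - sin (pi * f) ^+ 2 = 1.
  have := congr1 (@complex.Re R) hf; rewrite /= => <-.
  by rewrite (_ : 2 * pi * f = pi * f + pi * f) ?cosD ?expr2//; ring.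
have s0 : sin (pi * f) = 0.
  by apply/eqP; rewrite -sqrf_eq0; apply/eqP; have := cos2Dsin2 (pi * f); lra.
have /andP[f0 f1] := f01.
have [f00|] := eqVneq f 0; first by apply/eqP; rewrite -subr_eq0; exact/eqP.
move=> fn0; have fp : 0 < f by rewrite lt_neqAle eq_sym fn0.
have : 0 < sin (pi * f).
  by apply: sin_gt0_pi; rewrite mulr_gt0 ?pi_gt0//= -[ltRHS]mulr1 ltr_pM2l// pi_gt0.
by rewrite s0 ltxx.
Qed.

Lemma nonint_coord (s : plane) : (forall n : Z2, s != zv n) -> exists i, expi (2 * pi * s i 0) != 1.
Proof.
move=> h; apply: contrapT => hn.
have k i : exists k : int, s i 0 = k%:~R.
  by apply: expi_eq1; apply/eqP; apply: contrapT => /negP e; apply: hn; exists i.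
have [k0 e0] := k 0; have [k1 e1] := k 1.
by move/eqP: (h (zpair (k0, k1))); apply; apply: plane_eq; rewrite !mxE /=.
Qed.

Variable M : 'M[R]_2.
Hypothesis dM : \det M != 0.
Variables (Y : choiceType) (c : Y -> R) (yb : R -> {fset Y}) (d : nat).
Hypothesis c0 : forall y, 0 <= c y.
Hypothesis mem_yb : forall r y, 0 < r -> (y \in yb r) = (c y < r).
Hypothesis yb_lower : exists2 k : R, 0 < k & forall r, 1 <= r -> k * r ^+ d <= #|` yb r|%:R.
Hypothesis yb_upper : exists2 K : R, 0 < K & forall r, 1 <= r -> #|` yb r|%:R <= K * r ^+ d.

(** A ball for the combined norm of Z^2 and a further factor Y, of size function c and growth r^d.
    One point with d = 0 serves the real sites, a second reciprocal lattice with d = 2 the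
    reciprocal ones. *)
Definition cylb (r : R) : {fset Z2 * Y} :=
  [fset p in (zb M r `*` yb r)%fset | Num.sqrt (norm2 (M *m zv p.1) ^+ 2 + c p.2 ^+ 2) < r]%fset.

Lemma sqrt_le_sum (a b r : R) : 0 <= a -> 0 <= b -> Num.sqrt (a ^+ 2 + b ^+ 2) < r -> a < r /\ b < r.
Proof.
move=> a0 b0 h; split; apply: le_lt_trans h.
  by rewrite -[leLHS](ger0_norm a0) -sqrtr_sqr ler_wsqrtr// lerDl sqr_ge0.
by rewrite -[leLHS](ger0_norm b0) -sqrtr_sqr ler_wsqrtr// lerDr sqr_ge0.
Qed.

Lemma mem_cylb r p : (p \in cylb r) = (Num.sqrt (norm2 (M *m zv p.1) ^+ 2 + c p.2 ^+ 2) < r).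
Proof.
rewrite !inE /=; apply/andP/idP => [[]//|h]; split => //.
have [h1 h2] := sqrt_le_sum (norm2_ge0 _) (c0 _) h.
by rewrite mem_zb// h1 mem_yb// (le_lt_trans (c0 p.2)).
Qed.

(** At fixed y the first component is confined to a ball, of radius given by Pythagoras. If c y >= r
    the square root is 0 and the slice is empty, the inequality being strict. *)
Lemma cylb_slice r p : 0 < r -> (p \in cylb r) = (p.1 \in zb M (Num.sqrt (r ^+ 2 - c p.2 ^+ 2))).
Proof.
move=> r0; rewrite mem_cylb mem_zb//; set a := norm2 _; set b := c _.
have a0 : 0 <= a by exact: norm2_ge0.
have s0 : 0 <= a ^+ 2 + b ^+ 2 by rewrite addr_ge0 ?sqr_ge0.
rewrite -[X in _ < X = _](ger0_norm (ltW r0)) -(sqrtr_sqr r) ltr_sqrt ?exprn_gt0//.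
rewrite -[X in _ = (X < _)](ger0_norm a0) -(sqrtr_sqr a).
have [h|h] := ltP 0 (r ^+ 2 - b ^+ 2); first by rewrite ltr_sqrt// ltrBrDr.
rewrite (ler0_sqrtr h) sqrtr_sqr normr_lt0; apply/negbTE; rewrite -leNgt.
by have := sqr_ge0 a; lra.
Qed.

(** The slice is a ball, so it meets a line along [unitz i] in an interval, which has a single last
    point. [rev_ord i] is the other coordinate, constant along the line. *)
Lemma cylb_line r i (p q : Z2 * Y) : 0 < r -> p \in cylb r -> q \in cylb r ->
  (p.1 + unitz i, p.2) \notin cylb r -> (q.1 + unitz i, q.2) \notin cylb r ->
  (p.1 (rev_ord i) 0, p.2) = (q.1 (rev_ord i) 0, q.2) -> p = q.
Proof.
move=> r0; case: p q => [n y] [n' y'] /= hp hq sp sq [hn hy]; rewrite -{}hy in hq sq *; congr (_, _).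
rewrite !cylb_slice//= in hp hq sp sq.
set rho := Num.sqrt _ in hp hq sp sq.
have line (a b : Z2) : a (rev_ord i) 0 = b (rev_ord i) 0 -> (a i 0 < b i 0)%R ->
    exists k : nat, b = a + unitz i *+ k.+1.
  move=> e l; exists (absz (b i 0 - a i 0)%R).-1.
  have pos : ((absz (b i 0 - a i 0)%R).-1.+1 : int) = (b i 0 - a i 0)%R by lia.
  have un k : unitz i *+ k = \col_l (((l == i) : nat)%:Z * k%:Z).
    by apply/matrixP => l' j; rewrite mulmxnE !mxE -mulr_natr natz.
  rewrite un pos; apply/matrixP => l' j; rewrite ord1 !mxE.
  have [<-|li] := eqVneq l' i; first by rewrite /= mul1r addrC subrK.
  rewrite mul0r addr0.
  have -> : l' = rev_ord i by move: li e; have [->|->] := ord2 l'; have [->|->] := ord2 i => //= _ _; apply/val_inj.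
  by rewrite e.
have [lt|lt|eq] := ltgtP (n i 0) (n' i 0).
- have [k E] := line n n' hn lt.
  by exfalso; move/negP: sp; apply; apply: (@zb_convex _ _ _ _ _ k) => //; rewrite -E.
- have [k E] := line n' n (esym hn) lt.
  by exfalso; move/negP: sq; apply; apply: (@zb_convex _ _ _ _ _ k) => //; rewrite -E.
apply/matrixP => l' j; rewrite ord1.
have [->//|li] := eqVneq l' i.
have -> : l' = rev_ord i by move: li; have [->|->] := ord2 l'; have [->|->] := ord2 i => //= _; apply/val_inj.
by [].
Qed.

(** A boundary point is determined by its line, that is by one integer coordinate, with O(r) values,
    and by y, with O(r^d) values. *)
Lemma cylb_boundary : exists2 C : R, 0 < C & forall r (i : 'I_2), 1 <= r ->
  #|` [fset p in cylb r | ((p.1 + unitz i)%R, p.2) \notin cylb r]%fset|%:R <= C * r ^+ d.+1.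
Proof.
have [C C0 hC] := zb_coord dM; have [K K0 hK] := yb_upper.
exists ((2 * C + 1) * K); first by rewrite mulr_gt0//; lra.
move=> r i r1; have r0 : 0 < r by lra.
pose N := Num.truncn (C * r).
have h : (#|` [fset p in cylb r | ((p.1 + unitz i)%R, p.2) \notin cylb r]%fset| <= #|` (ibox N `*` yb r)%fset|)%N.
  apply: (@boundary_card _ _ _ _ (fun p : Z2 * Y => (p.1 (rev_ord i) 0, p.2))) => [p hp|p q]; last exact: cylb_line.
  rewrite in_fsetM /=; move: hp; rewrite !inE /= => /andP[/andP[h1 h2] _].
  by rewrite h2 andbT; exact: hC.
apply: (@le_trans _ _ (#|` (ibox N `*` yb r)%fset|%:R)); first by rewrite ler_nat.
have -> : (2 * C + 1) * K * r ^+ d.+1 = ((2 * C + 1) * r) * (K * r ^+ d) by rewrite exprS; ring.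
rewrite (@card_fsetM R) natrM ler_pM//; last exact: hK.
apply: (@le_trans _ _ ((2 * N).+1%:R)); first by rewrite ler_nat card_ibox.
have Nr : N%:R <= C * r by rewrite truncn_le// mulr_ge0//; lra.
by rewrite -natr1 natrM; lra.
Qed.

(** The product of the two balls of radius r / 2 lies inside, and r >= 2 makes the lower bounds
    available at that radius. *)
Lemma cylb_lower : exists2 k : R, 0 < k & forall r, 2 <= r -> k * r ^+ d.+2 <= #|` cylb r|%:R.
Proof.
have [k1 k10 h1] := zb_lower dM; have [k2 k20 h2] := yb_lower.
exists (k1 * k2 / 2 ^+ d.+2); first by apply: divr_gt0; [exact: mulr_gt0|exact: exprn_gt0].
move=> r r2; have r0 : 0 < r / 2 by lra.
have sB : ((zb M (r / 2) `*` yb (r / 2)) `<=` cylb r)%fset.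
  apply/fsubsetP => p; rewrite in_fsetM mem_cylb mem_zb// mem_yb// => /andP[ha hb].
  have e : norm2 (M *m zv p.1) ^+ 2 + c p.2 ^+ 2 < r ^+ 2.
    have := norm2_ge0 (M *m zv p.1); have := c0 p.2 => ? ?; nra.
  rewrite -[X in _ < X]ger0_norm; last by lra.
  by rewrite -sqrtr_sqr ltr_sqrt// exprn_gt0//; lra.
apply: (@le_trans _ _ (#|` (zb M (r / 2) `*` yb (r / 2))%fset|%:R)); last by rewrite ler_nat fsubset_leq_card.
rewrite (@card_fsetM R) natrM.
have -> : k1 * k2 / 2 ^+ d.+2 * r ^+ d.+2 = (k1 * (r / 2) ^+ 2) * (k2 * (r / 2) ^+ d).
  by rewrite -(addn2 d) !exprD !expr_div_n; field; rewrite expf_neq0.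
rewrite ler_pM ?h1//; [| |apply: h2; lra]; rewrite mulr_ge0 ?exprn_ge0 ?(ltW r0)// ltW//.
Qed.

Lemma cylb_card_gt0 r : 2 <= r -> (0 < #|` cylb r|)%N.
Proof.
move=> r2; have [k k0 hk] := cylb_lower; have := hk r r2.
by rewrite -(ltr_nat R); apply: lt_le_trans; rewrite mulr_gt0 ?exprn_gt0//; lra.
Qed.

(** Some coordinate of s is not an integer; shifting n by that unit vector multiplies the summand by
    a fixed z different from 1, whatever phi is. A boundary of order r^(d+1) against at least a
    multiple of r^(d+2) points makes the average O(1 / r). *)
Lemma equidistribution (s : plane) (phi : Y -> R[i]) :
  (forall n : Z2, s != zv n) -> (forall y, nrm (phi y) <= 1) ->
  clim +oo (fun r => avgF (cylb r) (fun p => ch p.1 s * phi p.2)) 0.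
Proof.
move=> sZ phi1; have [i zi] := nonint_coord sZ.
set z := expi _ in zi.
have z0 : 0 < nrm (z - 1).
  rewrite lt_neqAle nrm_ge0 andbT eq_sym; apply: contra_neq zi => /nrm_eq0/eqP.
  by rewrite subr_eq0 => /eqP.
have [C C0 hC] := cylb_boundary; have [k k0 hk] := cylb_lower.
pose chi (p : Z2 * Y) := ch p.1 s * phi p.2.
have chi1 p : nrm (chi p) <= 1 by rewrite nrmM nrm_ch mul1r.
have hchi (p : Z2 * Y) : chi (p.1 + unitz i, p.2) = z * chi p.
  rewrite /chi /= mulrA; congr (_ * _); rewrite -chM mulrC; congr (_ * _).
  by rewrite /ch /z; congr (expi (_ * _)); rewrite dotE !mxE; have [->|->] := ord2 i; rewrite /= ?mul1r ?mul0r ?addr0 ?add0r.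
have isg : injective (fun p : Z2 * Y => (p.1 + unitz i, p.2)).
  by move=> [a b] [a' b'] /= [/addIr -> ->].
have main r : 2 <= r -> nrm (avgF (cylb r) chi) <= (2 * C / k / nrm (z - 1)) / r.
  move=> r2; have r0 : 0 < r by lra.
  have := shift_bound isg chi1 hchi (leqnn _) => /(_ (cylb r)) sb.
  have /= hb := hC r i (_ : 1 <= r).
  have cB := cylb_card_gt0 r2.
  have cR : 0 < #|` cylb r|%:R :> R by rewrite ltr0n.
  have E : (#|` cylb r|%:R : R[i])^-1 = ((#|` cylb r|%:R : R)^-1)%:C by rewrite rmorphV ?unitfE ?gt_eqF// rmorph_nat.
  rewrite /avgF E nrmM nrm_real ger0_norm ?invr_ge0 ?ler0n// ler_pdivrMl//.
  have hkr := hk r r2.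
  have S1 : nrm (z - 1) * nrm (\sum_(x <- cylb r) chi x) <= 2 * (C * r ^+ d.+1).
    by apply: (le_trans sb); rewrite ler_pM2l// hb//; lra.
  rewrite -(ler_pM2l z0) (le_trans S1)//.
  have -> : nrm (z - 1) * (#|` cylb r|%:R * (2 * C / k / nrm (z - 1) / r)) = (2 * C / k / r) * #|` cylb r|%:R.
    by field; rewrite !gt_eqF.
  have -> : 2 * (C * r ^+ d.+1) = (2 * C / k / r) * (k * r ^+ d.+2).
    by rewrite (exprS r d.+1); field; rewrite !gt_eqF.
  by rewrite ler_wpM2l// !divr_ge0 ?mulr_ge0// ltW.
move=> e e0; rewrite /=.
near=> r; rewrite subr0.
have r2 : 2 <= r by near: r; exact: nbhs_pinfty_ge.
have r0 : 0 < r by lra.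
apply: (le_lt_trans (main r r2)); rewrite ltr_pdivrMr// [e * r]mulrC -ltr_pdivrMr//.
by near: r; apply: nbhs_pinfty_gt; exact: num_real.
Unshelve. all: by end_near. Qed.

End Equidistribution.

(** * The two Hamiltonians *)

Section SectorSums.
Context {R : realType} (X W : choiceType) (S : finType) (e : X * S -> W).
Hypothesis be : bijective e.

Lemma esum_fintype (F : S -> \bar R) : (forall s, 0 <= F s)%E ->
  (\esum_(s in [set: S]) F s = \sum_(s : S) F s)%E.
Proof.
move=> F0; have fS : finite_set [set: S] by exact: finite_finset.
rewrite esum_fset// fsbig_finite//=.
apply: perm_big; apply: uniq_perm; rewrite ?fset_uniq ?index_enum_uniq// => s.
by rewrite in_fset_set// mem_index_enum; apply/idP; rewrite in_setT.
Qed.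

Lemma asum_sectors (f : W -> R[i]) : (asum f = \sum_(s : S) asum (fun x => f (e (x, s))))%E.
Proof.
rewrite -(asum_reindex _ be) -esum_fintype; last by move=> s; exact: asum_ge0.
by rewrite (asum_swap (fun s x => f (e (x, s)))) (asum_pair (fun x s => f (e (x, s)))); congr asum; apply/funext => -[].
Qed.

Lemma summ_sector (f : W -> R[i]) s : summ f -> summ (fun x => f (e (x, s))).
Proof.
rewrite /summ asum_sectors (bigD1 s)//=; apply: le_lt_trans.
by rewrite leeDl// sume_ge0// => *; exact: asum_ge0.
Qed.

Lemma csum_sectors (f : W -> R[i]) : summ f -> csum f = \sum_(s : S) csum (fun x => f (e (x, s))).
Proof.
move=> sf; rewrite -(csum_reindex _ be) csum_pair; last first.
  by apply/(summ_reindex f be).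
rewrite -csum_bigsum; last by move=> s _; exact: summ_sector.
by congr csum; apply/funext => x; rewrite csum_fintype.
Qed.

Lemma asum_sectors_le (f : W -> R[i]) (C : R) : (forall s, asum (fun x => f (e (x, s))) <= C%:E)%E ->
  (asum f <= (#|S|%:R * C)%:E)%E.
Proof.
move=> h; rewrite asum_sectors (le_trans (lee_sum _ (fun s _ => h s)))//.
by rewrite sumEFin sumr_const mulr_natl.
Qed.

End SectorSums.

(** * The real-space kernel and the decay of its functions *)

Section Decay.
Context {R : realType}.
Variables (theta : layer -> R) (h : hoppings R).
Hypothesis hdecay : exp_decay theta h.

Lemma fin_bound (T : finType) (P : T -> R -> Prop) : (forall t c c', c <= c' -> P t c -> P t c') ->
  (forall t, exists c, P t c) -> exists2 C : R, 0 < C & forall t, P t C.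
Proof.
move=> mono ex; have [c hc] := choice ex.
exists (\sum_t `|c t| + 1) => [|t]; first by rewrite ltr_wpDl// sumr_ge0.
apply: (mono _ _ _ _ (hc t)); rewrite (bigD1 t)//= (le_trans (ler_norm _))// -addrA lerDl.
by rewrite addr_ge0// sumr_ge0.
Qed.

Lemma ereal_sup_bnd (T : Type) (F : T -> R) : (ereal_sup [set (F x)%:E | x in [set: T]] < +oo)%E ->
  exists c, forall x, F x <= c.
Proof.
move=> hs; exists (fine (ereal_sup [set (F x)%:E | x in [set: T]])) => x.
have ub : ((F x)%:E <= ereal_sup [set (F x)%:E | x in [set: T]])%E.
  by apply: ereal_sup_ubound; exists x.
rewrite -lee_fin fineK//; rewrite fin_numE; apply/andP; split; last by rewrite lt_eqF.
by rewrite gt_eqF// (lt_le_trans _ ub)// ltNyr.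
Qed.

Lemma decay_consts : exists g C : R, [/\ 0 < g, 0 < C,
  forall j a k b x, j != k -> nrm (inter h j a k b x) <= C * expR (- g * norm2 x),
  forall j a k b x, j != k -> nrm (fourier (inter h j a k b) x) <= C * expR (- g * norm2 x) &
  forall j a b n, nrm (intra h j a b n) <= C * expR (- g * norm2 (lat theta j n))].
Proof.
have [g1 [g2 [g10 g20 h1 h2]]] := hdecay.
pose g := Num.min g1 g2.
have g0 : 0 < g by rewrite lt_min g10.
have conv (g' z t c : R) : 0 <= t -> g <= g' -> z * expR (g' * t) <= c -> 0 <= z -> z <= c * expR (- g * t).
  move=> t0 gg hz z0; rewrite mulNr expRN ler_pdivlMr ?expR_gt0//.
  by apply: le_trans hz; rewrite ler_wpM2l// ler_expR ler_wpM2r.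
have gg1 : g <= g1 by rewrite ge_min lexx.
have gg2 : g <= g2 by rewrite ge_min lexx orbT.
have mono (t : R) (c c' z : R) : c <= c' -> z <= c * expR t -> z <= c' * expR t.
  by move=> cc /le_trans; apply; rewrite ler_wpM2r.
pose P1 (t : layer * orbital * layer * orbital) (c : R) := t.1.1.1 != t.1.2 ->
  forall x, nrm (inter h t.1.1.1 t.1.1.2 t.1.2 t.2 x) <= c * expR (- g * norm2 x) /\
     nrm (fourier (inter h t.1.1.1 t.1.1.2 t.1.2 t.2) x) <= c * expR (- g * norm2 x).
pose P2 (t : layer * orbital * orbital) (c : R) :=
  forall n, nrm (intra h t.1.1 t.1.2 t.2 n) <= c * expR (- g * norm2 (lat theta t.1.1 n)).
have [C1 C10 H1] : exists2 C, 0 < C & forall t, P1 t C.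
  apply: fin_bound => [t c c' cc hh jk x|[[[j a] k] b]].
    by have [u1 u2] := hh jk x; split; [exact: mono cc u1|exact: mono cc u2].
  have [jk|jk] := eqVneq j k; first by exists 0; rewrite /P1 /= jk eqxx.
  have := h1 j a k b jk; set s1 := ereal_sup _; set s2 := ereal_sup _ => s12.
  have sup0 (F : 'cV[R]_2 -> R) : 0 <= F 0 -> (0 <= ereal_sup [set (F x)%:E | x in [set: 'cV[R]_2]])%E.
    by move=> F0; apply: (@le_trans _ _ (F 0)%:E); [rewrite lee_fin|apply: ereal_sup_ubound; exists 0].
  have s10 : (0 <= s1)%E by apply: sup0; rewrite mulr_ge0 ?nrm_ge0.
  have s20 : (0 <= s2)%E by apply: sup0; rewrite mulr_ge0 ?nrm_ge0.
  have [c1 hc1] : exists c, forall x, nrm (inter h j a k b x) * expR (g1 * norm2 x) <= c.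
    by apply: ereal_sup_bnd; apply: le_lt_trans s12; rewrite leeDl.
  have [c2 hc2] : exists c, forall x, nrm (fourier (inter h j a k b) x) * expR (g2 * norm2 x) <= c.
    by apply: ereal_sup_bnd; apply: le_lt_trans s12; rewrite leeDr.
  exists (Num.max c1 c2) => _ x /=; split.
    by apply: (@mono _ c1); [rewrite le_max lexx|apply: conv gg1 (hc1 x) _; rewrite ?norm2_ge0 ?nrm_ge0].
  by apply: (@mono _ c2); [rewrite le_max lexx orbT|apply: conv gg2 (hc2 x) _; rewrite ?norm2_ge0 ?nrm_ge0].
have [C2 C20 H2] : exists2 C, 0 < C & forall t, P2 t C.
  apply: fin_bound => [t c c' cc hh n|[[j a] b]]; first exact: mono cc (hh n).
  have [c hc] := ereal_sup_bnd (h2 j a b).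
  by exists c => n /=; apply: conv gg1 (hc n) _; rewrite ?norm2_ge0 ?nrm_ge0.
exists g, (C1 + C2); split => //; first by rewrite addr_gt0.
- move=> j a k b x jk; have [u _] := H1 (j, a, k, b) jk x.
  by apply: mono u; rewrite lerDl ltW.
- move=> j a k b x jk; have [_ u] := H1 (j, a, k, b) jk x.
  by apply: mono u; rewrite lerDl ltW.
by move=> j a b n; apply: mono (H2 (j, a, b) n); rewrite lerDr ltW.
Qed.

Definition pos (w : Omega) : 'cV[R]_2 := lat theta w.1.2 w.1.1 + tau theta w.1.2 w.2.

Definition Hk (w w' : Omega) : R[i] :=
  if w.1.2 == w'.1.2 then intra h w.1.2 w.2 w'.2 (w.1.1 - w'.1.1)
  else inter h w.1.2 w.2 w'.1.2 w'.2 (pos w - pos w').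

Definition site (p : Z2 * (layer * orbital)) : Omega := (p.1, p.2.1, p.2.2).

Lemma site_bij : bijective site.
Proof. by exists (fun w : Omega => (w.1.1, (w.1.2, w.2))) => [[n [j a]]|[[n j] a]]. Qed.

Lemma pos_sum : exists2 t0 : R, 0 < t0 & forall j a, norm2 (tau theta j a) <= t0.
Proof.
have [C C0 hC] := @fin_bound (layer * orbital)%type (fun t c => norm2 (tau theta t.1 t.2) <= c)
  (fun t c c' cc hc => le_trans hc cc) (fun t => ex_intro _ (norm2 (tau theta t.1 t.2)) (lexx _)).
by exists C => // j a; exact: (hC (j, a)).
Qed.

Lemma Hk_decay : exists g C : R, [/\ 0 < g, 0 < C &
  forall w w', nrm (Hk w w') <= C * expR (- g * norm2 (pos w - pos w'))].
Proof.
have [g [C [g0 C0 h1 _ h2]]] := decay_consts; have [t t0 ht] := pos_sum.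
(* The intralayer decay is in the lattice vector alone; the factor pays for the two orbital shifts,
   each of norm at most t. *)
exists g, (C * expR (g * (t + t))); split => //; first by rewrite mulr_gt0 ?expR_gt0.
move=> w w'; rewrite /Hk; case: eqP => [E|/eqP jk]; last first.
  apply: (le_trans (h1 _ _ _ _ _ jk)); rewrite -mulrA ler_wpM2l ?(ltW C0)// -expRD ler_expR lerDr.
  by rewrite mulr_ge0 ?(ltW g0)// addr_ge0// ltW.
apply: (le_trans (h2 _ _ _ _)); rewrite -mulrA ler_wpM2l ?(ltW C0)// -expRD ler_expR.
have : norm2 (pos w - pos w') <= norm2 (lat theta w.1.2 (w.1.1 - w'.1.1)) + (t + t).
  have -> : pos w - pos w' = lat theta w.1.2 (w.1.1 - w'.1.1) + (tau theta w.1.2 w.2 - tau theta w.1.2 w'.2).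
    by rewrite /pos -E latD latN; apply: plane_eq; rewrite !mxE; ring.
  rewrite (le_trans (norm2D _ _))// lerD2l (le_trans (norm2D _ _))// norm2N lerD//.
set u := norm2 _; set v := norm2 _ => uv.
have : g * u <= g * (v + (t + t)) by rewrite ler_wpM2l// ltW.
lra.
Qed.

Lemma site_sum (g : R) : 0 < g -> exists2 B : R, 0 < B &
  forall x : 'cV[R]_2, (\esum_(w' in [set: Omega]) (expR (- g * norm2 (x - pos w')))%:E <= B%:E)%E.
Proof.
move=> g0.
have dN j : \det (- mxAj theta j) != 0.
  by rewrite -scaleN1r detZ mulf_neq0 ?expf_neq0 ?oppr_eq0 ?oner_eq0// det_mxAj det_mxA_neq0.
pose P (t : layer * orbital) c := forall xi : 'cV[R]_2,
    (\esum_(n in [set: Z2]) (expR (- g * norm2 (xi + (- mxAj theta t.1) *m zv n)))%:E <= c%:E)%E.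
have [B B0 hB] : exists2 B, 0 < B & forall t, P t B.
  apply: fin_bound => [t c c' cc hc xi|t].
    by apply: (le_trans (hc xi)); rewrite lee_fin.
  by have [c _ hc] := lattice_sum g0 (dN t.1); exists c.
exists (#|{: layer * orbital}|%:R * B).
  by rewrite mulr_gt0// ltr0n; apply/card_gt0P; exists (ord0, false).
move=> x; set f : Omega -> R[i] := fun w' => (expR (- g * norm2 (x - pos w')))%:C.
have nf w : nrm (f w) = expR (- g * norm2 (x - pos w)) by rewrite nrm_real ger0_norm// expR_ge0.
have -> : (\esum_(w' in [set: Omega]) (expR (- g * norm2 (x - pos w')))%:E = asum f)%E.
  by apply: eq_esum => w' _; rewrite nf.
apply: (asum_sectors_le site_bij) => s; apply: le_trans (hB s (x - tau theta s.1 s.2)).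
apply: le_esum => n _; rewrite nf /pos /= latE mulNmx opprD.
by rewrite addrA addrAC.
Qed.

(** An exponential weight, submultiplicative by the triangle inequality, as [kpow_decay]
    requires. *)
Definition Wt (g : R) (w w' : Omega) : R := expR (g * norm2 (pos w - pos w')).

Lemma Wt_ge1 g w w' : 0 < g -> 1 <= Wt g w w'.
Proof.
by move=> g0; apply: le_trans (expR_ge1Dx _); rewrite lerDl mulr_ge0 ?norm2_ge0// ltW.
Qed.

Lemma Hk_weighted : exists g C : R, [/\ 0 < g, 0 < C, rowb Hk C & rowb (fun w w' => (Wt g w w')%:C * Hk w w') C].
Proof.
(* Half of the decay rate is spent on the weight, the other half on the summability of the rows. *)
have [g [C [g0 C0 hH]]] := Hk_decay; have g20 : 0 < g / 2 by rewrite divr_gt0.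
have [B B0 hB] := site_sum g20.
have key w w' : nrm ((Wt (g / 2) w w')%:C * Hk w w') <= C * expR (- (g / 2) * norm2 (pos w - pos w')).
  rewrite nrmM nrm_real ger0_norm ?expR_ge0//.
  apply: (le_trans (ler_wpM2l (expR_ge0 _) (hH w w'))); rewrite mulrCA ler_wpM2l ?(ltW C0)// -expRD ler_expR.
  lra.
have rb : rowb (fun w w' => (Wt (g / 2) w w')%:C * Hk w w') (C * B).
  move=> w; apply: (@le_trans _ _ (\esum_(w' in [set: Omega]) (C * expR (- (g / 2) * norm2 (pos w - pos w')))%:E)%E).
    by apply: le_esum => w' _; rewrite lee_fin.
  by rewrite esumZl ?(ltW C0)// EFinM lee_pmul ?lee_fin ?(ltW C0) ?esum_ge0.
exists (g / 2), (C * B); split => //; first by rewrite mulr_gt0.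
move=> w; apply: le_trans (rb w); apply: asum_le => w'; rewrite nrmM ler_peMl ?nrm_ge0//.
by rewrite nrm_real ger0_norm ?expR_ge0// Wt_ge1.
Qed.

(** The weighted entries of the n-th power are at most C^n, so the power series of f converges with
    the weight inside. *)
Lemma fker_decay (b : nat -> R) : (forall D, 0 <= D -> bsm b D) -> exists g C : R,
  [/\ 0 < g, 0 <= C & forall w w', nrm (fker b Hk w w') <= C * expR (- g * norm2 (pos w - pos w'))].
Proof.
move=> bD; have [g [C [g0 C0 rH rW]]] := Hk_weighted.
exists g, (bsum b C); split; [by []|exact: bsum_ge0 (ltW C0)|].
move=> w w'; have W0 := expR_gt0 (g * norm2 (pos w - pos w')).
rewrite mulNr expRN -ler_pdivrMr ?invr_gt0// invrK.
have key n : Wt g w w' * nrm (kpow Hk n w w') <= C ^+ n.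
  apply: (@kpow_decay _ _ Hk (Wt g) C C n w w' rH (ltW C0)).
  - by move=> *; exact: expR_gt0.
  - by rewrite /Wt subrr norm2_0 mulr0 expR0.
  - exact: ltW.
  - move=> i j k; rewrite /Wt -expRD ler_expR -mulrDr ler_wpM2l ?(ltW g0)//.
    by rewrite -[pos i - pos k](subrKA (pos j)) norm2D.
  - exact: rW.
rewrite -lee_fin.
have bC := bD C (ltW C0).
have : (asum (fun n => (Wt g w w')%:C * ((b n)%:C * kpow Hk n w w'))%R <= (bsum b C)%:E)%E.
  apply: asum_le_rsum => // n; rewrite !nrmM !nrm_real [X in X * _]ger0_norm ?expR_ge0//.
  by rewrite mulrCA ler_wpM2l.
move=> /nrm_csum_le; rewrite csumZ; last first.
  apply: (@summ_le_r _ _ _ (fun n => `|b n| * C ^+ n)) => // n.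
  rewrite nrmM nrm_real ler_wpM2l//; apply: le_trans (key n).
  by rewrite ler_peMl ?nrm_ge0// Wt_ge1.
by rewrite nrmM nrm_real ger0_norm ?expR_ge0// lee_fin mulrC.
Qed.

Lemma Hk_herm : hermitian_hoppings h -> hermk Hk.
Proof.
move=> [h1 h2] w w'; rewrite /Hk [w'.1.2 == _]eq_sym; case: eqP => [E|/eqP jk].
  by rewrite h1 opprB -E.
by rewrite h2// opprB.
Qed.

Lemma real_hamiltonianE (psi : Omega -> R[i]) : ell2 psi -> real_hamiltonian theta h psi = kop Hk psi.
Proof.
move=> l2; have [g [C [g0 C0 rH rW]]] := Hk_weighted.
have bp := nsq_bnd l2.
apply/funext => -[[n j] a]; set w : Omega := (n, j, a).
have sw := kop_summ w rH bp (sqrtr_ge0 _).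
rewrite /kop (csum_sectors site_bij sw) /real_hamiltonian.
pose F (s : layer * orbital) (m : Z2) := Hk w (site (m, s)) * psi (site (m, s)).
have sF s : summ (F s) := summ_sector site_bij s sw.
have bswap : bijective (fun p : Z2 * orbital => p) by exists id.
have sb k (u : Z2 * orbital -> R[i]) : (forall p, u p = F (k, p.2) p.1) -> summ u /\ csum u = \sum_(b : orbital) csum (F (k, b)).
  move=> hu; have su : summ u.
    rewrite /summ (asum_sectors bswap).
    rewrite (eq_bigr (fun b => asum (F (k, b)))); last by move=> b _; congr asum; apply/funext => m; rewrite hu.
    by apply: lte_sum_pinfty => b _; exact: sF.
  split => //; rewrite (csum_sectors bswap su); apply: eq_bigr => b _; congr csum; apply/funext => m; exact: hu.
transitivity (\sum_(k : layer) \sum_(b : orbital) csum (F (k, b))); last first.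
  by rewrite (pair_bigA _ (fun k b => csum (F (k, b)))); apply: eq_bigr => -[k b] _.
rewrite (bigD1 j)//=; congr (_ + _).
  rewrite (sb j _ _).2// => -[m b] /=; rewrite /F /Hk /= eqxx.
  by [].
apply: eq_bigr => k kj; rewrite (sb k _ _).2// => -[m b] /=; rewrite /F /Hk /= eq_sym (negbTE kj).
by rewrite /pos /= opprD addrA.
Qed.

End Decay.

(** * Indexing of the reciprocal sites *)

Section Layers.

Lemma thirdP (j k : layer) : j != k -> third j k != j /\ third j k != k.
Proof.
move=> jk; have jkn : (j : nat) != k by rewrite val_eqE.
rewrite /third; case: pickP => [l /= /andP[]//|h].
(* The layers 0, 1, 2 add up to 3, which gives the third one explicitly. *)
have := h (inord (3 - j - k)); rewrite -!val_eqE /= !inordK; last by have := ltn_ord j; have := ltn_ord k; lia.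
by have := ltn_ord j; have := ltn_ord k; lia.
Qed.

Lemma layer_cases (j k t : layer) : j != k -> [\/ t = j, t = k | t = third j k].
Proof.
move=> jk; have [h1 h2] := thirdP jk.
have [->|tj] := eqVneq t j; first by constructor 1.
have [->|tk] := eqVneq t k; first by constructor 2.
constructor 3; apply/val_inj => /=; move: jk h1 h2 tj tk; rewrite -!val_eqE /=.
by have := ltn_ord j; have := ltn_ord k; have := ltn_ord t; have := ltn_ord (third j k); lia.
Qed.

Lemma thirdC (j k : layer) : j != k -> third j k = third k j.
Proof.
move=> jk; have kj : k != j by rewrite eq_sym.
have [h1 h2] := thirdP jk.
by case: (layer_cases (third j k) kj) => // E; move: h1 h2; rewrite E ?eqxx.
Qed.

(** [nx1 k] and [nx2 k] list the two layers other than k, those in which a reciprocal site of layer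
    k has free components. *)
Definition nx1 (k : layer) : layer := if k == ord0 then ord_max else ord0.
Definition nx2 (k : layer) : layer := third k (nx1 k).

Lemma nx1P k : k != nx1 k.
Proof. by rewrite /nx1; have [->|] := eqVneq k ord0. Qed.

Lemma sum_layers (V : zmodType) (j k : layer) (F : layer -> V) : j != k ->
  \sum_t F t = F j + F k + F (third j k).
Proof.
move=> jk; have [h1 h2] := thirdP jk.
rewrite (bigD1 j)//= (bigD1 k) 1?eq_sym//= (bigD1 (third j k)) ?h1//= big1 ?addr0 ?addrA// => t.
by case: (layer_cases t jk) => ->; rewrite ?eqxx ?andbF.
Qed.

Lemma stsite_subproof (k : layer) (F : layer -> Z2) (b : orbital) :
  let w : {ffun layer -> Z2} * layer * orbital := ([ffun t => if t == k then 0 else F t], k, b) in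
  w.1.1 w.1.2 == 0.
Proof. by rewrite /= ffunE eqxx. Qed.

(** Erasing the component in layer k makes every F admissible, so that sites can be built without a
    side condition. *)
Definition stsite (k : layer) (F : layer -> Z2) (b : orbital) : Omega_star :=
  exist _ ([ffun t => if t == k then 0 else F t], k, b) (stsite_subproof k F b).

Lemma smom_stsite k F b t : smom (stsite k F b) t = if t == k then 0 else F t.
Proof. by rewrite /smom /= ffunE. Qed.
Lemma slay_stsite k F b : slay (stsite k F b) = k. Proof. by []. Qed.
Lemma sorb_stsite k F b : sorb (stsite k F b) = b. Proof. by []. Qed.

Lemma smom_slay (w : Omega_star) : smom w (slay w) = 0.
Proof. by rewrite /smom /slay; exact/eqP/(valP w). Qed.

Lemma star_eq (w w' : Omega_star) : slay w = slay w' -> sorb w = sorb w' ->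
  (forall t, smom w t = smom w' t) -> w = w'.
Proof.
move=> h1 h2 h3; apply/val_inj; move: h1 h2 h3; rewrite /slay /sorb /smom.
by case: (val w) (val w') => [[G j] a] [[G' j'] a'] /= -> -> h; congr (_, _, _); apply/ffunP.
Qed.

Lemma smom_eq (w w' : Omega_star) : ((val w).1.1 == (val w').1.1) = [forall t, smom w t == smom w' t].
Proof.
apply/eqP/forallP => [E t|h]; first by rewrite /smom E.
by apply/ffunP => t; exact: (eqP (h t)).
Qed.

Definition star (p : (Z2 * Z2) * (layer * orbital)) : Omega_star :=
  stsite p.2.1 (fun t => if t == nx1 p.2.1 then p.1.1 else p.1.2) p.2.2.

Lemma star_bij : bijective star.
Proof.
exists (fun w => ((smom w (nx1 (slay w)), smom w (nx2 (slay w))), (slay w, sorb w))) => [[[m n] [k b]]|w].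
  rewrite /star /= slay_stsite sorb_stsite !smom_stsite /=.
  have h := nx1P k; have [h1 h2] := thirdP h.
  by rewrite eq_sym (negbTE h) eqxx (negbTE h1) (negbTE h2).
apply: star_eq => // t; rewrite /star /= smom_stsite /=.
have h := nx1P (slay w); have [h1 h2] := thirdP h.
case: (layer_cases t h) => ->; first by rewrite eqxx smom_slay.
  by rewrite eq_sym (negbTE h) eqxx.
by rewrite (negbTE h1) (negbTE h2).
Qed.

(* The sites of the sector (k, b) with prescribed component along the third layer. *)
Definition fib (j k : layer) (b : orbital) (g : Z2) (n : Z2) : Omega_star :=
  stsite k (fun t => if t == j then n else g) b.

Lemma fib_inj j k b g : j != k -> injective (fib j k b g).
Proof.
move=> jk m n E; have := congr1 (fun w => smom w j) E.
by rewrite !smom_stsite (negbTE jk) eqxx.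
Qed.

Lemma fib_range j k b g (w : Omega_star) : j != k -> slay w = k -> sorb w = b -> smom w (third j k) = g ->
  fib j k b g (smom w j) = w.
Proof.
move=> jk wk wb wg; apply: star_eq => // t; rewrite smom_stsite.
have [h1 h2] := thirdP jk.
case: (layer_cases t jk) => ->; first by rewrite (negbTE jk) eqxx.
  by rewrite eqxx -wk smom_slay.
by rewrite (negbTE h1) (negbTE h2).
Qed.

End Layers.

(** * Hermiticity and row bounds of the reciprocal Hamiltonians *)

Section Reciprocal.
Context {R : realType}.

Lemma conjM (x y : R[i]) : conjc (x * y) = conjc x * conjc y.
Proof. by case: x y => [a b] [c d]; apply: complex_eq => /=; ring. Qed.

Lemma conj_real (x : R) : conjc x%:C = x%:C.
Proof. by apply: complex_eq; rewrite /= ?oppr0. Qed.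

Lemma conj0 : conjc (0 : R[i]) = 0.
Proof. by apply: complex_eq; rewrite /= ?oppr0. Qed.

Lemma conj_mul0 (c e f c' e' f' : R[i]) : 0 * c * e * f = conjc (0 * c' * e' * f').
Proof. by rewrite !mul0r conj0. Qed.

Lemma conj_mul1 (c t : R) (z : R[i]) :
  1 * c%:C * expi t * conjc z = conjc (1 * c%:C * expi (- t) * z).
Proof. by rewrite !mul1r !conjM conj_real conj_expi opprK. Qed.

Lemma conj_bool (b : bool) : conjc (b%:R : R[i]) = b%:R.
Proof. by case: b; apply: complex_eq; rewrite /= ?oppr0. Qed.

Variables (theta : layer -> R) (h : hoppings R).
Hypothesis hdecay : exp_decay theta h.
Hypothesis hherm : hermitian_hoppings h.
Hypothesis hcont : continuous_hoppings h.
Local Notation plane := 'cV[R]_2.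

Lemma intra_conj j a b n : intra h j a b n = conjc (intra h j b a (- n)).
Proof. exact: hherm.1. Qed.

Lemma inter_conj j a k b x : j != k -> inter h j a k b x = conjc (inter h k b j a (- x)).
Proof. exact: hherm.2. Qed.

Lemma inter_cont j a k b : j != k -> ccont (inter h j a k b).
Proof. by move=> jk x; apply/clim_cvg; exact: hcont. Qed.

Lemma inter_cint j a k b xi : j != k -> cint (fun x => inter h j a k b x * expi (- dot xi x)).
Proof.
move=> jk; have [g [C [g0 C0 h1 _ _]]] := decay_consts hdecay.
apply: (@cint_exp _ _ C g) => //.
  apply: cmeasM; first exact/cmeas_cont/inter_cont.
  have := cmeas_cont (ccont_expi xi (-1)).
  by under eq_fun do rewrite mulN1r.
by move=> x; rewrite nrmM nrm_expi mulr1; exact: h1.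
Qed.

Lemma cI_conj (f : plane -> R[i]) : cint f -> cI (fun x => conjc (f x)) = conjc (cI f).
Proof.
move=> fi; rewrite !cIE; apply: complex_eq => /=.
  by apply: eq_Rintegral => z _; case: (f _).
rewrite -mulN1r -RintegralZl//; last exact: fi.2.
by apply: eq_Rintegral => z _; rewrite mulN1r; case: (f _).
Qed.

(** Hermiticity relates x to - x; the change of variable x to - x in the integral turns this into a
    relation at one and the same xi. *)
Lemma fourier_herm j a k b xi : j != k ->
  fourier (inter h j a k b) xi = conjc (fourier (inter h k b j a) xi).
Proof.
move=> jk; have kj : k != j by rewrite eq_sym.
rewrite /fourier conjM conj_real; congr (_ * _).
rewrite -[RHS]cI_conj; last exact: inter_cint.
have i1 := inter_cint a b xi jk.
have d1 : \det (- 1%:M : 'M[R]_2) != 0.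
  by rewrite -scaleN1r detZ det1 mulr1 expf_neq0 ?oppr_eq0 ?oner_eq0.
have [_] := cI_affine 0 d1 i1.
have -> : `|\det (- 1%:M : 'M[R]_2)|^-1 = 1.
  by rewrite -scaleN1r detZ det1 mulr1 sqrrN expr1n normr1 invr1.
rewrite mul1r => E; rewrite -[LHS]/(cI (fun x : plane => inter h j a k b x * expi (- dot xi x))) -E.
congr cI; apply/funext => x.
rewrite addr0 mulNmx mul1mx (inter_conj _ _ _ jk) opprK conjM conj_expi dotNr.
by [].
Qed.

Lemma intra_bound : exists2 B : R, 0 < B & forall j a b, (asum (intra h j a b) <= B%:E)%E.
Proof.
have [g [C [g0 C0 _ _ h1]]] := decay_consts hdecay.
have [B B0 hB] := lattice_sum g0 (@det_mxA_neq0 R).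
exists (C * B + 1); first by rewrite ltr_wpDl// mulr_ge0// ltW.
move=> j a b; apply: (@le_trans _ _ (C * B)%:E); last by rewrite lee_fin lerDl.
apply: (@le_trans _ _ (\esum_(n in [set: Z2]) (C * expR (- g * norm2 (lat theta j n)))%:E)%E).
  by apply: le_esum => n _; rewrite lee_fin.
rewrite esumZl ?(ltW C0)// EFinM lee_pmul ?lee_fin ?(ltW C0) ?esum_ge0//.
by have := hB 0; under eq_esum do rewrite add0r -(norm2_lat theta j).
Qed.

Lemma bloch_summ j a b (q : plane) : summ (fun n : Z2 =>
    expi (- dot q (lat theta j n + tau theta j a - tau theta j b)) * intra h j a b n).
Proof.
have [B B0 hB] := intra_bound.
apply: (@summ_bnd _ _ _ _ 1) => [n|]; first by rewrite nrm_expi.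
by apply: le_lt_trans (hB j a b) _; exact: ltry.
Qed.

Lemma bloch_bound : exists2 B : R, 0 < B & forall j a b q, nrm (intra_bloch theta h j a b q) <= B.
Proof.
have [B B0 hB] := intra_bound; exists B => // j a b q.
apply: nrm_csum_le; apply: le_trans (hB j a b); apply: asum_le => n.
by rewrite nrmM nrm_expi mul1r.
Qed.

Lemma bloch_herm j a b q : intra_bloch theta h j a b q = conjc (intra_bloch theta h j b a q).
Proof.
have bN : bijective (-%R : Z2 -> Z2) by exists -%R; exact: opprK.
rewrite /intra_bloch -csum_conj -(csum_reindex _ bN); congr csum; apply/funext => n.
rewrite conjM conj_expi opprK [intra h j a b _]intra_conj opprK; congr (expi _ * _).
by rewrite -dotNr; congr dot; rewrite latN; apply: plane_eq; rewrite !mxE; ring.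
Qed.

Local Notation L := (reciprocal_entry theta h).

Lemma entry_herm q : hermk (L q).
Proof.
move=> w w'; rewrite /reciprocal_entry [slay w' == _]eq_sym; case: eqP => [E|/eqP jk].
  rewrite [(val w').1.1 == _]eq_sym conjM conj_bool; case: eqP => [G|_]; last by rewrite !mul0r.
  rewrite !mul1r bloch_herm E; congr (conjc (intra_bloch _ _ _ _ _ (q + _))).
  by apply: eq_bigr => t _; rewrite /smom G.
have lE := thirdC jk.
set l := third (slay w) _ in lE *; set l' := third (slay w') _ in lE *.
rewrite -{}lE; set u := smom w l; set u' := smom w' l.
rewrite [u' == u]eq_sym; case: eqP => [G|_]; last exact: conj_mul0.
rewrite (fourier_herm _ _ _ jk).
have -> : q + rlat theta (slay w) (smom w' (slay w)) + rlat theta (slay w') (smom w (slay w')) + rlat theta l u =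
   q + rlat theta (slay w') (smom w (slay w')) + rlat theta (slay w) (smom w' (slay w)) + rlat theta l u'.
  by rewrite G; apply: plane_eq; rewrite !mxE; ring.
move: (fourier _ _) => Z.
move: (dot _ _) => X; move: (dot _ _) => Y; move: (cstar _ _) => c1; move: (cstar _ _) => c2.
by apply: etrans (conj_mul1 _ _ _) _; rewrite opprB (mulrC c1).
Qed.

(** In each sector a row has at most one nonzero entry, if the layer is its own, or is supported on
    one fibre, where the Fourier decay is summed over a translate of a reciprocal lattice. *)
Lemma entry_rowb q : exists2 C : R, 0 < C & rowb (L q) C.
Proof.
have [g [C [g0 C0 _ h1 _]]] := decay_consts hdecay.
have [Bb Bb0 hBb] := bloch_bound.
have [B B0 hB] : exists2 B, 0 < B & forall j (xi : plane), (\esum_(n in [set: Z2]) (expR (- g * norm2 (xi + rlat theta j n)))%:E <= B%:E)%E.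
  apply: fin_bound => [t c c' cc hc xi|t]; first by apply: (le_trans (hc xi)); rewrite lee_fin.
  have dB : \det (mxBj theta t) != 0 by rewrite det_mxBj det_mxB_neq0.
  by have [c _ hc] := lattice_sum g0 dB; exists c.
pose D := `|\det (mxB : 'M[R]_2)|.
have D0 : 0 <= D by exact: normr_ge0.
exists (#|{: layer * orbital}|%:R * (Bb + D * C * B)).
  rewrite mulr_gt0//; last by rewrite ltr_pwDl// !mulr_ge0// ltW.
  by rewrite ltr0n; apply/card_gt0P; exists (ord0, false).
move=> w; apply: (asum_sectors_le star_bij) => -[k b].
set f := fun x => L q w (star (x, (k, b))).
have [kj|kj] := eqVneq (slay w) k.
  apply: (@le_trans _ _ Bb%:E); last by rewrite lee_fin lerDl !mulr_ge0// ltW.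
  rewrite (@asum_one _ _ f (smom w (nx1 k), smom w (nx2 k))).
    rewrite lee_fin /f /reciprocal_entry slay_stsite kj eqxx nrmM.
    by case: eqP => _; rewrite ?nrm1 ?nrm0 ?mul1r ?mul0r ?hBb// ltW.
  move=> [m n] mn; rewrite /f /reciprocal_entry slay_stsite kj eqxx smom_eq.
  case: forallP => [hh|_]; last by rewrite mul0r.
  exfalso; move/eqP: mn; apply.
  have hn := nx1P k; have [h2 h3] := thirdP hn.
  have := hh (nx1 k); have := hh (nx2 k); rewrite !smom_stsite /= eqxx [nx1 k == k]eq_sym (negbTE hn).
  by rewrite (negbTE h2) (negbTE h3) => /eqP -> /eqP ->.
apply: (@le_trans _ _ (D * C * B)%:E); last by rewrite lee_fin lerDr ltW.
set j := slay w in kj *.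
pose g0' := smom w (third j k).
(* The row extended by 0 outside the sector: the sum over pairs becomes one over all sites and then
   one over the fibre, off which the Kronecker factor vanishes. *)
pose F (w' : Omega_star) := if (slay w' == k) && (sorb w' == b) then L q w w' else 0.
have EF : asum f = asum F.
  have isx : injective (fun x => star (x, (k, b))).
    by move=> x y /(bij_inj star_bij) [].
  rewrite (asum_inj isx) => [|w' hw]; first by congr asum; apply/funext => x; rewrite /F /= !eqxx.
  rewrite /F; case: andP => // -[/eqP wk /eqP wb]; exfalso.
  have [gi gK Kg] := star_bij.
  have := hw (gi w').1; rewrite -[X in _ != X -> _](Kg w').
  have : (gi w').2 = (k, b) by rewrite -[w']Kg in wk wb; case: (gi w') wk wb => [x [k' b']] /= <- <-.
  by case: (gi w') => x s /= ->; rewrite eqxx.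
rewrite EF (asum_inj (@fib_inj j k b g0' kj)); last first.
  move=> w' hw; rewrite /F; case: andP => // -[/eqP wk /eqP wb].
  rewrite /reciprocal_entry -/j wk (negbTE kj).
  case: eqP => [G|_]; last by rewrite !mul0r.
  by have := hw (smom w' j); rewrite fib_range// eqxx.
apply: (@le_trans _ _ (\esum_(n in [set: Z2]) (D * C * expR (- g * norm2 ((q + rlat theta k (smom w k) + rlat theta (third j k) g0') + rlat theta j n)))%:E)%E).
  apply: le_esum => n _; rewrite lee_fin /F /= !eqxx.
  set l := third j k in g0' *; pose z := q + rlat theta k (smom w k) + rlat theta l g0' + rlat theta j n.
  have smj : smom (fib j k b g0' n) j = n by rewrite smom_stsite (negbTE kj) eqxx.
  have Ez : q + rlat theta j n + rlat theta k (smom w k) + rlat theta l g0' = z.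
    by rewrite /z; apply: plane_eq; rewrite !mxE; ring.
  rewrite /reciprocal_entry -/j slay_stsite (negbTE kj) -/l -/g0' smj Ez.
  have := h1 j (sorb w) k (sorb (fib j k b g0' n)) z kj; move: (fourier _ z) => Z hF.
  rewrite !nrmM nrm_expi mulr1 nrm_real cstarM normr_id -/D.
  have d1 (u : bool) : nrm (u%:R : R[i]) <= 1 by case: u; rewrite ?nrm1 ?nrm0.
  have D1 : D * nrm Z <= D * C * expR (- g * norm2 z) by rewrite -[leRHS]mulrA; exact: ler_wpM2l.
  rewrite -mulrA; apply: le_trans D1; apply: ler_piMl (d1 _).
  by rewrite mulr_ge0 ?nrm_ge0.
rewrite esumZl ?mulr_ge0 ?(ltW C0)// [leRHS]EFinM lee_pmul ?esum_ge0 ?lee_fin ?mulr_ge0 ?(ltW C0)//.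
Qed.

End Reciprocal.

(** * Plane waves intertwine the two Hamiltonians *)

Section Intertwining.
Context {R : realType}.
Variables (theta : layer -> R) (h : hoppings R).
Hypothesis hdecay : exp_decay theta h.
Hypothesis hcont : continuous_hoppings h.
Local Notation plane := 'cV[R]_2.
Local Notation L := (reciprocal_entry theta h).
Local Notation H := (Hk theta h).
Local Notation pos := (pos theta).

Definition mom (v : Omega_star) : plane := \sum_t rlat theta t (smom v t).

Definition Phi (q : plane) (w : Omega) (v : Omega_star) : R[i] :=
  if (w.1.2 == slay v) && (w.2 == sorb v) then expi (dot (q + mom v) (pos w)) else 0.

Lemma nrm_Phi q w v : nrm (Phi q w v) <= 1.
Proof. by rewrite /Phi; case: ifP => _; rewrite ?nrm_expi ?nrm0. Qed.

Lemma momE (j k : layer) v : j != k -> slay v = k ->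
  mom v = rlat theta j (smom v j) + rlat theta (third j k) (smom v (third j k)).
Proof.
move=> jk E; have s0 : smom v k = 0 by rewrite -E smom_slay.
by rewrite /mom (sum_layers _ jk) s0 rlat0 addr0.
Qed.

Lemma near_affine (M : 'M[R]_2) (x b : plane) (P : plane -> Prop) :
  (\forall y \near (M *m x + b), P y) -> \forall y \near x, P (M *m y + b).
Proof.
move=> hP; have [d d0 hd] := near_box hP; have [K K0 hK] := norm2_mul_le M.
have e0 : 0 < d / (2 * K) by rewrite divr_gt0// mulr_gt0.
apply: filterS (near_norm2 x e0) => y yx.
have main : norm2 (M *m (y - x)) < d.
  apply: (le_lt_trans (hK _)).
  have : `|(y - x) 0 0| + `|(y - x) 1 0| <= 2 * norm2 (y - x).
    by have := coord_le_norm2 (y - x) 0; have := coord_le_norm2 (y - x) 1; lra.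
  rewrite -(ler_pM2l K0) => /le_lt_trans; apply.
  by move: yx; rewrite ltr_pdivlMr ?mulr_gt0//; lra.
have E i : (M *m y + b) i 0 - (M *m x + b) i 0 = (M *m (y - x)) i 0.
  by rewrite mulmxBr !mxE; ring.
by apply: hd; rewrite E; apply: le_lt_trans main; exact: coord_le_norm2.
Qed.

Lemma ccont_affine (f : plane -> R[i]) (M : 'M[R]_2) b : ccont f -> ccont (fun x => f (M *m x + b)).
Proof. by move=> cf x e e0; exact: near_affine (cf (M *m x + b) e e0). Qed.

(** Within a layer Poisson summation does not enter: a plane wave turns the convolution into
    multiplication by the Bloch symbol, and the only contributing site is v with its orbital
    replaced by that of w. *)
Lemma intertwine_same q w v : w.1.2 = slay v ->
  csum (fun n : Z2 => H w (n, slay v, sorb v) * expi (dot (q + mom v) (pos (n, slay v, sorb v)))) =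
  csum (fun v' => Phi q w v' * L q v' v).
Proof.
case: w => [[n j] a] /= jk; set p := q + mom v.
pose v0 := stsite j (smom v) a.
have sm0 t : smom v0 t = smom v t.
  by rewrite smom_stsite; case: eqP => // ->; rewrite jk smom_slay.
have m0 : mom v0 = mom v by apply: eq_bigr => t _; rewrite sm0.
rewrite [RHS](@csum_one _ _ _ v0); last first.
  move=> v' v'0; rewrite /Phi /=; case: andP => [[/eqP e1 /eqP e2]|_]; last by rewrite mul0r.
  rewrite /reciprocal_entry -e1 -jk eqxx smom_eq; case: forallP => [hh|_]; last by rewrite mul0r mulr0.
  exfalso; move/eqP: v'0; apply; apply: star_eq; rewrite ?slay_stsite ?sorb_stsite// => t.
  by rewrite sm0; exact: (eqP (hh t)).
rewrite /Phi /= !eqxx /= m0 -/p /reciprocal_entry -/(mom v0) m0 -/p.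
have -> : ((val v0).1.1 == (val v).1.1) = true by rewrite smom_eq; apply/forallP => t; rewrite sm0.
rewrite slay_stsite sorb_stsite jk eqxx mul1r /intra_bloch -csumZ; last exact: bloch_summ.
have br : bijective (fun m : Z2 => n - m) by exists (fun m => n - m) => m; rewrite opprB addrC subrK.
rewrite -(csum_reindex _ br); congr csum; apply/funext => m.
rewrite /Hk /= eqxx opprB addrC subrK mulrA -expiD mulrC; congr (expi _ * _).
rewrite -dotNr -dotDr; congr (dot p _).
by rewrite /pos /= latD latN; apply: plane_eq; rewrite !mxE; ring.
Qed.

Section Diff.
Variables (q : plane) (w : Omega) (v : Omega_star).
Let j := w.1.2. Let k := slay v. Let l := third j k. Let p := q + mom v.
Let a := w.2. Let b := sorb v.
Hypothesis jk : j != k.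

Let K : R := `|\det (mxB : 'M[R]_2)|.

(** The interlayer summand extended from sites to the whole plane, in coordinates where the lattice
    of layer k is Z^2. *)
Let vv (x : plane) := inter h j a k b (- mxAj theta k *m x + (pos w - tau theta k b)) *
  expi (dot p (mxAj theta k *m x + tau theta k b)).

Let dA : \det (- mxAj theta k) != 0.
Proof. by rewrite -scaleN1r detZ mulf_neq0 ?expf_neq0 ?oppr_eq0 ?oner_eq0// det_mxAj det_mxA_neq0. Qed.

Lemma fiber_cont : ccont vv.
Proof.
apply: ccontM; first exact: (ccont_affine _ _ (inter_cont hcont a b jk)).
have := ccont_affine (mxAj theta k) (tau theta k b) (ccont_expi p 1).
by under eq_fun do rewrite mul1r.
Qed.

Lemma fiber_decay : exists g C : R, 0 < g /\ forall x, nrm (vv x) <= C * expR (- g * norm2 x).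
Proof.
have [g [C [g0 C0 h1 _ _]]] := decay_consts hdecay.
have [c c0 hc] := coord_le_mul dA.
set u := pos w - tau theta k b.
exists (g * (c / 2)), (C * expR (g * norm2 u)); split; first by rewrite mulr_gt0// divr_gt0.
move=> x; rewrite /vv -/u nrmM nrm_expi mulr1 (le_trans (h1 _ _ _ _ _ jk))// -mulrA ler_wpM2l ?(ltW C0)// -expRD ler_expR.
have h2 : c / 2 * norm2 x <= norm2 (- mxAj theta k *m x).
  have := norm2_le_coord x; rewrite -(ler_pM2l c0); have := hc x 0; have := hc x 1; lra.
have h3 : norm2 (- mxAj theta k *m x) <= norm2 (- mxAj theta k *m x + u) + norm2 u.
  by rewrite -[norm2 u]norm2N; apply: le_trans (norm2D _ _); rewrite addrK.
have : g * (c / 2 * norm2 x) <= g * (norm2 (- mxAj theta k *m x + u) + norm2 u).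
  by rewrite ler_wpM2l ?(ltW g0)//; exact: le_trans h2 h3.
lra.
Qed.

(** Change of variable y = - A_k x + u. Duality turns the character into a plane wave, and the
    Jacobian 1 / |det A| is |det B| / (4 pi^2): this provides both the constant in [fourier] and the
    factor c_j c_k of the entries. *)
Lemma fiber_coef m : cI (fun x => vv x * ch m x) =
  K%:C * (expi (dot p (pos w) + dot (rlat theta k m) (pos w - tau theta k b)) *
  fourier (inter h j a k b) (p + rlat theta k m)).
Proof.
set u := pos w - tau theta k b; set P := p + rlat theta k m.
pose F (y : plane) := inter h j a k b y * expi (- dot P y).
have iF : cint F by exact: (inter_cint hdecay hcont a b P jk).
set c := expi _.
have [iG eG] := cI_Z c iF.
have [_] := cI_affine u dA iG.
rewrite eG (_ : (fun x : plane => _) = (fun x => vv x * ch m x)); last first.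
  apply/funext => x; rewrite /F /vv /c mulrCA -!mulrA; congr (_ * _).
  rewrite -expiD /ch -(dual theta k) -rlatE -expiD; congr expi.
  rewrite /P /u mulNmx !dotDl !dotDr !dotNr; ring.
move=> ->; rewrite /fourier -/(cI F) /K det_mxB.
have -> : `|\det (- mxAj theta k)| = `|\det (mxA : 'M[R]_2)|.
  by rewrite -scaleN1r detZ sqrrN expr1n mul1r det_mxAj.
have d0 := @det_mxA_neq0 R.
have pp : 0 <= 4 * pi ^+ 2 :> R by rewrite mulr_ge0 ?sqr_ge0.
rewrite normrM normfV (ger0_norm pp); move: (cI F) => z.
have -> : (`|\det (mxA : 'M[R]_2)|^-1)%:C = (4 * pi ^+ 2 / `|\det (mxA : 'M[R]_2)|)%:C * ((4 * pi ^+ 2)^-1)%:C :> R[i].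
  have p0 : (4 * pi ^+ 2 : R) != 0 by rewrite mulf_neq0 ?expf_neq0// gt_eqF ?pi_gt0.
  by rewrite -rcM mulrAC divff// mul1r.
by move: (_%:C) (_%:C) => s t; ring.
Qed.

(** The dual index m of Poisson summation is the component of v' along layer k, so the sum over m
    runs along one fibre of reciprocal sites. *)
Lemma intertwine_diff :
  csum (fun n : Z2 => H w (n, slay v, sorb v) * expi (dot (q + mom v) (pos (n, slay v, sorb v)))) =
  csum (fun v' => Phi q w v' * L q v' v).
Proof.
have kj : k != j by rewrite eq_sym.
have [g [C [g0 hg]]] := fiber_decay.
have E1 (n : Z2) : H w (n, slay v, sorb v) * expi (dot (q + mom v) (pos (n, slay v, sorb v))) = vv (zv n).
  rewrite /Hk /= (negbTE jk) /vv; congr (inter h j a k b _ * _).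
  by rewrite /pos /= latE mulNmx; apply: plane_eq; rewrite !mxE; ring.
have -> : (fun n : Z2 => H w (n, slay v, sorb v) * expi (dot (q + mom v) (pos (n, slay v, sorb v)))) = fun n => vv (zv n).
  by apply/funext.
have sv : summ (fun m => cI (fun x => vv x * ch m x)).
  have [g' [C' [g'0 C'0 _ h1 _]]] := decay_consts hdecay.
  apply: (@summ_le_r _ _ _ (fun m => K * C' * expR (- g' * norm2 (p + rlat theta k m)))).
    move=> m; rewrite fiber_coef nrmM nrm_real normr_id -mulrA ler_wpM2l ?normr_ge0//.
    by rewrite nrmM nrm_expi mul1r; exact: h1.
  by apply: rsmZ; apply: lattice_rsm => //; rewrite det_mxBj det_mxB_neq0.
rewrite (poisson g0 fiber_cont hg sv).
rewrite [RHS](csum_inj (@fib_inj k j a (smom v l) kj)); last first.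
  move=> v' hv'; rewrite /Phi -/j -/a; case: andP => [[/eqP e1 /eqP e2]|_]; last by rewrite mul0r.
  rewrite /reciprocal_entry -e1 -/k (negbTE jk) -/l; case: eqP => [G|_]; last by rewrite !mul0r mulr0.
  by have := hv' (smom v' k); rewrite fib_range// ?eqxx// thirdC.
congr csum; apply/funext => m; rewrite fiber_coef.
have [t1 t2] := thirdP jk.
set v' := fib _ _ _ _ _.
have sk : smom v' k = m by rewrite smom_stsite (negbTE kj) eqxx.
have sl : smom v' l = smom v l by rewrite smom_stsite (negbTE t1) (negbTE t2).
rewrite /Phi -/j -/a !eqxx /= /reciprocal_entry slay_stsite -/k (negbTE jk) -/l sk sl eqxx.
rewrite (cstarM theta j k) -/K sorb_stsite -/b.
have mv : mom v = rlat theta j (smom v j) + rlat theta l (smom v l) by exact: momE.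
have mv' : mom v' = rlat theta k m + rlat theta l (smom v l).
  by rewrite (momE kj (_ : slay v' = j))// -(thirdC jk) sk -/l sl.
have -> : p + rlat theta k m = q + rlat theta j (smom v j) + rlat theta k m + rlat theta l (smom v l).
  by rewrite /p mv; apply: plane_eq; rewrite !mxE; ring.
move: (fourier _ _) => Z; rewrite -[true%:R]/(1 : R[i]) mul1r.
have ph : expi (dot p (pos w) + dot (rlat theta k m) (pos w - tau theta k b)) =
  expi (dot (q + mom v') (pos w)) * expi (dot (rlat theta j (smom v j)) (tau theta j a) - dot (rlat theta k m) (tau theta k b)).
  rewrite -expiD.
  (* The two phases differ by the product of a reciprocal vector of layer j with the lattice vector
     of w in the same layer, a multiple of 2 pi. *)
  have -> : dot p (pos w) + dot (rlat theta k m) (pos w - tau theta k b) =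
     (dot (q + mom v') (pos w) + (dot (rlat theta j (smom v j)) (tau theta j a) - dot (rlat theta k m) (tau theta k b)))
      + dot (rlat theta j (smom v j)) (lat theta j w.1.1).
    rewrite /p mv mv' /pos -/j -/a !dotDl !dotDr !dotNr; ring.
  by rewrite [LHS]expiD dual_int [X in _ * X = _](ch_zv (smom v j) w.1.1) mulr1.
by rewrite ph; move: (expi _) (expi _) => x y; ring.
Qed.

End Diff.

Lemma Phi_intertwine q w v : kop H (fun w' => Phi q w' v) w = csum (fun v' => Phi q w v' * L q v' v).
Proof.
rewrite /kop (@csum_inj _ _ _ (fun n : Z2 => (n, slay v, sorb v) : Omega)); last 2 first.
- by move=> m n [].
- move=> [[n k] b] hn; rewrite /Phi /=; case: andP => [[/eqP e1 /eqP e2]|_]; last by rewrite mulr0.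
  by have := hn n; rewrite e1 e2 eqxx.
rewrite (_ : (fun n : Z2 => _) = fun n : Z2 => H w (n, slay v, sorb v) * expi (dot (q + mom v) (pos (n, slay v, sorb v)))); last first.
  by apply/funext => n; rewrite /Phi /= !eqxx.
have [jk|jk] := eqVneq w.1.2 (slay v); first exact: intertwine_same.
exact: intertwine_diff.
Qed.

End Intertwining.

(** * The densities of states *)

Section LatticeCharacters.
Context {R : realType}.
Local Notation plane := 'cV[R]_2.
Variables (M N : 'M[R]_2).
Hypothesis dM : \det M != 0.
Hypothesis MN : forall u w : plane, dot (N *m u) (M *m w) = 2 * pi * dot u w.

Lemma dot_inj (u v : plane) : (forall w, dot u w = dot v w) -> u = v.
Proof.
move=> h; have := h (col2 1 0); have := h (col2 0 1).
by rewrite !dotE !mxE /= !mulr1 !mulr0 !addr0 !add0r => h1 h0; exact: plane_eq.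
Qed.

Lemma dual_tr (u : plane) : M^T *m (N *m u) = (2 * pi) *: u.
Proof.
apply: dot_inj => w; rewrite dot_tr MN !dotE !mxE; ring.
Qed.

(** The point of the torus whose character of Z^2 sends n to exp (i M n . D). M and its dual N are
    abstract because real and reciprocal lattices each take the part of M. *)
Definition freq (D : plane) : plane := (2 * pi)^-1 *: (M^T *m D).

Lemma ch_freq n D : ch n (freq D) = expi (dot (M *m zv n) D).
Proof.
have p0 : 2 * pi != 0 :> R by rewrite mulf_neq0// gt_eqF ?pi_gt0.
have dotZr c (u v : plane) : dot u (c *: v) = c * dot u v by rewrite !dotE !mxE; ring.
by rewrite /ch /freq dotZr mulVKf// -[in RHS](trmxK M) dot_tr.
Qed.

Lemma freq_int D (k : Z2) : freq D = zv k -> D = N *m zv k.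
Proof.
have p0 : 2 * pi != 0 :> R by rewrite mulf_neq0// gt_eqF ?pi_gt0.
have MU : M \in unitmx by rewrite unitmxE unitfE.
move=> h; apply: dot_inj => w; rewrite -[w](mulKVmx MU) -!dot_tr; congr dot.
by rewrite dual_tr -h /freq scalerA divff// scale1r.
Qed.

End LatticeCharacters.

Section Sequences.
Context {R : realType}.

(** The averages are indexed by real radii, while dominated convergence is used along sequences. *)
Lemma clim_seq (u : R -> R[i]) (l : R[i]) :
  (forall r_ : nat -> R, r_ @ \oo --> +oo -> clim \oo (fun i => u (r_ i)) l) -> clim +oo u l.
Proof.
move=> h; apply/clim_ReIm; split; apply/cvg_pinftyP => r_ hr; have /clim_ReIm[] := h r_ hr; done.
Qed.

Lemma clim_comp_seq (u : R -> R[i]) (l : R[i]) (r_ : nat -> R) : clim +oo u l -> r_ @ \oo --> +oo ->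
  clim \oo (fun i => u (r_ i)) l.
Proof. by move=> hu hr e e0; exact: hr (hu e e0). Qed.

End Sequences.

Section Densities.
Context {R : realType}.
Variables (theta : layer -> R) (h : hoppings R).
Hypothesis hinc : double_incommensurate theta.
Hypothesis hdecay : exp_decay theta h.
Hypothesis hcont : continuous_hoppings h.
Hypothesis hherm : hermitian_hoppings h.
Variable b : nat -> R.
Hypothesis bD : forall D, 0 <= D -> bsm b D.
Local Notation plane := 'cV[R]_2.
Local Notation L := (reciprocal_entry theta h).
Local Notation H := (Hk theta h).
Local Notation pos := (pos theta).
Local Notation mom := (mom theta).
Local Notation fH := (fker b H).
Local Notation fL q := (fker b (L q)).

Lemma fker_intertwine q w v : csum (fun w' => fH w w' * Phi theta q w' v) = csum (fun v' => Phi theta q w v' * fL q v' v).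
Proof.
have [g [C [g0 C0 rH _]]] := Hk_weighted hdecay.
have [D D0 rL] := entry_rowb hdecay q.
have cL := herm_colb (entry_herm hdecay hherm hcont q) rL.
apply: (kop_intertwine rH cL (ltW C0) (ltW D0) ler01 (bD (ltW C0)) (bD (ltW D0)) (@nrm_Phi R theta q)).
by move=> w' v'; exact: Phi_intertwine.
Qed.

Lemma fH_bound : exists2 d : layer -> Z2 -> R, (forall j, rsm (d j)) &
  forall n j a m, nrm (fH (n, j, a) (n + m, j, a)) <= d j m.
Proof.
have [g [C [g0 C0 hC]]] := fker_decay hdecay bD.
exists (fun j m => C * expR (- g * norm2 (0 + mxAj theta j *m zv m))).
  by move=> j; apply: rsmZ; apply: lattice_rsm => //; rewrite det_mxAj det_mxA_neq0.
move=> n j a m; apply: (le_trans (hC _ _)); rewrite le_eqVlt; apply/orP; left; apply/eqP.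
congr (_ * expR (_ * _)); rewrite -norm2N; congr norm2.
by rewrite /pos /= latD; apply: plane_eq; rewrite !mxE; ring.
Qed.

Lemma fL_summ q v : summ (fun v' => fL q v' v).
Proof.
have [D D0 rL] := entry_rowb hdecay q.
have cL := herm_colb (entry_herm hdecay hherm hcont q) rL.
have cf := fker_colb rL (ltW D0) (bD (ltW D0)) cL (ltW D0) (bD (ltW D0)).
by apply: le_lt_trans (cf v) _; exact: ltry.
Qed.

(** The ball of lattice sites, seen as a cylinder over one point so that [equidistribution] applies
    with d = 0. Rotations preserve the norm, so the unrotated matrix serves all layers. *)
Definition ucyl (r : R) : {fset Z2 * unit} :=
  cylb (mxA : 'M[R]_2) (fun _ : unit => 0) (fun r => if 0 < r then [fset tt]%fset else fset0) r.

Lemma mem_ubase (r : R) (y : unit) : 0 < r -> (y \in (if 0 < r then [fset tt]%fset else fset0)) = ((0 : R) < r).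
Proof. by move=> r0; rewrite r0 inE; case: y. Qed.

Lemma ubase_card : exists2 k : R, 0 < k & forall r, 1 <= r ->
  k * r ^+ 0 <= #|` (if 0 < r then [fset tt]%fset else fset0 : {fset unit})|%:R.
Proof. by exists 1 => // r r1; rewrite (lt_le_trans ltr01 r1) cardfs1 mulr1. Qed.

Lemma ubase_card' : exists2 K : R, 0 < K & forall r, 1 <= r ->
  #|` (if 0 < r then [fset tt]%fset else fset0 : {fset unit})|%:R <= K * r ^+ 0.
Proof. by exists 1 => // r r1; rewrite (lt_le_trans ltr01 r1) cardfs1 mulr1. Qed.

Lemma ucyl_card r : 2 <= r -> (0 < #|` ucyl r|)%N.
Proof.
exact: (@cylb_card_gt0 R mxA det_mxA_neq0 unit _ _ 0 (fun _ => lexx 0) mem_ubase ubase_card).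
Qed.

Lemma ucyl_equi (s : plane) (phi : unit -> R[i]) : (forall n : Z2, s != zv n) -> (forall y, nrm (phi y) <= 1) ->
  clim +oo (fun r => avgF (ucyl r) (fun p => ch p.1 s * phi p.2)) 0.
Proof.
exact: (@equidistribution R mxA det_mxA_neq0 unit _ _ 0 (fun _ => lexx 0) mem_ubase ubase_card ubase_card').
Qed.

Section Sector.
Variables (j : layer) (a : orbital).

Definition avg_coef (r : R) (m : Z2) : R[i] :=
  avgF (ucyl r) (fun x => fH (x.1, j, a) (x.1 + m, j, a)).

(** The intertwining relation at site n, divided by the plane wave of v there. The left side then
    depends on n only through the entries of f(H), the right side only through phases, and both can
    be averaged over n. *)
Lemma site_identity q v n : slay v = j -> sorb v = a ->
  csum (fun m => fH (n, j, a) (n + m, j, a) * expi (dot (q + mom v) (lat theta j m))) =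
  csum (fun v' => (if (j == slay v') && (a == sorb v') then expi (dot (mom v' - mom v) (pos (n, j, a))) else 0) * fL q v' v).
Proof.
move=> vj va; have := fker_intertwine q (n, j, a) v.
rewrite (@csum_inj _ _ _ (fun m : Z2 => (n + m, j, a) : Omega)); last 2 first.
- by move=> m m' [] /addrI.
- move=> [[n' k'] b'] hn; rewrite /Phi /= vj va; case: andP => [[/eqP e1 /eqP e2]|_]; last by rewrite mulr0.
  by have := hn (n' - n); rewrite e1 e2 addrC subrK eqxx.
set z := expi (- dot (q + mom v) (pos (n, j, a))).
move=> /(congr1 (fun t => z * t)).
rewrite -!csumZ.
- move=> E; transitivity (csum (fun m => z * (fH (n, j, a) (n + m, j, a) * Phi theta q (n + m, j, a) v))).
    congr csum; apply/funext => m; rewrite /Phi /= vj va !eqxx /= mulrCA -expiD; congr (_ * expi _).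
    rewrite -dotNr -dotDr; congr dot.
    by rewrite /pos /= latD; apply: plane_eq; rewrite !mxE; ring.
  rewrite E; congr csum; apply/funext => v'; rewrite /Phi /= mulrA; congr (_ * _).
  case: ifP => _; last by rewrite mulr0.
  by rewrite -expiD; congr expi; rewrite -[mom v']addr0 !dotDl dotNl; ring.
- by apply: (summ_bnd (C := 1)) => [v'|]; [exact: nrm_Phi|exact: fL_summ].
- have [d sd hd] := fH_bound; apply: (@summ_le_r _ _ _ (d j)) => // m.
  by rewrite nrmM -[leRHS]mulr1 ler_pM ?nrm_ge0 ?nrm_Phi.
Qed.

Lemma avg_coef_bound : exists2 d : Z2 -> R, rsm d & forall r m, nrm (avg_coef r m) <= d m.
Proof.
have [d sd hd] := fH_bound; exists (d j) => // r m; apply: avgF_nrm => [|x]; last exact: hd.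
exact: le_trans (nrm_ge0 _) (hd 0 j a m).
Qed.

Lemma avgF_Zr {X : choiceType} (B : {fset X}) (g : X -> R[i]) c : avgF B (fun x => g x * c) = avgF B g * c.
Proof. by rewrite /avgF -mulr_suml mulrA. Qed.

Lemma dotC (u v : plane) : dot u v = dot v u.
Proof. by rewrite !dotE; ring. Qed.

Lemma mom_freq v v' : slay v = j -> slay v' = j -> sorb v = sorb v' -> v' != v ->
  forall n : Z2, freq (mxAj theta j) (mom v' - mom v) != zv n.
Proof.
move=> vj v'j vo vv k; apply/eqP => E.
have dA : \det (mxAj theta j) != 0 by rewrite det_mxAj det_mxA_neq0.
have := freq_int dA (dual theta j) E; rewrite -rlatE => D.
(* If the frequency were integral, mom v' - mom v would lie in the reciprocal lattice of layer j;
   with - k in slot j this is a vanishing sum over the three reciprocal lattices. *)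
pose n t := if t == j then - k else smom v' t - smom v t.
have s0 : \sum_(t in [set: layer]%SET) latvec (mxBj theta t) (n t) = 0.
  rewrite (eq_bigl xpredT); last by move=> t; rewrite inE.
  rewrite (bigD1 j)//= {1}/n eqxx.
  have -> : \sum_(t | t != j) latvec (mxBj theta t) (n t) = mom v' - mom v.
    rewrite /mom -sumrB [RHS](bigD1 j)//= -[X in smom v' X]v'j -[X in smom v X]vj !smom_slay subrr add0r.
    by apply: eq_bigr => t tj; rewrite /n (negbTE tj) -rlatN -rlatD.
  by rewrite D -[latvec _ _]/(rlat theta j (- k)) rlatN addNr.
have /(_ s0) hz := (hinc.2 [set: layer]%SET n).1.
move/eqP: vv; apply; apply: star_eq; [by rewrite v'j vj|by rewrite vo|] => t.
have [->|tj] := eqVneq t j; first by rewrite -[X in smom v' X]v'j -[X in smom v X]vj !smom_slay.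
have dB : \det (mxBj theta t) != 0 by rewrite det_mxBj det_mxB_neq0.
have := latvec_eq0 dB (hz t (finset.in_setT t)); rewrite /n (negbTE tj) => /eqP.
by rewrite subr_eq0 => /eqP.
Qed.

(** The summable column of f(Hhat_q) dominates the sum over v'. The averaged phases tend to 1 at v'
    = v and, by [mom_freq], to 0 elsewhere in the sector of v. *)
Lemma sector_limit q v : slay v = j -> sorb v = a ->
  clim +oo (fun r => csum (fun m => avg_coef r m * expi (dot (q + mom v) (lat theta j m)))) (fL q v v).
Proof.
move=> vj va; have [d sd hd] := fH_bound.
pose T (n : Z2) v' : R[i] := if (j == slay v') && (a == sorb v') then expi (dot (mom v' - mom v) (pos (n, j, a))) else 0.
have T1 n v' : nrm (T n v') <= 1 by rewrite /T; case: ifP => _; rewrite ?nrm_expi ?nrm0.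
have E r : csum (fun m => avg_coef r m * expi (dot (q + mom v) (lat theta j m))) =
    csum (fun v' => avgF (ucyl r) (fun x => T x.1 v') * fL q v' v).
  transitivity (avgF (ucyl r) (fun x => csum (fun m => fH (x.1, j, a) (x.1 + m, j, a) * expi (dot (q + mom v) (lat theta j m))))).
    rewrite avgF_csum; first by congr csum; apply/funext => m; rewrite avgF_Zr.
    move=> x; apply: (@summ_le_r _ _ _ (d j)) => // m.
    by rewrite nrmM nrm_expi mulr1.
  rewrite (_ : (fun x : Z2 * unit => _) = fun x => csum (fun v' => T x.1 v' * fL q v' v)); last first.
    by apply/funext => x; exact: site_identity.
  rewrite avgF_csum; first by congr csum; apply/funext => v'; rewrite avgF_Zr.
  by move=> x; apply: (summ_bnd (C := 1)) => [v'|]; [exact: T1|exact: fL_summ].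
under eq_fun do rewrite E.
have -> : fL q v v = csum (fun v' => (v' == v)%:R * fL q v' v).
  by rewrite (@csum_one _ _ _ v) ?eqxx ?mul1r// => v' /negbTE ->; rewrite mul0r.
apply: (@csum_clim _ _ _ _ _ _ _ (fun v' => nrm (fL q v' v))).
- exact: (proj1 (summ_rsm _) (fL_summ q v)).
- near=> r => v'; rewrite nrmM ler_piMl ?nrm_ge0//.
  by apply: avgF_nrm => // x; exact: T1.
- by move=> v'; rewrite nrmM ler_piMl ?nrm_ge0//; case: (v' == v); rewrite ?nrm1 ?nrm0.
move=> v'; have key : clim +oo (fun r => avgF (ucyl r) (fun x => T x.1 v')) (v' == v)%:R.
  have [->|vv] := eqVneq v' v.
    apply: (@clim_near_eq _ _ _ _ (fun=> 1)); last exact: clim_cst.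
    near=> r; rewrite (_ : (fun x : Z2 * unit => _) = fun=> 1).
      by rewrite avgF_cst// ucyl_card//; near: r; exact: nbhs_pinfty_ge.
    by apply/funext => x; rewrite /T vj va !eqxx /= subrr dot0l expi0.
  case: (boolP ((j == slay v') && (a == sorb v'))) => [/andP[/eqP e1 /eqP e2]|ne]; last first.
    apply: (@clim_near_eq _ _ _ _ (fun=> 0)); last exact: clim_cst.
    near=> r; rewrite (_ : (fun x : Z2 * unit => _) = fun=> 0); first by rewrite /avgF big1// mulr0.
    by apply/funext => x; rewrite /T (negbTE ne).
  pose phi (_ : unit) : R[i] := expi (dot (mom v' - mom v) (tau theta j a)).
  have phi1 : nrm (phi tt) <= 1 by rewrite nrm_expi.
  have vo : sorb v = sorb v' by rewrite va.
  have h0 := @ucyl_equi _ phi (mom_freq vj (esym e1) vo vv) (fun _ => phi1).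
  apply: clim_near_eq h0.
  near=> r; congr avgF; apply/funext => x.
  rewrite /T e1 e2 !eqxx /= ch_freq -expiD; congr expi.
  by rewrite [dot (mxAj _ _ *m _) _]dotC -dotDr /pos /= -e1 -e2.
by have := climM _ key (@clim_cst _ _ _ _ (fL q v' v)); apply.
Unshelve. all: by end_near. Qed.

Let v0 := Omega_star0 j a.

Definition Fsec (q : plane) : R[i] := fL q v0 v0.

Lemma mom0 : mom v0 = 0.
Proof. by rewrite /mom big1// => t _; rewrite /smom /= ffunE rlat0. Qed.

Lemma Fsec_limit q : clim +oo (fun r => csum (fun m => avg_coef r m * expi (dot q (lat theta j m)))) (Fsec q).
Proof. by have := @sector_limit q v0 erefl erefl; rewrite mom0 addr0. Qed.

(** Both entries are limits of the same averages, which depend on q and v only through q + mom v. *)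
Lemma diag_Fsec q v : slay v = j -> sorb v = a -> fL q v v = Fsec (q + mom v).
Proof.
move=> vj va.
exact: (@clim_unique _ _ +oo _ _ _ _ _ (sector_limit q vj va) (Fsec_limit _)).
Qed.

Definition lim_coef (m : Z2) : R[i] := cI (fun x => icell x * (Fsec (mxBj theta j *m x) * ch (- m) x)).

Lemma avg_coef_summ r : summ (fun m => avg_coef r (- m)).
Proof.
have [d sd hd] := avg_coef_bound; apply/(summ_reindex (avg_coef r) oppz_bij).
exact: (@summ_le_r _ _ _ d).
Qed.

(** [Fsec] is known only as a pointwise limit, so its integrability over the cell comes out of the
    same dominated convergence as the limit of the coefficients. *)
Lemma avg_coef_dct m (r_ : nat -> R) : r_ @ \oo --> +oo ->
  cint (fun x => icell x * (Fsec (mxBj theta j *m x) * ch (- m) x)) /\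
  clim \oo (fun i => avg_coef (r_ i) m) (lim_coef m).
Proof.
move=> hr; have [d sd hd] := avg_coef_bound.
pose t i := trig (fun m => avg_coef (r_ i) (- m)).
have tE i x : t i x = csum (fun m => avg_coef (r_ i) m * expi (dot (mxBj theta j *m x) (lat theta j m))).
  by congr csum; apply/funext => k; rewrite opprK /ch dual dotC.
have tB i x : nrm (t i x) <= rsum d.
  apply: nrm_csum_le; apply: asum_le_rsum => // k.
  by rewrite nrmM nrm_ch mulr1 opprK.
have tF i : cI (fun x => icell x * (t i x * ch (- m) x)) = avg_coef (r_ i) m.
  have := dual_fourier (avg_coef_summ (r_ i)) 0 (- m); rewrite oppr0 ch_0 mul1r opprK => <-.
  by congr cI; apply/funext => x; rewrite addr0.
have [h1 h2] : cint (fun x => icell x * (Fsec (mxBj theta j *m x) * ch (- m) x)) /\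
   clim \oo (fun i => cI (fun x => icell x * (t i x * ch (- m) x))) (lim_coef m).
  apply: (@cI_dct _ _ _ (fun z => rsum d * (cellb (vec z))%:R)).
  - move=> i; apply: cmeasM; first exact: cmeas_icell.
    by apply: cmeasM; [exact: cmeas_cont (dual_cont (avg_coef_summ _))|exact: cmeas_ch].
  - by apply: rintZ; exact: rint_cell.1.
  - by move=> i z; rewrite !nrmM nrm_icell nrm_ch mulr1 mulrC ler_wpM2r.
  - move=> x; apply: climZ; apply: climM; last exact: clim_cst.
    under eq_fun do rewrite tE.
    exact: (clim_comp_seq (Fsec_limit _) hr).
by split => //; move: h2; under eq_fun do rewrite tF.
Qed.

Lemma lim_coef_cint m : cint (fun x => icell x * (Fsec (mxBj theta j *m x) * ch (- m) x)).
Proof. exact: (avg_coef_dct m (@cvgr_idn R)).1. Qed.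

Lemma avg_coef_limit m : clim +oo (avg_coef ^~ m) (lim_coef m).
Proof. by apply: clim_seq => r_ hr; exact: (avg_coef_dct m hr).2. Qed.

Lemma lim_coef_bound : exists2 d : Z2 -> R, rsm d & (forall m, nrm (lim_coef m) <= d m) /\ forall r m, nrm (avg_coef r m) <= d m.
Proof.
have [d sd hd] := avg_coef_bound; exists d => //; split => // m.
apply: (clim_nrm_le _ (avg_coef_limit m)); near=> r; exact: hd.
Unshelve. all: by end_near. Qed.

Lemma FsecE q : Fsec q = csum (fun m => lim_coef m * expi (dot q (lat theta j m))).
Proof.
have [d sd [hc ha]] := lim_coef_bound.
apply: (@clim_unique _ _ +oo _ _ _ _ _ (Fsec_limit q)).
apply: (@csum_clim _ _ _ _ _ _ _ d) => //.
- by near=> r => m; rewrite nrmM nrm_expi mulr1.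
- by move=> m; rewrite nrmM nrm_expi mulr1.
by move=> m; apply: climM; [exact: avg_coef_limit|exact: clim_cst].
Unshelve. all: by end_near. Qed.

Lemma trace_sector : cintegral2 (rcell theta j) Fsec = (`|\det (mxB : 'M[R]_2)|)%:C * lim_coef 0.
Proof.
have E : (fun x => icell x * (Fsec (mxBj theta j *m x) * ch (- 0) x)) = fun x => icell x * Fsec (mxBj theta j *m x).
  by apply/funext => x; rewrite oppr0 ch0 mulr1.
have := lim_coef_cint 0; rewrite E => i0.
by rewrite (cI_rcell i0) /lim_coef E.
Qed.

(** Pairs of momenta, one for each layer other than j, the second being the base of growth r^2; the
    matrix is again unrotated. *)
Definition bcyl (r : R) : {fset Z2 * Z2} :=
  cylb (mxB : 'M[R]_2) (fun n => norm2 ((mxB : 'M[R]_2) *m zv n)) (zb (mxB : 'M[R]_2)) r.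

Lemma bcyl_card r : 2 <= r -> (0 < #|` bcyl r|)%N.
Proof.
apply: (@cylb_card_gt0 R mxB det_mxB_neq0 Z2 _ _ 2 (fun _ => norm2_ge0 _)).
  by move=> r' y r'0; rewrite mem_zb// det_mxB_neq0.
have [k k0 hk] := zb_lower (@det_mxB_neq0 R); exists k => // r' r1; apply: hk; exact: lt_le_trans r1.
Qed.

Lemma bcyl_equi (s : plane) (phi : Z2 -> R[i]) : (forall n : Z2, s != zv n) -> (forall y, nrm (phi y) <= 1) ->
  clim +oo (fun r => avgF (bcyl r) (fun p => ch p.1 s * phi p.2)) 0.
Proof.
apply: (@equidistribution R mxB det_mxB_neq0 Z2 _ _ 2 (fun _ => norm2_ge0 _)).
- by move=> r' y r'0; rewrite mem_zb// det_mxB_neq0.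
- have [k k0 hk] := zb_lower (@det_mxB_neq0 R); exists k => // r' r1; apply: hk; exact: lt_le_trans r1.
- exact: zb_upper det_mxB_neq0.
Qed.

(** If A_j m belonged to the lattice of layer i, there would be a nontrivial relation between two
    real lattices, excluded by incommensurability for the subset of j and i. *)
Lemma lat_freq i m : j != i -> m != 0 -> forall n : Z2, freq (mxBj theta i) (lat theta j m) != zv n.
Proof.
move=> ji m0 n; apply/eqP => E.
have dB : \det (mxBj theta i) != 0 by rewrite det_mxBj det_mxB_neq0.
have MN (u w : plane) : dot (mxAj theta i *m u) (mxBj theta i *m w) = 2 * pi * dot u w.
  by rewrite dotC dual dotC.
have := freq_int dB MN E; rewrite -latE => D.
pose f t := if t == j then m else - n.
have s0 : \sum_(t in [set j; i]%SET) latvec (mxAj theta t) (f t) = 0.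
  rewrite big_setU1 ?inE//= big_set1 /f eqxx eq_sym (negbTE ji).
  by rewrite -[latvec _ _]/(lat theta j m) -[latvec (mxAj theta i) _]/(lat theta i (- n)) latN D subrr.
have /(_ s0) hz := (hinc.1 [set j; i]%SET f).1.
have := hz j (set21 _ _); rewrite /f eqxx => z.
by move/eqP: m0; apply; apply: latvec_eq0 z; rewrite det_mxAj det_mxA_neq0.
Qed.

Lemma recip_limit : clim +oo (fun r => avgF (bcyl r) (fun x => fL 0 (star (x, (j, a))) (star (x, (j, a))))) (lim_coef 0).
Proof.
have [d sd [hc _]] := lim_coef_bound.
have nj := nx1P j; have [n1 n2] := thirdP nj.
have momS x : mom (star (x, (j, a))) = rlat theta (nx1 j) x.1 + rlat theta (nx2 j) x.2.
  rewrite /mom (sum_layers _ nj) !smom_stsite eqxx rlat0 add0r /=.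
  by rewrite [nx1 j == j]eq_sym (negbTE nj) eqxx (negbTE n1) (negbTE n2).
have ES r : avgF (bcyl r) (fun x => fL 0 (star (x, (j, a))) (star (x, (j, a)))) =
   csum (fun m => lim_coef m * avgF (bcyl r) (fun x => expi (dot (mom (star (x, (j, a)))) (lat theta j m)))).
  rewrite (_ : (fun x : Z2 * Z2 => fL 0 _ _) = fun x => csum (fun m => expi (dot (mom (star (x, (j, a)))) (lat theta j m)) * lim_coef m)); last first.
    by apply/funext => x; rewrite diag_Fsec// add0r FsecE; congr csum; apply/funext => m; rewrite mulrC.
  rewrite avgF_csum; first by congr csum; apply/funext => m; rewrite avgF_Zr mulrC.
  by move=> x; apply: (@summ_le_r _ _ _ d) => // m; rewrite nrmM nrm_expi mul1r.
under eq_fun do rewrite ES.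
have -> : lim_coef 0 = csum (fun m => lim_coef m * (m == 0)%:R).
  by rewrite (@csum_one _ _ _ 0) ?eqxx ?mulr1// => m /negbTE ->; rewrite mulr0.
apply: (@csum_clim _ _ _ _ _ _ _ d) => //.
- near=> r => m; rewrite nrmM (le_trans _ (hc m))// ler_piMr ?nrm_ge0//.
  by apply: avgF_nrm => // x; rewrite nrm_expi.
- by move=> m; rewrite nrmM (le_trans _ (hc m))// ler_piMr ?nrm_ge0//; case: (m == 0); rewrite ?nrm1 ?nrm0.
move=> m; apply: climM; first exact: clim_cst.
have [->|m0] := eqVneq m 0.
  apply: (@clim_near_eq _ _ _ _ (fun=> 1)); last exact: clim_cst.
  near=> r; rewrite (_ : (fun x : Z2 * Z2 => _) = fun=> 1).
    by rewrite avgF_cst// bcyl_card//; near: r; exact: nbhs_pinfty_ge.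
  by apply/funext => x; rewrite lat0 dot0r expi0.
(* Cancellation in the first momentum suffices; the phase of the second one goes into phi. *)
have h0 := @bcyl_equi _ (fun y => expi (dot (rlat theta (nx2 j) y) (lat theta j m))) (lat_freq nj m0) _.
apply: clim_near_eq (h0 _); last by move=> y; rewrite nrm_expi.
near=> r; congr avgF; apply/funext => x.
by rewrite ch_freq -rlatE -expiD -dotDl momS.
Unshelve. all: by end_near. Qed.

End Sector.
End Densities.

(** * Comparison of the three densities *)

Section Conclusion.
Context {R : realType}.
Variables (theta : layer -> R) (h : hoppings R).
Hypothesis hinc : double_incommensurate theta.
Hypothesis hdecay : exp_decay theta h.
Hypothesis hcont : continuous_hoppings h.
Hypothesis hherm : hermitian_hoppings h.
Variable b : nat -> R.
Hypothesis bD : forall D, 0 <= D -> bsm b D.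
Local Notation S := (layer * orbital)%type.
Local Notation L := (reciprocal_entry theta h).
Local Notation H := (Hk theta h).
Local Notation dos := ((#|{: S}|%:R)^-1 * \sum_(s : S) lim_coef theta h b s.1 s.2 0).

Definition usite (p : (Z2 * unit) * S) : Omega := (p.1.1, p.2.1, p.2.2).

Lemma usite_bij : bijective usite.
Proof. by exists (fun w : Omega => ((w.1.1, tt), (w.1.2, w.2))) => [[[n []] [j a]]|[[n j] a]]. Qed.

Lemma clim_sectors (u : S -> R -> R[i]) (l : S -> R[i]) : (forall s, clim +oo (u s) (l s)) ->
  clim +oo (fun r => (#|{: S}|%:R)^-1 * \sum_(s : S) u s r) ((#|{: S}|%:R)^-1 * \sum_(s : S) l s).
Proof. by move=> ul; apply: climZ; apply: clim_sum. Qed.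

Lemma real_average_clim (F : Omega -> R[i]) : (forall w, F w = fker b H w w) ->
  clim +oo (set_average (Omega_r theta) F) dos.
Proof.
move=> FE.
have -> : set_average (Omega_r theta) F =
  fun r => (#|{: S}|%:R)^-1 * \sum_(s : S) avg_coef theta h b s.1 s.2 r 0.
  apply/funext => r; rewrite (sector_average usite_bij (B := @ucyl R)).
    congr (_ * _); apply: eq_bigr => -[j a] _; congr avgF; apply/funext => x.
    by rewrite FE addr0.
  move=> r' [n []] [j a]; rewrite /ucyl mem_cylb ?det_mxA_neq0//; last exact: mem_ubase.
  by rewrite /= expr0n addr0 sqrtr_sqr ger0_norm ?norm2_ge0// -(norm2_lat theta j).
by apply: clim_sectors => -[j a]; exact: avg_coef_limit.
Qed.

Lemma reciprocal_average_clim (F : Omega_star -> R[i]) : (forall w, F w = fker b (L 0) w w) ->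
  clim +oo (set_average (Omega_star_r theta) F) dos.
Proof.
move=> FE.
have -> : set_average (Omega_star_r theta) F =
  fun r => (#|{: S}|%:R)^-1 * \sum_(s : S) avgF (bcyl r) (fun x => fker b (L 0) (star (x, s)) (star (x, s))).
  apply/funext => r; rewrite (sector_average star_bij (B := @bcyl R)).
    by congr (_ * _); apply: eq_bigr => s _; congr avgF; apply/funext => x.
  move=> r' [m n] [j a]; have mz r2 (y : Z2) : 0 < r2 -> (y \in zb (mxB : 'M[R]_2) r2) = (norm2 (mxB *m zv y) < r2).
    by move=> _; rewrite mem_zb// det_mxB_neq0.
  rewrite /bcyl (mem_cylb det_mxB_neq0 (fun _ => norm2_ge0 _) mz).
  have nj := nx1P j; have [n1 n2] := thirdP nj.
  have ES (G : layer -> R) : \sum_(k | k != j) G k = G (nx1 j) + G (nx2 j).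
    by rewrite big_mkcond (sum_layers _ nj) eqxx [nx1 j == j]eq_sym nj n1 add0r.
  have -> : Omega_star_r theta r' (star (m, n, (j, a))) =
     (Num.sqrt (\sum_(k | k != j) norm2 (rlat theta k (smom (star (m, n, (j, a))) k)) ^+ 2) < r') :> Prop by [].
  rewrite ES !smom_stsite /= [nx1 j == j]eq_sym (negbTE nj) eqxx (negbTE n1) (negbTE n2).
  by rewrite !norm2_rlat.
by apply: clim_sectors => -[j a]; exact: recip_limit.
Qed.

Variable f : R -> R.
Hypothesis fE : forall x, f x = rsum (fun k => b k * x ^+ k).

Lemma real_entry w w' : op_entry (fcalc (real_hamiltonian theta h) f) w w' = fker b H w w'.
Proof.
have [g [C [g0 C0 rH _]]] := Hk_weighted hdecay; have hH := Hk_herm theta hherm.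
rewrite (@fcalc_ext _ _ (kop H)).
- exact: (op_entry_fcalc hH rH C0 bD fE).
- by move=> psi; exact: (T_ell2 hH rH C0).
- by move=> psi; exact: real_hamiltonianE.
Qed.

Lemma reciprocal_entryE q v v' : op_entry (fcalc (reciprocal_hamiltonian theta h q) f) v v' = fker b (L q) v v'.
Proof.
have [D D0 rL] := entry_rowb hdecay q.
exact: (op_entry_fcalc (entry_herm hdecay hherm hcont q) rL D0 bD fE).
Qed.

Lemma momentum_traceE : momentum_trace theta h f = dos.
Proof.
set D := `|\det (mxB : 'M[R]_2)|.
have D0 : D != 0 by rewrite normr_eq0 det_mxB_neq0.
(* All cells have area |det B|, so the normalisation is the inverse of six times this area and
   cancels the Jacobian in [trace_sector]. *)
have nuE : nu_star theta = (#|{: S}|%:R * D)^-1.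
  rewrite /nu_star; congr (_^-1).
  under eq_bigr do rewrite area_rcell -/D.
  by rewrite sumr_const -[_ *+ _]mulr_natl mulrA card_prod natrM.
rewrite /momentum_trace nuE pair_bigA /=.
under eq_bigr => s _.
  rewrite (_ : (fun q => _) = Fsec theta h b s.1 s.2); last by apply/funext => q; rewrite reciprocal_entryE.
  rewrite trace_sector// -/D.
  over.
rewrite -mulr_sumr mulrA -rcM; congr (_ * _).
rewrite invfM mulfVK// rmorphV ?rmorph_nat// unitfE pnatr_eq0 -lt0n.
by apply/card_gt0P; exists (ord0, false).
Qed.

End Conclusion.

Theorem corollary3p1 (R : realType) (theta : layer -> R) (h : hoppings R)
    (hinc : double_incommensurate theta)
    (hcont : continuous_hoppings h)
    (hdecay : exp_decay theta h)
    (hherm : hermitian_hoppings h)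
    (hnear : nearest_layer_coupling h)
    (eps : R) (heps : 0 < eps) (E : R) :
  [/\ cvg ((reciprocal_dos_average theta h eps E r : R[i]^o) @[r --> +oo]),
      cvg ((real_dos_average theta h eps E r : R[i]^o) @[r --> +oo]),
      reciprocal_dos theta h eps E =
        momentum_trace theta h (fun x => gauss eps (E - x))
    & momentum_trace theta h (fun x => gauss eps (E - x)) =
        real_dos theta h eps E].
Proof.
have [b bD fE] := gauss_entire E heps.
have /clim_cvg cr := reciprocal_average_clim hinc hdecay hcont hherm bD
  (fun w => reciprocal_entryE hdecay hcont hherm bD fE 0 w w).
have /clim_cvg ch := real_average_clim hinc hdecay hcont hherm bD
  (fun w => real_entry hdecay hherm bD fE w w).
rewrite (momentum_traceE hinc hdecay hcont hherm bD fE); split.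
- exact: cvgP cr.
- exact: cvgP ch.
- by rewrite /reciprocal_dos; apply: (cvg_lim _ cr).
- by rewrite /real_dos; apply/esym; apply: (cvg_lim _ ch).
Qed.
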